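(* Let $(\mathcal F,\Gamma)$ be a complex Hessian operator with its cone satisfying the structural conditions in the context, let $\Omega\subset\mathbb C^n$ be a bounded strictly $\Gamma$-pseudoconvex domain with $C^4$ boundary, and let $\psi$ be a defining function for $\Omega$ normalized as in the context. Let the $\Gamma$-admissible function $u$, continuous up to the boundary of $\Omega$, solve $$\begin{cases}\mathcal F(u_{z_i\bar z_j})=f & \text{in }\Omega,\\ u=g & \text{on }\partial\Omega.\end{cases}$$ Assume that $f,g\in C^{1,1}(\overline\Omega)$ and $f\ge0$ in $\Omega$. Then for any $\epsilon>0$ and $\delta>0$ there is a constant $$C_{\epsilon,\delta}=C\big(\|f\|_{C^{1,1}},\|g\|_{C^{1,1}},\|\psi\|_{C^{3,1}},n,\epsilon,\delta\big),$$ independent of $\inf f$, such that for any unit length vector $\zeta\in\mathbb C^n$ and any $z\in\Omega_\delta=\{z\in\Omega:\ \mathrm{dist}(z,\partial\Omega)>\delta\}$ one has $$|u_{(\zeta)(\zeta)}(z)|\le\epsilon\,\sup_{\partial\Omega}|u_{\nu\nu}|+C_{\epsilon,\delta},$$ where $\nu$ is the inner normal along $\partial\Omega$.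
   Context: Notation: for constant $\zeta\in\mathbb C^n$, $u_{(\zeta)}=\sum_i(\zeta_iu_{z_i}+\bar\zeta_iu_{\bar z_i})$ and $u_{(\zeta)(\zeta)}=(u_{(\zeta)})_{(\zeta)}=\sum_{i,j}\big(\zeta_i\zeta_ju_{z_iz_j}+2\zeta_i\bar\zeta_ju_{z_i\bar z_j}+\bar\zeta_i\bar\zeta_ju_{\bar z_i\bar z_j}\big)$. $D^2_{\mathbb C}u=(u_{z_i\bar z_j})$ is the complex Hessian. Cone: $\Gamma\subset\mathbb R^n$ is an open convex cone with vertex at the origin, symmetric under permutation of coordinates, with $\Gamma_n\subset\Gamma\subset\Gamma_1$, where $\Gamma_k=\{\lambda:\sigma_1(\lambda)>0,\dots,\sigma_k(\lambda)>0\}$ and $\sigma_j$ is the $j$-th elementary symmetric polynomial. $\tilde\Gamma$ is the cone of Hermitian $n\times n$ matrices whose eigenvalue vector lies in $\Gamma$. A $C^2$ function $u$ is $\Gamma$-admissible if the eigenvalue vector of $D^2_{\mathbb C}u$ lies in $\overline\Gamma$ at each point, and strictly $\Gamma$-admissible if for every $\chi\in C^2_0(\Omega)$ there is $\epsilon>0$ with $u+\epsilon\chi$ $\Gamma$-admissible. Operator: $\mathcal F(A)=\mathsf f(\lambda(A))$ for $A\in\tilde\Gamma$, with $\mathsf f:\Gamma\to\mathbb R$ symmetric and: (1) $\partial\mathsf f/\partial\lambda_i>0$ on $\Gamma$ for all $i$; (2) $\mathsf f$ concave; (3) $\mathsf f(t\lambda)=t\mathsf f(\lambda)$ for $t>0$;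 (4) for any compact $K\subset\Gamma$ and $C>0$ there is $R_0$ such that $\mathsf f(\lambda_1,\dots,\lambda_{n-1},\lambda_n+R)\ge C$ for all $\lambda\in K$, $R\ge R_0$; (5) for any compact $K\subset\Gamma$ and $C>0$ there is $R_0$ such that $\mathsf f(R\lambda)\ge C$ for all $\lambda\in K$, $R\ge R_0$, and $\limsup_{\lambda\to\lambda_0}\mathsf f(\lambda)=0$ for each $\lambda_0\in\partial\Gamma$. Domain: $\Omega$ is strictly $\Gamma$-pseudoconvex if it has a negative defining function whose complex Hessian has eigenvalue vector in $\Gamma$ on $\overline\Omega$. Here $\psi$ is defined near $\overline\Omega$, of class $C^4$, with $\Omega=\{\psi>0\}$, $\partial\Omega=\{\psi=0\}$, $|\nabla\psi|\ge1$ on $\partial\Omega$, $-\psi$ strictly $\Gamma$-admissible up to $\partial\Omega$, and $\psi$ is scaled so that $\sum_{i,j}a^{i\bar j}\psi_{z_i\bar z_j}\le-2$ on $\overline\Omega$ for every matrix $(a^{i\bar j})\in\tilde\Gamma^*$ of trace $1$, where $\tilde\Gamma^*=\{A:\mathrm{tr}(AB)>0\ \forall B\in\tilde\Gamma\}$. This is an a priori estimate: the derivatives of $u$ that occur are assumed to exist (the paper reduces by approximation to $\partial\Omega\in C^4$, $f>0$ of class $C^2$, boundary data of class $C^4$).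
   Formalization: The constant may also depend on the fixed operator and cone (F, Γ), which the statement's list omits; without this the claim fails, e.g. F = σ_1/(nt), u = t(|z|²−1), f = 1, g = 0 on the unit ball as t → ∞. *)

(* Defs.v *)
From HB Require Import structures.
From mathcomp Require Import all_boot all_order all_algebra.
From mathcomp Require Import perm complex.
From mathcomp Require Import all_classical all_reals all_analysis.

Set Implicit Arguments.
Unset Strict Implicit.
Unset Printing Implicit Defensive.

Import Order.TTheory GRing.Theory Num.Theory.
Import numFieldNormedType.Exports.

Local Open Scope classical_set_scope.
Local Open Scope ring_scope.
Local Open Scope complex_scope.

(* C^n is identified with R^(2n): a point is the row vector (x, y) with
   z_i = x_i + 'i y_i, where x_i is the coordinate [lshift n i] and y_i the
   coordinate [rshift n i].  The norm carried by the type is the sup norm;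
   wherever lengths matter the Euclidean norm [enorm] is used instead. *)
Notation "''Cn[' R ]_ n" := 'rV[R]_(n + n)
  (at level 8, n at level 2, format "''Cn[' R ]_ n") : type_scope.

Section Euclidean.
Variables (R : realType) (m : nat).
Implicit Types (v w d : 'rV[R]_m) (A Om : set 'rV[R]_m).

Definition bdry A : set 'rV[R]_m := closure A `\` A°.

Definition enorm v : R := Num.sqrt (\sum_(k < m) v 0 k ^+ 2).

Definition eucl_dist v A : R := inf [set enorm (v - w) | w in A].

Definition unit_vec (k : 'I_m) : 'rV[R]_m := delta_mx 0 k.

Definition grad (h : 'rV[R]_m -> R) v : 'rV[R]_m :=
  \row_k 'D_(unit_vec k) h v.

(* A multi-index is a sequence of directions: the order of the derivative is
   the size of the sequence. *)
Definition partial (s : seq 'I_m) (h : 'rV[R]_m -> R) : 'rV[R]_m -> R :=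
  foldr (fun k g v => 'D_(unit_vec k) g v) h s.

Definition Cclass (r : nat) Om (h : 'rV[R]_m -> R) : Prop :=
  (forall s k v, (size s < r)%N -> Om v -> derivable (partial s h) v (unit_vec k))
  /\ (forall s v, (size s <= r)%N -> Om v -> {for v, continuous (partial s h)}).

Definition Cclass_near (r : nat) A (h : 'rV[R]_m -> R) : Prop :=
  exists U, [/\ open U, A `<=` U & Cclass r U h].

(* C^r of the closure of the open set Om: the derivatives of order at most r
   extend continuously from Om to its closure. *)
Definition Cclass_closure (r : nat) Om (h : 'rV[R]_m -> R) : Prop :=
  [/\ Cclass r Om h,
      {within closure Om, continuous h}
    & forall s v, (size s <= r)%N -> bdry Om v ->
        cvg (partial s h @ within Om (nbhs v))].

Definition deriv_values (r : nat) Om (h : 'rV[R]_m -> R) : set R :=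
  [set a | exists s v, [/\ (size s <= r)%N, Om v & a = `|partial s h v|]].

Definition lip_quotients (r : nat) Om (h : 'rV[R]_m -> R) : set R :=
  [set a | exists s v w, [/\ size s = r, Om v, Om w, v <> w
     & a = `|partial s h v - partial s h w| / enorm (v - w)]].

(* The Hoelder class C^(r,1) of the closure of Om, and its norm. *)
Definition Cr1 (r : nat) Om (h : 'rV[R]_m -> R) : Prop :=
  [/\ Cclass r Om h,
      {within closure Om, continuous h},
      has_ubound (deriv_values r Om h)
    & has_ubound (lip_quotients r Om h)].

Definition Cr1_norm (r : nat) Om (h : 'rV[R]_m -> R) : R :=
  sup (deriv_values r Om h) + sup (lip_quotients r Om h).

(* rho < 0 exactly in Om, near the closure of Om, and rho is regular on the
   boundary. *)
Definition negative_defining (r : nat) Om (rho : 'rV[R]_m -> R) : Prop :=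
  exists U, [/\ open U, closure Om `<=` U, Cclass r U rho
    & [/\ Om = U `&` [set v | rho v < 0],
          bdry Om = U `&` [set v | rho v = 0]
        & forall v, bdry Om v -> grad rho v != 0]].

Definition boundary_class (r : nat) Om : Prop :=
  forall v, bdry Om v -> exists V rho,
    [/\ open V, V v, Cclass r V rho, grad rho v != 0
      & Om `&` V = V `&` [set w | rho w < 0] /\
        bdry Om `&` V = V `&` [set w | rho w = 0]].

Definition bounded_domain Om : Prop :=
  [/\ open Om, Om !=set0, connected Om & bounded_set Om].

(* Inner unit normal, for a defining function psi positive inside. *)
Definition inner_normal (psi : 'rV[R]_m -> R) v : 'rV[R]_m :=
  (enorm (grad psi v))^-1 *: grad psi v.

(* Second derivative of u at a boundary point v in the fixed direction d, as
   the limit of the interior values. *)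
Definition bdry_second (Om : set 'rV[R]_m) (u : 'rV[R]_m -> R) d v : R :=
  lim ('D_d ('D_d u) @ within Om (nbhs v)).

End Euclidean.

Section Complex.
Variables (R : realType) (n : nat).
Implicit Types (H : 'Cn[R]_n -> R[i]) (u : 'Cn[R]_n -> R) (z : 'Cn[R]_n).

Definition toC u : 'Cn[R]_n -> R[i] := fun z => (u z)%:C.

Definition partialC (k : 'I_(n + n)) H z : R[i] :=
  ('D_(unit_vec R k) (fun w => complex.Re (H w)) z)
    +i* ('D_(unit_vec R k) (fun w => complex.Im (H w)) z).

Definition dz (i : 'I_n) H z : R[i] :=
  (partialC (lshift n i) H z - 'i * partialC (rshift n i) H z) / 2%:R.

Definition dzbar (i : 'I_n) H z : R[i] :=
  (partialC (lshift n i) H z + 'i * partialC (rshift n i) H z) / 2%:R.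

Definition hessC u z : 'M[R[i]]_n :=
  \matrix_(i, j) dzbar j (dz i (toC u)) z.

(* H |-> H_(zeta), for a constant vector zeta *)
Definition dirC (zeta : 'rV[R[i]]_n) H z : R[i] :=
  \sum_(i < n) (zeta 0 i * dz i H z + (zeta 0 i)^* * dzbar i H z).

(* Eigenvalue vector of a Hermitian matrix, with multiplicity; its order is
   immaterial below, everything being symmetric. *)
Definition eigvec (A : 'M[R[i]]_n) : 'rV[R]_n :=
  map_mx (@complex.Re R) (spectral_diag A).

Definition esym (k : nat) (lam : 'rV[R]_n) : R :=
  \sum_(S : {set 'I_n} | #|S| == k) \prod_(i in S) lam 0 i.

Definition Garding (k : nat) : set 'rV[R]_n :=
  [set lam | forall j, (1 <= j <= k)%N -> 0 < esym j lam].

Implicit Types (Gam : set 'rV[R]_n) (F : 'rV[R]_n -> R).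

Record symmetric_cone Gam : Prop := {
  cone_open : open Gam;
  cone_convex : forall l m (t : R), Gam l -> Gam m -> 0 <= t <= 1 ->
    Gam (t *: l + (1 - t) *: m);
  cone_scale : forall l (t : R), Gam l -> 0 < t -> Gam (t *: l);
  cone_perm : forall l (s : 'S_n), Gam l -> Gam (col_perm s l);
  cone_lower : Garding n `<=` Gam;
  cone_upper : Gam `<=` Garding 1 }.

(* (0, ..., 0, r) *)
Definition last_coord (r : R) : 'rV[R]_n :=
  \row_(j < n) (if j.+1 == n then r else 0).

Record structure_conditions Gam F : Prop := {
  op_symmetric : forall l (s : 'S_n), Gam l -> F (col_perm s l) = F l;
  op_increasing : forall l i, Gam l ->
    derivable F l (unit_vec R i) /\ 0 < 'D_(unit_vec R i) F l;
  op_concave : forall l m (t : R), Gam l -> Gam m -> 0 <= t <= 1 ->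
    t * F l + (1 - t) * F m <= F (t *: l + (1 - t) *: m);
  op_homogeneous : forall l (t : R), Gam l -> 0 < t -> F (t *: l) = t * F l;
  op_last_large : forall (K : set 'rV[R]_n) (C : R), compact K -> K `<=` Gam -> 0 < C ->
    exists2 R0 : R, 0 < R0 &
      forall l (r : R), K l -> R0 <= r -> C <= F (l + last_coord r);
  op_large : forall (K : set 'rV[R]_n) (C : R), compact K -> K `<=` Gam -> 0 < C ->
    exists2 R0 : R, 0 < R0 &
      forall l (r : R), K l -> R0 <= r -> C <= F (r *: l);
  op_boundary : forall l0, bdry Gam l0 ->
    limf_esup (fun l : 'rV[R]_n => (F l)%:E) (within Gam (nbhs l0)) = 0%E }.

(* Hermitian matrices with eigenvalues in Gam *)
Definition herm_cone Gam : set 'M[R[i]]_n :=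
  [set A | A \is hermsymmx /\ Gam (eigvec A)].

(* Here [0 < w] in R[i] means that w is real and positive. *)
Definition dual_cone (G : set 'M[R[i]]_n) : set 'M[R[i]]_n :=
  [set A | A \is hermsymmx /\ forall B, G B -> 0 < \tr (A *m B)].

(* The Hessian of an admissible function may have its eigenvalues on the
   boundary of Gam, where F is extended by its limit 0 (F > 0 in Gam by
   op_homogeneous and op_large, and the limsup at the boundary is 0). *)
Definition hess_op Gam F (A : 'M[R[i]]_n) : R :=
  if eigvec A \in Gam then F (eigvec A) else 0.

Definition admissible Gam (Om : set 'Cn[R]_n) u : Prop :=
  Cclass 2 Om u /\ forall z, Om z -> closure Gam (eigvec (hessC u z)).

(* Strict admissibility up to the boundary: the perturbations chi need not
   vanish near the boundary. *)
Definition strictly_admissible_closure Gam (Om : set 'Cn[R]_n) u : Prop :=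
  Cclass_near 2 (closure Om) u /\
  forall chi : 'Cn[R]_n -> R, Cclass_near 2 (closure Om) chi ->
    exists2 e : R, 0 < e & forall z, closure Om z ->
      closure Gam (eigvec (hessC (fun w => u w + e * chi w) z)).

Definition strictly_pseudoconvex Gam (Om : set 'Cn[R]_n) : Prop :=
  exists2 rho : 'Cn[R]_n -> R, negative_defining 2 Om rho &
    forall z, closure Om z -> Gam (eigvec (hessC rho z)).

Record normalized_defining Gam (Om : set 'Cn[R]_n) (psi : 'Cn[R]_n -> R) :
    Prop := {
  psi_defining : negative_defining 4 Om (fun z => - psi z);
  psi_grad : forall z, bdry Om z -> 1 <= enorm (grad psi z);
  psi_strict : strictly_admissible_closure Gam Om (fun z => - psi z);
  psi_scaled : forall A, dual_cone (herm_cone Gam) A -> \tr A = 1 ->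
    forall z, closure Om z ->
      \sum_(i < n) \sum_(j < n) A i j * hessC psi z i j <= - 2%:R }.

End Complex.

(* Main.v *)
(* The bound holds without the boundary term.  Concavity and homogeneity make the equation an
   infimum of linear equations \sum_i u_(s i)(s i) = b f over frames s of real directions: the
   supergradient of the operator at l, diagonalized in any unitary frame, lies above the equation
   by the rearrangement inequality for doubly stochastic matrices.  As u is only C^2, the equation
   is never differentiated; instead u is compared with its transports along curves of complex
   similarities, which map frames to frames, and the maximum principle is applied to symmetric
   second quotients in h, whose limits are second derivatives of u.
   Translations bound u_(x)(x) on {psi >= mu} by its maximum on {psi = mu} plus a constant.  Near
   the boundary, take the maximum over z and x of the ratio of u_(x)(x) to
     p^2 / y(psi) + (chi(psi) - c \sum_j (u_j + C)^2) |x|^2,    p = <grad psi, x>,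
   where y is a logarithmic scale.  At an interior maximum the similarity is chosen to cancel the
   derivative of p up to a multiple of p, and the ratio is bounded; hence it is governed by its
   values at psi = 0, where y = 0 leaves only tangential directions, controlled by g, and at
   psi = l.  A suitable scale gives that a bound N on {psi = l} yields the bound N / 2 + C on
   {psi = mu}, mu < l, hence, with the first step, also on {psi = l}; so N <= 2 C.  The lower bound
   follows from a nonnegative Laplacian, and psi >= dist^2 by comparison with delta^2 - |z - z0|^2. *)

Require Import Defs.
From HB Require Import structures.
From mathcomp Require Import all_boot all_order all_algebra.
From mathcomp Require Import perm complex ring lra.
From mathcomp Require Import all_classical all_reals all_analysis.

Set Implicit Arguments.
Unset Strict Implicit.
Unset Printing Implicit Defensive.

Import Order.TTheory GRing.Theory Num.Theory.
Import numFieldNormedType.Exports.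

Local Open Scope classical_set_scope.
Local Open Scope ring_scope.

(** * First and second order calculus *)

(** Since f may vanish, the supporting operators are controlled only by their trace, normalized to
    1; no ellipticity is available. Favourable terms come from two sources: psi, which every such
    operator sends to at most -2, and the squares of the shifted first derivatives, which supply
    \sum_i |s_i D^2 u|^2. The latter pays for D^2 u paired with the acceleration of the motion and
    for D^2 u in the critical-point equation. The scale y is dictated by the requirement that y' chi
    be about 1. With y' = 1 / (kap + psi / l) the concavity of y costs the square (a y' psi_x)^2 /
    (2 l), where a = p / y. The critical-point equation reads a y' psi_x = - th <xi, x> + error with
    0 <= th <= 1, and the cross term between chi' and the dilation part of the similarity outweighs
    that square. f enters only through b f with 0 <= b <= 1 / F(1, ..., 1), so f >= 0 and its
    C^(1,1) norm suffice. Moduli of continuity of u and of its derivatives only select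
    neighbourhoods and levels; they never reach a constant of the estimate. *)

HB.lock Definition dot (R : realType) (m : nat) (x y : 'rV[R]_m) : R :=
  \sum_k x 0 k * y 0 k.

Section Dot.
Variables (R : realType) (m : nat).
Implicit Types (x y z : 'rV[R]_m) (A H : 'M[R]_m) (a : R).

Lemma dot_sum x y : dot x y = \sum_k x 0 k * y 0 k.
Proof. by rewrite dot.unlock. Qed.

Lemma dotC x y : dot x y = dot y x.
Proof. by rewrite !dot_sum; apply: eq_bigr => k _; rewrite mulrC. Qed.

Lemma dotDl x y z : dot (x + y) z = dot x z + dot y z.
Proof. by rewrite !dot_sum -big_split; apply: eq_bigr => k _; rewrite mxE mulrDl. Qed.

Lemma dotZl a x y : dot (a *: x) y = a * dot x y.
Proof. by rewrite !dot_sum big_distrr; apply: eq_bigr => k _; rewrite mxE -mulrA. Qed.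

Lemma dotNl x y : dot (- x) y = - dot x y.
Proof. by rewrite -scaleN1r dotZl mulN1r. Qed.

Lemma dotBl x y z : dot (x - y) z = dot x z - dot y z.
Proof. by rewrite dotDl dotNl. Qed.

Lemma dot0l x : dot 0 x = 0.
Proof. by rewrite -(scale0r x) dotZl mul0r. Qed.

Lemma dotDr x y z : dot x (y + z) = dot x y + dot x z.
Proof. by rewrite dotC dotDl !(dotC x). Qed.

Lemma dotZr a x y : dot x (a *: y) = a * dot x y.
Proof. by rewrite dotC dotZl dotC. Qed.

Lemma dotNr x y : dot x (- y) = - dot x y.
Proof. by rewrite dotC dotNl dotC. Qed.

Lemma dotBr x y z : dot x (y - z) = dot x y - dot x z.
Proof. by rewrite dotDr dotNr. Qed.

Lemma dot0r x : dot x 0 = 0.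
Proof. by rewrite dotC dot0l. Qed.

Definition dotE := (dotDl, dotBl, dotZl, dotNl, dotDr, dotBr, dotZr, dotNr, dot0l, dot0r).

Lemma dot_mx x y : dot x y = (x *m y^T) 0 0.
Proof. by rewrite dot_sum mxE; apply: eq_bigr => k _; rewrite mxE. Qed.

Lemma dot_mulmx x y A : dot (x *m A) y = dot x (y *m A^T).
Proof. by rewrite !dot_mx trmx_mul trmxK mulmxA. Qed.

Lemma dot_deltar x k : dot x (delta_mx 0 k) = x 0 k.
Proof.
rewrite dot_sum (bigD1 k) //= big1 ?mxE ?eqxx ?mulr1 ?addr0 // => i /negbTE ik.
by rewrite mxE ik andbF mulr0.
Qed.

Lemma dot_ge0 x : 0 <= dot x x.
Proof. by rewrite dot_sum; apply: sumr_ge0 => k _; rewrite -expr2 sqr_ge0. Qed.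

Lemma dot_eq0 x : dot x x = 0 -> x = 0.
Proof.
move=> /eqP; rewrite dot_sum psumr_eq0 => [/allP h|k _]; last by rewrite -expr2 sqr_ge0.
apply/rowP => k; rewrite mxE; apply/eqP.
by have := h k (mem_index_enum _); rewrite mulf_eq0 orbb.
Qed.

Lemma entry_le_norm x k : `|x 0 k| <= `|x|.
Proof.
rewrite [leRHS]/Num.norm /= mx_normrE.
by apply: (le_bigmax_cond _ (fun ij => `|x ij.1 ij.2|) (j := (0, k))).
Qed.

Lemma mx_entry_le_norm A i k : `|A i k| <= `|A|.
Proof.
rewrite [leRHS]/Num.norm /= mx_normrE.
by apply: (le_bigmax_cond _ (fun ij => `|A ij.1 ij.2|) (j := (i, k))).
Qed.

Lemma norm_rV_le x a : 0 <= a -> (forall k, `|x 0 k| <= a) -> `|x| <= a.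
Proof.
move=> a0 h; rewrite [leLHS]/Num.norm /= mx_normrE; apply/bigmax_leP; split => // -[i k] _ /=.
by rewrite (ord1 i).
Qed.

Lemma sqr_norm_le_dot x : `|x| ^+ 2 <= dot x x.
Proof.
rewrite -[leRHS]sqr_sqrtr ?dot_ge0// ler_sqr ?nnegrE ?sqrtr_ge0//.
apply: norm_rV_le => [|k]; first exact: sqrtr_ge0.
rewrite -sqrtr_sqr ler_wsqrtr// dot_sum (bigD1 k)//= -expr2 lerDl.
by apply: sumr_ge0 => i _; rewrite -expr2 sqr_ge0.
Qed.

Lemma dot_le_norm x y : `|dot x y| <= m%:R * `|x| * `|y|.
Proof.
rewrite dot_sum; apply: le_trans (ler_norm_sum _ _ _) _.
rewrite -mulrA mulr_natl -[leRHS](_ : \sum_(k < m) (`|x| * `|y|) = _); last first.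
  by rewrite sumr_const card_ord.
by apply: ler_sum => k _; rewrite normrM ler_pM// entry_le_norm.
Qed.

Lemma CauchySchwarz_dot x y : dot x y ^+ 2 <= dot x x * dot y y.
Proof.
have [/dot_eq0->|x0] := eqVneq (dot x x) 0; first by rewrite !dot0l expr0n mul0r.
have xx : 0 < dot x x by rewrite lt0r x0 dot_ge0.
have := dot_ge0 (dot x x *: y - dot x y *: x).
rewrite !dotE (dotC y x) => h.
have : 0 <= dot x x * (dot x x * dot y y - dot x y ^+ 2) by apply: le_trans h _; lra.
by rewrite pmulr_rge0// subr_ge0.
Qed.

Lemma norm_mulmx_le x A : `|x *m A| <= m%:R * `|A| * `|x|.
Proof.
apply: norm_rV_le => [|k]; first by rewrite !mulr_ge0.
rewrite mxE (_ : \sum_j _ = dot x (col k A)^T); last first.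
  by rewrite dot_sum; apply: eq_bigr => j _; rewrite !mxE.
rewrite (le_trans (dot_le_norm _ _))// -!mulrA ler_wpM2l// mulrC ler_wpM2r//.
by apply: norm_rV_le => // j; rewrite !mxE mx_entry_le_norm.
Qed.

End Dot.

Section FirstOrder.
Variables (R : realType) (m : nat).
Implicit Types (x y z v w : 'rV[R]_m) (U : set 'rV[R]_m) (h : 'rV[R]_m -> R).

Lemma is_derive_line h z v (t : R) : derivable h (z + t *: v) v ->
  is_derive t 1 (fun s : R => h (z + s *: v)) ('D_v h (z + t *: v)).
Proof.
have E : (fun k : R => k^-1 *: (((fun s : R => h (z + s *: v)) \o shift t) (k *: 1)
           - h (z + t *: v)))
       = (fun k : R => k^-1 *: ((h \o shift (z + t *: v)) (k *: v) - h (z + t *: v))).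
  apply/funext => k /=; congr (_ *: (h _ - _)).
  by rewrite [k *: 1]mulr1 scalerDl addrCA addrA.
by move=> dh; apply: DeriveDef; rewrite /derivable/derive E.
Qed.

Lemma line_MVT (g dg : R -> R) : (forall t : R, 0 <= t <= 1 -> is_derive t 1 g (dg t)) ->
  exists2 t, 0 < t < 1 & g 1 - g 0 = dg t.
Proof.
move=> dG; have [||t] := @MVT R g dg 0 1 ltr01.
- by move=> t; rewrite in_itv /= => /andP[t0 t1]; apply: dG; rewrite !ltW.
- apply: continuous_in_subspaceT => t; rewrite inE /= in_itv /= => t01.
  apply: differentiable_continuous; apply/derivable1_diffP.
  exact: (@ex_derive _ _ _ _ _ _ _ (dG t t01)).
- by rewrite in_itv /= subr0 mulr1 => t01 ->; exists t.
Qed.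

Lemma coord_MVT h z k (a : R) :
  (forall t : R, 0 <= t <= 1 -> derivable h (z + (t * a) *: unit_vec R k) (unit_vec R k)) ->
  exists2 t : R, 0 <= t <= 1 & h (z + a *: unit_vec R k) - h z
     = a * partial [:: k] h (z + (t * a) *: unit_vec R k).
Proof.
move=> dh.
have [t t01|t /andP[t0 t1] E] := @line_MVT (fun t => h (z + (t * a) *: unit_vec R k))
   (fun t => partial [:: k] h (z + (t * a) *: unit_vec R k) * a).
  have H1 := is_derive_line (dh t t01).
  have H2 : is_derive t 1 (fun s : R => s * a) a.
    have -> : (fun s : R => s * a) = a *: id by apply/funext => s; rewrite mulrC.
    by apply: is_derive_eq; rewrite /GRing.scale /= mulr1.
  exact: (@is_derive1_comp _ (fun s : R => h (z + s *: unit_vec R k)) (fun s : R => s * a) t _ _ H1 H2).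
by exists t; [rewrite !ltW | rewrite mulrC -E mul1r mul0r scale0r addr0].
Qed.

Lemma is_derive_eps (g : R -> R) (t d : R) :
  (forall e : R, 0 < e -> exists2 del : R, 0 < del &
     forall k : R, `|k| < del -> `|g (t + k) - g t - d * k| <= e * `|k|) ->
  is_derive t 1 g d.
Proof.
move=> H.
have C : (fun k : R => k^-1 *: ((g \o shift t) (k *: 1) - g t)) @ 0^' --> d.
  apply/cvgrPdist_le => e e0; have [del del0 Hd] := H _ e0.
  exists del => //= k; rewrite /= sub0r normrN => kd k0; rewrite [k *: 1]mulr1.
  have -> : d - k^-1 *: (g (k + t) - g t) = - (k^-1 * (g (t + k) - g t - d * k)).
    by rewrite /GRing.scale /= addrC (addrC k t); field.
  rewrite normrN normrM normfV ler_pdivrMl ?normr_gt0// [leRHS]mulrC; exact: Hd.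
apply: DeriveDef; first by apply/cvg_ex; exists d.
exact/cvg_lim.
Qed.

Lemma continuous_eps h z : {for z, continuous h} -> forall e : R, 0 < e ->
  exists2 d : R, 0 < d & forall w, `|w - z| < d -> `|h w - h z| < e.
Proof.
move=> /(@cvgrPdist_lt _ _ _ (nbhs z)) H e /H /nbhs_ballP[d /= d0 B]; exists d => // w wz.
by rewrite distrC; apply: B; rewrite -ball_normE /= distrC.
Qed.

Lemma continuous_of_eps h z : (forall e : R, 0 < e ->
  exists2 d : R, 0 < d & forall w, `|w - z| < d -> `|h w - h z| < e) ->
  {for z, continuous h}.
Proof.
move=> H; apply/(@cvgrPdist_lt _ _ _ (nbhs z)) => e /H[d d0 B]; apply/nbhs_ballP; exists d => // w.
by rewrite -ball_normE /= distrC => /B; rewrite distrC.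
Qed.

Lemma open_eps U z : open U -> U z -> exists2 d : R, 0 < d & forall w, `|w - z| < d -> U w.
Proof.
move=> oU Uz; have /nbhs_ballP[d /= d0 B] : nbhs z U by apply: open_nbhs_nbhs.
by exists d => // w wz; apply: B; rewrite -ball_normE /= distrC.
Qed.

Lemma finite_eps (I : finType) (P : I -> R -> Prop) :
  (forall i d d', P i d -> 0 < d' -> d' <= d -> P i d') ->
  (forall i, exists2 d : R, 0 < d & P i d) ->
  exists2 d : R, 0 < d & forall i, P i d.
Proof.
move=> mono ex.
pose d_ i := s2val (cid2 (ex i)).
have d0 i : 0 < d_ i by rewrite /d_; case: cid2.
have Pd i : P i (d_ i) by rewrite /d_; case: cid2.
(* The initial value 1 keeps the radius positive over an empty index type. *)
exists (\big[Num.min/1]_i d_ i) => [|i].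
  by apply: lt_bigmin.
apply: mono (Pd i) _ _; first exact: lt_bigmin.
exact: bigmin_le_cond.
Qed.

Lemma Cclass_partial r U h k : Cclass r.+1 U h -> Cclass r U (partial [:: k] h).
Proof.
have E s : partial s (partial [:: k] h) = partial (rcons s k) h.
  by rewrite /partial -cats1 foldr_cat.
move=> [dh ch]; split => [s l v sr Uv|s v sr Uv]; rewrite E.
  by apply: dh => //; rewrite size_rcons.
by apply: ch => //; rewrite size_rcons.
Qed.

Lemma Cclass_le r r' U h : (r' <= r)%N -> Cclass r U h -> Cclass r' U h.
Proof.
move=> rr [dh ch]; split => [s l v sr|s v sr].
  by apply: dh; apply: leq_trans rr.
by apply: ch; apply: leq_trans rr.
Qed.

Lemma Cclass_sub r U U' h : U' `<=` U -> Cclass r U h -> Cclass r U' h.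
Proof. by move=> UU [dh ch]; split => [s l v sr /UU|s v sr /UU]; [exact: dh|exact: ch]. Qed.

(** A staircase from 0 to [v], one coordinate at a time: [Cclass] provides derivatives along
    coordinate directions only. *)
Let trunc (j : nat) v : 'rV[R]_m := \row_k (if (k < j)%N then v 0 k else 0).

Let trunc0 v : trunc 0 v = 0.
Proof. by apply/rowP => k; rewrite !mxE. Qed.

Let truncS (k : 'I_m) v : trunc k.+1 v = trunc k v + v 0 k *: unit_vec R k.
Proof.
apply/rowP => i; rewrite !mxE eqxx /= ltnS leq_eqVlt -val_eqE /=.
by case: eqP => [/val_inj->|_] /=; rewrite ?ltnn ?mulr1 ?add0r ?mulr0 ?addr0.
Qed.

Let trunc_full v : trunc m v = v.
Proof. by apply/rowP => i; rewrite !mxE ltn_ord. Qed.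

Let trunc_norm j v : `|trunc j v| <= `|v|.
Proof.
apply: norm_rV_le => // k; rewrite mxE; case: ifP => _; rewrite ?normr0 //.
exact: entry_le_norm.
Qed.

(** Each step of the staircase is a mean value theorem in one coordinate, and the partial
    derivatives at the intermediate point and at [z] are compared through their value at [z0]. Hence
    one radius serves all base points near [z0], as the compactness arguments require. *)
Lemma uniform_Taylor1 U h z0 : open U -> U z0 -> Cclass 1 U h ->
  forall e : R, 0 < e -> exists2 d : R, 0 < d & forall z v, `|z - z0| < d -> `|v| < d ->
    `|h (z + v) - h z - dot (grad h z) v| <= e * `|v|.
Proof.
move=> oU Uz0 [dh ch] e e0.
have [d1 d10 Ud1] := open_eps oU Uz0.
(* Two comparisons with [z0], each below [e1], in each of [m] steps cost at most [e]; [m.+1] also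
   covers m = 0. *)
pose e1 : R := e / (2 * m.+1%:R).
have e10 : 0 < e1 by rewrite divr_gt0 // mulr_gt0.
have [d2 d20 Hd2] : exists2 d : R, 0 < d & forall k : 'I_m, forall w, `|w - z0| < d ->
    `|partial [:: k] h w - partial [:: k] h z0| < e1.
  apply: finite_eps => [k d d' H _ dd' w wz|k]; first by apply: H; apply: lt_le_trans dd'.
  by apply: continuous_eps e10; apply: ch.
(* Intermediate points lie within 2 |v| of [z], hence within 3 d of [z0]. *)
pose d := Num.min d1 d2 / 3.
have dd1 : 3 * d <= d1 by rewrite /d mulrC divfK // ge_min lexx.
have dd2 : 3 * d <= d2 by rewrite /d mulrC divfK // ge_min lexx orbT.
have d0 : 0 < d by rewrite divr_gt0 // lt_min d10.
exists d => // z v zd vd.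
have near3 w : `|w - z| <= 2 * `|v| -> `|w - z0| < 3 * d.
  move=> wz; rewrite (_ : w - z0 = (w - z) + (z - z0)); last by rewrite addrA subrK.
  apply: le_lt_trans (ler_normD _ _) _.
  by apply: (@le_lt_trans _ _ (2 * `|v| + `|z - z0|)); lra.
have step (j : nat) : (j <= m)%N -> `|h (z + trunc j v) - h z - dot (grad h z) (trunc j v)|
    <= j%:R * (2 * e1) * `|v|.
  elim: j => [_|j IH jm]; first by rewrite trunc0 addr0 subrr dot0r subr0 normr0 !mul0r.
  have := IH (ltnW jm); set k : 'I_m := Ordinal jm.
  have -> : j = k :> nat by [].
  rewrite truncS dotDr dotZr dot_deltar mxE.
  have N (t : R) : 0 <= t <= 1 -> `|z + trunc k v + (t * v 0 k) *: unit_vec R k - z| <= 2 * `|v|.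
    move=> /andP[t0 t1]; rewrite addrAC (addrAC z) subrr add0r.
    apply: le_trans (ler_normD _ _) _; rewrite mulr2n mulrDl mul1r lerD //.
    apply: norm_rV_le => // i; rewrite !mxE normrM normrM (ger0_norm t0).
    have vk := entry_le_norm v k; have v0 := normr_ge0 (v 0 k).
    by case: (_ && _); rewrite ?normr1 ?normr0; nra.
  have [t t01 E] := @coord_MVT h (z + trunc k v) k (v 0 k) (fun t t01 =>
     dh [::] k _ isT (Ud1 _ (lt_le_trans (near3 _ (N t t01)) dd1))).
  rewrite (addrA z) => IH1; set w := z + trunc k v + (t * v 0 k) *: unit_vec R k in E.
  have -> : h (z + trunc k v + v 0 k *: unit_vec R k) - h z
    - (dot (grad h z) (trunc k v) + v 0 k * 'D_(unit_vec R k) h z)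
    = (h (z + trunc k v) - h z - dot (grad h z) (trunc k v))
    + v 0 k * (partial [:: k] h w - partial [:: k] h z).
    by rewrite mulrBr -E /=; ring.
  apply: le_trans (ler_normD _ _) _; rewrite -natr1 mulrDl mulrDl; apply: lerD => //.
  rewrite mul1r normrM mulrC ler_pM // ?entry_le_norm //.
  have := Hd2 k w (lt_le_trans (near3 _ (N t t01)) dd2).
  have := Hd2 k z (lt_le_trans (near3 _ _) dd2); rewrite subrr normr0 mulr_ge0 // => /(_ isT).
  rewrite (_ : partial [:: k] h w - partial [:: k] h z = (partial [:: k] h w
    - partial [:: k] h z0) - (partial [:: k] h z - partial [:: k] h z0)); last by ring.
  by move=> A B; apply: le_trans (ler_normB _ _) _; lra.
have := step m (leqnn m); rewrite trunc_full => H; apply: le_trans H _.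
rewrite ler_wpM2r // /e1 (_ : m%:R * _ = e * (m%:R / m.+1%:R)); last first.
  by field; rewrite ?pnatr_eq0 // natr1 pnatr_eq0.
by rewrite ler_piMr ?ltW // ltr_pdivrMr // mul1r ltr_nat.
Qed.

End FirstOrder.

HB.lock Definition hess (R : realType) (m : nat) (h : 'rV[R]_m -> R) (z : 'rV[R]_m) : 'M[R]_m :=
  \matrix_(k, l) partial [:: l; k] h z.

Section SecondOrder.
Variables (R : realType) (m : nat).
Implicit Types (x y z v w : 'rV[R]_m) (U : set 'rV[R]_m) (h : 'rV[R]_m -> R).

Lemma hess_entry h z k l : hess h z k l = partial [:: l; k] h z.
Proof. by rewrite hess.unlock mxE. Qed.

Lemma hessE h z v w :
  dot (v *m hess h z) w = \sum_k v 0 k * dot (grad (partial [:: k] h) z) w.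
Proof.
rewrite dot_sum; under eq_bigr do rewrite mxE mulr_suml.
rewrite exchange_big; apply: eq_bigr => k _; rewrite dot_sum mulr_sumr.
by apply: eq_bigr => l _; rewrite hess_entry mxE mulrA.
Qed.

Lemma derive_line U h z v (t : R) : open U -> Cclass 1 U h -> U (z + t *: v) ->
  is_derive t 1 (fun s : R => h (z + s *: v)) (dot (grad h (z + t *: v)) v).
Proof.
move=> oU ch Ut; apply: is_derive_eps => e e0.
have e'0 : 0 < e / (1 + `|v|) by rewrite divr_gt0 // ltr_pwDl.
have [d d0 Hd] := uniform_Taylor1 oU Ut ch e'0.
exists (d / (1 + `|v|)) => [|k kd]; first by rewrite divr_gt0 // ltr_pwDl.
rewrite scalerDl addrA [_ * k]mulrC -dotZr.
have kv : `|k *: v| < d.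
  rewrite normrZ; move: kd; rewrite ltr_pdivlMr ?ltr_pwDl // mulrDr mulr1.
  by have := normr_ge0 k; lra.
have := Hd (z + t *: v) (k *: v); rewrite subrr normr0 => /(_ d0 kv) H.
apply: le_trans H _; rewrite normrZ mulrA mulrAC ler_wpM2r // -mulrA ler_piMr ?ltW //.
by rewrite mulrC ltr_pdivrMr ?ltr_pwDl // mul1r ltrDr.
Qed.

Lemma is_derive_parabola (a b t : R) :
  is_derive t 1 (fun s : R => a * s + b * s ^+ 2) (a + 2 * b * t).
Proof.
apply: is_derive_eps => e e0; exists (e / (1 + `|b|)) => [|k].
  by rewrite divr_gt0 // ltr_pwDl.
rewrite ltr_pdivlMr ?ltr_pwDl // => kd.
have -> : a * (t + k) + b * (t + k) ^+ 2 - (a * t + b * t ^+ 2) - (a + 2 * b * t) * k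
  = b * k * k by ring.
rewrite !normrM ler_wpM2r //; apply: le_trans (ltW kd).
by rewrite mulrDr mulr1 mulrC lerDr.
Qed.

Lemma derive_line_sum (F dF : 'I_m -> R -> R) (a : 'I_m -> R) (t : R) :
  (forall k, is_derive t 1 (F k) (dF k t)) ->
  is_derive t 1 (fun s => \sum_k a k * F k s) (\sum_k a k * dF k t).
Proof.
move=> H; have -> : (fun s => \sum_k a k * F k s) = \sum_k (a k *: F k).
  by apply/funext => s; rewrite fct_sumE.
by apply: is_derive_sum => k; exact: (is_deriveZ (a k)).
Qed.

Lemma derive_line2 U h z v (t : R) : open U -> Cclass 2 U h -> U (z + t *: v) ->
  is_derive t 1 (fun s : R => dot (grad h (z + s *: v)) v)
    (dot (v *m hess h (z + t *: v)) v).
Proof.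
move=> oU ch Ut; rewrite hessE.
have -> : (fun s : R => dot (grad h (z + s *: v)) v)
  = (fun s => \sum_k v 0 k * (fun k s => partial [:: k] h (z + s *: v)) k s).
  by apply/funext => s; rewrite dot_sum; apply: eq_bigr => k _; rewrite mxE mulrC.
apply: (derive_line_sum (dF := fun k t => dot (grad (partial [:: k] h) (z + t *: v)) v)).
by move=> k; exact: (derive_line oU (Cclass_partial k ch) Ut).
Qed.

Definition segment_in U z v := forall t : R, 0 <= t <= 1 -> U (z + t *: v).

Lemma segment_MVT U h z v : open U -> Cclass 1 U h -> segment_in U z v ->
  exists2 t : R, 0 < t < 1 & h (z + v) - h z = dot (grad h (z + t *: v)) v.
Proof.
move=> oU ch sg; have [t t01|t t01 E] := @line_MVT _ (fun t : R => h (z + t *: v))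
    (fun t => dot (grad h (z + t *: v)) v).
  by apply: derive_line (sg t t01).
by exists t; rewrite // -E scale1r scale0r addr0.
Qed.

Lemma scale_norm_le (t : R) v : 0 <= t <= 1 -> `|t *: v| <= `|v|.
Proof.
move=> /andP[t0 t1]; rewrite normrZ ger0_norm //.
by rewrite ler_piMl.
Qed.

(** Along the segment subtract the parabola with the expected first and second derivatives; the mean
    value theorem turns the remainder into first-order remainders of the partial derivatives, which
    [uniform_Taylor1] controls uniformly. *)
Lemma uniform_Taylor2 U h z0 : open U -> U z0 -> Cclass 2 U h ->
  forall e : R, 0 < e -> exists2 d : R, 0 < d & forall z v, `|z - z0| < d -> `|v| < d ->
    `|h (z + v) - h z - dot (grad h z) v - 2^-1 * dot (v *m hess h z) v| <= e * `|v| ^+ 2.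
Proof.
move=> oU Uz0 ch e e0.
have [d1 d10 Ud1] := open_eps oU Uz0.
pose e1 : R := e / m.+1%:R.
have e10 : 0 < e1 by rewrite divr_gt0.
have [d2 d20 Hd2] : exists2 d : R, 0 < d & forall k : 'I_m, forall z v,
    `|z - z0| < d -> `|v| < d ->
    `|partial [:: k] h (z + v) - partial [:: k] h z
      - dot (grad (partial [:: k] h) z) v| <= e1 * `|v|.
  apply: finite_eps => [k d d' H _ dd' z v zd vd|k].
    by apply: H; apply: lt_le_trans dd'.
  exact: (uniform_Taylor1 oU Uz0 (Cclass_partial k ch) e10).
pose d := Num.min d1 d2 / 2.
have dd1 : 2 * d <= d1 by rewrite /d mulrC divfK // ge_min lexx.
have dd2 : 2 * d <= d2 by rewrite /d mulrC divfK // ge_min lexx orbT.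
have d0 : 0 < d by rewrite divr_gt0 // lt_min d10.
exists d => // z v zd vd.
have Ut (t : R) : 0 <= t <= 1 -> U (z + t *: v).
  move=> t01; apply: Ud1; rewrite addrAC; apply: le_lt_trans (ler_normD _ _) _.
  by apply: le_lt_trans (_ : `|z - z0| + `|v| < _); [rewrite lerD2l scale_norm_le|lra].
pose Q := dot (v *m hess h z) v; pose D := dot (grad h z) v.
have [t t01|t /andP[t0 t1] E] := @line_MVT _
   ((fun t : R => h (z + t *: v)) - (fun t : R => D * t + 2^-1 * Q * t ^+ 2))
   (fun t => dot (grad h (z + t *: v)) v - (D + Q * t)).
  have H1 := derive_line oU (Cclass_le (isT : (1 <= 2)%N) ch) (Ut t t01).
  have H2 := is_derive_parabola D (2^-1 * Q) t.
  rewrite (_ : Q * t = 2 * (2^-1 * Q) * t); last by rewrite mulrA divff ?mul1r.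
  exact: (is_deriveB H1 H2).
have {}E : h (z + v) - h z - D - 2^-1 * Q = dot (grad h (z + t *: v)) v - (D + Q * t).
  rewrite -E !fctE /= scale1r scale0r addr0; ring.
rewrite E.
have -> : dot (grad h (z + t *: v)) v - (D + Q * t) = \sum_k v 0 k *
   (partial [:: k] h (z + t *: v) - partial [:: k] h z
      - dot (grad (partial [:: k] h) z) (t *: v)).
  rewrite /D /Q hessE opprD addrA -dotBl (dot_sum (_ - _)) mulr_suml -sumrB.
  by apply: eq_bigr => k _; rewrite dotZr !mxE /=; ring.
have t01 : 0 <= t <= 1 by rewrite !ltW.
have tv : `|t *: v| < d2 by apply: le_lt_trans (scale_norm_le v t01) _; lra.
apply: le_trans (ler_norm_sum _ _ _) _.
apply: (@le_trans _ _ (\sum_(k < m) e1 * `|v| ^+ 2)); last first.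
  rewrite sumr_const card_ord -mulr_natl mulrA ler_wpM2r ?exprn_ge0 //.
  by rewrite /e1 mulrCA ler_piMr ?ltW // ltr_pdivrMr // mul1r ltr_nat.
apply: ler_sum => k _; rewrite normrM expr2 mulrCA ler_pM ?entry_le_norm //.
apply: le_trans (Hd2 k z (t *: v) _ tv) _; first by lra.
by rewrite ler_wpM2l ?(ltW e10) // scale_norm_le.
Qed.

(** The mean value theorem in direction [k], applied to the difference of [h] along two parallel
    segments, leaves an increment of D_k h in direction [l]. The mixed difference itself is
    symmetric in [k] and [l], which yields the symmetry of the Hessian. *)
Lemma mixed_difference U h z (k l : 'I_m) : open U -> U z -> Cclass 2 U h ->
  forall e : R, 0 < e -> exists2 d : R, 0 < d & forall t, 0 < t -> t < d ->
    `|h (z + t *: unit_vec R k + t *: unit_vec R l) - h (z + t *: unit_vec R k)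
      - h (z + t *: unit_vec R l) + h z - t ^+ 2 * partial [:: l; k] h z| <= e * t ^+ 2.
Proof.
move=> oU Uz ch e e0.
have [d1 d10 Ud1] := open_eps oU Uz.
have e20 : 0 < e / 2 by rewrite divr_gt0.
have ck := Cclass_partial k ch.
have [d2 d20 Hd2] := uniform_Taylor1 oU Uz ck e20.
have [d3 d30 Hd3] := continuous_eps (ck.2 [:: l] z isT Uz) e20.
pose d := Num.min d1 (Num.min d2 d3) / 2.
have dd1 : 2 * d <= d1 by rewrite /d mulrC divfK // !ge_min lexx.
have dd2 : 2 * d <= d2 by rewrite /d mulrC divfK // !ge_min lexx orbT.
have dd3 : 2 * d <= d3 by rewrite /d mulrC divfK // !ge_min lexx !orbT.
have d0 : 0 < d by rewrite divr_gt0 // !lt_min d10 d20.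
exists d => // t t0 td.
have nt (i : 'I_m) (s : R) : 0 <= s <= 1 -> `|s *: (t *: unit_vec R i)| <= t.
  move=> s01; apply: (le_trans (scale_norm_le (t *: unit_vec R i) s01)).
  apply: norm_rV_le => [|j]; first exact: ltW.
  rewrite !mxE normrM (gtr0_norm t0) ler_piMr ?(ltW t0) //.
  by case: (_ && _); rewrite ?normr1 ?normr0.
have n1 (i : 'I_m) : `|t *: unit_vec R i| <= t.
  by rewrite -[t *: _]scale1r nt // ler01 lexx.
have Ua (s : R) : 0 <= s <= 1 -> U (z + s *: (t *: unit_vec R k)).
  by move=> s01; apply: Ud1; rewrite addrAC subrr add0r; have := nt k s s01; lra.
have Ub (s : R) : 0 <= s <= 1 -> U (z + t *: unit_vec R l + s *: (t *: unit_vec R k)).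
  move=> s01; apply: Ud1; rewrite -[z + _ + _]addrA addrAC subrr add0r.
  by apply: le_lt_trans (ler_normD _ _) _; have := nt k s s01; have := n1 l; lra.
have c1 := Cclass_le (isT : (1 <= 2)%N) ch.
have [s s01|s /andP[s0 s1] E] := @line_MVT _
   ((fun s : R => h (z + t *: unit_vec R l + s *: (t *: unit_vec R k)))
     - (fun s : R => h (z + s *: (t *: unit_vec R k))))
   (fun s => dot (grad h (z + t *: unit_vec R l + s *: (t *: unit_vec R k))) (t *: unit_vec R k)
    - dot (grad h (z + s *: (t *: unit_vec R k))) (t *: unit_vec R k)).
  have H1 := derive_line oU c1 (Ua s s01).
  have H2 := derive_line oU c1 (Ub s s01).
  exact: (is_deriveB H2 H1).
have s01 : 0 <= s <= 1 by rewrite !ltW.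
move: E; rewrite !fctE !scale1r !scale0r !addr0 !dotZr !dot_deltar !mxE.
set w := z + s *: (t *: unit_vec R k).
rewrite [z + t *: unit_vec R l + s *: _]addrAC -/w.
rewrite [z + t *: unit_vec R l + _]addrAC => E0.
have E : h (z + t *: unit_vec R k + t *: unit_vec R l) - h (z + t *: unit_vec R k)
  - (h (z + t *: unit_vec R l) - h z)
  = t * partial [:: k] h (w + t *: unit_vec R l) - t * partial [:: k] h w := E0.
have wz : `|w - z| <= t by rewrite /w addrAC subrr add0r nt.
have H2 : `|w - z| < d2 -> `|t *: unit_vec R l| < d2 -> `|partial [:: k] h (w + t *: unit_vec R l)
    - partial [:: k] h w - t * partial [:: l; k] h w| <= e / 2 * `|t *: unit_vec R l|.
  by have := Hd2 w (t *: unit_vec R l); rewrite dotZr dot_deltar mxE.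
have := Hd3 w (le_lt_trans wz _) => H3.
set X := (X in `|X|).
have -> : X = t * (partial [:: k] h (w + t *: unit_vec R l) - partial [:: k] h w
    - t * partial [:: l; k] h w) + t ^+ 2 * (partial [:: l; k] h w - partial [:: l; k] h z).
  rewrite /X -[LHS](_ : (h (z + t *: unit_vec R k + t *: unit_vec R l)
     - h (z + t *: unit_vec R k) - (h (z + t *: unit_vec R l) - h z))
     - t ^+ 2 * partial [:: l; k] h z = _); last by ring.
  rewrite E; move: (partial [:: k] h w) (partial [:: k] h (w + _)) (partial [:: l; k] h w)
    (partial [:: l; k] h z) => p1 p2 p3 p4; ring.
apply: le_trans (ler_normD _ _) _; rewrite !normrM (gtr0_norm t0).
have A : `|partial [:: k] h (w + t *: unit_vec R l) - partial [:: k] h w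
    - t * partial [:: l; k] h w| <= e / 2 * t.
  apply: le_trans (H2 _ _) _; [|have := n1 l|]; [clear -wz dd2 td t0; lra|clear -dd2 td t0; lra|].
  by rewrite ler_wpM2l ?(ltW e20).
have B : `|partial [:: l; k] h w - partial [:: l; k] h z| <= e / 2.
  by apply/ltW/H3; clear -dd3 td t0; lra.
have -> : e * t ^+ 2 = t * (e / 2 * t) + t * t * (e / 2) by field.
by apply: lerD; apply: ler_wpM2l => //; rewrite ?mulr_ge0 // ltW.
Qed.

Lemma hess_sym U h z : open U -> U z -> Cclass 2 U h -> (hess h z)^T = hess h z.
Proof.
move=> oU Uz ch; apply/matrixP => k l; rewrite mxE !hess_entry; apply/eqP; rewrite -subr_eq0 -normr_le0.
apply/ler_addgt0Pl => e e0; rewrite addr0.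
have e20 : 0 < e / 2 by rewrite divr_gt0.
have [d d0 Hd] := mixed_difference k l oU Uz ch e20.
have [d' d'0 Hd'] := mixed_difference l k oU Uz ch e20.
pose t := Num.min d d' / 2.
have t0 : 0 < t by rewrite divr_gt0 // lt_min d0.
have td : t < d by rewrite ltr_pdivrMr // gt_min; apply/orP; left; lra.
have td' : t < d' by rewrite ltr_pdivrMr // gt_min; apply/orP; right; lra.
have := Hd t t0 td; have := Hd' t t0 td'.
rewrite [z + t *: _ + _]addrAC => A B.
have t20 : 0 < t ^+ 2 by rewrite exprn_gt0.
rewrite -(ler_pM2l t20) -[X in X * `|_|]gtr0_norm // -normrM.
have -> : t ^+ 2 * e = e / 2 * t ^+ 2 + e / 2 * t ^+ 2 by field.
set XA := (X in `|X| <= _) in A; set XB := (X in `|X| <= _) in B.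
have -> : t ^+ 2 * (partial [:: k; l] h z - partial [:: l; k] h z) = XB - XA.
  rewrite /XA /XB; move: (partial [:: l; k] h z) (partial [:: k; l] h z) => p1 p2; ring.
exact: (le_trans (ler_normB XB XA) (lerD B A)).
Qed.

Lemma bil_sym U h z v w : open U -> U z -> Cclass 2 U h ->
  dot (v *m hess h z) w = dot (w *m hess h z) v.
Proof. by move=> oU Uz ch; rewrite dot_mulmx (hess_sym oU Uz ch) dotC. Qed.

(* A lower bound on the second derivative along a segment bounds the second
   difference from below: subtract the parabola and apply the mean value theorem. *)
Lemma second_difference_ge U h z v (c : R) : open U -> Cclass 2 U h ->
  (forall t : R, -1 <= t <= 1 -> U (z + t *: v)) ->
  (forall t : R, -1 <= t <= 1 -> c <= dot (v *m hess h (z + t *: v)) v) ->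
  c <= h (z + v) + h (z - v) - 2 * h z.
Proof.
move=> oU ch Ut Hc.
pose k t := dot (grad h (z + t *: v)) v.
have c1 := Cclass_le (isT : (1 <= 2)%N) ch.
have nv t : z + t *: - v = z + (- t) *: v by rewrite scalerN scaleNr.
have [t /andP[t0 t1]|t /andP[t0 t1] E] := @line_MVT _
   ((fun t : R => h (z + t *: v)) + (fun t : R => h (z + t *: - v))
     - (fun t : R => 0 * t + c * t ^+ 2))
   (fun t => k t - k (- t) - (0 + 2 * c * t)).
  have H1 : is_derive t 1 (fun t : R => h (z + t *: v)) (k t).
    by apply: (derive_line oU c1); apply: Ut; apply/andP; split; lra.
  have H2 : is_derive t 1 (fun t : R => h (z + t *: - v)) (- k (- t)).
    rewrite /k -nv -dotNr; apply: (derive_line oU c1); rewrite nv; apply: Ut.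
    by apply/andP; split; lra.
  exact: (is_deriveB (is_deriveD H1 H2) (is_derive_parabola 0 c t)).
have P r : z - t *: v + r *: ((2 * t) *: v) = z + (- t + r * (2 * t)) *: v.
  by rewrite -addrA scalerA -scaleNr -scalerDl.
have [s|s /andP[s0 s1]] := @line_MVT _
   (fun s : R => dot (grad h (z - t *: v + s *: ((2 * t) *: v))) ((2 * t) *: v))
   (fun s => dot (((2 * t) *: v) *m hess h (z - t *: v + s *: ((2 * t) *: v))) ((2 * t) *: v)).
  by move=> /andP[s0 s1]; apply: (derive_line2 oU ch); rewrite P; apply: Ut; nra.
rewrite !P (_ : - t + 1 * (2 * t) = t); last by ring.
rewrite (_ : - t + 0 * (2 * t) = - t); last by ring.
rewrite !dotZr -/(k t) -/(k (- t)) -scalemxAl dotZl => Es.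
have Hs : c <= dot (v *m hess h (z + (- t + s * (2 * t)) *: v)) v by apply: Hc; nra.
move: E; rewrite !fctE /= !scale1r !scale0r !addr0 => E.
have -> : h (z + v) + h (z - v) - 2 * h z = c + (k t - k (- t) - (0 + 2 * c * t)).
  by rewrite -E; ring.
rewrite lerDl.
have Es' : k t - k (- t) = 2 * t * dot (v *m hess h (z + (- t + s * (2 * t)) *: v)) v.
  apply: (@mulfI _ (2 * t)); first by rewrite mulf_neq0 // gt_eqF.
  by rewrite mulrBr Es.
by rewrite Es'; nra.
Qed.

Lemma gradient_Lipschitz_Taylor U h z v (L : R) : open U -> Cclass 1 U h ->
  segment_in U z v ->
  (forall k (t : R), 0 <= t <= 1 ->
     `|partial [:: k] h (z + t *: v) - partial [:: k] h z| <= L * `|v|) ->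
  `|h (z + v) - h z - dot (grad h z) v| <= m%:R * L * `|v| ^+ 2.
Proof.
move=> oU ch sg HL; have [t /andP[t0 t1] ->] := segment_MVT oU ch sg.
rewrite -dotBl dot_sum; apply: le_trans (ler_norm_sum _ _ _) _.
apply: (@le_trans _ _ (\sum_(k < m) L * `|v| ^+ 2)); last first.
  by rewrite sumr_const card_ord -[leLHS]mulr_natl mulrA.
apply: ler_sum => k _; rewrite normrM !mxE expr2 mulrA ler_pM ?entry_le_norm //.
by apply: (HL k t); rewrite !ltW.
Qed.

End SecondOrder.

(** * Pointwise continuity of real functions *)

Section Continuity.
Variables (R : realType) (T : topologicalType).
Implicit Types (f g : T -> R) (x : T).

Lemma cont_cst (c : R) x : {for x, continuous (fun _ : T => c)}.
Proof. exact: cst_continuous. Qed.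

Lemma cont_add f g x : {for x, continuous f} -> {for x, continuous g} ->
  {for x, continuous (fun w => f w + g w)}.
Proof. by move=> cf cg; apply: continuousD. Qed.

Lemma cont_opp f x : {for x, continuous f} -> {for x, continuous (fun w => - f w)}.
Proof. by move=> cf; apply: continuousN. Qed.

Lemma cont_sub f g x : {for x, continuous f} -> {for x, continuous g} ->
  {for x, continuous (fun w => f w - g w)}.
Proof. by move=> cf cg; apply: cont_add => //; exact: cont_opp. Qed.

Lemma cont_mul f g x : {for x, continuous f} -> {for x, continuous g} ->
  {for x, continuous (fun w => f w * g w)}.
Proof. by move=> cf cg; apply: continuousM. Qed.

Lemma cont_sum (I : Type) (r : seq I) (f_ : I -> T -> R) x :
  (forall i, {for x, continuous (f_ i)}) -> {for x, continuous (fun w => \sum_(i <- r) f_ i w)}.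
Proof.
move=> H; elim: r => [|i r IH].
  rewrite (_ : (fun w => _) = (fun _ => 0)); first exact: cont_cst.
  by apply/funext => w; rewrite big_nil.
rewrite (_ : (fun w => _) = (fun w => f_ i w + \sum_(i <- r) f_ i w)); first exact: cont_add.
by apply/funext => w; rewrite big_cons.
Qed.

Lemma EVT_pointwise (K : set T) f : K !=set0 -> compact K ->
  (forall z : T, K z -> {for z, continuous f}) ->
  exists2 z, K z & forall w, K w -> f w <= f z.
Proof.
move=> K0 cK cf; have [|z Kz Hz] := @compact_EVT_max _ _ f K K0 cK.
  by apply: continuous_in_subspaceT => z; rewrite inE => /cf.
by exists z => [|w Kw]; [rewrite inE in Kz|apply: Hz; rewrite inE].
Qed.

End Continuity.

(** * Jets and a perturbed maximum principle *)

Section Jets.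
Variables (R : realType) (m : nat).
Implicit Types (x y z v w : 'rV[R]_m) (f g l q : 'rV[R]_m -> R) (c : R).

Definition linear_part l : Prop :=
  [/\ forall a x, l (a *: x) = a * l x, forall x y, l (x + y) = l x + l y,
      exists2 C : R, 0 <= C & forall x, `|l x| <= C * `|x| & continuous l].

Definition quadratic_part q : Prop :=
  [/\ forall a x, q (a *: x) = a ^+ 2 * q x,
      forall x y, q (x + y) + q (x - y) = 2 * q x + 2 * q y,
      exists2 C : R, 0 <= C & forall x, `|q x| <= C * `|x| ^+ 2 & continuous q].

Definition jet f z c l q : Prop :=
  [/\ linear_part l, quadratic_part q & forall e : R, 0 < e -> exists2 d : R, 0 < d &
      forall x, `|x| < d -> `|f (z + x) - c - l x - q x| <= e * `|x| ^+ 2].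

Lemma continuous_scale (k : R) f : continuous f -> continuous (fun x => k * f x).
Proof. by move=> cf x; apply: cont_mul; [exact: cont_cst|exact: cf]. Qed.

Lemma linear_part0 : linear_part (fun _ => 0).
Proof.
split=> [a x|x y||]; rewrite ?mulr0 ?addr0 //; first by exists 0 => // x; rewrite normr0 mul0r.
by move=> x; apply: cont_cst.
Qed.

Lemma quadratic_part0 : quadratic_part (fun _ => 0).
Proof.
split=> [a x|x y||]; rewrite ?mulr0 ?addr0 //; first by exists 0 => // x; rewrite normr0 mul0r.
by move=> x; apply: cont_cst.
Qed.

Lemma linear_partD l l' : linear_part l -> linear_part l' -> linear_part (fun x => l x + l' x).
Proof.
move=> [h1 h2 [C C0 h3] h4] [k1 k2 [D D0 k3] k4]; split=> [a x|x y||x].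
- by rewrite h1 k1 mulrDr.
- by rewrite h2 k2 addrACA.
- exists (C + D) => [|x]; first exact: addr_ge0.
  by rewrite mulrDl; apply: le_trans (ler_normD _ _) _; apply: lerD.
- by apply: cont_add; [exact: h4|exact: k4].
Qed.

Lemma linear_partZ k l : linear_part l -> linear_part (fun x => k * l x).
Proof.
move=> [h1 h2 [C C0 h3] h4]; split=> [a x|x y||].
- by rewrite h1 mulrCA.
- by rewrite h2 mulrDr.
- exists (`|k| * C) => [|x]; first by rewrite mulr_ge0.
  by rewrite normrM -mulrA ler_wpM2l.
- exact: continuous_scale.
Qed.

Lemma quadratic_partD q q' : quadratic_part q -> quadratic_part q' ->
  quadratic_part (fun x => q x + q' x).
Proof.
move=> [h1 h2 [C C0 h3] h4] [k1 k2 [D D0 k3] k4]; split=> [a x|x y||x].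
- by rewrite h1 k1 mulrDr.
- by rewrite addrACA h2 k2; ring.
- exists (C + D) => [|x]; first exact: addr_ge0.
  by rewrite mulrDl; apply: le_trans (ler_normD _ _) _; apply: lerD.
- by apply: cont_add; [exact: h4|exact: k4].
Qed.

Lemma quadratic_partZ k q : quadratic_part q -> quadratic_part (fun x => k * q x).
Proof.
move=> [h1 h2 [C C0 h3] h4]; split=> [a x|x y||].
- by rewrite h1 mulrCA.
- by rewrite -mulrDr h2; ring.
- exists (`|k| * C) => [|x]; first by rewrite mulr_ge0.
  by rewrite normrM -mulrA ler_wpM2l.
- exact: continuous_scale.
Qed.

Lemma quadratic_partM l l' : linear_part l -> linear_part l' ->
  quadratic_part (fun x => l x * l' x).
Proof.
move=> [h1 h2 [C C0 h3] h4] [k1 k2 [D D0 k3] k4]; split=> [a x|x y||x].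
- by rewrite h1 k1; ring.
- by rewrite -[- y]scaleN1r !h2 !k2 h1 k1; ring.
- exists (C * D) => [|x]; first exact: mulr_ge0.
  by rewrite normrM expr2 mulrACA ler_pM.
- by apply: cont_mul; [exact: h4|exact: k4].
Qed.

Lemma dot_continuous v : continuous (fun x => dot v x).
Proof.
move=> x; rewrite (_ : (fun y => _) = (fun y => \sum_k v 0 k * y 0 k)); last first.
  by apply/funext => y; rewrite dot_sum.
apply: cont_sum => k; apply: cont_mul; first exact: cont_cst.
exact: coord_continuous.
Qed.

Lemma linear_part_dot v : linear_part (fun x => dot v x).
Proof.
split=> [a x|x y||]; rewrite ?dotE //; last exact: dot_continuous.
by exists (m%:R * `|v|) => // x; exact: dot_le_norm.
Qed.

Lemma linear_part_dotM v (A : 'M[R]_m) : linear_part (fun x => dot v (x *m A)).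
Proof.
have -> : (fun x => dot v (x *m A)) = (fun x => dot (v *m A^T) x).
  by apply/funext => x; rewrite dot_mulmx trmxK.
exact: linear_part_dot.
Qed.

Lemma quadratic_part_sum (I : finType) (q_ : I -> 'rV[R]_m -> R) :
  (forall i, quadratic_part (q_ i)) -> quadratic_part (fun x => \sum_i q_ i x).
Proof.
move=> H; rewrite (_ : (fun x => _) = \sum_i q_ i); last by apply/funext => x; rewrite fct_sumE.
elim/big_ind: _ => [||i _]; [exact: quadratic_part0| |exact: H].
by move=> a b; exact: quadratic_partD.
Qed.

Lemma quadratic_part_bil (A B : 'M[R]_m) : quadratic_part (fun x => dot (x *m A) (x *m B)).
Proof.
rewrite (_ : (fun x => _) = (fun x => \sum_k dot (delta_mx 0 k) (x *m A) * dot (delta_mx 0 k) (x *m B))).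
  by apply: quadratic_part_sum => k; apply: quadratic_partM; exact: linear_part_dotM.
by apply/funext => x; rewrite dot_sum; apply: eq_bigr => k _; rewrite ![dot (delta_mx _ _) _]dotC !dot_deltar.
Qed.

Lemma jet_value f z c l q : jet f z c l q -> f z = c.
Proof.
move=> [[l1 _ _ _] [q1 _ _ _] H]; apply/eqP; rewrite -subr_eq0 -normr_le0.
have [d d0] := H 1 ltr01; move=> /(_ 0); rewrite normr0 => /(_ d0).
have := l1 0 0; rewrite scale0r mul0r => ->; have := q1 0 0; rewrite scale0r expr0n mul0r => ->.
by rewrite addr0 mulr0 !subr0.
Qed.

Lemma jet_continuous f z c l q : jet f z c l q -> {for z, continuous f}.
Proof.
move=> J; have fz := jet_value J; case: J => [[_ _ [C C0 lC] _] [_ _ [D D0 qD] _] H].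
apply: continuous_of_eps => e e0; have [d d0 Hd] := H 1 ltr01.
pose K := C + D + 2.
have K0 : 0 < K by rewrite /K; lra.
exists (Num.min 1 (Num.min d (e / K))) => [|w]; first by rewrite !lt_min ltr01 d0 divr_gt0.
rewrite !lt_min => /and3P[w1 wd we]; have := Hd (w - z) wd; rewrite (addrC z) subrK.
rewrite ltr_pdivlMr // in we; rewrite fz.
set x := w - z in w1 we *; have := lC x; have := qD x.
have := normr_ge0 x; set n := `|x| in w1 we *; move=> n0 hq hl hf.
have -> : f w - c = (f w - c - l x - q x) + (l x + q x) by ring.
apply: le_lt_trans (ler_normD _ _) _; apply: le_lt_trans (lerD (lexx _) (ler_normD _ _)) _.
have n2 : n ^+ 2 <= n by rewrite expr2 ler_piMl // ltW.
have := ler_wpM2l D0 n2; rewrite /K in we; nra.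
Qed.

Lemma jet_cst c z : jet (fun _ => c) z c (fun _ => 0) (fun _ => 0).
Proof.
split; [exact: linear_part0|exact: quadratic_part0|move=> e e0; exists 1 => // x _].
by rewrite subrr !subr0 normr0 mulr_ge0 ?exprn_ge0 // ltW.
Qed.

Lemma jetD f g z c c' l l' q q' : jet f z c l q -> jet g z c' l' q' ->
  jet (fun w => f w + g w) z (c + c') (fun x => l x + l' x) (fun x => q x + q' x).
Proof.
move=> [lp qp H] [lp' qp' H']; split; [exact: linear_partD|exact: quadratic_partD|].
move=> e e0; have e20 : 0 < e / 2 by rewrite divr_gt0.
have [d d0 Hd] := H _ e20; have [d' d'0 Hd'] := H' _ e20.
exists (Num.min d d') => [|x]; first by rewrite lt_min d0.
rewrite lt_min => /andP[/Hd A /Hd' B].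
have -> : f (z + x) + g (z + x) - (c + c') - (l x + l' x) - (q x + q' x)
  = (f (z + x) - c - l x - q x) + (g (z + x) - c' - l' x - q' x) by ring.
by apply: le_trans (ler_normD _ _) _; lra.
Qed.

Lemma jetZ k f z c l q : jet f z c l q ->
  jet (fun w => k * f w) z (k * c) (fun x => k * l x) (fun x => k * q x).
Proof.
move=> [lp qp H]; split; [exact: linear_partZ|exact: quadratic_partZ|].
move=> e e0; have [|d d0 Hd] := H (e / (1 + `|k|)); first by rewrite divr_gt0 // ltr_pwDl.
exists d => // x /Hd A; rewrite -!mulrBr normrM; apply: le_trans (ler_wpM2l (normr_ge0 k) A) _.
rewrite mulrA ler_wpM2r ?exprn_ge0 // mulrCA ler_piMr ?(ltW e0) //.
by rewrite ler_pdivrMr ?ltr_pwDl // mul1r lerDr.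
Qed.

Lemma jet_sum (I : finType) (f_ : I -> 'rV[R]_m -> R) z (c_ : I -> R)
    (l_ q_ : I -> 'rV[R]_m -> R) : (forall i, jet (f_ i) z (c_ i) (l_ i) (q_ i)) ->
  jet (fun w => \sum_i f_ i w) z (\sum_i c_ i) (fun x => \sum_i l_ i x)
    (fun x => \sum_i q_ i x).
Proof.
move=> H; elim: (index_enum I) => [|i r IH].
  have E (F : I -> 'rV[R]_m -> R) : (fun w => \sum_(i <- [::]) F i w) = (fun _ => 0).
    by apply/funext => w; rewrite big_nil.
  by rewrite !E big_nil; exact: jet_cst.
have E (F : I -> 'rV[R]_m -> R) : (fun w => \sum_(j <- i :: r) F j w)
    = (fun w => F i w + \sum_(j <- r) F j w).
  by apply/funext => w; rewrite big_cons.
by rewrite !E big_cons; exact: jetD.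
Qed.

Let small3 (C e : R) : 0 <= C -> 0 < e -> exists2 d : R, 0 < d &
  forall n : R, 0 <= n -> n < d -> [/\ n <= 1, C * n <= e & n ^+ 2 <= n].
Proof.
move=> C0 e0; have C10 : 0 < 1 + C by lra.
exists (Num.min 1 (e / (1 + C))) => [|n n0]; first by rewrite lt_min ltr01 divr_gt0.
rewrite lt_min ltr_pdivlMr // => /andP[n1 ne].
by split; nra.
Qed.

Lemma jetM f g z c c' l l' q q' : jet f z c l q -> jet g z c' l' q' ->
  jet (fun w => f w * g w) z (c * c') (fun x => c * l' x + c' * l x)
    (fun x => c * q' x + c' * q x + l x * l' x).
Proof.
move=> [lp qp H] [lp' qp' H']; split.
- by apply: linear_partD; apply: linear_partZ.
- by apply: quadratic_partD; [apply: quadratic_partD; exact: quadratic_partZ|exact: quadratic_partM].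
move=> e e0.
case: lp qp lp' qp' => [_ _ [a a0 la] _] [_ _ [b b0 qb] _] [_ _ [a' a'0 la'] _] [_ _ [b' b'0 qb'] _].
(* One bound for all coefficients: each error is then a multiple of K e1 n^2 or of K^2 n^3, n being
   the norm of the increment. *)
pose K := 1 + `|c| + `|c'| + a + b + a' + b'.
have c0 := normr_ge0 c; have c'0 := normr_ge0 c'.
have [K0 aK bK a'K b'K] : [/\ 0 < K, a <= K, b <= K, a' <= K & b' <= K].
  by rewrite /K; clear -a0 b0 a'0 b'0 c0 c'0; split; lra.
pose e1 := Num.min 1 (e / (8 * K)).
have e10 : 0 < e1 by rewrite lt_min ltr01 divr_gt0 // mulr_gt0.
have e11 : e1 <= 1 by rewrite ge_min lexx.
have e1e : e1 * (8 * K) <= e by rewrite -ler_pdivlMr ?mulr_gt0 // ge_min lexx orbT.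
have [d d0 Hd] := H _ e10; have [d' d'0 Hd'] := H' _ e10.
have [|d3 d30 Hd3] := @small3 (4 * K ^+ 2) e _ e0; first by rewrite mulr_ge0 ?exprn_ge0 // ltW.
exists (Num.min d (Num.min d' d3)) => [|x]; first by rewrite !lt_min d0 d'0.
rewrite !lt_min => /and3P[/Hd A /Hd' B /(Hd3 _ (normr_ge0 x))[n1 ne n2]].
have := la x; have := qb x; have := la' x; have := qb' x; have n0 := normr_ge0 x.
set n := `|x| in A B n0 n1 n2 ne *; set L := l x in A *; set L' := l' x in B *.
set Q := q x in A *; set Q' := q' x in B *; set F := f _ in A *; set G := g _ in B *.
move=> hQ' hL' hQ hL.
have n20 : 0 <= n ^+ 2 by rewrite exprn_ge0.
have hQ1 : `|Q| <= K * n ^+ 2.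
  by apply: le_trans hQ _; rewrite ler_wpM2r.
have hQ1' : `|Q'| <= K * n ^+ 2.
  by apply: le_trans hQ' _; rewrite ler_wpM2r.
have hL1 : `|L| <= K * n.
  by apply: le_trans hL _; rewrite ler_wpM2r.
have hL1' : `|L'| <= K * n.
  by apply: le_trans hL' _; rewrite ler_wpM2r.
have hG : `|G| <= K.
  have -> : G = (G - c' - L' - Q') + (c' + L' + Q') by ring.
  have t1 := ler_normD (G - c' - L' - Q') (c' + L' + Q').
  have t2 := ler_normD (c' + L') Q'; have t3 := ler_normD c' L'.
  have : e1 * n ^+ 2 <= 1 by rewrite mulr_ile1 ?(ltW e10) // (le_trans n2).
  have : b' * n ^+ 2 <= b' by rewrite ler_piMr // (le_trans n2).
  have : a' * n <= a' by rewrite ler_piMr.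
  by rewrite /K; clear -t1 t2 t3 B hQ' hL' c0 a0 b0; lra.
have hP : `|c + L + Q| <= K.
  have t2 := ler_normD (c + L) Q; have t3 := ler_normD c L.
  have : b * n ^+ 2 <= b by rewrite ler_piMr // (le_trans n2).
  have : a * n <= a by rewrite ler_piMr.
  by rewrite /K; clear -t2 t3 hQ hL c'0 a'0 b'0; lra.
have -> : F * G - c * c' - (c * L' + c' * L) - (c * Q' + c' * Q + L * L')
  = (F - c - L - Q) * G + (c + L + Q) * (G - c' - L' - Q') + (L * Q' + Q * L' + Q * Q') by ring.
have u1 := ler_normD ((F - c - L - Q) * G + (c + L + Q) * (G - c' - L' - Q')) (L * Q' + Q * L' + Q * Q').
have u2 := ler_normD ((F - c - L - Q) * G) ((c + L + Q) * (G - c' - L' - Q')).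
have u3 := ler_normD (L * Q' + Q * L') (Q * Q').
have u4 := ler_normD (L * Q') (Q * L').
rewrite !normrM in u1 u2 u3 u4.
have v1 : `|F - c - L - Q| * `|G| <= e1 * n ^+ 2 * K by apply: ler_pM.
have v2 : `|c + L + Q| * `|G - c' - L' - Q'| <= K * (e1 * n ^+ 2) by apply: ler_pM.
have v3 : `|L| * `|Q'| <= K * n * (K * n ^+ 2) by apply: ler_pM.
have v4 : `|Q| * `|L'| <= K * n ^+ 2 * (K * n) by apply: ler_pM.
have v5 : `|Q| * `|Q'| <= K * n ^+ 2 * (K * n ^+ 2) by apply: ler_pM.
have w1 : e1 * (8 * K) * n ^+ 2 <= e * n ^+ 2 by rewrite ler_wpM2r.
have w2 : 4 * K ^+ 2 * n * n ^+ 2 <= e * n ^+ 2 by rewrite ler_wpM2r.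
have w3 : K ^+ 2 * n ^+ 2 * n ^+ 2 <= K ^+ 2 * n * n ^+ 2.
  by rewrite ler_wpM2r // ler_wpM2l // exprn_ge0 // ltW.
have en : 0 <= e * n ^+ 2 by rewrite mulr_ge0 // ltW.
have kk : 0 <= K ^+ 2 * n * n ^+ 2 by rewrite !mulr_ge0 ?exprn_ge0 // ltW.
clear -u1 u2 u3 u4 v1 v2 v3 v4 v5 w1 w2 w3 en kk; lra.
Qed.

Lemma jet_comp f z c l q (F : R -> R) (F1 F2 : R) : jet f z c l q ->
  (forall e : R, 0 < e -> exists2 d : R, 0 < d &
     forall t : R, `|t| < d -> `|F (c + t) - F c - F1 * t - F2 * t ^+ 2| <= e * t ^+ 2) ->
  jet (fun w => F (f w)) z (F c) (fun x => F1 * l x) (fun x => F1 * q x + F2 * (l x * l x)).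
Proof.
move=> [lp qp H] HF; split.
- exact: linear_partZ.
- by apply: quadratic_partD; apply: quadratic_partZ => //; exact: quadratic_partM.
move=> e e0.
case: lp qp => [_ _ [a a0 la] _] [_ _ [b b0 qb] _].
pose K := 1 + `|F1| + `|F2| + a + b.
have F10 := normr_ge0 F1; have F20 := normr_ge0 F2.
have [K0 F1K F2K aK bK] : [/\ 0 < K, `|F1| <= K, `|F2| <= K, a <= K & b <= K].
  by rewrite /K; clear -a0 b0 F10 F20; split; lra.
have K1 : 1 <= K by rewrite /K; clear -a0 b0 F10 F20; lra.
have e1_ (k : R) : 0 < k -> 0 < Num.min 1 (e / k) /\ Num.min 1 (e / k) * k <= e.
  move=> k0; split; first by rewrite lt_min ltr01 divr_gt0.
  by rewrite -ler_pdivlMr // ge_min lexx orbT.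
have K4 : 0 < 4 * K by rewrite mulr_gt0.
have [e10 e1e] := e1_ _ K4; set e1 := Num.min _ _ in e10 e1e.
have K5 : 0 < 4 * K ^+ 2 by rewrite mulr_gt0 // exprn_gt0.
have [e20 e2e] := e1_ _ K5; set e2 := Num.min _ _ in e20 e2e.
have e11 : e1 <= 1 by rewrite ge_min lexx.
have [d d0 Hd] := H _ e10; have [d' d'0 Hd'] := HF _ e20.
have [|d3 d30 Hd3] := @small3 (12 * K ^+ 3) e _ e0; first by rewrite mulr_ge0 ?exprn_ge0 // ltW.
exists (Num.min d (Num.min d3 (d' / K))) => [|x]; first by rewrite !lt_min d0 d30 divr_gt0.
rewrite !lt_min ltr_pdivlMr // => /and3P[/Hd A /(Hd3 _ (normr_ge0 x))[n1 ne n2] nd'].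
have := la x; have := qb x; have n0 := normr_ge0 x.
set n := `|x| in A n0 n1 n2 ne nd' *; set L := l x in A *; set Q := q x in A *.
move=> hQ hL; have n20 : 0 <= n ^+ 2 by rewrite exprn_ge0.
set t := f (z + x) - c.
have -> : f (z + x) = c + t by rewrite /t; ring.
have ht : `|t| <= K * n.
  have -> : t = (f (z + x) - c - L - Q) + (L + Q) by rewrite /t; ring.
  have t1 := ler_normD (f (z + x) - c - L - Q) (L + Q); have t2 := ler_normD L Q.
  have : e1 * n ^+ 2 <= n by apply: le_trans n2; rewrite ler_piMl.
  have : b * n ^+ 2 <= b * n by rewrite ler_wpM2l.
  have : 0 <= (`|F1| + `|F2|) * n by rewrite mulr_ge0 // addr_ge0.
  by rewrite /K; clear -t1 t2 A hQ hL; lra.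
have td' : `|t| < d' by clear -ht nd'; lra.
have := Hd' t td'.
have hL1 : `|L| <= K * n by apply: le_trans hL _; rewrite ler_wpM2r.
have hQ1 : `|Q| <= K * n ^+ 2 by apply: le_trans hQ _; rewrite ler_wpM2r.
have htL : `|t - L| <= 2 * K * n ^+ 2.
  have -> : t - L = (f (z + x) - c - L - Q) + Q by rewrite /t; ring.
  apply: le_trans (ler_normD _ _) _.
  have : e1 * n ^+ 2 <= n ^+ 2 by rewrite ler_piMl.
  have : n ^+ 2 <= K * n ^+ 2 by rewrite ler_peMl.
  clear -A hQ1; lra.
move=> hF.
have -> : F (c + t) - F c - F1 * L - (F1 * Q + F2 * (L * L))
  = (F (c + t) - F c - F1 * t - F2 * t ^+ 2) + F1 * (f (z + x) - c - L - Q)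
    + F2 * ((t - L) * (t + L)) by rewrite /t; ring.
have u1 := ler_normD (F (c + t) - F c - F1 * t - F2 * t ^+ 2 + F1 * (f (z + x) - c - L - Q))
   (F2 * ((t - L) * (t + L))).
have u2 := ler_normD (F (c + t) - F c - F1 * t - F2 * t ^+ 2) (F1 * (f (z + x) - c - L - Q)).
have u3 := ler_normD t L.
rewrite !normrM in u1 u2.
have t2 : t ^+ 2 <= (K * n) ^+ 2 by rewrite -[t ^+ 2]ger0_norm ?sqr_ge0 // normrX ler_pXn2r // nnegrE // mulr_ge0 // ltW.
have v1 : e2 * t ^+ 2 <= e2 * (K * n) ^+ 2 by rewrite ler_wpM2l // ltW.
have v2 : `|F1| * `|f (z + x) - c - L - Q| <= K * (e1 * n ^+ 2).
  by apply: ler_pM.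
have v3 : `|F2| * (`|t - L| * `|t + L|) <= K * (2 * K * n ^+ 2 * (2 * (K * n))).
  apply: ler_pM => //.
  by apply: ler_pM => //; clear -u3 ht hL1; lra.
have w1 : e1 * (4 * K) * n ^+ 2 <= e * n ^+ 2 by rewrite ler_wpM2r.
have w2 : e2 * (4 * K ^+ 2) * n ^+ 2 <= e * n ^+ 2 by rewrite ler_wpM2r.
have w3 : 12 * K ^+ 3 * n * n ^+ 2 <= e * n ^+ 2 by rewrite ler_wpM2r.
have en : 0 <= e * n ^+ 2 by rewrite mulr_ge0 // ltW.
clear -u1 u2 hF v1 v2 v3 w1 w2 w3 en; lra.
Qed.

Lemma jet_Taylor U f z : open U -> U z -> Cclass 2 U f ->
  jet f z (f z) (dot (grad f z)) (fun x => 2^-1 * dot (x *m hess f z) x).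
Proof.
move=> oU Uz cf; split; first exact: linear_part_dot.
  apply: quadratic_partZ; have := quadratic_part_bil (hess f z) 1%:M.
  by under eq_fun do rewrite mulmx1.
move=> e e0; have [d d0 H] := uniform_Taylor2 oU Uz cf e0.
by exists d => // x xd; apply: H => //; rewrite subrr normr0.
Qed.

Lemma jet_affine f z w (M : 'M[R]_m) (T : 'rV[R]_m -> 'rV[R]_m) c l q :
  (forall x, T (z + x) = w + x *m M) -> jet f w c l q ->
  jet (fun v => f (T v)) z c (fun x => l (x *m M)) (fun x => q (x *m M)).
Proof.
move=> HT [[l1 l2 [a a0 la] cl] [q1 q2 [b b0 qb] cq] H].
have cM : continuous (fun x : 'rV[R]_m => x *m M).
  move=> x; apply/(@cvgrPdist_lt _ _ _ (nbhs x)) => e e0.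
  pose K := 1 + m%:R * `|M|; have K0 : 0 < K by rewrite ltr_pwDl ?mulr_ge0.
  apply/nbhs_ballP; exists (e / K) => [|y]; first by rewrite /= divr_gt0.
  rewrite -ball_normE /= -mulmxBl ltr_pdivlMr // => xy.
  apply: le_lt_trans (norm_mulmx_le _ _) _; apply: le_lt_trans xy.
  by rewrite /K mulrDr mulr1 mulrC lerDr.
have nM := @norm_mulmx_le R m ^~ M.
split.
- split=> [k x|x y||x]; rewrite -?scalemxAl ?mulmxDl ?l1 ?l2 //.
    exists (a * (m%:R * `|M|)) => [|x]; first by rewrite !mulr_ge0.
    by apply: le_trans (la _) _; rewrite -mulrA ler_wpM2l.
  exact: (cvg_comp _ _ (cM x) (cl _)).
- split=> [k x|x y||x]; rewrite -?scalemxAl ?mulmxDl ?mulNmx ?q1 ?q2 //.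
    exists (b * (m%:R * `|M|) ^+ 2) => [|x]; first by rewrite mulr_ge0 // exprn_ge0 // mulr_ge0.
    apply: le_trans (qb _) _; rewrite -mulrA ler_wpM2l // -exprMn.
    by rewrite ler_pXn2r // nnegrE ?mulr_ge0.
  exact: (cvg_comp _ _ (cM x) (cq _)).
move=> e e0; pose K := 1 + m%:R * `|M|; have K0 : 0 < K by rewrite ltr_pwDl ?mulr_ge0.
have [|d d0 Hd] := H (e / K ^+ 2); first by rewrite divr_gt0 // exprn_gt0.
exists (d / K) => [|x]; first by rewrite divr_gt0.
rewrite ltr_pdivlMr // => xd; rewrite HT.
have xK : `|x *m M| <= `|x| * K.
  by apply: le_trans (nM x) _; rewrite /K mulrDr mulr1 mulrC lerDr.
apply: le_trans (Hd _ (le_lt_trans xK xd)) _.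
rewrite -mulrA ler_wpM2l ?(ltW e0) // mulrC ler_pdivrMr ?exprn_gt0 // -exprMn.
by rewrite ler_pXn2r // nnegrE // mulr_ge0 // ltW.
Qed.

(** Symmetric second differences cancel the linear part. The second derivative test is stated
    through them because [g] has bounded second differences but no Hessian. *)
Lemma jet_second_difference_le f z c l q (Q : 'rV[R]_m -> R) x :
  jet f z c l q -> (exists2 d : R, 0 < d & forall t : R, 0 < t -> t < d ->
     f (z + t *: x) + f (z - t *: x) - 2 * f z <= t ^+ 2 * Q x) -> 2 * q x <= Q x.
Proof.
move=> J [d1 d10 H1]; have fz := jet_value J; case: J => [[l1 _ _ _] [q1 _ _ _] H].
apply/ler_addgt0Pl => e e0; pose n := `|x|.
have n0 : 0 <= n := normr_ge0 x; have n10 : 0 < 1 + n by lra.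
have [|d d0 Hd] := H (e / (2 * (1 + n) ^+ 2)); first by rewrite divr_gt0 ?mulr_gt0 ?exprn_gt0.
pose t := Num.min d1 (d / (1 + n)) / 2.
have t0 : 0 < t by rewrite divr_gt0 // lt_min d10 divr_gt0.
have td1 : t < d1 by rewrite ltr_pdivrMr // gt_min; apply/orP; left; lra.
have td : t * n < d.
  have : t < d / (1 + n) by rewrite ltr_pdivrMr // gt_min mulrC mulr2n mulrDl mul1r ltrDl divr_gt0 ?orbT.
  by rewrite ltr_pdivlMr //; lra.
clearbody t.
have nt : `|t *: x| = t * n by rewrite normrZ gtr0_norm.
have A := Hd (t *: x); have B := Hd (- (t *: x)).
have C := H1 t t0 td1.
move: A B; rewrite normrN nt -scaleNr !l1 !q1 sqrrN => /(_ td) A /(_ td) B.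
move: C; rewrite fz -scaleNr => C.
have t20 : 0 < t ^+ 2 by rewrite exprn_gt0.
rewrite -(ler_pM2l t20).
have E : e / (2 * (1 + n) ^+ 2) * (t * n) ^+ 2 <= t ^+ 2 * (e / 2).
  have -> : e / (2 * (1 + n) ^+ 2) * (t * n) ^+ 2 = t ^+ 2 * (e / 2) * (n ^+ 2 / (1 + n) ^+ 2).
    by field; rewrite gt_eqF.
  have te : 0 <= t ^+ 2 * (e / 2) by rewrite ltW // mulr_gt0 // divr_gt0.
  rewrite ler_piMr // ler_pdivrMr ?exprn_gt0 // mul1r.
  by rewrite ler_pXn2r ?nnegrE ?(ltW n10) // lerDr.
have A' := le_trans A E; have B' := le_trans B E.
move: A' B'; rewrite !ler_norml => /andP[A1 _] /andP[B1 _].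
lra.
Qed.

Lemma closed_norm_ball (r : R) : closed [set x : 'rV[R]_m | `|x| <= r].
Proof.
have := @closed_comp _ _ (fun x : 'rV[R]_m => `|x|) [set t : R | t <= r].
by apply; [move=> x _; exact: norm_continuous|exact: closed_le].
Qed.

Lemma compact_norm_ball (r : R) : compact [set x : 'rV[R]_m | `|x| <= r].
Proof.
apply: bounded_closed_compact; last exact: closed_norm_ball.
by exists r; split; rewrite ?num_real // => M rM x /= xr; apply: le_trans xr (ltW rM).
Qed.

Lemma dot_sqr_continuous : continuous (fun x : 'rV[R]_m => dot x x).
Proof.
by have [_ _ _ +] := quadratic_part_bil 1%:M 1%:M; under eq_fun do rewrite mulmx1.
Qed.

Lemma cont_shift f z x : {for z + x, continuous f} -> {for x, continuous (fun y => f (z + y))}.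
Proof.
move=> cf; apply: continuous_of_eps => e /(continuous_eps cf)[d d0 H]; exists d => // y yx.
by apply: H; rewrite opprD addrACA subrr add0r.
Qed.

(* The perturbed maximum principle: if the merely continuous G0 is touched from
   above at z0 by a quadratic polynomial, nearby smooth G h have, at nearby points,
   second-order parts almost below that polynomial. *)
Lemma touch z0 (rho e r : R) (G0 : 'rV[R]_m -> R) (G : R -> 'rV[R]_m -> R) l q :
  0 < rho -> 0 < e -> 0 < r -> linear_part l -> quadratic_part q ->
  (forall x, `|x| <= rho -> G0 (z0 + x) <= G0 z0 + l x + q x + e * `|x| ^+ 2) ->
  (forall eta : R, 0 < eta -> exists2 h0 : R, 0 < h0 & forall h, 0 < h -> h < h0 ->
     forall x, `|x| <= rho -> `|G h (z0 + x) - G0 (z0 + x)| <= eta) ->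
  (exists2 h0 : R, 0 < h0 & forall h, 0 < h -> h < h0 ->
     forall x, `|x| <= rho -> {for z0 + x, continuous (G h)}) ->
  exists2 h0 : R, 0 < h0 & forall h, 0 < h -> h < h0 -> exists2 z1, `|z1 - z0| < r &
    forall c1 l1 q1, jet (G h) z1 c1 l1 q1 -> forall x, q1 x <= q x + 2 * e * dot x x.
Proof.
move=> rho0 e0 r0 [l1 l2 _ cl] [q1 q2 _ cq] G0le Gunif [h1 h10 cG].
pose r1 := Num.min rho r / 2.
have r10 : 0 < r1 by rewrite divr_gt0 // lt_min rho0.
have r1rho : r1 <= rho by rewrite ler_pdivrMr // ge_min; apply/orP; left; lra.
have r1r : r1 < r by rewrite ltr_pdivrMr // gt_min; apply/orP; right; lra.
(* On |x| = r1 the subtracted 2 e |x|^2 exceeds the allowed e |x|^2 by at least e r1^2, more than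
   twice this tolerance, so the maximum over the ball cannot lie there. *)
have eta0 : 0 < e * r1 ^+ 2 / 4 by rewrite divr_gt0 // mulr_gt0 // exprn_gt0.
have [h2 h20 Hunif] := Gunif _ eta0.
exists (Num.min h1 h2) => [|h h0]; first by rewrite lt_min h10.
rewrite lt_min => /andP[hh1 hh2].
pose H x := G h (z0 + x) - l x - q x - 2 * e * dot x x.
have lN x : l (- x) = - l x by rewrite -scaleN1r l1 mulN1r.
have [|||x1 /= x1r max1] := @EVT_pointwise _ _ [set x : 'rV[R]_m | `|x| <= r1] H.
- by exists 0; rewrite /= normr0 ltW.
- exact: compact_norm_ball.
- move=> x /= xr1; apply: cont_sub; last first.
    by apply: cont_mul; [exact: cont_cst|exact: dot_sqr_continuous].
  apply: cont_sub; last exact: cq.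
  apply: cont_sub; last exact: cl.
  have cx : {for z0 + x, continuous (G h)} by apply: cG => //; apply: le_trans r1rho.
  exact: cont_shift.
have l0 : l 0 = 0 by have := l1 0 0; rewrite scale0r mul0r.
have q0 : q 0 = 0 by have := q1 0 0; rewrite scale0r expr0n mul0r.
have x1lt : `|x1| < r1.
  rewrite lt_neqAle x1r andbT; apply/eqP => x1E.
  have := max1 0; rewrite /= normr0 => /(_ (ltW r10)); rewrite /H addr0 l0 q0 dot0l !subr0 mulr0 subr0.
  have := Hunif h h0 hh2 0; rewrite normr0 addr0 => /(_ (ltW rho0)).
  have x1rho : `|x1| <= rho by lra.
  have := Hunif h h0 hh2 x1 x1rho; have := G0le x1 x1rho; have := sqr_norm_le_dot x1.
  rewrite x1E !ler_norml => D A /andP[B1 B2] /andP[C1 C2] E.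
  have : 2 * e * r1 ^+ 2 <= 2 * e * dot x1 x1 by rewrite ler_wpM2l // mulr_ge0 // ltW.
  have := eta0; lra.
exists (z0 + x1) => [|c1 L1 Q1 J x].
  by rewrite addrAC subrr add0r; apply: lt_trans r1r.
have := @jet_second_difference_le (G h) (z0 + x1) c1 L1 Q1 (fun x => 2 * (q x + 2 * e * dot x x)) x J.
rewrite ler_pM2l //; apply.
have n10 : 0 < 1 + `|x| by rewrite ltr_pwDl.
exists ((r1 - `|x1|) / (1 + `|x|)) => [|t t0]; first by rewrite divr_gt0 // subr_gt0.
rewrite ltr_pdivlMr // => tx.
have tn : `|t *: x| < r1 - `|x1|.
  by rewrite normrZ (gtr0_norm t0); have := normr_ge0 x; lra.
have A := max1 (x1 + t *: x) (le_trans (ler_normD _ _) _).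
have B := max1 (x1 - t *: x) (le_trans (ler_normB _ _) _).
have {}A := A ltac:(rewrite /=; lra); have {}B := B ltac:(rewrite /=; lra).
move: A B; rewrite /H !l2 lN !dotE !(l1 t) (dotC x x1).
have := q2 x1 (t *: x); rewrite (q1 t) !addrA => P A B.
have t20 : t ^+ 2 = t * t by rewrite expr2.
rewrite t20 in P *; lra.
Qed.

End Jets.

(** * Skew matrices and orthogonal curves commuting with [J] *)

Section Skew.
Variables (R : realType) (m : nat).
Implicit Types (x y v w : 'rV[R]_m) (A P J : 'M[R]_m).

Lemma dot_skew x A : A^T = - A -> dot (x *m A) x = 0.
Proof.
by move=> AT; have := dot_mulmx x x A; rewrite AT mulmxN dotNr (dotC x); lra.
Qed.

Lemma dot_add_le x y : dot (x + y) (x + y) <= 2 * dot x x + 2 * dot y y.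
Proof. by have := dot_ge0 (x - y); rewrite !dotE (dotC y x); lra. Qed.

Lemma dot_le_sqr_norm x : dot x x <= m%:R * `|x| ^+ 2.
Proof. by apply: le_trans (ler_norm _) _; rewrite expr2 mulrA dot_le_norm. Qed.

Lemma skew_unit P (a : R) : P^T = - P -> 1%:M - a *: P \in unitmx.
Proof.
move=> PT; rewrite unitmxE unitfE; apply/negP => /det0P[v v0].
rewrite mulmxBr mulmx1 -scalemxAr => /eqP; rewrite subr_eq0 => /eqP vE.
move/eqP: v0; apply; apply: dot_eq0.
by rewrite {1}vE dotZl dot_skew // mulr0.
Qed.

(** Skewness makes [v] and [v *m P] orthogonal, so 1 - a P does not decrease lengths. *)
Lemma skew_inv_contract P (a : R) y : P^T = - P ->
  dot (y *m invmx (1%:M - a *: P)) (y *m invmx (1%:M - a *: P)) <= dot y y.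
Proof.
move=> PT; set v := y *m invmx _.
have -> : y = v - a *: (v *m P).
  by rewrite -[RHS]mulmx1 mulmx1 scalemxAr -{1}(mulmx1 v) -mulmxBr mulmxKV ?skew_unit.
rewrite !dotE (dotC v (v *m P)) dot_skew //.
by have := dot_ge0 (v *m P); have := sqr_ge0 a; nra.
Qed.

(* The Cayley transform gives an exactly orthogonal curve with prescribed
   skew velocity, commuting with whatever commutes with the velocity. *)
Lemma Cayley_curve P J : P^T = - P -> P *m J = J *m P ->
  exists O : R -> 'M[R]_m, [/\ forall h, O h *m (O h)^T = 1%:M,
    forall h, O h *m J = J *m O h &
    exists2 C : R, 0 <= C & forall h x,
      `|x *m O h - x - h *: (x *m P) - (h ^+ 2 / 2) *: (x *m P *m P)| <= C * `|h| ^+ 3 * `|x|].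
Proof.
move=> PT PJ.
pose D h : 'M[R]_m := 1%:M - (h / 2) *: P.
pose E h : 'M[R]_m := 1%:M + (h / 2) *: P.
have Du h : D h \in unitmx by exact: skew_unit.
have DT h : (D h)^T = E h by rewrite /D /E linearB linearZ /= trmx1 PT scalerN opprK.
have ED h : E h *m D h = D h *m E h.
  by rewrite /D /E !mulmxBr !mulmxBl !mulmxDl !mulmxDr !mulmx1 !mul1mx addrAC.
have ET h : (E h)^T = D h by rewrite -DT trmxK.
have Eu h : E h \in unitmx by rewrite -DT unitmx_tr.
exists (fun h => E h *m invmx (D h)); split.
- move=> h; rewrite trmx_mul trmx_inv DT ET -mulmxA (mulmxA (invmx _)).
  have DE : D h *m invmx (E h) = invmx (E h) *m D h.
    by apply: (canRL (mulKmx (Eu h))); rewrite mulmxA ED mulmxK.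
  by rewrite -[invmx (D h) *m invmx (E h) *m _]mulmxA -DE mulKmx // mulmxV.
- move=> h; have JD : D h *m J = J *m D h.
    by rewrite /D mulmxBl mulmxBr mul1mx mulmx1 -scalemxAl -scalemxAr PJ.
  have JE : E h *m J = J *m E h.
    by rewrite /E mulmxDl mulmxDr mul1mx mulmx1 -scalemxAl -scalemxAr PJ.
  have JDi : invmx (D h) *m J = J *m invmx (D h).
    apply: (canRL (mulmxK (Du h))); rewrite -mulmxA -JD mulmxA mulVmx ?mul1mx //.
  by rewrite -mulmxA JDi mulmxA JE mulmxA.
(* An exact expansion: the inverse survives only in the cubic remainder, where it is a
   contraction. *)
have EDi h : E h *m invmx (D h) = 1%:M + h *: P + (h ^+ 2 / 2) *: (P *m P)
    + (h ^+ 3 / 4) *: (P *m P *m P *m invmx (D h)).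
  apply: (canLR (mulmxK (Du h))).
  rewrite mulmxDl -scalemxAl mulmxKV //.
  rewrite /D !mulmxBr !mulmxDl !mulmx1 !mul1mx -!scalemxAr -!scalemxAl !scalerA.
  by rewrite /E; apply/matrixP => i j; rewrite !mxE; field.
exists (m%:R ^+ 2 * (m%:R * `|P|) ^+ 3) => [|h x].
  by rewrite mulr_ge0 ?exprn_ge0 // mulr_ge0.
rewrite EDi !mulmxDr mulmx1 -!scalemxAr !mulmxA addrAC.
set y := x *m P *m P *m P.
rewrite (_ : _ - h *: (x *m P) = (h ^+ 3 / 4) *: (y *m invmx (D h))); last first.
  by apply/rowP => j; rewrite !mxE; ring.
rewrite normrZ normrM normrX.
have n1 : `|4^-1 : R| <= 1 by rewrite ger0_norm; lra.
have ny : `|y| <= (m%:R * `|P|) ^+ 3 * `|x|.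
  have N0 : 0 <= m%:R * `|P| by rewrite mulr_ge0.
  have nP z := norm_mulmx_le z P; rewrite !exprS expr0 mulr1 -!mulrA.
  rewrite (le_trans (nP _)) // -!mulrA !ler_wpM2l // mulrA.
  by rewrite (le_trans (nP _)) // -!mulrA !ler_wpM2l // mulrA.
have m1 : `|y *m invmx (D h)| <= m%:R ^+ 2 * `|y|.
  have [m0|m0] := posnP m.
    by rewrite (_ : y *m _ = 0) ?normr0 ?mulr_ge0 ?exprn_ge0 //; apply/rowP => -[j jm]; exfalso; have := jm; rewrite m0.
  have m1 : 1 <= m%:R :> R by rewrite ler1n.
  rewrite -ler_sqr ?nnegrE ?mulr_ge0 ?exprn_ge0 //.
  apply: le_trans (sqr_norm_le_dot _) _; apply: le_trans (skew_inv_contract _ _ PT) _.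
  apply: le_trans (dot_le_sqr_norm _) _; rewrite exprMn ler_wpM2r ?exprn_ge0 //.
  by rewrite -exprM -{1}[m%:R]expr1 ler_weXn2l.
rewrite -[leLHS]mulrA [leRHS](_ : _ = `|h| ^+ 3 * (m%:R ^+ 2 * ((m%:R * `|P|) ^+ 3 * `|x|))); last by ring.
rewrite ler_wpM2l ?exprn_ge0 //.
apply: (@le_trans _ _ (`|y *m invmx (D h)|)); first by rewrite ler_piMl.
by apply: le_trans m1 _; rewrite ler_wpM2l ?exprn_ge0.
Qed.

Lemma mulmx_dyad x v w : x *m (v^T *m w) = dot x v *: w.
Proof. by rewrite mulmxA dot_mx {1}[x *m v^T]mx11_scalar mul_scalar_mx. Qed.

(** The rank-two matrix v^T w - w^T v is skew and sends v to a multiple of w when v and w are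
    orthogonal. Adding its conjugate by [J] makes it commute with [J] but creates a component along
    v J, which the multiple [om] of [J] removes. *)
Lemma skew_with_image J v w : J^T = - J -> J *m J = - 1%:M -> v != 0 -> dot v w = 0 ->
  exists P, [/\ P^T = - P, P *m J = J *m P, v *m P = w &
    forall x, dot (x *m P) (x *m P) <= 40 * (dot w w / dot v v) * dot x x].
Proof.
move=> JT JJ v0 vw.
have vv : 0 < dot v v.
  by rewrite lt0r dot_ge0 andbT; apply: contra_neq v0; exact: dot_eq0.
have isoJ x y : dot (x *m J) (y *m J) = dot x y.
  by rewrite dot_mulmx JT mulmxN -mulmxA JJ mulmxN mulmx1 opprK.
have antiJ x y : dot (x *m J) y = - dot x (y *m J) by rewrite dot_mulmx JT mulmxN dotNr.
pose k := (dot v v)^-1.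
pose om := k * dot v (w *m J).
pose P := k *: (v^T *m w + (v *m J)^T *m (w *m J) - w^T *m v - (w *m J)^T *m (v *m J)) + om *: J.
have PE x : x *m P = k *: (dot x v *: w + dot x (v *m J) *: (w *m J) - dot x w *: v
    - dot x (w *m J) *: (v *m J)) + om *: (x *m J).
  by rewrite /P mulmxDr -!scalemxAr !mulmxBr mulmxDr !mulmx_dyad.
exists P; split.
- have D1 : w^T *m v = (v^T *m w)^T by rewrite [RHS]trmx_mul trmxK.
  have D2 : (w *m J)^T *m (v *m J) = ((v *m J)^T *m (w *m J))^T by rewrite [RHS]trmx_mul trmxK.
  have JE i j : J j i = - J i j by have /matrixP/(_ i j) := JT; rewrite !mxE.
  rewrite /P D1 D2; move: (v^T *m w) ((v *m J)^T *m (w *m J)) => A B.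
  by apply/matrixP => i j; rewrite !mxE JE; ring.
- apply/row_matrixP => i; rewrite !rowE !mulmxA PE (PE (_ *m J)); set x := delta_mx 0 i.
  rewrite !mulmxDl -!scalemxAl !mulmxBl !mulmxDl -!scalemxAl.
  rewrite !isoJ !antiJ -!mulmxA JJ !mulmxN !mulmx1 !scaleNr !scalerN !opprK.
  congr (_ *: _ + _); apply/rowP => j; rewrite !mxE; ring.
- have vJv : dot v (v *m J) = 0 by rewrite dotC dot_skew.
  rewrite PE vw vJv !scale0r addr0 subr0 scalerBr !scalerA mulVf ?gt_eqF // scale1r.
  by rewrite /om subrK.
move=> x; rewrite PE.
set a := dot x v; set b := dot x (v *m J); set c := dot x w; set d := dot x (w *m J).
have := CauchySchwarz_dot x v; rewrite -/a => ha.
have := CauchySchwarz_dot x (v *m J); rewrite isoJ -/b => hb.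
have := CauchySchwarz_dot x w; rewrite -/c => hc.
have := CauchySchwarz_dot x (w *m J); rewrite isoJ -/d => hd.
have := CauchySchwarz_dot v (w *m J); rewrite isoJ => he.
apply: le_trans (dot_add_le _ _) _.
have H1 : dot (a *: w + b *: (w *m J) - c *: v - d *: (v *m J))
   (a *: w + b *: (w *m J) - c *: v - d *: (v *m J)) <= 16 * (dot v v * dot w w * dot x x).
  have -> : a *: w + b *: (w *m J) - c *: v - d *: (v *m J)
    = (a *: w + b *: (w *m J)) + (- (c *: v) + - (d *: (v *m J))) by rewrite !addrA.
  apply: le_trans (dot_add_le _ _) _.
  apply: le_trans (lerD (ler_wpM2l _ (dot_add_le _ _)) (ler_wpM2l _ (dot_add_le _ _))) _ => //.
  rewrite !dotE !isoJ.
  have := ler_wpM2r (dot_ge0 w) ha; have := ler_wpM2r (dot_ge0 w) hb.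
  have := ler_wpM2r (dot_ge0 v) hc; have := ler_wpM2r (dot_ge0 v) hd.
  lra.
rewrite !dotZl !dotZr isoJ.
have k0 : 0 < k by rewrite invr_gt0.
have kv : k * dot v v = 1 by rewrite /k mulVf // gt_eqF.
have H2 : k ^+ 2 * dot (a *: w + b *: (w *m J) - c *: v - d *: (v *m J))
   (a *: w + b *: (w *m J) - c *: v - d *: (v *m J)) <= 16 * (k * dot w w * dot x x).
  apply: le_trans (ler_wpM2l (sqr_ge0 k) H1) _.
  rewrite [leLHS](_ : _ = k * dot v v * (16 * (k * dot w w * dot x x))); last by ring.
  by rewrite kv mul1r.
have H3 : om ^+ 2 <= k * dot w w.
  rewrite /om exprMn; apply: le_trans (ler_wpM2l (sqr_ge0 k) he) _.
  rewrite [leLHS](_ : _ = k * dot v v * (k * dot w w)); last by ring.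
  by rewrite kv mul1r.
have H4 := ler_wpM2r (dot_ge0 x) H3.
have H5 : 0 <= k * dot w w * dot x x by rewrite !mulr_ge0 ?dot_ge0 // ltW.
rewrite (_ : dot w w / dot v v = k * dot w w); last by rewrite mulrC.
clearbody k om; move: H2 H4 H5; move: (dot (_ - _) _) (dot x x) (dot w w) => X Y Z H2 H4 H5.
lra.
Qed.

End Skew.

Section ScalarExpansions.
Variable R : realType.

Lemma scalar_Taylor2 (F F' : R -> R) (c r F2 : R) : 0 < r ->
  (forall t, `|t - c| < r -> is_derive t 1 F (F' t)) -> is_derive c 1 F' F2 ->
  forall e : R, 0 < e -> exists2 d : R, 0 < d &
     forall t : R, `|t| < d -> `|F (c + t) - F c - F' c * t - F2 / 2 * t ^+ 2| <= e * t ^+ 2.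
Proof.
move=> r0 dF dF' e e0.
have [dd dv] := dF'.
have /cvgrPdist_le/(_ e e0)[d1 /= d10 H1] : (fun k : R => k^-1 *: ((F' \o shift c) (k *: 1) - F' c)) @ 0^' --> F2.
  by rewrite -dv; exact: dd.
have F'e k : `|k| < d1 -> `|F' (c + k) - F' c - F2 * k| <= e * `|k|.
  have [->|k0 kd] := eqVneq k 0; first by rewrite addr0 subrr mulr0 subr0 normr0 mulr0.
  have := H1 k; rewrite /= sub0r normrN => /(_ kd k0).
  rewrite [k *: 1]mulr1 (addrC k).
  have -> : F2 - k^-1 *: (F' (c + k) - F' c) = - (k^-1 * (F' (c + k) - F' c - F2 * k)).
    by rewrite /GRing.scale /=; field.
  by rewrite normrN normrM normfV ler_pdivrMl ?normr_gt0 // [leRHS]mulrC.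
exists (Num.min r d1) => [|t]; first by rewrite lt_min r0.
rewrite lt_min => /andP[tr td].
have lin (s : R) : is_derive s 1 (fun s : R => c + s * t) t.
  have := is_derive_parabola t 0 s; rewrite mulr0 mul0r addr0 => H.
  rewrite (_ : (fun s : R => c + s * t) = cst c + (fun s : R => t * s + 0 * s ^+ 2)).
    by have := is_deriveD (is_derive_cst c s 1) H; rewrite add0r.
  by apply/funext => w; rewrite !fctE /=; ring.
have [s /andP[s0 s1]|s /andP[s0 s1] E] := @line_MVT _
  ((fun s : R => F (c + s * t)) - (fun s : R => F' c * t * s + F2 / 2 * t ^+ 2 * s ^+ 2))
  (fun s => F' (c + s * t) * t - (F' c * t + 2 * (F2 / 2 * t ^+ 2) * s)).
  apply: (is_deriveB _ (is_derive_parabola _ _ s)).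
  have H : is_derive (c + s * t) 1 F (F' (c + s * t)).
    apply: dF; rewrite addrAC subrr add0r normrM ger0_norm //.
    by apply: le_lt_trans tr; rewrite ler_piMl.
  exact: (@is_derive1_comp _ F (fun s : R => c + s * t) s _ _ H (lin s)).
move: E; rewrite !fctE /= mul1r mul0r addr0 => E.
have -> : F (c + t) - F c - F' c * t - F2 / 2 * t ^+ 2
   = (F' (c + s * t) - F' c - F2 * (s * t)) * t.
  transitivity (F (c + t) - (F' c * t * 1 + F2 / 2 * t ^+ 2 * 1 ^+ 2)
     - (F c - (F' c * t * 0 + F2 / 2 * t ^+ 2 * 0 ^+ 2))); first by ring.
  by rewrite E; field.
have st : `|s * t| <= `|t| by rewrite normrM gtr0_norm // ler_piMl // ltW.
have t2 : t ^+ 2 = `|t| * `|t| by rewrite -expr2 real_normK ?num_real.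
rewrite normrM t2 [leRHS]mulrA ler_wpM2r //.
apply: le_trans (F'e _ (le_lt_trans st td)) _.
by rewrite ler_wpM2l // ltW.
Qed.

Lemma ln_expansion (c : R) : 0 < c -> forall e : R, 0 < e -> exists2 d : R, 0 < d &
  forall t : R, `|t| < d ->
    `|ln (c + t) - ln c - c^-1 * t - (- (c ^- 2) / 2) * t ^+ 2| <= e * t ^+ 2.
Proof.
move=> c0; apply: (@scalar_Taylor2 (@ln R) (@GRing.inv R) c c) => //.
  move=> t tc; apply: is_derive1_ln.
  by move: tc; rewrite ltr_norml => /andP[]; lra.
apply: is_derive_eps => e e0; exists (Num.min (c / 2) (e * c ^+ 3 / 2)) => [|k].
  by rewrite lt_min divr_gt0 //= divr_gt0 // mulr_gt0 // exprn_gt0.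
rewrite lt_min => /andP[kc ke].
have ck : c / 2 < c + k by move: kc; rewrite ltr_norml => /andP[]; lra.
have ck0 : 0 < c + k by lra.
have -> : (c + k)^-1 - c^-1 - - c ^- 2 * k = k / (c ^+ 2 * (c + k)) * k.
  by field; rewrite !gt_eqF.
have c2 : 0 < c ^+ 2 * (c + k) by rewrite mulr_gt0 // exprn_gt0.
rewrite normrM ler_wpM2r // normrM normfV (gtr0_norm c2) ler_pdivrMr //.
apply: le_trans (ltW ke) _; rewrite -mulrA ler_wpM2l ?(ltW e0) //.
by rewrite exprSr -mulrA ler_wpM2l ?exprn_ge0 // ltW.
Qed.

End ScalarExpansions.

(** * The Bellman form and the boundary estimates *)

Section Setting.
Variables (R : realType) (m : nat) (J : 'M[R]_m) (I : finType).
Variables (K Kf Kg b0 : R).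
Variables (fr : (I -> 'rV[R]_m) -> R -> Prop).

Definition trace_op (s : I -> 'rV[R]_m) (h : 'rV[R]_m -> R) z : R :=
  \sum_i dot (s i *m hess h z) (s i).

Lemma trace_opE s h z : trace_op s h z = \sum_i dot (s i *m hess h z) (s i).
Proof. by []. Qed.

(* The normalized Bellman form of the Dirichlet problem: fr s b says that
   w |-> \sum_i w_(s i)(s i) is an operator a^(ij) w_(ij) of trace 1 supporting
   the nonlinear operator, b being the corresponding multiple of f. *)
Record setting (Om : set 'rV[R]_m) (psi f g u : 'rV[R]_m -> R) : Prop := Setting {
  st_open : open Om;
  st_bounded : bounded_set Om;
  st_psi : exists U, [/\ open U, closure Om `<=` U, Cclass 4 U psi,
    Om = U `&` [set z | 0 < psi z] & bdry Om = U `&` [set z | psi z = 0]];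
  st_psi_le : forall s z, (size s <= 3)%N -> Om z -> `|partial s psi z| <= K;
  st_grad : forall z, bdry Om z -> 1 <= dot (grad psi z) (grad psi z);
  st_f : Cclass 1 Om f;
  st_f0 : forall z, Om z -> 0 <= f z;
  st_f_le : forall s z, (size s <= 1)%N -> Om z -> `|partial s f z| <= Kf;
  st_f_lip : forall k v w, Om v -> Om w ->
    `|partial [:: k] f v - partial [:: k] f w| <= Kf * `|v - w|;
  st_g : Cclass 1 Om g;
  st_gc : {within closure Om, continuous g};
  st_g_le : forall s z, (size s <= 1)%N -> Om z -> `|partial s g z| <= Kg;
  st_g_lip : forall k v w, Om v -> Om w ->
    `|partial [:: k] g v - partial [:: k] g w| <= Kg * `|v - w|;
  st_u : Cclass 2 Om u;
  st_uc : {within closure Om, continuous u};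
  st_ulim : forall s z, (size s <= 2)%N -> bdry Om z -> cvg (partial s u @ within Om (nbhs z));
  st_ug : forall z, bdry Om z -> u z = g z;
  st_sub : forall s b z, fr s b -> Om z -> b * f z <= trace_op s u z;
  st_eq : forall z e, Om z -> 0 < e -> exists s b,
    fr s b /\ trace_op s u z <= b * f z + e;
  st_psi_sup : forall s b z, fr s b -> Om z -> trace_op s psi z <= - 2 }.

(** The value 1/2 is complex trace 1 in real terms: a Hermitian form is a quarter of the sum of the
    real forms along xi and i xi, so weights of sum 1 give 1/4 + 1/4. Invariance under rotations
    commuting with [J] is what lets similarities act on the equation. *)
Record frames : Prop := Frames {
  fr_norm : forall s b, fr s b -> \sum_i dot (s i) (s i) = 2^-1;
  fr_b : forall s b, fr s b -> 0 <= b <= b0;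
  fr_rot : forall (O : 'M[R]_m) s b, O *m O^T = 1%:M -> O *m J = J *m O -> fr s b ->
    fr (fun i => s i *m O) b }.

End Setting.

(** * Geometry of the domain and of its defining function *)

Section Domain.
Variables (R : realType) (m : nat) (J : 'M[R]_m) (I : finType).
Variables (K Kf Kg b0 : R) (fr : (I -> 'rV[R]_m) -> R -> Prop).
Variables (Om : set 'rV[R]_m) (psi f g u : 'rV[R]_m -> R).
Hypothesis (frP : frames J b0 fr) (st : setting K Kf Kg fr Om psi f g u).
Hypothesis (K1 : 1 <= K) (Kf0 : 0 <= Kf) (Kg0 : 0 <= Kg) (b00 : 0 <= b0).
Implicit Types (z v w x : 'rV[R]_m).

Let Om_open : open Om := st_open st.

Lemma closed_of_eps (A : set 'rV[R]_m) : (forall z, ~ A z -> exists2 d : R, 0 < d &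
  forall w, `|w - z| < d -> ~ A w) -> closed A.
Proof.
move=> H; rewrite -openC openE => z /H[d d0 Hd]; rewrite /interior /=.
by apply/nbhs_ballP; exists d => // w; rewrite -ball_normE /= distrC => /Hd.
Qed.

Lemma closureE z : closure Om z <-> forall d : R, 0 < d -> exists2 w, Om w & `|w - z| < d.
Proof.
split=> [cz d d0|H B /nbhs_ballP[d /= d0 dB]].
  have [w [Ow]] := cz (ball z d) (nbhsx_ballx z d d0).
  by rewrite -ball_normE /= distrC; exists w.
have [w Ow wz] := H d d0; exists w; split => //; apply: dB.
by rewrite -ball_normE /= distrC.
Qed.

Lemma Om_closure z : Om z -> closure Om z.
Proof. exact: subset_closure. Qed.

Lemma bdryE z : bdry Om z <-> closure Om z /\ ~ Om z.
Proof.
have E : Om° = Om by apply/interior_id.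
by rewrite /bdry E.
Qed.

Lemma closure_cases z : closure Om z -> Om z \/ bdry Om z.
Proof. by move=> cz; have [Oz|nOz] := pselect (Om z); [left|right; apply/bdryE]. Qed.

Lemma psi_near_class : exists2 U, open U & closure Om `<=` U /\ Cclass 4 U psi.
Proof. by have [U [oU cU ch _ _]] := st_psi st; exists U. Qed.

Lemma psi_class : Cclass 4 Om psi.
Proof.
have [U oU [cU ch]] := psi_near_class; apply: Cclass_sub ch => z Oz.
exact/cU/Om_closure.
Qed.

Lemma partial_psi_continuous s z : (size s <= 4)%N -> closure Om z ->
  {for z, continuous (partial s psi)}.
Proof. by have [U oU [cU [_ ch]]] := psi_near_class => sz /cU Uz; exact: ch. Qed.

Lemma psi_gt0 z : Om z -> 0 < psi z.
Proof. by have [U [_ _ _ -> _]] := st_psi st => -[]. Qed.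

Lemma psi_bdry z : bdry Om z -> psi z = 0.
Proof. by have [U [_ _ _ _ ->]] := st_psi st => -[]. Qed.

Lemma Om_of_psi z : closure Om z -> 0 < psi z -> Om z.
Proof. by move=> /closure_cases[//|/psi_bdry->]; rewrite ltxx. Qed.

Lemma compact_closure_of_bounded : bounded_set Om -> compact (closure Om).
Proof.
move=> [M [_ HM]]; apply: bounded_closed_compact; last exact: closed_closure.
exists (M + 1); split; rewrite ?num_real // => r Mr z /closureE cz.
apply/ler_addgt0Pl => e e0; have [w Ow wz] := cz e e0.
have := HM (M + 1); rewrite ltrDl ltr01 => /(_ isT) /= /(_ w Ow) wM.
have -> : z = w - (w - z) by rewrite opprB addrCA subrr addr0.
by apply: le_trans (ler_normB _ _) _; lra.
Qed.

Lemma compact_closure : compact (closure Om).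
Proof. exact: compact_closure_of_bounded (st_bounded st). Qed.

Lemma compact_level (lam : R) : compact [set z | closure Om z /\ lam <= psi z].
Proof.
apply: (subclosed_compact _ compact_closure) => [|z []//].
apply: closed_of_eps => z /not_andP[ncz|].
  have : open (~` closure Om) by rewrite openC; exact: closed_closure.
  move=> /open_eps/(_ ncz)[d d0 H]; exists d => // w /H ncw [//].
have [cz /negP|ncz _] := pselect (closure Om z).
  rewrite -ltNge -subr_gt0 => pl.
  have [d d0 H] := continuous_eps (partial_psi_continuous (s := [::]) isT cz) pl.
  exists d => // w /H; rewrite /= => pw [_].
  by move: pw; rewrite ltr_norml => /andP[_]; lra.
have : open (~` closure Om) by rewrite openC; exact: closed_closure.
by move=> /open_eps/(_ ncz)[d d0 H]; exists d => // w /H ncw [].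
Qed.

(** The infimum of the exit times is itself an exit time because [Om] is open, and a limit of points
    of [Om] from before. *)
Lemma first_exit z v : Om z -> ~ Om (z + v) -> exists2 t : R, 0 < t <= 1 &
  bdry Om (z + t *: v) /\ forall s : R, 0 <= s -> s < t -> Om (z + s *: v).
Proof.
move=> Oz nOv; pose A : set R := [set t : R | 0 <= t <= 1 /\ ~ Om (z + t *: v)].
have A1 : A 1 by rewrite /A /= ler01 lexx scale1r.
have Ah : has_inf A by split; [exists 1|exists 0 => t [/andP[]]].
pose t := inf A.
have tle s : A s -> t <= s by move=> As; apply: ge_inf => //; exact: Ah.2.
have t1 : t <= 1 by exact: tle.
have before s : 0 <= s -> s < t -> Om (z + s *: v).
  move=> s0 st1; apply: contrapT => nO.
  have : A s by split => //; rewrite s0; lra.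
  by move/tle; rewrite leNgt st1.
have v1 : 0 < 1 + `|v| by rewrite ltr_pwDl.
have nOt : ~ Om (z + t *: v).
  move=> /(open_eps Om_open)[d d0 Hd].
  have dv0 : 0 < d / (1 + `|v|) by rewrite divr_gt0.
  have [s As] := inf_adherent dv0 Ah; rewrite -/t => ts.
  have := tle s As => st'; case: As => _; apply; apply: Hd.
  have -> : z + s *: v - (z + t *: v) = (s - t) *: v.
    by rewrite opprD addrACA subrr add0r -scalerBl.
  rewrite normrZ ger0_norm ?subr_ge0 //.
  move: ts; rewrite -ltrBlDl ltr_pdivlMr // => ts; apply: le_lt_trans ts.
  by rewrite mulrDr mulr1 lerDr subr_ge0.
have t0 : 0 < t.
  rewrite lt_neqAle; apply/andP; split.
    by apply/eqP => t0; apply: nOt; rewrite -t0 scale0r addr0.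
  by apply: lb_le_inf; [exists 1|move=> s [/andP[]]].
exists t; first by rewrite t0.
split=> //; apply/bdryE; split=> //; apply/closureE => d d0.
pose s := t - Num.min t (d / (1 + `|v|)) / 2.
have q0 : 0 < Num.min t (d / (1 + `|v|)) by rewrite lt_min t0 divr_gt0.
exists (z + s *: v).
  apply: before; rewrite /s; last by lra.
  have : Num.min t (d / (1 + `|v|)) <= t by rewrite ge_min lexx.
  lra.
have -> : z + s *: v - (z + t *: v) = (s - t) *: v.
  by rewrite opprD addrACA subrr add0r -scalerBl.
have -> : s - t = - (Num.min t (d / (1 + `|v|)) / 2) by rewrite /s; ring.
rewrite normrZ normrN gtr0_norm ?divr_gt0 //.
have : Num.min t (d / (1 + `|v|)) <= d / (1 + `|v|) by rewrite ge_min lexx orbT.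
rewrite ler_pdivlMr //; set q := Num.min _ _ in q0 *; have := normr_ge0 v; nra.
Qed.

Lemma segment_in_scale U z v (t : R) : segment_in U z v -> 0 <= t <= 1 -> segment_in U z (t *: v).
Proof.
move=> sg /andP[t0 t1] s /andP[s0 s1]; rewrite scalerA; apply: sg.
by rewrite mulr_ge0 //= mulr_ile1.
Qed.

Lemma gradient_difference h (L : R) U z v : open U -> Cclass 2 U h -> segment_in U z v ->
  (forall k l w, U w -> `|partial [:: l; k] h w| <= L) ->
  forall k (t : R), 0 <= t <= 1 ->
    `|partial [:: k] h (z + t *: v) - partial [:: k] h z| <= m%:R * L * `|v|.
Proof.
move=> oU ch sg HL k t t01.
have [s /andP[s0 s1] ->] := segment_MVT oU (Cclass_partial k ch) (segment_in_scale sg t01).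
apply: le_trans (dot_le_norm _ _) _; apply: ler_pM; rewrite ?mulr_ge0 //.
  rewrite ler_wpM2l //; apply: norm_rV_le => [|l].
    apply: le_trans (HL k k _ (sg 0 _)); rewrite ?lexx ?ler01 //.
  by rewrite mxE; apply: HL; rewrite scalerA; apply: sg; case/andP: t01 => *; nra.
exact: scale_norm_le.
Qed.

(** Taylor constant of [psi] on segments: m K is a Lipschitz constant of the partial derivatives,
    and the other factor m sums over the coordinates. *)
Definition K2 : R := m%:R * (m%:R * K).

Lemma K2_ge0 : 0 <= K2.
Proof. by have := K1; rewrite /K2 => ?; rewrite !mulr_ge0 //; lra. Qed.

Lemma psi_grad_difference z v : segment_in Om z v -> forall k (t : R), 0 <= t <= 1 ->
  `|partial [:: k] psi (z + t *: v) - partial [:: k] psi z| <= m%:R * K * `|v|.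
Proof.
move=> sg; apply: (gradient_difference Om_open (Cclass_le (isT : (2 <= 4)%N) psi_class) sg).
by move=> k l w Ow; apply: (st_psi_le st).
Qed.

Lemma psi_Taylor z v : segment_in Om z v ->
  `|psi (z + v) - psi z - dot (grad psi z) v| <= K2 * `|v| ^+ 2.
Proof.
move=> sg; apply: (gradient_Lipschitz_Taylor Om_open (Cclass_le (isT : (1 <= 4)%N) psi_class) sg).
exact: psi_grad_difference.
Qed.

(** At a first exit [psi] would vanish, while Taylor's formula keeps it above a positive constant.
    The derivative bounds hold only inside [Om], so the comparison is made just before the exit. *)
Lemma segment_in_Om z v (a : R) : Om z -> 0 <= a -> - dot (grad psi z) v <= a ->
  a + K2 * `|v| ^+ 2 < psi z -> segment_in Om z v.
Proof.
move=> Oz a0 ga small t /andP[t0 t1]; apply: contrapT => nO.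
have [r /andP[r0 r1] [br Or]] := first_exit Oz nO.
set c := psi z - (a + K2 * `|v| ^+ 2) in small *.
have c0 : 0 < c by rewrite /c subr_gt0.
have [cb _] := (bdryE _).1 br.
have [d d0 Hd] := continuous_eps (partial_psi_continuous (s := [::]) isT cb) c0.
have w1 : 0 < 1 + `|t *: v| by rewrite ltr_pwDl.
pose q := Num.min r (d / (1 + `|t *: v|)).
have q0 : 0 < q by rewrite lt_min r0 divr_gt0.
have qr : q <= r by rewrite ge_min lexx.
have qd : q * (1 + `|t *: v|) <= d by rewrite -ler_pdivlMr // ge_min lexx orbT.
pose s := r - q / 2.
have s0 : 0 <= s by rewrite /s; lra.
have sr : s < r by rewrite /s; lra.
have near_b : `|z + s *: (t *: v) - (z + r *: (t *: v))| < d.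
  rewrite opprD addrACA subrr add0r -scalerBl normrZ (_ : s - r = - (q / 2)); last by rewrite /s; ring.
  by rewrite normrN gtr0_norm ?divr_gt0 //; have := normr_ge0 (t *: v); nra.
have := Hd _ near_b; rewrite /= (psi_bdry br) subr0.
have sg : segment_in Om z (s *: (t *: v)).
  move=> p /andP[p0 p1]; rewrite scalerA; apply: Or; first exact: mulr_ge0.
  by apply: le_lt_trans sr; rewrite ler_piMl.
have := psi_Taylor sg; rewrite scalerA dotZr.
have st01 : 0 <= s * t <= 1 by rewrite mulr_ge0 //= mulr_ile1 //; lra.
have := scale_norm_le v st01; have := normr_ge0 ((s * t) *: v).
set n := `|(s * t) *: v| => n0 nv.
have n2 : K2 * n ^+ 2 <= K2 * `|v| ^+ 2.
  by rewrite ler_wpM2l ?K2_ge0 // ler_pXn2r // nnegrE.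
have D : - a <= s * t * dot (grad psi z) v by case/andP: st01 => *; nra.
by rewrite ler_norml ltr_norml => /andP[A _] /andP[_]; rewrite /c; lra.
Qed.

Lemma frame_exists z : Om z -> exists s b, fr s b.
Proof. by move=> Oz; have [s [b [? _]]] := st_eq st Oz ltr01; exists s, b. Qed.

Lemma frame_sum_le s b (q : I -> R) (c : R) : fr s b ->
  (forall i, q i <= c * dot (s i) (s i)) -> \sum_i q i <= c / 2.
Proof.
by move=> H le; rewrite -(fr_norm frP H) mulr_sumr; apply: ler_sum.
Qed.

Lemma dist_le_psi z (d : R) : Om z -> 0 <= d ->
  (forall w, bdry Om w -> d ^+ 2 < dot (w - z) (w - z)) -> d ^+ 2 <= psi z.
Proof.
move=> Oz d0 far.
have inOm x : dot x x <= d ^+ 2 -> Om (z + x).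
  move=> xd; apply: contrapT => nO; have [t /andP[t0 t1] [bt _]] := first_exit Oz nO.
  have := far _ bt; rewrite addrAC subrr add0r dotZl dotZr => far'.
  have : t * (t * dot x x) <= dot x x.
    by rewrite mulrA ler_piMl ?dot_ge0 // mulr_ile1 // ltW.
  lra.
have [|||x0 /= x0d Hx] := @EVT_pointwise _ _ [set x : 'rV[R]_m | dot x x <= d ^+ 2]
    (fun x => - psi (z + x) - dot x x).
- by exists 0; rewrite /= dot0l exprn_ge0.
- apply: (subclosed_compact _ (@compact_norm_ball _ _ d)) => [|x /= xd].
    apply: closed_of_eps => x /negP; rewrite -ltNge -subr_gt0 => xd.
    have [e e0 H] := continuous_eps (@dot_sqr_continuous R m x) xd.
    exists e => // w /H; rewrite ltr_norml => /andP[A _] /= B; lra.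
  rewrite -ler_sqr ?nnegrE //; exact: le_trans (sqr_norm_le_dot x) xd.
- move=> x /= xd; apply: cont_sub; last exact: dot_sqr_continuous.
  apply: cont_opp; apply: cont_shift.
  exact: (partial_psi_continuous (s := [::]) isT (Om_closure (inOm _ xd))).
have := Hx 0; rewrite /= dot0l addr0 subr0 => /(_ (exprn_ge0 _ d0)) H0.
have psi0 := psi_gt0 (inOm _ x0d).
have [lt|ge] := ltP (dot x0 x0) (d ^+ 2); last by lra.
exfalso; have [s [b sb]] := frame_exists Oz; set y := z + x0 in psi0 *.
have Oy : Om y by exact: inOm.
have J1 := jetZ (-1) (jet_Taylor Om_open Oy (Cclass_le (isT : (2 <= 4)%N) psi_class)).
have key x : - (dot (x *m hess psi y) x) <= 2 * dot x x.
  have := jet_second_difference_le (Q := fun x => 2 * dot x x) (x := x) J1.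
  rewrite (_ : 2 * (-1 * (2^-1 * dot (x *m hess psi y) x)) = - dot (x *m hess psi y) x); last by field.
  apply; rewrite -subr_gt0 in lt.
  have [e e0 He] := continuous_eps (@dot_sqr_continuous R m x0) lt.
  have x1 : 0 < 1 + `|x| by rewrite ltr_pwDl.
  exists (e / (1 + `|x|)) => [|t t0]; first by rewrite divr_gt0.
  rewrite ltr_pdivlMr // => te.
  have tx : `|t *: x| < e by rewrite normrZ gtr0_norm //; lra.
  have A1 := He (x0 + t *: x); have A2 := He (x0 - t *: x).
  rewrite addrAC subrr add0r in A1; rewrite addrAC subrr add0r normrN in A2.
  have B1 : dot (x0 + t *: x) (x0 + t *: x) <= d ^+ 2.
    by have := A1 tx; rewrite ltr_norml => /andP[_]; lra.
  have B2 : dot (x0 - t *: x) (x0 - t *: x) <= d ^+ 2.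
    by have := A2 tx; rewrite ltr_norml => /andP[_]; lra.
  have := Hx _ B1; have := Hx _ B2; rewrite !dotE !addrA -/y (dotC x x0) => C1 C2.
  have := expr2 t; move: (t ^+ 2) => t2 ->; lra.
(* Summation over the frame gives 2 <= 1: the left side is at least 2 by the scaling of [psi], the
   right side is 2 \sum_i |s_i|^2 = 1. *)
have := frame_sum_le sb (fun i => key (s i)); rewrite sumrN divff ?pnatr_eq0 // -trace_opE.
by have := st_psi_sup st sb Oy; lra.
Qed.

(** Below this level the boundary is within distance sqrt lam1, over which the gradient of [psi]
    varies by at most 1/2 in length: m^3 K^2 lam1 <= 1/4. *)
Definition lam1 : R := (4 * (m%:R ^+ 3 + 1) * K ^+ 2)^-1.

Lemma lam1_gt0 : 0 < lam1.
Proof.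
rewrite invr_gt0 mulr_gt0 ?exprn_gt0 ?mulr_gt0 ?ltr_wpDl ?exprn_ge0 //.
exact: lt_le_trans K1.
Qed.

(** The segment towards a close boundary point is followed to its first exit [y], where |grad psi|
    >= 1. Second derivatives are bounded strictly before the exit only, so the variation of the
    gradient is estimated up to an arbitrary [e]. *)
Lemma grad_psi_ge z : Om z -> psi z < lam1 -> 4^-1 <= dot (grad psi z) (grad psi z).
Proof.
move=> Oz small.
have [w bw wz] : exists2 w, bdry Om w & dot (w - z) (w - z) <= lam1.
  apply: contrapT => /forall2NP H; move: small; rewrite ltNge => /negP; apply.
  have s0 : 0 <= Num.sqrt lam1 by exact: sqrtr_ge0.
  rewrite -[lam1]sqr_sqrtr ?(ltW lam1_gt0) //; apply: dist_le_psi => // w bw.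
  rewrite sqr_sqrtr ?(ltW lam1_gt0) // ltNge; apply/negP => le.
  by case: (H w).
have nO : ~ Om (z + (w - z)) by rewrite addrC subrK; case: ((bdryE w).1 bw).
have [t /andP[t0 t1] [bt Ot]] := first_exit Oz nO.
set y := z + t *: (w - z) in bt.
have nwz : `|w - z| ^+ 2 <= lam1 by apply: le_trans wz; exact: sqr_norm_le_dot.
have comp k : `|partial [:: k] psi y - partial [:: k] psi z| <= m%:R * K * `|w - z|.
  apply/ler_addgt0Pl => e e0.
  have cy := ((bdryE y).1 bt).1.
  have [d d0 Hd] := continuous_eps (partial_psi_continuous (s := [:: k]) isT cy) e0.
  have w1 : 0 < 1 + `|w - z| by rewrite ltr_pwDl.
  pose q := Num.min t (d / (1 + `|w - z|)).
  have q0 : 0 < q by rewrite lt_min t0 divr_gt0.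
  have qt : q <= t by rewrite ge_min lexx.
  have qd : q * (1 + `|w - z|) <= d by rewrite -ler_pdivlMr // ge_min lexx orbT.
  pose r := t - q / 2.
  have r0 : 0 <= r by rewrite /r; lra.
  have rt : r < t by rewrite /r; lra.
  have near_y : `|z + r *: (w - z) - y| < d.
    rewrite /y opprD addrACA subrr add0r -scalerBl normrZ (_ : r - t = - (q / 2)); last by rewrite /r; ring.
    by rewrite normrN gtr0_norm ?divr_gt0 //; have := normr_ge0 (w - z); nra.
  have sg : segment_in Om z (r *: (w - z)).
    move=> p /andP[p0 p1]; rewrite scalerA; apply: Ot; first exact: mulr_ge0.
    by apply: le_lt_trans rt; rewrite ler_piMl.
  have r01 : 0 <= r <= 1 by rewrite r0; lra.
  have := psi_grad_difference sg k (t := 1); rewrite ler01 lexx scale1r => /(_ isT) A.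
  have B := ltW (Hd _ near_y).
  have C : `|r *: (w - z)| <= `|w - z| := scale_norm_le _ r01.
  have mK : 0 <= m%:R * K by rewrite mulr_ge0 // (le_trans ler01).
  rewrite -[X in `|X|](subrKA (partial [:: k] psi (z + r *: (w - z)))).
  apply: le_trans (ler_normD _ _) _; rewrite distrC; apply: lerD => //.
  by apply: le_trans A _; rewrite ler_wpM2l.
have d4 : dot (grad psi y - grad psi z) (grad psi y - grad psi z) <= 4^-1.
  rewrite dot_sum; apply: (@le_trans _ _ (\sum_(k < m) (m%:R * K) ^+ 2 * lam1)).
    apply: ler_sum => k _; rewrite -expr2 -[leLHS]ger0_norm ?sqr_ge0 // normrX.
    rewrite !mxE; apply: (@le_trans _ _ ((m%:R * K * `|w - z|) ^+ 2)).
      by rewrite ler_pXn2r ?nnegrE ?mulr_ge0 // ?(le_trans ler01) //; exact: comp.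
    by rewrite exprMn ler_wpM2l // sqr_ge0.
  rewrite sumr_const card_ord -[leLHS]mulr_natl /lam1.
  have K0 : 0 < K := lt_le_trans ltr01 K1.
  have m0 : 0 <= m%:R :> R by [].
  have m3 : 0 < m%:R ^+ 3 + 1 :> R by rewrite ltr_wpDl ?exprn_ge0.
  rewrite [leLHS](_ : _ = 4^-1 * (m%:R ^+ 3 / (m%:R ^+ 3 + 1))).
    by rewrite ler_piMr // ler_pdivrMr // mul1r lerDl.
  by field; rewrite !gt_eqF.
have := st_grad st bt; have := dot_add_le (grad psi z) (grad psi y - grad psi z).
by rewrite addrC subrK; lra.
Qed.

(** Limits at the boundary make each derivative locally Cauchy around every point of the compact
    closure. The resulting modulus depends on [u] and may only be used to choose neighbourhoods. *)
Lemma u_uniform_continuity (s : seq 'I_m) (e : R) : (size s <= 2)%N -> 0 < e ->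
  exists2 d : R, 0 < d & forall z w, Om z -> Om w -> `|z - w| < d ->
    `|partial s u z - partial s u w| <= e.
Proof.
move=> sz e0.
have loc z : closure Om z -> exists2 d : R, 0 < d & forall v w, Om v -> Om w ->
    `|v - z| < d -> `|w - z| < d -> `|partial s u v - partial s u w| <= e.
  have e20 : 0 < e / 2 by rewrite divr_gt0.
  suff H : closure Om z -> exists c, exists2 d : R, 0 < d & forall v, Om v -> `|v - z| < d ->
      `|partial s u v - c| < e / 2.
    move=> /H[c [d d0 Hd]]; exists d => // v w Ov Ow vz wz.
    have := Hd v Ov vz; have := Hd w Ow wz; rewrite -(distrC (partial s u w)).
    have -> : partial s u w - partial s u v = (partial s u w - c) - (partial s u v - c) by ring.
    by move=> A B; apply: le_trans (ler_normB _ _) _; lra.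
  move=> /closure_cases[Oz|bz].
    exists (partial s u z).
    have [d d0 Hd] := continuous_eps ((st_u st).2 s z sz Oz) e20.
    by exists d => // v _ /Hd.
  have /cvg_ex[c Hc] := st_ulim st sz bz; exists c.
  have /cvgrPdist_lt/(_ _ e20) := Hc; rewrite /within /= => /nbhs_ballP[d /= d0 Hd].
  exists d => // v Ov vz; rewrite distrC; apply: Hd => //.
  by rewrite -ball_normE /= distrC.
have := compact_closure; rewrite compact_near_coveringP => nc.
have FF : Filter (at_right (0 : R)) by exact: at_right_proper_filter.
have := nc R (at_right 0) (fun r z => forall v w, Om v -> Om w ->
    `|v - z| < r -> `|w - z| < r -> `|partial s u v - partial s u w| <= e) FF.
move=> [].
  move=> z cz; have [d d0 Hd] := loc z cz.
  have d20 : 0 < d / 2 by rewrite divr_gt0.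
  exists (ball z (d / 2), [set r : R | 0 < r < d / 2]) => /=.
    split; first exact: nbhsx_ballx.
    exists (d / 2) => //= r /=; rewrite sub0r normrN => rd r0.
    by rewrite r0 (le_lt_trans (ler_norm r)).
  move=> [z' r] [/= zz' /andP[r0 rd]] v w Ov Ow vz wz.
  rewrite -ball_normE /= in zz'.
  have tri x : `|x - z'| < r -> `|x - z| < d.
    move=> xz; rewrite -(subrKA z' x); apply: le_lt_trans (ler_normD _ _) _.
    by rewrite (distrC z'); lra.
  by apply: Hd => //; exact: tri.
move=> r /= r0 Hr.
pose q := r / 2.
have q0 : 0 < q by rewrite divr_gt0.
have := Hr q; rewrite /= sub0r normrN gtr0_norm // => /(_ _ q0) H.
exists q => // z w Oz Ow zw; have {}H := H _ z (Om_closure Oz).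
by apply: H; rewrite /q ?subrr ?normr0 // 1?distrC //; lra.
Qed.

(** [G] need not extend to the boundary: the bound in the collar forces the maximum into the compact
    set psi >= lam. *)
Lemma exhaustion (G : 'rV[R]_m -> R) (lam b : R) z1 : 0 < lam ->
  (forall z, Om z -> {for z, continuous G}) ->
  (forall z, Om z -> psi z < lam -> G z <= b) -> Om z1 -> b < G z1 ->
  exists2 z0, Om z0 & b < G z0 /\ forall z, Om z -> G z <= G z0.
Proof.
move=> lam0 cG near Oz1 bz1.
have z1l : lam <= psi z1 by rewrite leNgt; apply/negP => /(near z1 Oz1); rewrite leNgt bz1.
have sub z : closure Om z /\ lam <= psi z -> Om z.
  by move=> [cz lz]; apply: Om_of_psi => //; apply: lt_le_trans lz.
have [|||z0 z0l Hz0] := @EVT_pointwise _ _ [set z | closure Om z /\ lam <= psi z] G.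
- by exists z1; split => //; exact: Om_closure.
- exact: compact_level.
- by move=> z /sub; exact: cG.
have b0' : b < G z0 by apply: lt_le_trans bz1 _; apply: Hz0; split => //; exact: Om_closure.
exists z0; [exact: sub|split => // z Oz].
have [|zl] := leP lam (psi z); first by move=> zl; apply: Hz0; split => //; exact: Om_closure.
by apply: ltW; apply: le_lt_trans (near z Oz zl) b0'.
Qed.

End Domain.

(** * Uniformity over compact sets *)

Section CompactUniform.
Variables (R : realType) (m : nat).
Implicit Types (x z v w : 'rV[R]_m) (U A : set 'rV[R]_m) (h : 'rV[R]_m -> R).

Lemma compact_uniform A (P : R -> 'rV[R]_m -> Prop) : compact A ->
  (forall z d d', P d z -> 0 < d' -> d' <= d -> P d' z) ->
  (forall z, A z -> exists2 d : R, 0 < d & forall w, `|w - z| < d -> P d w) ->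
  exists2 d : R, 0 < d & forall z, A z -> P d z.
Proof.
rewrite compact_near_coveringP => nc mono loc.
have FF : Filter (at_right (0 : R)) by exact: at_right_proper_filter.
have [|r /= r0 Hr] := nc R (at_right 0) P FF.
  move=> z /loc[d d0 Hd].
  exists (ball z d, [set r : R | 0 < r < d]) => /=.
    split; first exact: nbhsx_ballx.
    exists d => //= r /=; rewrite sub0r normrN => rd r0.
    by rewrite r0 (le_lt_trans (ler_norm r)).
  move=> [z' r] [/= zz' /andP[r0 rd]]; rewrite -ball_normE /= in zz'.
  by apply: mono r0 (ltW rd); apply: Hd; rewrite distrC.
exists (r / 2) => [|z Az]; first by rewrite divr_gt0.
apply: Hr => //; last by rewrite divr_gt0.
by rewrite /= sub0r normrN gtr0_norm ?divr_gt0 //; lra.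
Qed.

Lemma compact_ball z0 (r : R) : compact [set z : 'rV[R]_m | `|z - z0| <= r].
Proof.
apply: bounded_closed_compact.
  exists (`|z0| + r); split; rewrite ?num_real // => M rM x /= xr.
  rewrite -(subrK z0 x); apply: le_trans (ler_normD _ _) _; lra.
have := @closed_comp _ _ (fun x : 'rV[R]_m => `|x - z0|) [set t : R | t <= r].
apply; last exact: closed_le.
move=> x _; apply: continuous_of_eps => e e0; exists e => // w wx.
rewrite (_ : w - x = (w - z0) - (x - z0)) in wx; last by rewrite opprB addrA subrK.
exact: le_lt_trans (ler_dist_dist _ _) wx.
Qed.

Lemma compact_Taylor1 U A h : open U -> compact A -> A `<=` U -> Cclass 1 U h ->
  forall e : R, 0 < e -> exists2 d : R, 0 < d & forall z, A z -> forall v, `|v| < d ->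
    `|h (z + v) - h z - dot (grad h z) v| <= e * `|v|.
Proof.
move=> oU cA AU ch e e0; apply: compact_uniform => [//|z d d' H d'0 dd v vd|z Az].
  by apply: H; apply: lt_le_trans dd.
have [d d0 Hd] := uniform_Taylor1 oU (AU z Az) ch e0.
by exists d => // w wz v; apply: Hd.
Qed.

Lemma compact_Taylor2 U A h : open U -> compact A -> A `<=` U -> Cclass 2 U h ->
  forall e : R, 0 < e -> exists2 d : R, 0 < d & forall z, A z -> forall v, `|v| < d ->
    `|h (z + v) - h z - dot (grad h z) v - 2^-1 * dot (v *m hess h z) v| <= e * `|v| ^+ 2.
Proof.
move=> oU cA AU ch e e0; apply: compact_uniform => [//|z d d' H d'0 dd v vd|z Az].
  by apply: H; apply: lt_le_trans dd.
have [d d0 Hd] := uniform_Taylor2 oU (AU z Az) ch e0.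
by exists d => // w wz v; apply: Hd.
Qed.

Lemma jet_shift (f : 'rV[R]_m -> R) z v c l q :
  jet f (z + v) c l q -> jet (fun y => f (y + v)) z c l q.
Proof.
move=> [lp qp H]; split=> // e /H[d d0 Hd]; exists d => // x xd.
by rewrite (addrAC z); apply: Hd.
Qed.

End CompactUniform.

Lemma barrier_arith (R : realType) (k k1 k2 k3 S1 S2 : R) : S1 <= -2 -> k3 <= S2 ->
  2^-1 * S2 + - k / 2 * S1 + 0 * S1 <= k1 / 2 -> 0 <= k1 -> 0 <= k2 -> k = k1 + k2 + 1 ->
  k * S1 <= k * -2 -> 0 <= k3 -> False.
Proof. lra. Qed.

Lemma barrier_arith' (R : realType) (k k1 k2 k3 S1 S2 : R) : S1 <= k3 + 1 -> S2 <= -2 ->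
  - 2^-1 * S1 + - k / 2 * S2 + 0 * S2 <= k1 / 2 -> 0 <= k1 -> 0 <= k2 -> k = k1 + k2 + 1 ->
  k * S2 <= k * -2 -> k3 <= k2 -> False.
Proof. lra. Qed.

(** * Boundary barriers and the gradient bound *)

Section Estimates.
Variables (R : realType) (m : nat) (J : 'M[R]_m) (I : finType).
Variables (K Kf Kg b0 : R) (fr : (I -> 'rV[R]_m) -> R -> Prop).
Variables (Om : set 'rV[R]_m) (psi f g u : 'rV[R]_m -> R).
Hypothesis (frP : frames J b0 fr) (st : setting K Kf Kg fr Om psi f g u).
Hypothesis (K1 : 1 <= K) (Kf0 : 0 <= Kf) (Kg0 : 0 <= Kg) (b00 : 0 <= b0).
Implicit Types (z v w x : 'rV[R]_m).

Let Om_open : open Om := st_open st.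
Let psi2 : Cclass 2 Om psi := Cclass_le (isT : (2 <= 4)%N) (psi_class st).
Let u1 : Cclass 1 Om u := Cclass_le (isT : (1 <= 2)%N) (st_u st).

Lemma norm_mx_le (A : 'M[R]_m) (a : R) : 0 <= a -> (forall i k, `|A i k| <= a) -> `|A| <= a.
Proof.
by move=> a0 H; rewrite [leLHS]/Num.norm /= mx_normrE; apply/bigmax_leP; split.
Qed.

Lemma bil_le (H : 'M[R]_m) (L : R) x y : (forall i k, `|H i k| <= L) -> 0 <= L ->
  `|dot (x *m H) y| <= m%:R ^+ 2 * L * `|x| * `|y|.
Proof.
move=> HL L0; apply: le_trans (dot_le_norm _ _) _; rewrite ler_wpM2r //.
rewrite expr2 -!mulrA ler_wpM2l // (le_trans (norm_mulmx_le _ _)) // -mulrA ler_wpM2l //.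
by rewrite ler_wpM2r // norm_mx_le.
Qed.

(** The three Hessians may sit at different points: one frame is tested at all of them, as
    difference quotients demand. *)
Lemma trace_comb_le s b (h1 h2 h3 : 'rV[R]_m -> R) z1 z2 z3 (a1 a2 a3 c : R) : fr s b ->
  (forall x, a1 * dot (x *m hess h1 z1) x + a2 * dot (x *m hess h2 z2) x
     + a3 * dot (x *m hess h3 z3) x <= c * dot x x) ->
  a1 * trace_op s h1 z1 + a2 * trace_op s h2 z2 + a3 * trace_op s h3 z3 <= c / 2.
Proof.
move=> sb H; rewrite /trace_op !mulr_sumr -!big_split /=.
by apply: (frame_sum_le frP sb) => i.
Qed.

Lemma second_difference_lip h (L : R) z v : Cclass 1 Om h ->
  (forall k v w, Om v -> Om w -> `|partial [:: k] h v - partial [:: k] h w| <= L * `|v - w|) ->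
  0 <= L -> segment_in Om z v -> segment_in Om z (- v) ->
  `|h (z + v) + h (z - v) - 2 * h z| <= 2 * m%:R * L * `|v| ^+ 2.
Proof.
move=> ch HL L0 sg sg'.
have T w : segment_in Om z w -> `|h (z + w) - h z - dot (grad h z) w| <= m%:R * L * `|w| ^+ 2.
  move=> sw; apply: (gradient_Lipschitz_Taylor Om_open ch sw) => k t t01.
  have Oz : Om z by have := sw 0; rewrite scale0r addr0 lexx ler01 => /(_ isT).
  apply: le_trans (HL k _ _ (sw t t01) Oz) _.
  by rewrite addrAC subrr add0r ler_wpM2l // scale_norm_le.
have := T _ sg; have := T _ sg'; rewrite dotNr normrN => A B.
have -> : h (z + v) + h (z - v) - 2 * h z = (h (z + v) - h z - dot (grad h z) v)
   + (h (z - v) - h z - - dot (grad h z) v) by ring.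
apply: le_trans (ler_normD _ _) _; lra.
Qed.

Lemma difference_le h (L : R) z v : Cclass 1 Om h ->
  (forall s z, (size s <= 1)%N -> Om z -> `|partial s h z| <= L) -> 0 <= L -> segment_in Om z v ->
  `|h (z + v) - h z| <= m%:R * L * `|v|.
Proof.
move=> ch HL L0 sg; have [t /andP[t0 t1] ->] := segment_MVT Om_open ch sg.
apply: le_trans (dot_le_norm _ _) _; rewrite ler_wpM2r // ler_wpM2l //.
apply: norm_rV_le => // k; rewrite mxE; apply: (HL [:: k]) => //.
by apply: sg; rewrite !ltW.
Qed.

Lemma small_segment z : Om z -> exists2 d : R, 0 < d & forall w v, `|w - z| < d -> `|v| < d ->
  segment_in Om w v.
Proof.
move=> Oz; have [d d0 Hd] := open_eps Om_open Oz; exists (d / 2) => [|w v wz vd t t01].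
  by rewrite divr_gt0.
apply: Hd; rewrite addrAC; apply: le_lt_trans (ler_normD _ _) _.
by have := scale_norm_le v t01; lra.
Qed.

(** With this coefficient the trace of Kb psi outweighs both the second differences of [g] (the term
    m Kg) and the right-hand side of the equation (the term b0 Kf). *)
Definition Kb : R := m%:R * Kg + b0 * Kf + 1.

Lemma Kb_gt0 : 0 < Kb.
Proof. by rewrite /Kb ltr_wpDl // addr_ge0 ?mulr_ge0. Qed.

Let boundary_max (a c : R) : (a = 1 \/ a = - 1) -> 0 <= c ->
  (exists2 z, Om z & 0 < a * (u z - g z) - c * psi z) ->
  exists2 z, Om z & forall w, Om w -> a * (u w - g w) - c * psi w <= a * (u z - g z) - c * psi z.
Proof.
move=> a1 c0 [z1 Oz1 pos].
have cl1 : closure Om z1 by exact: Om_closure.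
pose F z := a * (u z - g z) - c * psi z.
have cF : {within closure Om, continuous F}.
  have cu := st_uc st; have cg := st_gc st.
  have cp : {within closure Om, continuous psi}.
    apply: continuous_in_subspaceT => z; rewrite inE => cz.
    exact: (partial_psi_continuous st (s := [::]) isT cz).
  move=> x; exact: (@cont_sub _ (subspace (closure Om)) _ _ x
    (cont_mul (@cont_cst _ _ a x) (cont_sub (cu x) (cg x)))
    (cont_mul (@cont_cst _ _ c x) (cp x))).
have [z0] := compact_EVT_max (ex_intro _ z1 cl1) (compact_closure st) cF.
rewrite inE => cz0 Hz0.
have Oz0 : Om z0.
  have [//|bz0] := closure_cases st cz0.
  have := Hz0 z1; rewrite inE => /(_ cl1); rewrite /F (st_ug st bz0) subrr mulr0 (psi_bdry st bz0) mulr0.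
  by rewrite subrr leNgt pos.
by exists z0 => // w Ow; apply: Hz0; rewrite inE; exact: Om_closure.
Qed.

(** Stand-in for the Hessian of [g]: at a maximum of a (u - g) - c psi, these second differences
    bound those of a u - c psi. *)
Let g_second z x : Om z -> exists2 d : R, 0 < d & forall t, 0 < t -> t < d ->
  [/\ Om (z + t *: x), Om (z - t *: x) &
   `|g (z + t *: x) + g (z - t *: x) - 2 * g z| <= t ^+ 2 * (2 * m%:R * Kg * dot x x)].
Proof.
move=> Oz; have [d d0 Hd] := small_segment Oz.
have x1 : 0 < 1 + `|x| by rewrite ltr_pwDl.
exists (d / (1 + `|x|)) => [|t t0]; first by rewrite divr_gt0.
rewrite ltr_pdivlMr // => td.
have nt : `|t *: x| = t * `|x| by rewrite normrZ gtr0_norm.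
have sg : segment_in Om z (t *: x) by apply: Hd; rewrite ?subrr ?normr0 ?nt; lra.
have sg' : segment_in Om z (- (t *: x)) by apply: Hd; rewrite ?subrr ?normrN ?normr0 ?nt; lra.
have i1 : 0 <= (1 : R) <= 1 by rewrite ler01 lexx.
split; first by have := sg 1 i1; rewrite scale1r.
  by have := sg' 1 i1; rewrite scale1r.
apply: le_trans (second_difference_lip (st_g st) (st_g_lip st) Kg0 sg sg') _.
rewrite nt exprMn [leRHS](_ : _ = 2 * m%:R * Kg * (t ^+ 2 * dot x x)); last by ring.
by rewrite ler_wpM2l ?mulr_ge0 // ler_wpM2l ?sqr_ge0 // sqr_norm_le_dot.
Qed.

Lemma u_le_g z : Om z -> u z - g z <= Kb * psi z.
Proof.
move=> Oz; rewrite -subr_le0 leNgt; apply/negP => pos.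
have [|z0 Oz0 H0] := @boundary_max 1 Kb (or_introl erefl) (ltW Kb_gt0).
  by exists z; rewrite ?mul1r.
have J0 := jetD (jet_Taylor Om_open Oz0 (st_u st)) (jetZ (- Kb) (jet_Taylor Om_open Oz0 psi2)).
have key x : 2^-1 * dot (x *m hess u z0) x + - Kb * (2^-1 * dot (x *m hess psi z0) x)
    <= m%:R * Kg * dot x x.
  have := jet_second_difference_le (Q := fun x => 2 * m%:R * Kg * dot x x) (x := x) J0.
  rewrite -[in X in _ -> X](ler_pM2l (ltr0Sn R 1)) [X in _ -> _ <= X](_ : _ = 2 * m%:R * Kg * dot x x).
    apply; have [d d0 Hd] := g_second x Oz0.
    exists d => // t t0 td; have [A B] := Hd t t0 td; rewrite ler_norml => /andP[_ C].
    have := H0 _ A; have := H0 _ B; move: C; move: (t ^+ 2 * _) => T.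
    by lra.
  by ring.
have [s [b sb]] := frame_exists st Oz0.
have key2 x : 2^-1 * dot (x *m hess u z0) x + - Kb / 2 * dot (x *m hess psi z0) x
    + 0 * dot (x *m hess psi z0) x <= m%:R * Kg * dot x x by have := key x; lra.
have := trace_comb_le sb key2.
have := st_sub st sb Oz0; have := st_psi_sup st sb Oz0.
have := st_f0 st Oz0; have /andP[b_0 b_1] := fr_b frP sb.
move: (trace_op s psi z0) (trace_op s u z0) => S1 S2 f0 A B C.
have : 0 <= b * f z0 by rewrite mulr_ge0.
have := Kb_gt0; have kk : 0 <= m%:R * Kg by rewrite mulr_ge0.
have kk2 : 0 <= b0 * Kf by rewrite mulr_ge0.
have : Kb * S1 <= Kb * - 2 by rewrite ler_wpM2l // ltW // Kb_gt0.
have KbE : Kb = m%:R * Kg + b0 * Kf + 1 by [].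
move=> X Y Z; exact: barrier_arith A B C kk kk2 KbE X Z.
Qed.

Lemma g_le_u z : Om z -> g z - u z <= Kb * psi z.
Proof.
move=> Oz; rewrite -subr_le0 leNgt; apply/negP => pos.
have [|z0 Oz0 H0] := @boundary_max (-1) Kb (or_intror erefl) (ltW Kb_gt0).
  by exists z => //; move: pos; lra.
have J0 := jetD (jetZ (-1) (jet_Taylor Om_open Oz0 (st_u st)))
  (jetZ (- Kb) (jet_Taylor Om_open Oz0 psi2)).
have key x : -1 * (2^-1 * dot (x *m hess u z0) x) + - Kb * (2^-1 * dot (x *m hess psi z0) x)
    <= m%:R * Kg * dot x x.
  have := jet_second_difference_le (Q := fun x => 2 * m%:R * Kg * dot x x) (x := x) J0.
  rewrite -[in X in _ -> X](ler_pM2l (ltr0Sn R 1)) [X in _ -> _ <= X](_ : _ = 2 * m%:R * Kg * dot x x).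
    apply; have [d d0 Hd] := g_second x Oz0.
    exists d => // t t0 td; have [A B] := Hd t t0 td; rewrite ler_norml => /andP[C _].
    have := H0 _ A; have := H0 _ B; move: C; move: (t ^+ 2 * _) => T.
    by lra.
  by ring.
have [s [b [sb eqs]]] := st_eq st Oz0 ltr01.
have key2 x : - 2^-1 * dot (x *m hess u z0) x + - Kb / 2 * dot (x *m hess psi z0) x
    + 0 * dot (x *m hess psi z0) x <= m%:R * Kg * dot x x by have := key x; lra.
have := trace_comb_le sb key2.
have := st_psi_sup st sb Oz0; have := st_f_le st (s := [::]) isT Oz0; rewrite /= => fle.
have /andP[b_0 b_1] := fr_b frP sb; move: eqs.
move: (trace_op s u z0) (trace_op s psi z0) => S1 S2 A B C.
have fK : f z0 <= Kf by apply: le_trans fle; exact: ler_norm.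
have : b * f z0 <= b0 * Kf by apply: ler_pM => //; exact: st_f0 st _ Oz0.
have kk : 0 <= m%:R * Kg by rewrite mulr_ge0.
have kk2 : 0 <= b0 * Kf by rewrite mulr_ge0.
have : Kb * S2 <= Kb * - 2 by rewrite ler_wpM2l // ltW // Kb_gt0.
have KbE : Kb = m%:R * Kg + b0 * Kf + 1 by [].
move=> X Y; exact: barrier_arith' A B C kk kk2 KbE X Y.
Qed.

Lemma psi_le z : Om z -> psi z <= K.
Proof. by move=> Oz; apply: le_trans (ler_norm _) (st_psi_le st (s := [::]) isT Oz). Qed.

Lemma grad_psi_norm z : Om z -> `|grad psi z| <= K.
Proof.
move=> Oz; apply: norm_rV_le => [|k]; first exact: le_trans K1.
by rewrite mxE; apply: (st_psi_le st (s := [:: k])).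
Qed.

(** A step of length psi(z) / Dg in a coordinate direction stays in [Om] and at most doubles
    [psi]. *)
Let Dg : R := 2 * (m%:R * K) + 2 * (K2 m K * K) + 1.
Let K20 : 0 <= K2 m K := K2_ge0 m K1.
Let K0 : 0 < K := lt_le_trans ltr01 K1.

Definition Cgrad : R := m%:R * Kg + 3 * Kb * Dg + 1 + (b0 * (m%:R * Kf) + 1) * K.

(** Compare u with g at both ends of a step of length t = psi(z) / Dg: the barriers cost 3 Kb psi(z)
    = 3 Kb Dg t, proportional to the step. The mean value theorem gives the bound at an intermediate
    point, and uniform continuity of the gradient moves it to [z] at the cost of 1. The collar width
    [lam] depends on [u], the bound does not. *)
Let grad_near_boundary : exists2 lam : R, 0 < lam & forall z (e : 'rV[R]_m), Om z -> psi z < lam ->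
  (exists k, e = unit_vec R k \/ e = - unit_vec R k) ->
  dot (grad u z) e <= m%:R * Kg + 3 * Kb * Dg + 1.
Proof.
have mK : 0 <= m%:R * K by rewrite mulr_ge0 // ltW.
have K2K : 0 <= K2 m K * K by rewrite mulr_ge0 // ltW.
have D1 : 1 <= Dg by rewrite /Dg; lra.
have D0 : 0 < Dg by lra.
have [d d0 Hd] : exists2 d : R, 0 < d & forall k : 'I_m, forall z w, Om z -> Om w ->
    `|z - w| < d -> `|partial [:: k] u z - partial [:: k] u w| <= 1.
  apply: finite_eps => [k d d' H _ dd z w Oz Ow zw|k].
    by apply: H => //; apply: lt_le_trans dd.
  exact: (u_uniform_continuity st (s := [:: k]) isT ltr01).
exists d => // z e Oz zd [k ek].
have ne : `|e| <= 1.
  have nk : `|unit_vec R k| <= 1.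
    by apply: norm_rV_le => // j; rewrite mxE; case: (_ && _); rewrite ?normr1 ?normr0.
  by case: ek => ->; rewrite ?normrN.
have psi0 := psi_gt0 st Oz; have psiK := psi_le Oz.
pose t := psi z / Dg; have t0 : 0 < t by rewrite divr_gt0.
have tD : t * Dg = psi z by rewrite /t divfK // gt_eqF.
have tpsi : t <= psi z by rewrite -tD ler_peMr // ltW.
have nte : `|t *: e| <= t by rewrite normrZ gtr0_norm // ler_piMr // ltW.
have gte : `|dot (grad psi z) (t *: e)| <= m%:R * K * t.
  apply: le_trans (dot_le_norm _ _) _; apply: ler_pM; rewrite ?mulr_ge0 //.
  by rewrite ler_wpM2l // grad_psi_norm.
have K2t : K2 m K * `|t *: e| ^+ 2 <= K2 m K * K * t.
  rewrite -mulrA ler_wpM2l // expr2 ler_pM //; exact: le_trans nte (le_trans tpsi psiK).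
have small : m%:R * K * t + K2 m K * `|t *: e| ^+ 2 < psi z.
  apply: le_lt_trans (_ : m%:R * K * t + K2 m K * K * t < _); first by rewrite lerD2l.
  have : 0 <= m%:R * K * t by rewrite mulr_ge0 // ltW.
  have : 0 <= K2 m K * K * t by rewrite mulr_ge0 // ltW.
  by rewrite -tD /Dg; lra.
have sg : segment_in Om z (t *: e).
  apply: (segment_in_Om st K1 Oz _ _ small); first by rewrite mulr_ge0 // ltW.
  by move: gte; rewrite ler_norml => /andP[]; lra.
have [r r01 E] := segment_MVT Om_open u1 sg.
have i1 : 0 <= (1 : R) <= 1 by rewrite ler01 lexx.
have Ote : Om (z + t *: e) by have := sg 1 i1; rewrite scale1r.
have A1 := u_le_g Ote; have A2 := g_le_u Oz.
have A3 := difference_le (st_g st) (st_g_le st) Kg0 sg.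
have A4 := psi_Taylor st sg.
have psite : psi (z + t *: e) <= 2 * psi z.
  by move: A4 gte; rewrite !ler_norml => /andP[_ B1] /andP[_ B2]; lra.
have A5 : m%:R * Kg * `|t *: e| <= m%:R * Kg * t by rewrite ler_wpM2l // mulr_ge0.
have A6 : Kb * psi (z + t *: e) <= Kb * (2 * psi z) by rewrite ler_wpM2l // ltW // Kb_gt0.
have A7 : Kb * psi z = Kb * Dg * t by rewrite -tD; ring.
have main : t * dot (grad u (z + r *: (t *: e))) e <= t * (m%:R * Kg + 3 * Kb * Dg).
  rewrite -dotZr -E; move: A3; rewrite ler_norml => /andP[_]; lra.
rewrite ler_pM2l // in main.
apply: le_trans (_ : dot (grad u (z + r *: (t *: e))) e + 1 <= _); last by rewrite lerD2r.
case/andP: r01 => r0 r1; have r01 : 0 <= r <= 1 by rewrite !ltW.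
have near_z : `|z + r *: (t *: e) - z| < d.
  rewrite addrAC subrr add0r; apply: le_lt_trans (scale_norm_le _ r01) _.
  by apply: le_lt_trans nte _; lra.
have := Hd k _ _ (sg r r01) Oz near_z; rewrite ler_norml => /andP[B1 B2].
have gk w : dot (grad u w) (unit_vec R k) = partial [:: k] u w by rewrite dot_deltar mxE.
move: B1 B2; move: (z + r *: (t *: e)) => w.
by case: ek => ->; rewrite ?dotNr !gk; lra.
Qed.

Lemma grad_continuous z (e : 'rV[R]_m) : Om z -> {for z, continuous (fun w => dot (grad u w) e)}.
Proof.
move=> Oz; rewrite (_ : (fun w => _) = (fun w => \sum_k grad u w 0 k * e 0 k)); last first.
  by apply/funext => w; rewrite dot_sum.
apply: cont_sum => k; apply: cont_mul; last exact: cont_cst.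
rewrite (_ : (fun w => _) = partial [:: k] u); last by apply/funext => w; rewrite mxE.
exact: ((st_u st).2 [:: k] z isT Oz).
Qed.

(** At an interior maximum of u_e - C3 psi the linearized equation bounds the trace of D^2 u_e below
    by -C3, whereas C3 psi has trace at most -2 C3. Since u_e has no Hessian, the difference
    quotients [G] are used at nearby touching points. *)
Lemma gradient_bound z k : Om z -> `|partial [:: k] u z| <= Cgrad.
Proof.
move=> Oz.
have bf : 0 <= b0 * (m%:R * Kf) by rewrite !mulr_ge0.
pose C3 : R := b0 * (m%:R * Kf) + 1.
have C30 : 0 < C3 by rewrite /C3; lra.
suff H (e : 'rV[R]_m) : (exists k, e = unit_vec R k \/ e = - unit_vec R k) ->
    dot (grad u z) e - C3 * psi z <= m%:R * Kg + 3 * Kb * Dg + 1.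
  have psiK : C3 * psi z <= C3 * K by rewrite ler_wpM2l ?psi_le // ltW.
  have A := H (unit_vec R k) (ex_intro _ k (or_introl erefl)).
  have B := H (- unit_vec R k) (ex_intro _ k (or_intror erefl)).
  move: A B; rewrite dotNr dot_deltar mxE /Cgrad -/C3 ler_norml /=; lra.
move=> [j ej].
have ne : `|e| <= 1.
  have nk : `|unit_vec R j| <= 1.
    by apply: norm_rV_le => // i; rewrite mxE; case: (_ && _); rewrite ?normr1 ?normr0.
  by case: ej => ->; rewrite ?normrN.
rewrite leNgt; apply/negP => gt.
have [lam lam0 Hlam] := grad_near_boundary.
have [||z0 Oz0 [_ Hmax]] := @exhaustion _ _ _ _ _ _ _ _ _ _ _ _ st
   (fun w => dot (grad u w) e - C3 * psi w) lam _ z lam0 _ _ Oz gt.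
- move=> w Ow; apply: cont_sub; first exact: grad_continuous.
  apply: cont_mul; first exact: cont_cst.
  exact: (partial_psi_continuous st (s := [::]) isT (Om_closure Ow)).
- move=> w Ow wl; have := Hlam w e Ow wl (ex_intro _ j ej).
  have : 0 <= C3 * psi w by rewrite mulr_ge0 ?(ltW C30) // ltW // (psi_gt0 st Ow).
  move: (dot _ _) (C3 * _) => a1 a2; lra.
have [_ _ Jpsi] := jetZ C3 (jet_Taylor Om_open Oz0 psi2).
have [q1 q2 _] := jetZ C3 (jet_Taylor Om_open Oz0 psi2).
have e40 : 0 < (8^-1 : R) by [].
have [d1 d10 Hd1] := Jpsi _ e40.
have [d2 d20 Hd2] := small_segment Oz0.
have [d3 d30 Hd3] : exists2 d : R, 0 < d & forall x, `|x| < d -> Om (z0 + x).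
  have [d d0 Hd] := open_eps Om_open Oz0; exists d => // x xd; apply: Hd.
  by rewrite addrAC subrr add0r.
pose dm := Num.min d1 (Num.min d2 d3).
have dm0 : 0 < dm by rewrite !lt_min d10 d20.
have dm1 : dm <= d1 by rewrite ge_min lexx.
have dm2 : dm <= d2 by rewrite !ge_min lexx orbT.
have dm3 : dm <= d3 by rewrite !ge_min lexx !orbT.
have rho0 : 0 < dm / 4 by rewrite divr_gt0.
have r0 : 0 < dm / 4 by [].
pose G h w : R := h^-1 * (u (w + h *: e) + -1 * u w).
have nhe h : 0 < h -> `|h *: e| <= h.
  by move=> h0; rewrite normrZ gtr0_norm // ler_piMr // ltW.
have [|||h0 h00 Hh] := @touch _ _ z0 (dm / 4) 8^-1 (dm / 4) (fun w => dot (grad u w) e) G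
    (fun x => C3 * dot (grad psi z0) x) (fun x => C3 * (2^-1 * dot (x *m hess psi z0) x))
    rho0 e40 r0 q1 q2.
- move=> x xr; have xd1 : `|x| < d1 by lra.
  have xd3 : `|x| < d3 by lra.
  have := Hmax _ (Hd3 x xd3); have := Hd1 x xd1; rewrite ler_norml => /andP[_]; lra.
- move=> eta eta0; have [||d d0 Hd] := compact_Taylor1 (A := [set z | `|z - z0| <= dm / 4])
      Om_open _ _ u1 eta0; first exact: compact_ball.
    by move=> w /= wz; rewrite -(subrK z0 w) addrC; apply: Hd3; lra.
  exists d => // h h0 hd x xr; rewrite /G.
  have := Hd (z0 + x); rewrite /= addrAC subrr add0r => /(_ xr (h *: e)).
  have heh := nhe h h0; rewrite dotZr => /(_ (le_lt_trans heh hd)) H.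
  rewrite (_ : _ - _ = h^-1 * (u (z0 + x + h *: e) - u (z0 + x) - h * dot (grad u (z0 + x)) e)).
    rewrite normrM gtr0_norm ?invr_gt0 // ler_pdivrMl //.
    by apply: le_trans H _; rewrite mulrC ler_wpM2r // ltW.
  by field; rewrite gt_eqF.
- exists (dm / 4) => // h h0 hd x xr.
  have Ox : Om (z0 + x) by apply: Hd3; lra.
  have Oxh : Om (z0 + x + h *: e).
    by rewrite -addrA; apply: Hd3; apply: le_lt_trans (ler_normD _ _) _; have := nhe h h0; lra.
  apply: (jet_continuous (jetZ h^-1 (jetD (jet_shift (jet_Taylor Om_open Oxh (st_u st)))
     (jetZ (-1) (jet_Taylor Om_open Ox (st_u st)))))).
pose h := Num.min h0 (dm / 4) / 2.
have mn0 : 0 < Num.min h0 (dm / 4) by rewrite lt_min h00.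
have hp : 0 < h by rewrite divr_gt0.
have hh0 : h < h0 by rewrite ltr_pdivrMr // gt_min; apply/orP; left; lra.
have hdm : h < dm / 4 by rewrite ltr_pdivrMr // gt_min; apply/orP; right; lra.
have [y yz Hy] := Hh h hp hh0.
have Oy : Om y by rewrite -(subrK z0 y) addrC; apply: Hd3; lra.
have Oyh : Om (y + h *: e).
  rewrite -(subrK z0 y) addrAC addrC; apply: Hd3; apply: le_lt_trans (ler_normD _ _) _.
  by have := nhe h hp; lra.
have := Hy _ _ _ (jetZ h^-1 (jetD (jet_shift (jet_Taylor Om_open Oyh (st_u st)))
     (jetZ (-1) (jet_Taylor Om_open Oy (st_u st))))).
(* The frame is nearly optimal at [y] and merely supporting at y + h e. The error h becomes 1 after
   division by h and is the summand 1 of [C3]. *)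
have [s [b [sb eqs]]] := st_eq st Oy hp.
move=> key.
have key2 x : h^-1 / 2 * dot (x *m hess u (y + h *: e)) x + - (h^-1 / 2) * dot (x *m hess u y) x
    + - (C3 / 2) * dot (x *m hess psi z0) x <= 4^-1 * dot x x by have := key x; lra.
have := trace_comb_le sb key2.
have := st_sub st sb Oyh; have := st_psi_sup st sb Oz0; move: eqs.
move: (trace_op s u y) (trace_op s u (y + h *: e)) (trace_op s psi z0) => S1 S2 S3 E1 E2 E3 E4.
have sg : segment_in Om y (h *: e).
  by apply: Hd2; [lra|have := nhe h hp; lra].
have := difference_le (st_f st) (st_f_le st) Kf0 sg.
have mf : m%:R * Kf * `|h *: e| <= m%:R * Kf * h by rewrite ler_wpM2l ?nhe // mulr_ge0.
move=> /le_trans/(_ mf); rewrite ler_norml => /andP[F1 _].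
have /andP[b_0 b_1] := fr_b frP sb.
have F2 : - (b0 * (m%:R * Kf) * h) <= b * (f (y + h *: e) - f y).
  have : b * (- (m%:R * Kf * h)) <= b * (f (y + h *: e) - f y) by rewrite ler_wpM2l.
  have : b * (m%:R * Kf * h) <= b0 * (m%:R * Kf * h).
    by rewrite ler_wpM2r // !mulr_ge0 // ltW.
  lra.
have E5 : - (C3 * h) <= S2 - S1 by rewrite /C3; lra.
have E6 : - C3 <= h^-1 * (S2 - S1) by rewrite ler_pdivlMl //; lra.
have E7 : C3 * S3 <= C3 * - 2 by rewrite ler_wpM2l // ltW.
have E8 : 1 <= C3 by rewrite /C3; lra.
lra.
Qed.

End Estimates.

Lemma tangential_arith (R : realType) (gp gm gz up um uz pp pm pz Kb G2 c : R) :
  up - gp <= Kb * pp -> um - gm <= Kb * pm -> gz - uz <= Kb * pz ->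
  gp + gm - 2 * gz <= G2 -> c <= up + um - 2 * uz -> c <= G2 + Kb * (pp + pm + 2 * pz).
Proof. lra. Qed.

(** * Second derivatives in a collar of the boundary *)

Section SecondDerivatives.
Variables (R : realType) (m : nat) (J : 'M[R]_m) (I : finType).
Variables (K Kf Kg b0 : R) (fr : (I -> 'rV[R]_m) -> R -> Prop).
Variables (Om : set 'rV[R]_m) (psi f g u : 'rV[R]_m -> R).
Hypothesis (frP : frames J b0 fr) (st : setting K Kf Kg fr Om psi f g u).
Hypothesis (K1 : 1 <= K) (Kf0 : 0 <= Kf) (Kg0 : 0 <= Kg) (b00 : 0 <= b0).
Implicit Types (z v w x : 'rV[R]_m).

Let Om_open : open Om := st_open st.
Let psi2 : Cclass 2 Om psi := Cclass_le (isT : (2 <= 4)%N) (psi_class st).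

(** Qualitative only: [L] depends on [u]. It makes later choices of radii and levels possible and
    enters no final constant. *)
Lemma hess_bounded : exists2 L : R, 0 <= L & forall z k l, Om z -> `|hess u z k l| <= L.
Proof.
(* Bounds are encoded as d^-1, so that lemmas producing small radii also produce large bounds. *)
have loc (s : seq 'I_m) : (size s <= 2)%N -> exists2 d : R, 0 < d & forall z, closure Om z ->
    Om z -> `|partial s u z| <= d^-1.
  move=> sz; have [d d0 Hd] := u_uniform_continuity st sz ltr01.
  apply: (compact_uniform (compact_closure st)) => [z a a' H a0 aa Oz|z cz].
    by apply: le_trans (H Oz) _; rewrite lef_pV2 // posrE // (lt_le_trans a0).
  have d20 : 0 < d / 2 by rewrite divr_gt0.
  have [w0 Ow0 wz] := (closureE Om z).1 cz _ d20.
  pose L := `|partial s u w0| + 1; have L0 : 0 < L by rewrite /L ltr_wpDl.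
  exists (Num.min (d / 2) L^-1) => [|w]; first by rewrite lt_min d20 invr_gt0.
  rewrite lt_min => /andP[wd _] Ow.
  have near_w : `|w - w0| < d.
    rewrite -(subrK z w) -addrA; apply: le_lt_trans (ler_normD _ _) _.
    by rewrite (distrC z); lra.
  have H := Hd w w0 Ow Ow0 near_w.
  apply: (@le_trans _ _ L).
    rewrite -(subrK (partial s u w0) (partial s u w)) /L addrC.
    by apply: le_trans (ler_normD _ _) _; rewrite lerD2l.
  rewrite -[leLHS]invrK lef_pV2 ?posrE ?lt_min ?d20 ?invr_gt0 //.
  by rewrite ge_min lexx orbT.
have [d d0 Hd] : exists2 d : R, 0 < d & forall kl : 'I_m * 'I_m, forall z, closure Om z ->
    Om z -> `|partial [:: kl.2; kl.1] u z| <= d^-1.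
  apply: finite_eps => [k a a' H a0 aa z cz Oz|k]; last exact: loc.
  by apply: le_trans (H z cz Oz) _; rewrite lef_pV2 // posrE // (lt_le_trans a0).
exists d^-1; first by rewrite invr_ge0 ltW.
by move=> z k l Oz; rewrite hess_entry; apply: (Hd (k, l)) => //; exact: Om_closure.
Qed.

(** The first summand is the second difference of g, the second the barriers at z + v, z - v and z
    with psi(z) = (2 K2 + 1) |v|^2, and 1 pays for the oscillation of D^2 u. *)
Definition Ctan : R := 2 * m%:R * Kg + Kb m Kf Kg b0 * (4 * (2 * K2 m K + 1) + 2 * K2 m K) + 1.

Lemma Ctan_ge0 : 0 <= Ctan.
Proof.
have := K2_ge0 m K1; have := Kb_gt0 m Kf0 Kg0 b00 => k0 k1.
apply: addr_ge0 => //; apply: addr_ge0; first by rewrite !mulr_ge0.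
by apply: mulr_ge0; [exact: ltW|lra].
Qed.

(** A tangential step v with |v|^2 comparable to psi(z) keeps z + v and z - v in [Om] with psi of
    order |v|^2 there. The barriers then bound the second difference of u by that of g plus a
    multiple of |v|^2, and near the boundary such v are so short that D^2 u is almost constant along
    the step. *)
Let tangent_second : exists2 lam : R, 0 < lam & forall z y, Om z -> psi z < lam ->
  dot (grad psi z) y = 0 -> dot (y *m hess u z) y <= Ctan * dot y y.
Proof.
have K20 := K2_ge0 m K1; have kb0 := Kb_gt0 m Kf0 Kg0 b00.
pose e : R := (m%:R ^+ 2 + 1)^-1.
have m31 : 0 < m%:R ^+ 2 + 1 :> R by rewrite ltr_wpDl ?exprn_ge0.
have e0 : 0 < e by rewrite invr_gt0.
have [d d0 Hd] : exists2 d : R, 0 < d & forall kl : 'I_m * 'I_m, forall z w, Om z -> Om w ->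
    `|z - w| < d -> `|partial [:: kl.2; kl.1] u z - partial [:: kl.2; kl.1] u w| <= e.
  apply: finite_eps => [k a a' H a0 aa z w Oz Ow zw|k].
    by apply: H => //; apply: lt_le_trans aa.
  exact: (u_uniform_continuity st (s := [:: k.2; k.1]) isT e0).
have D0 : 0 < 2 * K2 m K + 1 by lra.
exists (d ^+ 2) => [|z y Oz zd Ny]; first by rewrite exprn_gt0.
have [->|y0] := eqVneq y 0; first by rewrite mul0mx !dotE mulr0.
have yy : 0 < dot y y by rewrite lt0r dot_ge0 andbT; apply: contra_neq y0; exact: dot_eq0.
have pz := psi_gt0 st Oz.
(* Solves (2 K2 + 1) |t y|^2 = psi(z). *)
pose t := Num.sqrt (psi z / ((2 * K2 m K + 1) * dot y y)).
have tt : t ^+ 2 * dot y y * (2 * K2 m K + 1) = psi z.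
  rewrite sqr_sqrtr; last by rewrite divr_ge0 ?(ltW pz) // mulr_ge0 ?dot_ge0 // ltW.
  by rewrite -mulrA [dot y y * _]mulrC divfK // mulf_neq0 ?gt_eqF.
have t0 : 0 < t by rewrite sqrtr_gt0 divr_gt0 // mulr_gt0.
pose v := t *: y; have Nv : dot (grad psi z) v = 0 by rewrite dotZr Ny mulr0.
have vv : dot v v = t ^+ 2 * dot y y by rewrite /v !dotE; ring.
have vv0 : 0 < dot v v by rewrite vv mulr_gt0 // exprn_gt0.
have nv : `|v| ^+ 2 <= dot v v := sqr_norm_le_dot v.
have vvp : dot v v * (2 * K2 m K + 1) = psi z by rewrite vv.
have K2v : K2 m K * `|v| ^+ 2 <= K2 m K * dot v v by rewrite ler_wpM2l.
have K2vv : 0 <= K2 m K * dot v v by rewrite mulr_ge0 // ltW.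
have small : 0 + K2 m K * `|v| ^+ 2 < psi z by lra.
have sgp : segment_in Om z v by apply: (segment_in_Om st K1 Oz (lexx 0) _ small); rewrite Nv oppr0.
have sgm : segment_in Om z (- v).
  by apply: (segment_in_Om st K1 Oz (lexx 0)); rewrite ?dotNr ?Nv ?oppr0 ?normrN.
have seg2 (r : R) : -1 <= r <= 1 -> Om (z + r *: v).
  move=> /andP[r1 r2]; have [r0|r0] := leP 0 r; first by apply: sgp; rewrite r0.
  by rewrite -[r]opprK scaleNr -scalerN; apply: sgm; apply/andP; split; lra.
have vd : `|v| < d.
  rewrite -(ltr_pXn2r (isT : (0 < 2)%N)) ?nnegrE ?(ltW d0) //.
  by apply: le_lt_trans zd; lra.
have near_hess (r : R) : -1 <= r <= 1 ->
    dot (v *m hess u z) v - dot v v <= dot (v *m hess u (z + r *: v)) v.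
  move=> r1; have Or := seg2 r r1.
  have H k l : `|(hess u z - hess u (z + r *: v)) k l| <= e.
    rewrite mxE [X in _ + X]mxE !hess_entry; apply: (Hd (k, l)) => //.
    rewrite opprD addNKr normrN normrZ; apply: le_lt_trans vd.
    by rewrite ler_piMl // ler_norml.
  have := bil_le v v H (ltW e0); rewrite mulmxBr dotDl dotNl ler_norml => /andP[_].
  suff le : m%:R ^+ 2 * e * `|v| * `|v| <= dot v v by lra.
  apply: le_trans nv; rewrite -mulrA -expr2 ler_piMl ?exprn_ge0 //.
  by rewrite ler_pdivrMr // mul1r lerDl.
have C1 := second_difference_ge Om_open (st_u st) seg2 near_hess.
have i1 : 0 <= (1 : R) <= 1 by rewrite ler01 lexx.
have Op : Om (z + v) by have := sgp 1 i1; rewrite scale1r.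
have Om' : Om (z - v) by have := sgm 1 i1; rewrite scale1r.
have A1 := u_le_g frP st Kf0 Kg0 b00 Op; have A2 := u_le_g frP st Kf0 Kg0 b00 Om'.
have A3 := g_le_u frP st Kf0 Kg0 b00 Oz.
have := second_difference_lip st (st_g st) (st_g_lip st) Kg0 sgp sgm.
rewrite ler_norml => /andP[_ A4].
have C2 := tangential_arith A1 A2 A3 A4 C1.
have := psi_Taylor st sgp; have := psi_Taylor st sgm.
rewrite dotNr Nv oppr0 !subr0 !ler_norml normrN => /andP[_ P1] /andP[_ P2].
have P3 : Kb m Kf Kg b0 * (psi (z + v) + psi (z - v) + 2 * psi z) <=
    Kb m Kf Kg b0 * ((4 * (2 * K2 m K + 1) + 2 * K2 m K) * dot v v).
  by rewrite ler_wpM2l ?(ltW kb0) //; lra.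
have P4 : 2 * m%:R * Kg * `|v| ^+ 2 <= 2 * m%:R * Kg * dot v v by rewrite ler_wpM2l // !mulr_ge0.
have P5 : dot (v *m hess u z) v <= Ctan * dot v v.
  rewrite (_ : Ctan * dot v v = 2 * m%:R * Kg * dot v v + Kb m Kf Kg b0 *
    ((4 * (2 * K2 m K + 1) + 2 * K2 m K) * dot v v) + dot v v); last by rewrite /Ctan; ring.
  rewrite -lerBlDr; apply: le_trans C2 _; exact: lerD P4 P3.
move: P5; rewrite vv /v -scalemxAl !dotE [leRHS]mulrCA mulrA -expr2.
by rewrite ler_pM2l // exprn_gt0.
Qed.

(** Split x into its tangential part and a multiple of grad psi; Young's inequality moves the mixed
    term to the square of the normal part. [Cu] depends on [u], harmlessly: the test function
    contains p^2 / y(psi), whose coefficient is unbounded as psi tends to 0. *)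
Lemma tangential : exists Cu lam, [/\ 0 <= Cu, 0 < lam & forall z x, Om z -> psi z < lam ->
  dot (x *m hess u z) x <= (Ctan + 1) * dot x x + Cu * dot (grad psi z) x ^+ 2].
Proof.
have [L L0 HL] := hess_bounded; have [lam lam0 Hlam] := tangent_second.
have K0 : 0 < K := lt_le_trans ltr01 K1.
pose B : R := m%:R ^+ 2 * L * K.
have m2L : 0 <= m%:R ^+ 2 * L by rewrite mulr_ge0 ?exprn_ge0.
have B0 : 0 <= B by rewrite mulr_ge0 // ltW.
exists (16 * (B ^+ 2 + B * K)), (Num.min lam (lam1 m K)); split.
- by rewrite mulr_ge0 // addr_ge0 ?exprn_ge0 // mulr_ge0 // ltW.
- by rewrite lt_min lam0 lam1_gt0.
move=> z x Oz; rewrite lt_min => /andP[zl /(grad_psi_ge frP st K1 Oz)].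
set N := grad psi z => NN.
have NN0 : 0 < dot N N by apply: lt_le_trans NN.
set p := dot N x.
have [a aN] : exists a, a * dot N N = p by exists (p / dot N N); rewrite divfK // gt_eqF.
have [y xE] : exists y, x = y + a *: N by exists (x - a *: N); rewrite subrK.
have Ny : dot N y = 0 by have := aN; rewrite /p xE !dotE; lra.
have yy : dot y y <= dot x x.
  have : dot x x = dot y y + a ^+ 2 * dot N N.
    by rewrite xE !dotE (dotC y N) Ny; ring.
  have : 0 <= a ^+ 2 * dot N N by rewrite mulr_ge0 ?sqr_ge0 // ltW.
  by lra.
have a2 : a ^+ 2 <= 16 * p ^+ 2.
  have : a ^+ 2 * 16^-1 <= a ^+ 2 * (dot N N) ^+ 2.
    rewrite ler_wpM2l ?sqr_ge0 // (_ : 16^-1 = 4^-1 ^+ 2); last by rewrite expr2 -invfM; congr _^-1; ring.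
    by rewrite ler_pXn2r ?nnegrE ?(ltW NN0).
  by rewrite -[X in _ <= X -> _]exprMn aN; lra.
have Nn : `|N| <= K by exact: grad_psi_norm st K1 z Oz.
have Hx : dot (x *m hess u z) x = dot (y *m hess u z) y + 2 * a * dot (y *m hess u z) N
    + a ^+ 2 * dot (N *m hess u z) N.
  by rewrite xE mulmxDl -scalemxAl !dotE (bil_sym N y Om_open Oz (st_u st)); ring.
have H1 := Hlam z y Oz zl Ny.
have := bil_le y N (fun k l => HL z k l Oz) L0; have := bil_le N N (fun k l => HL z k l Oz) L0.
have yN : m%:R ^+ 2 * L * `|y| * `|N| <= B * `|y|.
  by rewrite mulrAC ler_wpM2r // ler_wpM2l.
have NN2 : m%:R ^+ 2 * L * `|N| * `|N| <= B * K.
  by rewrite ler_pM // ?mulr_ge0 // ler_wpM2l.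
move=> /le_trans/(_ NN2); rewrite ler_norml => /andP[_ H2].
move=> /le_trans/(_ yN); rewrite ler_norml => H3.
have H4 : a ^+ 2 * dot (N *m hess u z) N <= 16 * p ^+ 2 * (B * K).
  apply: le_trans (_ : a ^+ 2 * (B * K) <= _); first by rewrite ler_wpM2l ?sqr_ge0.
  by rewrite ler_wpM2r // mulr_ge0 // ltW.
have H5 : 2 * a * dot (y *m hess u z) N <= `|y| ^+ 2 + a ^+ 2 * B ^+ 2.
  case/andP: H3 => H3 H3'.
  have : 0 <= (`|a| * B - `|y|) ^+ 2 by rewrite sqr_ge0.
  have : a * dot (y *m hess u z) N <= `|a| * (B * `|y|).
    by apply: le_trans (ler_norm _) _; rewrite normrM ler_wpM2l // ler_norml H3.
  rewrite sqrrB exprMn real_normK ?num_real //; move: (dot _ N) (`|a|) => D A.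
  by lra.
have H6 : a ^+ 2 * B ^+ 2 <= 16 * p ^+ 2 * B ^+ 2 by rewrite ler_wpM2r ?sqr_ge0.
have H7 := sqr_norm_le_dot y.
have H8 : Ctan * dot y y <= Ctan * dot x x by rewrite ler_wpM2l // Ctan_ge0.
rewrite Hx; move: H1 H4 H5 H8; clear -H6 H7 yy.
move: (dot (y *m _) y) (2 * a * dot _ N) (a ^+ 2 * dot _ N) (Ctan * dot y y) => D1 D2 D3 D4.
rewrite [(Ctan + 1) * _]mulrDl; move: (Ctan * _) => D5; lra.
Qed.

End SecondDerivatives.

(** * Transport by similarities *)

Section Motion.
Variables (R : realType) (m : nat).
Implicit Types (x z v w : 'rV[R]_m) (P J : 'M[R]_m).

(* A one-parameter family of similarities whose velocity is the affine field
   [xi0 + r x + x P]. *)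
Lemma affine_motion P J (r : R) : P^T = - P -> P *m J = J *m P ->
  exists O : R -> 'M[R]_m, [/\ forall h, O h *m (O h)^T = 1%:M,
    forall h, O h *m J = J *m O h &
    exists2 C : R, 0 <= C & forall (h : R) xi0 x, `|h| <= 1 ->
      `|h *: xi0 + (x *m ((1 + h * r) *: O h) - x) - h *: (xi0 + (r *: x + x *m P))|
         <= C * h ^+ 2 * `|x|
      /\ `|(h *: xi0 + (x *m ((1 + h * r) *: O h) - x))
           + ((- h) *: xi0 + (x *m ((1 + (- h) * r) *: O (- h)) - x))
           - h ^+ 2 *: (x *m P *m P + (2 * r) *: (x *m P))| <= C * `|h| ^+ 3 * `|x|].
Proof.
move=> PT PJ; have [rot [rot1 rot2 [C0 C00 HO]]] := Cayley_curve PT PJ.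
exists rot; split => //.
pose a : R := m%:R * `|P|; have a0 : 0 <= a by rewrite mulr_ge0.
have n1 x : `|x *m P| <= a * `|x| by exact: norm_mulmx_le.
have n2 x : `|x *m P *m P| <= a * (a * `|x|).
  by apply: le_trans (norm_mulmx_le _ _) _; rewrite ler_wpM2l.
have rr : 0 <= `|r| by exact: normr_ge0.
exists (a * a + `|r| * a + `|r| * (a * a) + 2 * (1 + `|r|) * C0).
  by rewrite !addr_ge0 ?mulr_ge0 // addr_ge0.
move=> h xi0 x h1.
have h0 : 0 <= `|h| := normr_ge0 h.
have h2E : h ^+ 2 = `|h| ^+ 2 by rewrite real_normK // num_real.
have h32 : `|h| ^+ 3 <= `|h| ^+ 2 by rewrite exprS ler_piMl ?exprn_ge0.
have hr (k : R) : `|k| = `|h| -> `|1 + k * r| <= 1 + `|r|.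
  move=> kh; apply: le_trans (ler_normD _ _) _.
  by rewrite normr1 lerD2l normrM kh ler_piMl.
have HE (k : R) : `|k| = `|h| -> exists2 e, `|e| <= (1 + `|r|) * (C0 * `|h| ^+ 3 * `|x|) &
    x *m ((1 + k * r) *: rot k) = (1 + k * r) *: (x + k *: (x *m P) + (k ^+ 2 / 2) *: (x *m P *m P)) + e.
  move=> kh; pose E := x *m rot k - x - k *: (x *m P) - (k ^+ 2 / 2) *: (x *m P *m P).
  exists ((1 + k * r) *: E).
    rewrite normrZ; apply: ler_pM; rewrite ?normr_ge0 ?hr //.
    by have := HO k x; rewrite kh.
  rewrite -scalerDr -scalemxAr /E; congr (_ *: _).
  by apply/rowP => j; rewrite !mxE; move: (\sum__ _) (\sum__ _) (\sum__ _) => *; ring.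
have [e He ->] := HE h erefl; have [e' He' ->] := HE (- h) (normrN h).
move: (n1 x) (n2 x); move: (x *m P *m P) => xPP; move: (x *m P) => xP N1 N2.
have X0 : 0 <= `|x| := normr_ge0 x.
split.
  rewrite (_ : _ - _ = h ^+ 2 *: (2^-1 *: xPP + r *: xP) + (h ^+ 3 * r / 2) *: xPP + e); last first.
    by apply/rowP => j; rewrite !mxE; field.
  have B1 : `|h ^+ 2 *: (2^-1 *: xPP + r *: xP)| <= h ^+ 2 * (a * a + `|r| * a) * `|x|.
    rewrite normrZ ger0_norm ?sqr_ge0 // -mulrA ler_wpM2l ?sqr_ge0 //.
    apply: le_trans (ler_normD _ _) _; rewrite !normrZ gtr0_norm ?invr_gt0 //.
    have : `|r| * `|xP| <= `|r| * (a * `|x|) by rewrite ler_wpM2l.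
    have : 0 <= a * (a * `|x|) by rewrite !mulr_ge0.
    lra.
  have B2 : `|(h ^+ 3 * r / 2) *: xPP| <= h ^+ 2 * (`|r| * (a * a)) * `|x|.
    rewrite normrZ normrM [`|h ^+ 3 * r|]normrM normrX.
    have -> : h ^+ 2 * (`|r| * (a * a)) * `|x| = h ^+ 2 * `|r| * 1 * (a * (a * `|x|)) by ring.
    apply: ler_pM => //; rewrite ?mulr_ge0 ?exprn_ge0 //; apply: ler_pM; rewrite ?mulr_ge0 ?exprn_ge0 //.
      by rewrite h2E; exact: ler_wpM2r.
    by rewrite gtr0_norm ?invr_gt0 // invf_le1 // ler1n.
  have B3 : `|e| <= h ^+ 2 * ((1 + `|r|) * C0) * `|x|.
    apply: le_trans He _.
    have -> : h ^+ 2 * ((1 + `|r|) * C0) * `|x| = (1 + `|r|) * (C0 * h ^+ 2 * `|x|) by ring.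
    rewrite ler_wpM2l ?addr_ge0 // ler_wpM2r // ler_wpM2l // h2E //.
  apply: le_trans (ler_normD _ _) _.
  apply: le_trans (lerD (ler_normD _ _) B3) _.
  apply: le_trans (lerD (lerD B1 B2) (lexx _)) _.
  have : 0 <= h ^+ 2 * ((1 + `|r|) * C0) * `|x| by rewrite mulr_ge0 // mulr_ge0 ?sqr_ge0 // mulr_ge0 // addr_ge0.
  lra.
rewrite (_ : _ - _ = e + e'); last by apply/rowP => j; rewrite !mxE; field.
apply: le_trans (ler_normD _ _) _; apply: le_trans (lerD He He') _.
have : 0 <= (a * a + `|r| * a + `|r| * (a * a)) * (`|h| ^+ 3 * `|x|).
  by rewrite mulr_ge0 ?addr_ge0 ?mulr_ge0 ?exprn_ge0.
lra.
Qed.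

(** A displacement, not a position: [x] is the offset from the centre of the similarity. *)
Definition motion (xi0 : 'rV[R]_m) (M : R -> 'M[R]_m) (h : R) x : 'rV[R]_m :=
  h *: xi0 + (x *m M h - x).

Lemma small_motion P J (r : R) xi0 : P^T = - P -> P *m J = J *m P -> dot xi0 xi0 = 1 ->
  exists rot C rho, [/\ forall h, rot h *m (rot h)^T = 1%:M, forall h, rot h *m J = J *m rot h,
    0 <= C, 0 < rho <= 1 & forall h x, `|h| <= rho -> `|x| <= rho ->
    let xi := xi0 + (r *: x + x *m P) in
    let mv := motion xi0 (fun h => (1 + h * r) *: rot h) in
    [/\ `|mv h x| <= 2 * `|h| /\ `|mv h x - h *: xi| <= C * h ^+ 2,
        `|mv h x + mv (- h) x - h ^+ 2 *: (x *m P *m P + (2 * r) *: (x *m P))| <= C * `|h| ^+ 3,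
        `|mv h x + mv (- h) x| <= h ^+ 2, `|xi| <= 2 & 2^-1 <= dot xi xi <= 2]].
Proof.
move=> PT PJ unit_xi0; have [rot [rot1 rot2 [C C0 HC]]] := affine_motion r PT PJ.
pose a : R := m%:R * `|P|; have a0 : 0 <= a by rewrite mulr_ge0.
(* B dominates every coefficient of |x| or |h| below, and rho B <= 1/2. The factor 6 m keeps |xi|^2
   between 1/2 and 2. *)
pose B : R := (6 * m%:R + 1) * (`|r| + a) + (a * a + 2 * `|r| * a) + C.
have r0 : 0 <= `|r| := normr_ge0 r.
have m60 : 0 <= 6 * m%:R + 1 :> R by rewrite addr_ge0 // mulr_ge0.
have B1 : 0 <= (6 * m%:R + 1) * (`|r| + a) by rewrite mulr_ge0 ?addr_ge0.
have B2 : 0 <= a * a + 2 * `|r| * a by rewrite addr_ge0 ?mulr_ge0.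
have B0 : 0 <= B by apply: addr_ge0 => //; exact: addr_ge0.
exists rot, C, (2 * (B + 1))^-1; have rho0 : 0 < (2 * (B + 1))^-1 by rewrite invr_gt0; lra.
have rhoB : (2 * (B + 1))^-1 * (B + 1) = 2^-1 by field; rewrite gt_eqF // ltr_wpDl.
set rho := (2 * (B + 1))^-1 in rhoB rho0 *.
have rhoB0 : 0 <= rho * B by rewrite mulr_ge0 // ltW.
have rho1 : rho <= 1 by lra.
split => //; first by rewrite rho0.
move=> h x hr xr xi mv.
have h1 : `|h| <= 1 by exact: le_trans rho1.
have x1 : `|x| <= 1 by exact: le_trans rho1.
have h0 : 0 <= `|h| := normr_ge0 h; have x0 : 0 <= `|x| := normr_ge0 x.
have [D1 D2] := HC h xi0 x h1.
have h2E : h ^+ 2 = `|h| * `|h| by rewrite -expr2 real_normK // num_real.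
have h3E : `|h| ^+ 3 = `|h| * h ^+ 2 by rewrite h2E; ring.
have hh0 : 0 <= `|h| * `|h| by rewrite mulr_ge0.
have scale (k b : R) : 0 <= k -> k <= B -> b <= k * `|x| -> b <= 2^-1.
  move=> k0 kB /le_trans; apply; apply: (@le_trans _ _ (B * rho)).
    exact: ler_pM.
  by rewrite mulrC; lra.
pose y := r *: x + x *m P.
have ny : `|y| <= (`|r| + a) * `|x|.
  apply: le_trans (ler_normD _ _) _; rewrite mulrDl normrZ lerD2l; exact: norm_mulmx_le.
have y0 : 0 <= `|y| := normr_ge0 y.
have my : (6 * m%:R + 1) * `|y| <= 2^-1.
  apply: (scale _ _ B1); first by rewrite /B; lra.
  by rewrite -mulrA ler_wpM2l.
have my0 : 0 <= m%:R * `|y| by rewrite mulr_ge0.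
have n0 : `|xi0| <= 1.
  rewrite -[leRHS]sqrtr1 -unit_xi0 -[leLHS]ger0_norm // -sqrtr_sqr ler_sqrt ?dot_ge0 //.
  exact: sqr_norm_le_dot.
have nxi : `|xi| <= 3 / 2 by apply: le_trans (ler_normD _ _) _; move: ny; rewrite -/y; lra.
have Cx : C * `|x| <= 2^-1 by apply: (scale _ _ C0) => //; rewrite /B; lra.
have Ch : C * `|h| <= 2^-1.
  apply: (@le_trans _ _ (B * rho)); last by rewrite mulrC; lra.
  apply: ler_pM => //; rewrite /B; lra.
have S2 : C * h ^+ 2 * `|x| <= C * h ^+ 2 by rewrite ler_piMr // mulr_ge0 // sqr_ge0.
have S3 : C * `|h| ^+ 3 * `|x| <= C * `|h| ^+ 3 by rewrite ler_piMr // mulr_ge0 // exprn_ge0.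
have E2 : C * h ^+ 2 <= 2^-1 * `|h| by rewrite h2E mulrA ler_wpM2r.
have E3 : C * `|h| ^+ 3 * `|x| <= 2^-1 * h ^+ 2.
  have : C * `|x| * (`|h| * h ^+ 2) <= 2^-1 * (1 * h ^+ 2).
    have q0 : 0 <= h ^+ 2 := sqr_ge0 h.
    apply: ler_pM => //; [exact: mulr_ge0|exact: mulr_ge0|exact: ler_wpM2r].
  by rewrite h3E; lra.
split; rewrite ?unit_xi0.
- split; last exact: le_trans D1 S2.
  rewrite -(subrK (h *: xi) (mv h x)); apply: le_trans (ler_normD _ _) _.
  have : `|h *: xi| <= `|h| * (3 / 2) by rewrite normrZ ler_wpM2l.
  by have := le_trans D1 S2; rewrite -/xi -/(mv h x); lra.
- exact: le_trans D2 S3.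
- rewrite -(subrK (h ^+ 2 *: (x *m P *m P + (2 * r) *: (x *m P))) (mv h x + _)).
  apply: le_trans (ler_normD _ _) _.
  suff : `|h ^+ 2 *: (x *m P *m P + (2 * r) *: (x *m P))| <= h ^+ 2 * 2^-1.
    by have := le_trans D2 E3; rewrite -/(mv h x) -/(mv (- h) x); lra.
  rewrite normrZ ger0_norm ?sqr_ge0 // ler_wpM2l ?sqr_ge0 //.
  apply: (scale _ _ B2); first by rewrite /B; lra.
  apply: le_trans (ler_normD _ _) _.
  have n1 : `|x *m P| <= a * `|x| by exact: norm_mulmx_le.
  have n2 : `|x *m P *m P| <= a * (a * `|x|).
    by apply: le_trans (norm_mulmx_le _ _) _; rewrite ler_wpM2l.
  have : `|(2 * r) *: (x *m P)| <= 2 * `|r| * (a * `|x|).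
    by rewrite normrZ normrM ger0_norm // ler_wpM2l // mulr_ge0.
  lra.
- lra.
have dotxi (v : 'rV[R]_m) : dot (xi0 + v) (xi0 + v) = 1 + (2 * dot xi0 v + dot v v).
  by rewrite dotDl !dotDr unit_xi0 (dotC v); ring.
rewrite (dotxi y : dot xi xi = _).
have := dot_ge0 y; have := dot_le_sqr_norm y; have := dot_le_norm xi0 y.
have : m%:R * `|xi0| * `|y| <= m%:R * `|y| by rewrite ler_wpM2r // ler_piMr.
move=> /[swap] /le_trans/[apply]; rewrite ler_norml => /andP[Z1 Z2] Z3 Z4.
have Z5 : m%:R * `|y| ^+ 2 <= m%:R * `|y|.
  by rewrite expr2 mulrA ler_piMr //; lra.
apply/andP; split; lra.
Qed.

End Motion.

(* [h^-2] times the left-hand sides below are the f-terms produced by a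
   similarity of ratio [1 + h r]. *)
Lemma transport_arith (R : realType) (b b0 L h r f0 fp fm : R) : 0 <= b <= b0 -> 0 <= L -> 0 < h ->
  0 <= fp -> 0 <= fm ->
  fp + fm - 2 * f0 >= - (9 * L * h ^+ 2) -> `|fp - fm| <= 4 * L * h ->
  - ((b0 * (9 * L)) * (1 + `|r|) + 1) * h ^+ 2 <=
    2^-1 * ((1 + h * r) ^+ 2 * (b * fp)) + 2^-1 * ((1 - h * r) ^+ 2 * (b * fm))
    - (b * f0 + h ^+ 2).
Proof.
move=> /andP[b_0 bb] L0 h0 fp0 fm0 A B.
have q0 : 0 <= h ^+ 2 := sqr_ge0 h.
have B1 : - (4 * L * (h ^+ 2 * `|r|)) <= h * r * (fp - fm).
  have : `|h * r * (fp - fm)| <= h * `|r| * (4 * L * h).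
    by rewrite !normrM gtr0_norm // ler_wpM2l // mulr_ge0 // ltW.
  rewrite ler_norml => /andP[+ _]; lra.
have B2 : 0 <= (h * r) ^+ 2 * (fp + fm) by rewrite mulr_ge0 ?sqr_ge0 // addr_ge0.
have B3 : b * (- (9 * L * h ^+ 2) * 2^-1 - 4 * L * (h ^+ 2 * `|r|)) <=
    b * (2^-1 * (fp + fm - 2 * f0) + h * r * (fp - fm) + 2^-1 * ((h * r) ^+ 2 * (fp + fm))).
  by rewrite ler_wpM2l //; lra.
have B4 : b * (9 * L * h ^+ 2 * 2^-1 + 4 * L * (h ^+ 2 * `|r|)) <=
   b0 * (9 * L * h ^+ 2 * (1 + `|r|)).
  have p1 : 0 <= L * h ^+ 2 by exact: mulr_ge0.
  have p2 : 0 <= L * h ^+ 2 * `|r| by exact: mulr_ge0.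
  apply: ler_pM => //; lra.
lra.
Qed.

(** * Transport of the equation *)

Section Transport.
Variables (R : realType) (m : nat) (J : 'M[R]_m) (I : finType).
Variables (K Kf Kg b0 : R) (fr : (I -> 'rV[R]_m) -> R -> Prop).
Variables (Om : set 'rV[R]_m) (psi f g u : 'rV[R]_m -> R).
Hypothesis (frP : frames J b0 fr) (st : setting K Kf Kg fr Om psi f g u).
Hypothesis (K1 : 1 <= K) (Kf0 : 0 <= Kf) (Kg0 : 0 <= Kg) (b00 : 0 <= b0).
Implicit Types (z v w x : 'rV[R]_m).

Let Om_open : open Om := st_open st.
Let u1 : Cclass 1 Om u := Cclass_le (isT : (1 <= 2)%N) (st_u st).
Let Cg := Cgrad m K Kf Kg b0.

(** The steps v and w are opposite only up to h^2. In 9 = 4 + 4 + 1, two Taylor remainders with |v|,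
    |w| <= 2 h are joined by grad f applied to v + w. *)
Let f_second z v w (h : R) : segment_in Om z v -> segment_in Om z w -> 0 < h ->
  `|v| <= 2 * h -> `|w| <= 2 * h -> `|v + w| <= h ^+ 2 ->
  f (z + v) + f (z + w) - 2 * f z >= - (9 * (m%:R * Kf) * h ^+ 2) /\
  `|f (z + v) - f (z + w)| <= 4 * (m%:R * Kf) * h.
Proof.
move=> sv sw h0 vh wh vwh.
have i0 : 0 <= (0 : R) <= 1 by rewrite lexx ler01.
have Oz : Om z by have := sv 0 i0; rewrite scale0r addr0.
have mK : 0 <= m%:R * Kf by rewrite mulr_ge0.
have T x : segment_in Om z x -> `|x| <= 2 * h ->
    `|f (z + x) - f z - dot (grad f z) x| <= 4 * (m%:R * Kf) * h ^+ 2.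
  move=> sx xh; apply: (@le_trans _ _ (m%:R * Kf * `|x| ^+ 2)).
    apply: (gradient_Lipschitz_Taylor Om_open (st_f st) sx) => k t t01.
    apply: le_trans (st_f_lip st k (sx t t01) Oz) _.
    by rewrite addrAC subrr add0r ler_wpM2l // scale_norm_le.
  have : `|x| ^+ 2 <= (2 * h) ^+ 2 by rewrite lerXn2r // nnegrE // mulr_ge0 // ltW.
  by rewrite exprMn => /(ler_wpM2l mK); lra.
split.
  have := T v sv vh; have := T w sw wh; rewrite !ler_norml => /andP[A _] /andP[B _].
  have : `|dot (grad f z) (v + w)| <= m%:R * Kf * h ^+ 2.
    apply: le_trans (dot_le_norm _ _) _; apply: ler_pM => //.
    rewrite ler_wpM2l //; apply: norm_rV_le => // k; rewrite mxE.
    exact: (st_f_le st (s := [:: k])).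
  rewrite dotDr ler_norml => /andP[C _].
  by move: A B C; move: (dot _ v) (dot _ w) (f (z + v)) (f (z + w)) (f z) (m%:R * Kf) => *; lra.
have D x : segment_in Om z x -> `|x| <= 2 * h -> `|f (z + x) - f z| <= 2 * (m%:R * Kf) * h.
  move=> sx xh; apply: le_trans (difference_le st (st_f st) (st_f_le st) Kf0 sx) _.
  by have := ler_wpM2l mK xh; lra.
have := D v sv vh; have := D w sw wh; rewrite !ler_norml => /andP[A1 A2] /andP[B1 B2].
move: A1 A2 B1 B2; move: (f (z + v)) (f (z + w)) (f z) (m%:R * Kf) => *; lra.
Qed.

(** A frame nearly optimal at [z] remains a frame, with the same [b], after rotation by [rp] or
    [rm], so it supports the equation at both displaced points. The difference with the near
    equality at [z] leaves only second differences of (1 + h r)^2 b f. *)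
Lemma transport_trace s b z v w (rp rm Mp Mm : 'M[R]_m) (h r : R) : fr s b ->
  rp *m rp^T = 1%:M -> rp *m J = J *m rp -> rm *m rm^T = 1%:M -> rm *m J = J *m rm ->
  0 < h -> segment_in Om z v -> segment_in Om z w ->
  `|v| <= 2 * h -> `|w| <= 2 * h -> `|v + w| <= h ^+ 2 ->
  trace_op s u z <= b * f z + h ^+ 2 ->
  Mp = (1 + h * r) *: rp -> Mm = (1 - h * r) *: rm ->
  - (b0 * (9 * (m%:R * Kf)) * (1 + `|r|) + 1) <=
  \sum_i h ^- 2 * (2^-1 * dot (s i *m Mp *m hess u (z + v)) (s i *m Mp)
    + (2^-1 * dot (s i *m Mm *m hess u (z + w)) (s i *m Mm)
    + - 2 * (2^-1 * dot (s i *m hess u z) (s i)))).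
Proof.
move=> sb rp1 rp2 rm1 rm2 h0 sv sw vh wh vwh tr -> ->.
have [fs fd] := f_second sv sw h0 vh wh vwh.
have i1 : 0 <= (1 : R) <= 1 by rewrite lexx ler01.
have Ov : Om (z + v) by have := sv 1 i1; rewrite scale1r.
have Ow : Om (z + w) by have := sw 1 i1; rewrite scale1r.
have mK : 0 <= m%:R * Kf by rewrite mulr_ge0.
have key := transport_arith r (fr_b frP sb) mK h0 (st_f0 st Ov) (st_f0 st Ow) fs fd.
have T1 := st_sub st (fr_rot frP rp1 rp2 sb) Ov.
have T2 := st_sub st (fr_rot frP rm1 rm2 sb) Ow.
have E (rt : 'M[R]_m) (k : R) y : \sum_i 2^-1 * dot (s i *m (k *: rt) *m hess u y) (s i *m (k *: rt))
    = 2^-1 * (k ^+ 2 * trace_op (fun i => s i *m rt) u y).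
  rewrite /trace_op !mulr_sumr; apply: eq_bigr => i _.
  by rewrite -!scalemxAr -!scalemxAl !dotE; ring.
rewrite -mulr_sumr !big_split /= E E -!mulr_sumr -/(trace_op s u z).
rewrite ler_pdivlMl ?exprn_gt0 // mulrC.
have C1 : (1 + h * r) ^+ 2 * (b * f (z + v)) <= (1 + h * r) ^+ 2 * trace_op (fun i => s i *m rp) u (z + v).
  by rewrite ler_wpM2l ?sqr_ge0.
have C2 : (1 - h * r) ^+ 2 * (b * f (z + w)) <= (1 - h * r) ^+ 2 * trace_op (fun i => s i *m rm) u (z + w).
  by rewrite ler_wpM2l ?sqr_ge0.
apply: le_trans key _.
move: tr C1 C2; move: (_ ^+ 2 * trace_op _ _ _) (_ ^+ 2 * trace_op _ _ _) (trace_op _ _ _) => *; lra.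
Qed.

End Transport.

Lemma sum_cst_ord (R : nzRingType) (m : nat) (a : R) : \sum_(j < m) a = m%:R * a.
Proof. by rewrite sumr_const card_ord mulr_natl. Qed.

(* The gradient terms [l j] produced by differentiating a sum of squares
   absorb the cross terms. *)
Lemma square_sum_arith (R : realType) (m : nat) (D l h : 'I_m -> R) (G X W AA Xi : R) :
  (forall j, 0 <= D j <= 2 * G) -> 2^-1 <= Xi -> W ^+ 2 <= 2 * AA -> 0 <= AA ->
  X <= \sum_j l j * l j ->
  2 * Xi * (\sum_j D j * h j) + 4^-1 * X - 128 * m%:R * G ^+ 2 * AA <=
  (\sum_j D j * D j) * AA + Xi * (\sum_j (D j * h j + D j * h j + l j * l j))
    + (\sum_j (D j * l j + D j * l j)) * (2 * W).
Proof.
move=> Db Xi2 W2 AA0 XX.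
have DD : 0 <= (\sum_j D j * D j) * AA.
  by rewrite mulr_ge0 // sumr_ge0 // => j _; rewrite -expr2 sqr_ge0.
have key : 4^-1 * (\sum_j l j * l j) + 2 * Xi * (\sum_j D j * h j) - m%:R * (128 * G ^+ 2 * AA) <=
   Xi * (\sum_j (D j * h j + D j * h j + l j * l j)) + (\sum_j (D j * l j + D j * l j)) * (2 * W).
  rewrite -(sum_cst_ord m (128 * G ^+ 2 * AA)) mulr_suml !mulr_sumr -sumrN -!big_split /=; apply: ler_sum => j _.
  have := Db j; move: (D j) (l j) (h j) => d a b /andP[d0 dG].
  have d2 : d ^+ 2 <= 4 * G ^+ 2.
    have : d ^+ 2 <= (2 * G) ^+ 2 by rewrite lerXn2r // nnegrE ?(le_trans d0).
    by rewrite exprMn; lra.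
  have : d ^+ 2 * W ^+ 2 <= (4 * G ^+ 2) * (2 * AA) by rewrite ler_pM ?sqr_ge0.
  have : 0 <= (2^-1 * a + 4 * d * W) ^+ 2 by rewrite sqr_ge0.
  have : 0 <= (Xi - 2^-1) * a ^+ 2 by rewrite mulr_ge0 ?sqr_ge0 ?subr_ge0.
  lra.
lra.
Qed.

(** * Expansions of difference quotients *)

Section Quotients.
Variables (R : realType) (m : nat).
Implicit Types (x z v w xi n : 'rV[R]_m) (A H : 'M[R]_m) (U : set 'rV[R]_m) (u : 'rV[R]_m -> R).

(** [xi] and [n] are the velocity and the acceleration of the curve through [z] whose values at
    times h and -h are z + v and z + w; Taylor's formula at [z] applies to both. *)
Lemma second_difference_expansion u H (G : 'rV[R]_m) z v w xi n (h C e L Gm : R) :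
  0 < h -> h <= 1 -> 0 <= C -> 0 <= L -> 0 <= Gm -> 0 <= e ->
  (forall k l, `|H k l| <= L) -> `|G| <= Gm ->
  `|u (z + v) - u z - dot G v - 2^-1 * dot (v *m H) v| <= e * `|v| ^+ 2 ->
  `|u (z + w) - u z - dot G w - 2^-1 * dot (w *m H) w| <= e * `|w| ^+ 2 ->
  `|v| <= 2 * h -> `|w| <= 2 * h -> `|v - h *: xi| <= C * h ^+ 2 ->
  `|w - (- h) *: xi| <= C * h ^+ 2 -> `|v + w - h ^+ 2 *: n| <= C * h ^+ 3 -> `|xi| <= 2 ->
  `|h ^- 2 * (u (z + v) + (u (z + w) + - 2 * u z)) - (dot (xi *m H) xi + dot G n)|
    <= 8 * e + (4 * (m%:R ^+ 2 * L * C) + m%:R * Gm * C) * h.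
Proof.
move=> h0 h1 C0 L0 Gm0 e0 HL GG Tv Tw vh wh vxi wxi vw xi2.
have hh : 0 < h ^+ 2 by rewrite exprn_gt0.
have mL : 0 <= m%:R ^+ 2 * L by rewrite mulr_ge0 ?exprn_ge0.
have quad x (k : R) : `|k| = h -> `|x| <= 2 * h -> `|x - k *: xi| <= C * h ^+ 2 ->
    `|dot (x *m H) x - h ^+ 2 * dot (xi *m H) xi| <= 4 * (m%:R ^+ 2 * L * C) * h ^+ 3.
  move=> kh xh xxi.
  have k2 : k ^+ 2 = h ^+ 2 by rewrite -(real_normK (num_real k)) kh.
  have -> : dot (x *m H) x - h ^+ 2 * dot (xi *m H) xi =
      dot ((x - k *: xi) *m H) x + k * dot (xi *m H) (x - k *: xi).
    by rewrite mulmxBl -scalemxAl !dotE -k2; ring.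
  apply: le_trans (ler_normD _ _) _; rewrite normrM kh.
  have B1 := bil_le (x - k *: xi) x HL L0; have B2 := bil_le xi (x - k *: xi) HL L0.
  have D1 : m%:R ^+ 2 * L * `|x - k *: xi| * `|x| <= m%:R ^+ 2 * L * (C * h ^+ 2) * (2 * h).
    by rewrite ler_pM // ?mulr_ge0 // ler_wpM2l.
  have D2 : m%:R ^+ 2 * L * `|xi| * `|x - k *: xi| <= m%:R ^+ 2 * L * 2 * (C * h ^+ 2).
    by rewrite ler_pM // ?mulr_ge0 // ler_wpM2l.
  have D3 : h * `|dot (xi *m H) (x - k *: xi)| <= h * (m%:R ^+ 2 * L * 2 * (C * h ^+ 2)).
    by rewrite ler_wpM2l ?(ltW h0) // (le_trans B2).
  apply: le_trans (lerD (le_trans B1 D1) D3) _; lra.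
have Q1 := quad v h (gtr0_norm h0) vh vxi.
have Q2 := quad w (- h) (etrans (normrN h) (gtr0_norm h0)) wh wxi.
have Q3 : `|dot G (v + w) - h ^+ 2 * dot G n| <= m%:R * Gm * (C * h ^+ 3).
  rewrite -dotZr -dotNr -dotDr; apply: le_trans (dot_le_norm _ _) _.
  by rewrite ler_pM // ?mulr_ge0 // ler_wpM2l.
have S x : `|x| <= 2 * h -> e * `|x| ^+ 2 <= 4 * e * h ^+ 2.
  move=> xh; have : `|x| ^+ 2 <= (2 * h) ^+ 2.
    by rewrite ler_sqr // ?nnegrE ?mulr_ge0 // ltW.
  by rewrite exprMn => /(ler_wpM2l e0); lra.
have Tv' := le_trans Tv (S v vh); have Tw' := le_trans Tw (S w wh).
rewrite (_ : _ - _ = h ^- 2 * ((u (z + v) - u z - dot G v - 2^-1 * dot (v *m H) v)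
   + (u (z + w) - u z - dot G w - 2^-1 * dot (w *m H) w)
   + 2^-1 * (dot (v *m H) v - h ^+ 2 * dot (xi *m H) xi)
   + 2^-1 * (dot (w *m H) w - h ^+ 2 * dot (xi *m H) xi)
   + (dot G (v + w) - h ^+ 2 * dot G n))); last first.
  rewrite (dotDr G v w); move: (dot _ _) (dot _ _) (dot _ _) (dot _ _) (dot _ _) (dot _ _) => *.
  by field; rewrite gt_eqF.
rewrite normrM (gtr0_norm (_ : 0 < h ^- 2)) ?invr_gt0 // ler_pdivrMl //.
apply: le_trans (ler_normD _ _) _; apply: le_trans (lerD (ler_normD _ _) Q3) _.
apply: le_trans (lerD (lerD (ler_normD _ _) (lexx _)) (lexx _)) _.
apply: le_trans (lerD (lerD (lerD (ler_normD _ _) (lexx _)) (lexx _)) (lexx _)) _.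
rewrite !normrM (gtr0_norm (_ : 0 < 2^-1)) ?invr_gt0 //.
lra.
Qed.

(** The gradients of the coordinate quotients approximate the rows of the Hessian, and a^2 >= b^2 /
    2 - (a - b)^2. The tolerance 1 / (m^3 + 1) makes the total error at most |x|^2. *)
Lemma quotient_gradient U u z0 z (H : 'M[R]_m) (h rho : R) x : open U -> Cclass 2 U u ->
  (forall w, `|w - z0| < rho -> U w /\ forall k l, `|hess u w k l - H k l| <= (m%:R ^+ 3 + 1)^-1) ->
  0 < h -> `|z - z0| + h < rho ->
  2^-1 * dot (x *m H) (x *m H) - dot x x <=
  \sum_j (h^-1 * (dot (grad u (z + h *: unit_vec R j)) x + -1 * dot (grad u z) x))
       * (h^-1 * (dot (grad u (z + h *: unit_vec R j)) x + -1 * dot (grad u z) x)).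
Proof.
move=> oU cu Hw h0 zh.
have m30 : 0 < m%:R ^+ 3 + 1 :> R by rewrite ltr_wpDl ?exprn_ge0.
set eta : R := (m%:R ^+ 3 + 1)^-1 in Hw *.
have eta0 : 0 < eta by rewrite invr_gt0.
have eta1 : eta * (m%:R ^+ 3 + 1) = 1 by rewrite /eta mulVf // gt_eqF.
have near_z (j : 'I_m) (t : R) : 0 <= t <= 1 -> `|z + (t * h) *: unit_vec R j - z0| < rho.
  move=> t01; rewrite addrAC; apply: le_lt_trans zh; apply: le_trans (ler_normD _ _) _.
  rewrite lerD2l -scalerA; apply: le_trans (scale_norm_le _ t01) _.
  rewrite normrZ gtr0_norm // ler_piMr ?(ltW h0) //.
  by apply: norm_rV_le => // i; rewrite mxE; case: (_ && _); rewrite ?normr1 ?normr0.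
have quot (j k : 'I_m) : `|h^-1 * (partial [:: k] u (z + h *: unit_vec R j) - partial [:: k] u z) - H k j| <= eta.
  have ck := Cclass_partial k cu.
  have [|t t01 E] := @coord_MVT _ _ (partial [:: k] u) z j h.
    move=> t t01; apply: (ck.1 [::]) => //; exact: (Hw _ (near_z j t t01)).1.
  rewrite E mulKf ?gt_eqF // -[partial [:: j] _ _]/(partial [:: j; k] u _) -hess_entry.
  exact: (Hw _ (near_z j t t01)).2.
have quot2 (j : 'I_m) : `|h^-1 * (dot (grad u (z + h *: unit_vec R j)) x + -1 * dot (grad u z) x) - (x *m H) 0 j|
    <= m%:R * eta * `|x|.
  have -> : h^-1 * (dot (grad u (z + h *: unit_vec R j)) x + -1 * dot (grad u z) x) - (x *m H) 0 j
     = \sum_k (h^-1 * (partial [:: k] u (z + h *: unit_vec R j) - partial [:: k] u z) - H k j) * x 0 k.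
    rewrite !dot_sum mxE mulN1r -sumrB mulr_sumr -sumrB; apply: eq_bigr => k _.
    have gE w : grad u w 0 k = partial [:: k] u w by rewrite mxE.
    by rewrite !gE; move: (partial [:: k] u _) (partial [:: k] u _) => a b; ring.
  apply: le_trans (ler_norm_sum _ _ _) _.
  rewrite -mulrA -(sum_cst_ord m (eta * `|x|)); apply: ler_sum => k _.
  by rewrite normrM ler_pM // entry_le_norm.
rewrite [dot (x *m H) _]dot_sum mulr_sumr.
have : m%:R * ((m%:R * eta * `|x|) ^+ 2) <= dot x x.
  have nx := sqr_norm_le_dot x; apply: le_trans nx.
  have e1 : eta <= 1 by rewrite invf_le1 // lerDr exprn_ge0.
  have -> : m%:R * (m%:R * eta * `|x|) ^+ 2 = (m%:R ^+ 3 * eta) * eta * `|x| ^+ 2 by ring.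
  have m3e : m%:R ^+ 3 * eta <= 1 by lra.
  have m3e0 : 0 <= m%:R ^+ 3 * eta by rewrite mulr_ge0 ?exprn_ge0 // ltW.
  by rewrite ler_piMl ?exprn_ge0 // mulr_ile1 // ltW.
rewrite -(sum_cst_ord m ((m%:R * eta * `|x|) ^+ 2)) -lerN2 => /(lerD (lexx (\sum_j 2^-1 * ((x *m H) 0 j * (x *m H) 0 j)))) => le.
apply: le_trans le _; rewrite -sumrN -big_split /=; apply: ler_sum => j _.
have := quot2 j; move: (h^-1 * _) ((x *m H) 0 j) (m%:R * eta * `|x|) => a b c abc.
have c2 : (a - b) ^+ 2 <= c ^+ 2.
  rewrite -(real_normK (num_real (a - b))) lerXn2r // nnegrE //.
  exact: le_trans (normr_ge0 _) abc.
have : 0 <= (2 * a - b) ^+ 2 by rewrite sqr_ge0.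
lra.
Qed.

Lemma jet_field_norm xi0 z0 A z : let xi1 := xi0 + (z - z0) *m A in
  jet (fun w => dot (xi0 + (w - z0) *m A) (xi0 + (w - z0) *m A)) z (dot xi1 xi1)
    (fun x => 2 * dot xi1 (x *m A)) (fun x => dot (x *m A) (x *m A)).
Proof.
move=> xi1; split; first by apply: linear_partZ; exact: linear_part_dotM.
  exact: quadratic_part_bil.
move=> e e0; exists 1 => // x _; rewrite (addrAC z) mulmxDl addrA -/xi1.
rewrite (_ : _ - _ = 0) ?normr0 ?mulr_ge0 ?exprn_ge0 ?(ltW e0) //.
by move: (x *m A) xi1 => y xi1; rewrite !dotE (dotC y); ring.
Qed.

Lemma jet_quotient U u z (h c0 : R) (v : 'rV[R]_m) : open U -> Cclass 2 U u -> U z -> U (z + v) ->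
  jet (fun w => h * (u (w + v) + -1 * u w) + c0) z (h * (u (z + v) + -1 * u z) + c0)
    (fun x => h * (dot (grad u (z + v)) x + -1 * dot (grad u z) x))
    (fun x => h * (2^-1 * dot (x *m hess u (z + v)) x + -1 * (2^-1 * dot (x *m hess u z) x))).
Proof.
move=> oU cu Uz Uv.
have := jetD (jetZ h (jetD (jet_shift (jet_Taylor oU Uv cu)) (jetZ (-1) (jet_Taylor oU Uz cu)))) (jet_cst c0 z).
by under [X in jet _ _ _ X]funext => x do rewrite addr0; under [X in jet _ _ _ _ X]funext => x do rewrite addr0.
Qed.

End Quotients.

Lemma grad_entry (R : realType) (m : nat) (h : 'rV[R]_m -> R) w (k : 'I_m) :
  grad h w 0 k = partial [:: k] h w.
Proof. by rewrite mxE. Qed.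

(** * Convergence of the transported quotients *)

Section TransportedMaximum.
Variables (R : realType) (m : nat) (J : 'M[R]_m) (I : finType).
Variables (K Kf Kg b0 : R) (fr : (I -> 'rV[R]_m) -> R -> Prop).
Variables (Om : set 'rV[R]_m) (psi f g u : 'rV[R]_m -> R).
Hypothesis (frP : frames J b0 fr) (st : setting K Kf Kg fr Om psi f g u).
Hypothesis (K1 : 1 <= K) (Kf0 : 0 <= Kf) (Kg0 : 0 <= Kg) (b00 : 0 <= b0).
Implicit Types (z v w x : 'rV[R]_m).

Let Om_open : open Om := st_open st.
Let u1 : Cclass 1 Om u := Cclass_le (isT : (1 <= 2)%N) (st_u st).
Let Cg := Cgrad m K Kf Kg b0.

Lemma Cgrad_ge0 : 0 <= Cg.
Proof.
have kb := Kb_gt0 m Kf0 Kg0 b00; have k2 := K2_ge0 m K1; have K0 : 0 <= K by exact: le_trans K1.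
rewrite /Cg /Cgrad; apply: addr_ge0; last by rewrite mulr_ge0 // addr_ge0 // !mulr_ge0.
apply: addr_ge0 => //; apply: addr_ge0; first by rewrite mulr_ge0.
by rewrite mulr_ge0 ?mulr_ge0 ?(ltW kb) // addr_ge0 // addr_ge0 // !mulr_ge0.
Qed.

Lemma grad_u_norm z : Om z -> `|grad u z| <= Cg.
Proof.
move=> Oz; apply: norm_rV_le => [|k]; first exact: Cgrad_ge0.
by rewrite grad_entry; exact: (gradient_bound frP st K1 Kf0 Kg0 b00 k Oz).
Qed.

Lemma norm_unit_vec (j : 'I_m) : `|unit_vec R j| <= 1.
Proof. by apply: norm_rV_le => // i; rewrite mxE; case: (_ && _); rewrite ?normr1 ?normr0. Qed.

(** The shift by the gradient bound makes the quotient nonnegative: differentiating its square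
    multiplies the trace of its Hessian by the quotient, and that trace is bounded from below
    only. *)
Definition quotient (h : R) (j : 'I_m) w : R :=
  h^-1 * (u (w + h *: unit_vec R j) + -1 * u w) + Cg.

Lemma quotient_bound (h : R) j z : 0 < h -> segment_in Om z (h *: unit_vec R j) ->
  0 <= quotient h j z <= 2 * Cg.
Proof.
move=> h0 sg; have [t /andP[t0 t1] E] := segment_MVT Om_open u1 sg.
have t01 : 0 <= t <= 1 by rewrite !ltW.
rewrite /quotient mulN1r E dotZr mulKf ?gt_eqF // dot_deltar grad_entry.
have := gradient_bound frP st K1 Kf0 Kg0 b00 j (sg t t01).
rewrite -/Cg; move: (partial [:: j] u _) => a; rewrite ler_norml => /andP[A B].
by apply/andP; split; lra.
Qed.

Lemma quotient_trace s b (h : R) j z : fr s b -> 0 < h -> h <= 1 ->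
  segment_in Om z (h *: unit_vec R j) -> trace_op s u z <= b * f z + h ^+ 2 ->
  - (2^-1 * (b0 * (m%:R * Kf) + 1)) <=
  \sum_i h^-1 * (2^-1 * dot (s i *m hess u (z + h *: unit_vec R j)) (s i)
    + -1 * (2^-1 * dot (s i *m hess u z) (s i))).
Proof.
move=> sb h0 h1 sg tr.
have i1 : 0 <= (1 : R) <= 1 by rewrite lexx ler01.
have Ov : Om (z + h *: unit_vec R j) by have := sg 1 i1; rewrite scale1r.
have T := st_sub st sb Ov.
rewrite -mulr_sumr !big_split /= -!mulr_sumr -/(trace_op s u z) -/(trace_op s u (_ + _)).
rewrite ler_pdivlMl //.
have mK : 0 <= m%:R * Kf by rewrite mulr_ge0.
have := difference_le st (st_f st) (st_f_le st) Kf0 sg.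
have : m%:R * Kf * `|h *: unit_vec R j| <= m%:R * Kf * h.
  by rewrite ler_wpM2l // normrZ gtr0_norm // ler_piMr ?(ltW h0) // norm_unit_vec.
move=> /[swap] /le_trans/[apply]; rewrite ler_norml => /andP[F _].
have /andP[b_0 bb] := fr_b frP sb.
have F1 : b * (- (m%:R * Kf * h)) <= b * (f (z + h *: unit_vec R j) - f z) by rewrite ler_wpM2l.
have F2 : b * (m%:R * Kf * h) <= b0 * (m%:R * Kf * h) by rewrite ler_wpM2r // mulr_ge0 // ltW.
have F3 : h ^+ 2 <= h by rewrite expr2 ler_piMl // ltW.
move: T tr F1 F2; move: (trace_op _ _ _) (trace_op _ _ _) (f (_ + _)) (f z) => *; lra.
Qed.

Definition grad_square z : R := \sum_j (partial [:: j] u z + Cg) * (partial [:: j] u z + Cg).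

(** The acceleration x N is already linear in x, so a first-order expansion of grad u gives a
    second-order expansion of its pairing with the acceleration. *)
Lemma grad_first_order z0 (N : 'M[R]_m) : Om z0 -> exists2 d : R, 0 < d & forall x, `|x| < d ->
  `|dot (grad u (z0 + x)) (x *m N) - dot (grad u z0) (x *m N) - dot (x *m hess u z0) (x *m N)|
    <= 8^-1 * `|x| ^+ 2.
Proof.
move=> Oz0; pose a : R := m%:R * (m%:R * `|N|); have a0 : 0 <= a by rewrite !mulr_ge0.
pose e : R := (8 * (a + 1))^-1; have e0 : 0 < e by rewrite invr_gt0 mulr_gt0 // ltr_wpDl.
have [d d0 Hd] : exists2 d : R, 0 < d & forall k : 'I_m, forall x, `|x| < d ->
    `|partial [:: k] u (z0 + x) - partial [:: k] u z0 - dot (grad (partial [:: k] u) z0) x| <= e * `|x|.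
  apply: finite_eps => [k d d' H _ dd x xd|k]; first by apply: H; apply: lt_le_trans dd.
  have [d d0 Hd] := uniform_Taylor1 Om_open Oz0 (Cclass_partial k (st_u st)) e0.
  by exists d => // x xd; apply: Hd => //; rewrite subrr normr0.
exists d => // x xd.
rewrite (bil_sym x (x *m N) Om_open Oz0 (st_u st)) hessE !dot_sum -!sumrB.
apply: (@le_trans _ _ (\sum_(k < m) e * `|x| * (m%:R * `|N| * `|x|))).
  apply: le_trans (ler_norm_sum _ _ _) _; apply: ler_sum => k _.
  rewrite (_ : _ - _ = (partial [:: k] u (z0 + x) - partial [:: k] u z0
     - dot (grad (partial [:: k] u) z0) x) * (x *m N) 0 k); last first.
    by rewrite !grad_entry; move: (partial [:: k] u _) (partial [:: k] u _) (dot _ _) => *; ring.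
  rewrite normrM ler_pM ?Hd //; exact: le_trans (entry_le_norm _ _) (norm_mulmx_le _ _).
rewrite sum_cst_ord [leLHS](_ : _ = e * a * `|x| ^+ 2); last by rewrite /a; ring.
rewrite ler_wpM2r ?exprn_ge0 // /e mulrC ler_pdivrMr ?mulr_gt0 ?ltr_wpDl //.
by lra.
Qed.

Lemma hess_near z0 (e : R) : Om z0 -> 0 < e -> exists2 d : R, 0 < d & forall w, `|w - z0| < d ->
  Om w /\ forall k l, `|hess u w k l - hess u z0 k l| <= e.
Proof.
move=> Oz0 e0; have [d1 d10 H1] := open_eps Om_open Oz0.
have [d2 d20 H2] : exists2 d : R, 0 < d & forall kl : 'I_m * 'I_m, forall w, `|w - z0| < d ->
    `|partial [:: kl.2; kl.1] u w - partial [:: kl.2; kl.1] u z0| <= e.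
  apply: finite_eps => [k d d' H _ dd x xd|k]; first by apply: H; apply: lt_le_trans dd.
  have [d d0 Hd] := continuous_eps ((st_u st).2 [:: k.2; k.1] z0 isT Oz0) e0.
  by exists d => // w wd; apply: ltW; apply: Hd.
exists (Num.min d1 d2) => [|w]; first by rewrite lt_min d10.
rewrite lt_min => /andP[w1 w2]; split; first exact: H1.
by move=> k l; rewrite !hess_entry; apply: (H2 (k, l)).
Qed.

Lemma grad_square_quotient (r d : R) z0 : 0 < r -> r < d ->
  (forall x, `|x| < d -> Om (z0 + x)) -> forall e : R, 0 < e ->
  exists2 h0 : R, 0 < h0 & forall h, 0 < h -> h < h0 -> forall x, `|x| <= r ->
    `|\sum_j quotient h j (z0 + x) * quotient h j (z0 + x) - grad_square (z0 + x)| <= e.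
Proof.
move=> r0 rd ball e e0; have Cg0 : 0 <= Cg := Cgrad_ge0.
pose e1 : R := e / (4 * m%:R * Cg + 1).
have D0 : 0 < 4 * m%:R * Cg + 1 by rewrite ltr_wpDl // !mulr_ge0.
have e10 : 0 < e1 by rewrite divr_gt0.
have [||d1 d10 H1] := compact_Taylor1 (A := [set z | `|z - z0| <= r]) Om_open _ _ u1 e10.
- exact: compact_ball.
- by move=> w /= wr; rewrite -(subrK z0 w) addrC; apply: ball; apply: le_lt_trans rd.
exists (Num.min d1 (d - r)) => [|h h0]; first by rewrite lt_min d10 subr_gt0.
rewrite lt_min => /andP[hd1 hd] x xr.
have nhe (j : 'I_m) : `|h *: unit_vec R j| <= h.
  by rewrite normrZ gtr0_norm // ler_piMr ?(ltW h0) // norm_unit_vec.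
rewrite /grad_square -sumrB; apply: le_trans (ler_norm_sum _ _ _) _.
apply: (@le_trans _ _ (\sum_(j < m) e1 * (4 * Cg))); last first.
  rewrite sum_cst_ord [leLHS](_ : _ = e1 * (4 * m%:R * Cg)); last by ring.
  apply: (@le_trans _ _ (e1 * (4 * m%:R * Cg + 1))); first by rewrite ler_wpM2l ?(ltW e10) // lerDl.
  by rewrite /e1 divfK ?gt_eqF.
apply: ler_sum => j _.
have sg : segment_in Om (z0 + x) (h *: unit_vec R j).
  move=> t t01; rewrite -addrA; apply: ball; apply: le_lt_trans (ler_normD _ _) _.
  by have := scale_norm_le (h *: unit_vec R j) t01; have := nhe j; lra.
have Ox : Om (z0 + x) by apply: ball; apply: le_lt_trans rd.
have /andP[Q1 Q2] := quotient_bound h0 sg.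
have := gradient_bound frP st K1 Kf0 Kg0 b00 j Ox; rewrite -/Cg ler_norml => /andP[P1 P2].
have Q : `|quotient h j (z0 + x) - (partial [:: j] u (z0 + x) + Cg)| <= e1.
  have H2 := H1 (z0 + x); rewrite /= addrAC subrr add0r in H2.
  have := H2 xr (h *: unit_vec R j) (le_lt_trans (nhe j) hd1).
  rewrite dotZr dot_deltar grad_entry => H3.
  rewrite /quotient (_ : _ - _ = h^-1 * (u (z0 + x + h *: unit_vec R j) - u (z0 + x)
     - h * partial [:: j] u (z0 + x))); last first.
    by move: (partial [:: j] _ _) => a; field; rewrite gt_eqF.
  rewrite normrM gtr0_norm ?invr_gt0 // ler_pdivrMl //.
  by apply: le_trans H3 _; rewrite mulrC ler_wpM2r // ltW.
move: Q1 Q2 P1 P2 Q; move: (quotient _ _ _) (partial _ _ _) => q p *.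
have -> : q * q - (p + Cg) * (p + Cg) = (q - (p + Cg)) * (q + (p + Cg)) by ring.
by rewrite normrM ler_pM // ler_norml; apply/andP; split; lra.
Qed.

(** Uniform convergence in x, as [touch] requires. It rests on the qualitative Hessian bound; the
    rate depends on [u] and is immaterial. *)
Lemma motion_second_difference xi0 (M : R -> 'M[R]_m) (A N : 'M[R]_m) z0 (C r d : R) :
  0 <= C -> 0 < r -> r <= 1 -> 3 * r < d -> (forall x, `|x| < d -> Om (z0 + x)) ->
  (forall h x, `|h| <= r -> `|x| <= r ->
     [/\ `|motion xi0 M h x| <= 2 * `|h|, `|motion xi0 M h x - h *: (xi0 + x *m A)| <= C * h ^+ 2,
      `|motion xi0 M h x + motion xi0 M (- h) x - h ^+ 2 *: (x *m N)| <= C * `|h| ^+ 3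
      & `|xi0 + x *m A| <= 2]) ->
  forall e : R, 0 < e -> exists2 h0 : R, 0 < h0 & forall h, 0 < h -> h < h0 -> forall x, `|x| <= r ->
    `|h ^- 2 * (u (z0 + x + motion xi0 M h x) + (u (z0 + x + motion xi0 M (- h) x) + - 2 * u (z0 + x)))
      - (dot ((xi0 + x *m A) *m hess u (z0 + x)) (xi0 + x *m A) + dot (grad u (z0 + x)) (x *m N))| <= e.
Proof.
move=> C0 r0 r1 rd ball mot e e0; have Cg0 : 0 <= Cg := Cgrad_ge0.
have [L L0 HL] := hess_bounded st.
have e10 : 0 < e / 16 by rewrite divr_gt0.
have [||d1 d10 H1] := compact_Taylor2 (A := [set z | `|z - z0| <= r]) Om_open _ _ (st_u st) e10.
- exact: compact_ball.
- by move=> w /= wr; rewrite -(subrK z0 w) addrC; apply: ball; lra.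
pose Q : R := 4 * (m%:R ^+ 2 * L * C) + m%:R * Cg * C.
have Q0 : 0 <= Q by apply: addr_ge0; rewrite !mulr_ge0 // exprn_ge0.
exists (Num.min r (Num.min (d1 / 2) (e / (2 * (Q + 1))))) => [|h h0].
  by rewrite !lt_min r0 divr_gt0 //= divr_gt0 // mulr_gt0 // ltr_wpDl.
rewrite !lt_min => /andP[hr /andP[hd1 he]] x xr.
have Ox : Om (z0 + x) by apply: ball; lra.
have nh : `|h| <= r by rewrite gtr0_norm // ltW.
have nh' : `|- h| <= r by rewrite normrN.
have [A1 A2 A3 A4] := mot h x nh xr; have [B1 B2 _ _] := mot (- h) x nh' xr.
rewrite (gtr0_norm h0) in A1 A3; rewrite normrN (gtr0_norm h0) in B1; rewrite sqrrN in B2.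
have H2 := H1 (z0 + x); rewrite /= addrAC subrr add0r in H2.
have := @second_difference_expansion _ _ u (hess u (z0 + x)) (grad u (z0 + x)) (z0 + x) _ _ _ (x *m N)
  h C (e / 16) L Cg h0 _ C0 L0 Cg0 (ltW e10) (fun k l => HL _ k l Ox) (grad_u_norm Ox)
  (H2 xr _ _) (H2 xr _ _) A1 B1 A2 B2 A3 A4.
rewrite -/Q => S; apply: le_trans (S _ _ _) _; [lra|lra|lra|].
have : h * (2 * (Q + 1)) <= e by rewrite -ler_pdivlMr ?mulr_gt0 ?ltr_wpDl // ltW.
by lra.
Qed.

End TransportedMaximum.

Lemma sum_linear (R : comNzRingType) (I : finType) (a b x y z : I -> R) (c k1 k2 k3 : R) :
  \sum_i (a i + c * (b i + k1 * (k2 * x i - y i) - k3 * z i)) =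
  \sum_i a i + c * (\sum_i b i + k1 * (k2 * (\sum_i x i) - \sum_i y i) - k3 * (\sum_i z i)).
Proof.
by rewrite big_split /= -mulr_sumr sumrB big_split /= -!mulr_sumr sumrB -mulr_sumr.
Qed.

(** * The maximum principle for transported second derivatives *)

Section TouchingInequality.
Variables (R : realType) (m : nat) (J : 'M[R]_m) (I : finType).
Variables (K Kf Kg b0 : R) (fr : (I -> 'rV[R]_m) -> R -> Prop).
Variables (Om : set 'rV[R]_m) (psi f g u : 'rV[R]_m -> R).
Hypothesis (frP : frames J b0 fr) (st : setting K Kf Kg fr Om psi f g u).
Hypothesis (K1 : 1 <= K) (Kf0 : 0 <= Kf) (Kg0 : 0 <= Kg) (b00 : 0 <= b0).
Implicit Types (z v w x : 'rV[R]_m).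

Let Om_open : open Om := st_open st.
Let u1 : Cclass 1 Om u := Cclass_le (isT : (1 <= 2)%N) (st_u st).
Let Cg := Cgrad m K Kf Kg b0.

Lemma jet_motion z0 z xi0 (M : R -> 'M[R]_m) (h : R) : Om (z + motion xi0 M h (z - z0)) ->
  jet (fun w => u (w + motion xi0 M h (w - z0))) z (u (z + motion xi0 M h (z - z0)))
    (fun x => dot (grad u (z + motion xi0 M h (z - z0))) (x *m M h))
    (fun x => 2^-1 * dot (x *m M h *m hess u (z + motion xi0 M h (z - z0))) (x *m M h)).
Proof.
move=> Oz; apply: (jet_affine _ (jet_Taylor Om_open Oz (st_u st))) => x.
rewrite /motion (_ : z + x - z0 = (z - z0) + x); last by rewrite addrAC.
rewrite mulmxDl; move: (_ *m M h) (x *m M h) => a b.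
by apply/rowP => k; rewrite !mxE; ring.
Qed.

(** For fixed h this has a second-order jet, being built from u by affine substitutions, sums and
    products, although its limit as h tends to 0 contains second derivatives of u. *)
Definition approximation z0 xi0 (M : R -> 'M[R]_m) (A : 'M[R]_m) (c h : R) w : R :=
  h ^- 2 * (u (w + motion xi0 M h (w - z0)) + (u (w + motion xi0 M (- h) (w - z0)) + - 2 * u w))
  + c * ((\sum_j quotient K Kf Kg b0 u h j w * quotient K Kf Kg b0 u h j w)
         * dot (xi0 + (w - z0) *m A) (xi0 + (w - z0) *m A)).

Lemma jet_approximation z0 xi0 M A c h z : Om z -> Om (z + motion xi0 M h (z - z0)) ->
  Om (z + motion xi0 M (- h) (z - z0)) -> (forall j, Om (z + h *: unit_vec R j)) ->
  let xi1 := xi0 + (z - z0) *m A in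
  let l_ j x := h^-1 * (dot (grad u (z + h *: unit_vec R j)) x + -1 * dot (grad u z) x) in
  let q_ j x := h^-1 * (2^-1 * dot (x *m hess u (z + h *: unit_vec R j)) x
    + -1 * (2^-1 * dot (x *m hess u z) x)) in
  let D_ j := quotient K Kf Kg b0 u h j z in
  exists c0 l0, jet (approximation z0 xi0 M A c h) z c0 l0 (fun x =>
    h ^- 2 * (2^-1 * dot (x *m M h *m hess u (z + motion xi0 M h (z - z0))) (x *m M h)
     + (2^-1 * dot (x *m M (- h) *m hess u (z + motion xi0 M (- h) (z - z0))) (x *m M (- h))
     + - 2 * (2^-1 * dot (x *m hess u z) x)))
   + c * ((\sum_j D_ j * D_ j) * dot (x *m A) (x *m A)
      + dot xi1 xi1 * (\sum_j (D_ j * q_ j x + D_ j * q_ j x + l_ j x * l_ j x))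
      + (\sum_j (D_ j * l_ j x + D_ j * l_ j x)) * (2 * dot xi1 (x *m A)))).
Proof.
move=> Oz Op Om' Oj xi1 l_ q_ D_.
eexists; eexists; apply: jetD.
  apply: jetZ; apply: jetD; first exact: jet_motion.
  apply: jetD; first exact: jet_motion.
  exact/jetZ/(jet_Taylor Om_open Oz (st_u st)).
apply: jetZ; apply: jetM; last exact: jet_field_norm.
apply: jet_sum => j; apply: jetM; exact: (jet_quotient h^-1 _ Om_open (st_u st) Oz (Oj j)).
Qed.

(** The next three constants are the costs of the second differences of f along the motion, of the
    variation of the field in the product with the squares, and of the first differences of f in the
    coordinate quotients; the numerical summands cover the slack terms. *)
Definition Ctouch : R := 9 * (b0 * (m%:R * Kf)) + 2.
Definition Cfield : R := 128 * m%:R * Cg ^+ 2.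
Definition Csquare : R := 4 * m%:R * Cg * (b0 * (m%:R * Kf) + 1) + 1.

(* At a touching point the quadratic part of the test function dominates the
   linearized operator applied to [approximation]. *)
Let touching_sum z0 xi0 M A (c h r : R) z (q : 'rV[R]_m -> R) s b (rp rm : 'M[R]_m) :
  0 <= c -> 0 < h -> h <= 1 -> fr s b ->
  trace_op s u z <= b * f z + h ^+ 2 ->
  M h = (1 + h * r) *: rp -> M (- h) = (1 - h * r) *: rm ->
  rp *m rp^T = 1%:M -> rp *m J = J *m rp -> rm *m rm^T = 1%:M -> rm *m J = J *m rm ->
  segment_in Om z (motion xi0 M h (z - z0)) -> segment_in Om z (motion xi0 M (- h) (z - z0)) ->
  `|motion xi0 M h (z - z0)| <= 2 * h -> `|motion xi0 M (- h) (z - z0)| <= 2 * h ->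
  `|motion xi0 M h (z - z0) + motion xi0 M (- h) (z - z0)| <= h ^+ 2 ->
  (forall j, segment_in Om z (h *: unit_vec R j)) ->
  2^-1 <= dot (xi0 + (z - z0) *m A) (xi0 + (z - z0) *m A) <= 2 ->
  (forall x, 2^-1 * dot (x *m hess u z0) (x *m hess u z0) - dot x x <=
    \sum_j (h^-1 * (dot (grad u (z + h *: unit_vec R j)) x + -1 * dot (grad u z) x))
         * (h^-1 * (dot (grad u (z + h *: unit_vec R j)) x + -1 * dot (grad u z) x))) ->
  (forall c1 l1 q1, jet (approximation z0 xi0 M A c h) z c1 l1 q1 ->
     forall x, q1 x <= q x + 2^-1 * dot x x) ->
  - (Ctouch * (1 + `|r|)) + c * (8^-1 * (\sum_i dot (s i *m hess u z0) (s i *m hess u z0))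
     - Cfield * (\sum_i dot (s i *m A) (s i *m A)) - Csquare) <= \sum_i q (s i).
Proof.
move=> c0 h0 h1 sb tr Mp Mm rp1 rp2 rm1 rm2 sp sm np nm npm sj.
set xi1 := xi0 + (z - z0) *m A => /andP[xi1l xi1u] Hl Hq.
have i1 : 0 <= (1 : R) <= 1 by rewrite lexx ler01.
have i0 : 0 <= (0 : R) <= 1 by rewrite lexx ler01.
have Oz : Om z by have := sp 0 i0; rewrite scale0r addr0.
have O1 : Om (z + motion xi0 M h (z - z0)) by have := sp 1 i1; rewrite scale1r.
have O2 : Om (z + motion xi0 M (- h) (z - z0)) by have := sm 1 i1; rewrite scale1r.
have O3 j : Om (z + h *: unit_vec R j) by have := sj j 1 i1; rewrite scale1r.
have [c1 [l1 Jt]] := jet_approximation A c Oz O1 O2 O3.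
have key := Hq _ _ _ Jt.
have T1 := transport_trace frP st Kf0 sb rp1 rp2 rm1 rm2 h0 sp sm np nm npm tr Mp Mm.
pose D j := quotient K Kf Kg b0 u h j z.
have HD j : 0 <= D j <= 2 * Cg := quotient_bound frP st K1 Kf0 Kg0 b00 h0 (sj j).
pose q_ j x := h^-1 * (2^-1 * dot (x *m hess u (z + h *: unit_vec R j)) x
    + -1 * (2^-1 * dot (x *m hess u z) x)).
have T2 j : - (2^-1 * (b0 * (m%:R * Kf) + 1)) <= \sum_i q_ j (s i).
  exact: (quotient_trace frP st Kf0 sb h0 h1 (sj j) tr).
have Cg0 : 0 <= Cg := Cgrad_ge0 m K1 Kf0 Kg0 b00.
have T3 x : 2 * dot xi1 xi1 * (\sum_j D j * q_ j x)
    + 4^-1 * (2^-1 * dot (x *m hess u z0) (x *m hess u z0) - dot x x)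
    - 128 * m%:R * Cg ^+ 2 * dot (x *m A) (x *m A) <= _ :=
  square_sum_arith (q_^~ x) HD xi1l (_ : dot xi1 (x *m A) ^+ 2 <= 2 * dot (x *m A) (x *m A))
    (dot_ge0 _) (Hl x).
have T4 x : h ^- 2 * (2^-1 * dot (x *m M h *m hess u (z + motion xi0 M h (z - z0))) (x *m M h)
     + (2^-1 * dot (x *m M (- h) *m hess u (z + motion xi0 M (- h) (z - z0))) (x *m M (- h))
     + - 2 * (2^-1 * dot (x *m hess u z) x)))
   + c * (2 * dot xi1 xi1 * (\sum_j D j * q_ j x)
    + 4^-1 * (2^-1 * dot (x *m hess u z0) (x *m hess u z0) - dot x x)
    - 128 * m%:R * Cg ^+ 2 * dot (x *m A) (x *m A)) <= q x + 2^-1 * dot x x.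
  apply: le_trans (key x); rewrite lerD2l ler_wpM2l //; apply: T3.
  move=> y; apply: le_trans (CauchySchwarz_dot xi1 (y *m A)) _.
  by rewrite ler_wpM2r // dot_ge0.
have : \sum_i (h ^- 2 * (2^-1 * dot (s i *m M h *m hess u (z + motion xi0 M h (z - z0))) (s i *m M h)
     + (2^-1 * dot (s i *m M (- h) *m hess u (z + motion xi0 M (- h) (z - z0))) (s i *m M (- h))
     + - 2 * (2^-1 * dot (s i *m hess u z) (s i))))
   + c * (2 * dot xi1 xi1 * (\sum_j D j * q_ j (s i))
    + 4^-1 * (2^-1 * dot (s i *m hess u z0) (s i *m hess u z0) - dot (s i) (s i))
    - 128 * m%:R * Cg ^+ 2 * dot (s i *m A) (s i *m A))) <= \sum_i (q (s i) + 2^-1 * dot (s i) (s i)).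
  by apply: ler_sum => i _; exact: T4.
rewrite sum_linear [leRHS]big_split /= -[X in _ <= _ + X]mulr_sumr (fr_norm frP sb) -[X in _ + _ * (X + _ - _)]mulr_sumr.
have T5 : - (4 * m%:R * Cg * (b0 * (m%:R * Kf) + 1)) <= 2 * dot xi1 xi1 * (\sum_i \sum_j D j * q_ j (s i)).
  rewrite exchange_big /=.
  pose a : R := b0 * (m%:R * Kf) + 1; have a0 : 0 <= a by rewrite addr_ge0 // !mulr_ge0.
  have S : - (m%:R * (Cg * a)) <= \sum_j \sum_i D j * q_ j (s i).
    rewrite -(sum_cst_ord m (Cg * a)) -sumrN; apply: ler_sum => j _; rewrite -mulr_sumr.
    have /andP[d0 dG] := HD j.
    have := ler_wpM2l d0 (T2 j); have : 0 <= (2 * Cg - D j) * a by rewrite mulr_ge0 // subr_ge0.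
    by rewrite -/a; lra.
  have n0 : 0 <= m%:R * (Cg * a) by rewrite !mulr_ge0.
  have : (2 * dot xi1 xi1) * - (m%:R * (Cg * a)) <= 2 * dot xi1 xi1 * (\sum_j \sum_i D j * q_ j (s i)).
    by rewrite ler_wpM2l // mulr_ge0 // dot_ge0.
  have : (2 * dot xi1 xi1) * (m%:R * (Cg * a)) <= 4 * (m%:R * (Cg * a)).
    by rewrite ler_wpM2r //; lra.
  by rewrite -/a; lra.
move: T1 T5; rewrite /Ctouch /Cfield /Csquare -/Cg.
move: (\sum_i dot (_ *m A) _) (\sum_i dot (_ *m hess u z0) _) (2 * _ * \sum_i _) (\sum_i q _) => SA SH SD Sq.
move: (\sum_i h ^- 2 * _) => S0 T1 T5 T6.
have : c * (- (4 * m%:R * Cg * (b0 * (m%:R * Kf) + 1))) <= c * SD by rewrite ler_wpM2l.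
have r0 : 0 <= `|r| := normr_ge0 r.
by move: T1 T6; move: (128 * _ * _) (4 * _ * _ * _) => k1 k2; lra.
Qed.

(** The hypothesis says that D^2 u evaluated on the velocity field of a similarity, plus weighted
    squares of the gradient, is touched from above at [z0]. The conclusion is the linearized
    equation there. The acceleration [N] of the motion appears on the right because the limit of the
    second quotients also contains grad u paired with x N. *)
Lemma transported_max z0 xi0 (P A N : 'M[R]_m) (r c d : R) (lP qP : 'rV[R]_m -> R) :
  P^T = - P -> P *m J = J *m P -> A = r%:M + P -> N = P *m P + (2 * r) *: P ->
  dot xi0 xi0 = 1 -> Om z0 -> 0 <= c -> linear_part lP -> quadratic_part qP -> 0 < d ->
  (forall x, `|x| < d -> dot ((xi0 + x *m A) *m hess u (z0 + x)) (xi0 + x *m A)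
      + c * (grad_square K Kf Kg b0 u (z0 + x) * dot (xi0 + x *m A) (xi0 + x *m A))
    <= dot (xi0 *m hess u z0) xi0 + c * grad_square K Kf Kg b0 u z0 + lP x + qP x + 8^-1 * `|x| ^+ 2) ->
  exists s b, fr s b /\
    - (Ctouch * (1 + `|r|)) + c * (8^-1 * (\sum_i dot (s i *m hess u z0) (s i *m hess u z0))
       - Cfield * (\sum_i dot (s i *m A) (s i *m A)) - Csquare)
    <= \sum_i (qP (s i) + dot (s i *m hess u z0) (s i *m N)).
Proof.
move=> PT PJ AE NE unit_xi0 Oz0 c0 lin quad d0 bound.
have xA x : x *m A = r *: x + x *m P by rewrite AE mulmxDr mul_mx_scalar.
have xN x : x *m N = x *m P *m P + (2 * r) *: (x *m P) by rewrite NE mulmxDr mulmxA scalemxAr.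
have [rot [C [rho1 [rot1 rot2 C0 /andP[rho10 rho11] mot]]]] := small_motion r PT PJ unit_xi0.
pose M (h : R) : 'M[R]_m := (1 + h * r) *: rot h.
pose eta : R := (m%:R ^+ 3 + 1)^-1.
have eta0 : 0 < eta by rewrite invr_gt0 ltr_wpDl ?exprn_ge0.
have [d1 d10 H1] := hess_near st Oz0 eta0.
have [d2 d20 H2] := grad_first_order st N Oz0.
pose rho := Num.min rho1 (Num.min d (Num.min d1 d2)) / 8.
have mn0 : 0 < Num.min rho1 (Num.min d (Num.min d1 d2)) by rewrite !lt_min rho10 d0 d10.
have rho0 : 0 < rho by rewrite divr_gt0.
have rho8 : rho * 8 = Num.min rho1 (Num.min d (Num.min d1 d2)) by rewrite /rho divfK.
have [m1 m2 m3 m4] : [/\ rho * 8 <= rho1, rho * 8 <= d, rho * 8 <= d1 & rho * 8 <= d2].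
  by rewrite rho8; split; rewrite !ge_min lexx ?orbT.
have ball x : `|x| < d1 -> Om (z0 + x).
  by move=> xd; apply: (H1 _ _).1; rewrite addrAC subrr add0r.
have rho_1 : rho <= 1 by lra.
have mot2 h x : `|h| <= rho -> `|x| <= rho ->
     [/\ `|motion xi0 M h x| <= 2 * `|h|, `|motion xi0 M h x - h *: (xi0 + x *m A)| <= C * h ^+ 2,
      `|motion xi0 M h x + motion xi0 M (- h) x - h ^+ 2 *: (x *m N)| <= C * `|h| ^+ 3
      & `|xi0 + x *m A| <= 2].
  move=> hr xr; have [||[A1 A2] A3 A4 A5 A6] := mot h x; [lra|lra|].
  by split; rewrite ?xA ?xN.
pose G0 w := dot ((xi0 + (w - z0) *m A) *m hess u w) (xi0 + (w - z0) *m A)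
  + dot (grad u w) ((w - z0) *m N)
  + c * (grad_square K Kf Kg b0 u w * dot (xi0 + (w - z0) *m A) (xi0 + (w - z0) *m A)).
pose q x := qP x + dot (x *m hess u z0) (x *m N).
have shift x : z0 + x - z0 = x by rewrite addrAC subrr add0r.
have segs z v (t : R) : `|z - z0| <= rho -> `|v| <= 2 * rho -> segment_in Om z v.
  move=> zr vr k k01; rewrite -(subrK z0 z) addrAC addrC; apply: ball.
  apply: le_lt_trans (ler_normD _ _) _; have := scale_norm_le v k01; lra.
(* 1/4 = 1/8 + 1/8: the error in the hypothesis and the one in [grad_first_order]. *)
have e40 : 0 < 4^-1 :> R by rewrite invr_gt0.
have lin2 : linear_part (fun x => lP x + dot (grad u z0) (x *m N)).
  by apply: linear_partD => //; exact: linear_part_dotM.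
have quad2 : quadratic_part q by apply: quadratic_partD => //; exact: quadratic_part_bil.
have [|||h0 h00 Hh] := @touch _ _ z0 rho 4^-1 rho G0
  (approximation z0 xi0 M A c) _ q rho0 e40 rho0 lin2 quad2.
- move=> x xr; rewrite /G0 /q shift.
  have [xd xd2] : `|x| < d /\ `|x| < d2 by split; lra.
  have := bound x xd; have := H2 x xd2; rewrite ler_norml => /andP[_].
  rewrite subrr !mul0mx addr0 unit_xi0 mulr1 [dot _ 0]dotC dot0l.
  move: (dot _ _) (dot _ _) (dot _ _) (dot _ _) (dot _ _) => a1 a2 a3 a4 a5.
  by move: (c * _) (c * _) (lP x) (qP x) (`|x| ^+ 2) => a6 a7 a8 a9 a10; lra.
- move=> e e0; have e20 : 0 < e / 2 by rewrite divr_gt0.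
  have e30 : 0 < e / (4 * (c + 1)) by rewrite divr_gt0 // mulr_gt0 // ltr_wpDl.
  have [|k1 k10 U1] := motion_second_difference frP st K1 Kf0 Kg0 b00 C0 rho0 rho_1 _ ball mot2 e20.
    by lra.
  have [|k2 k20 U2] := grad_square_quotient frP st K1 Kf0 Kg0 b00 rho0 _ ball e30; first by lra.
  exists (Num.min k1 (Num.min k2 rho)) => [|h hp]; first by rewrite !lt_min k10 k20.
  rewrite !lt_min => /andP[hk1 /andP[hk2 hr]] x xr.
  rewrite /approximation /G0 shift.
  have := U1 h hp hk1 x xr; have := U2 h hp hk2 x xr.
  have [||_ _ _ _ /andP[Y1 Y2]] := mot h x; [rewrite gtr0_norm //; lra|lra|].
  rewrite -xA in Y1 Y2; move: Y1 Y2.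
  move: (dot (xi0 + _) (xi0 + _)) (\sum_j _) (grad_square _ _ _ _ _ _) => Y S Q Y1 Y2 A1 A2.
  rewrite (_ : _ - _ = (h ^- 2 * (u (z0 + x + motion xi0 M h x) + (u (z0 + x + motion xi0 M (- h) x)
     + -2 * u (z0 + x))) - (dot ((xi0 + x *m A) *m hess u (z0 + x)) (xi0 + x *m A)
     + dot (grad u (z0 + x)) (x *m N))) + c * ((S - Q) * Y)); last first.
    by move: (dot _ _) (dot _ _) (h ^- 2 * _) => *; ring.
  apply: le_trans (ler_normD _ _) _.
  suff : `|c * ((S - Q) * Y)| <= e / 2 by lra.
  rewrite !normrM (ger0_norm c0) (ger0_norm (_ : 0 <= Y)); last by lra.
  have : c * (`|S - Q| * Y) <= c * (e / (4 * (c + 1)) * 2).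
    by rewrite ler_wpM2l // ler_pM //; lra.
  move=> /le_trans; apply; rewrite [leLHS](_ : _ = c / (c + 1) * (e / 2)); last first.
    by field; rewrite gt_eqF // ltr_wpDl.
  by rewrite ler_piMl ?(ltW e20) // ler_pdivrMr ?ltr_wpDl //; lra.
- exists rho => // h hp hr x xr.
  have zr : `|z0 + x - z0| <= rho by rewrite shift.
  have nh : `|h| = h := gtr0_norm hp.
  have [||A1 _ _ _] := mot2 h x; [lra|lra|]; have [||B1 _ _ _] := mot2 (- h) x; [rewrite normrN; lra|lra|].
  rewrite nh in A1; rewrite normrN nh in B1.
  have i1 : 0 <= (1 : R) <= 1 by rewrite lexx ler01.
  have end1 v : `|v| <= 2 * rho -> Om (z0 + x + v).
    by move=> vr; have := segs _ v 0 zr vr 1 i1; rewrite scale1r.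
  have [|||j|c1 [l1 Jt]] := @jet_approximation z0 xi0 M A c h (z0 + x); rewrite ?shift.
  + by rewrite -[_ + x]addr0; apply: end1; rewrite normr0; lra.
  + by apply: end1; lra.
  + by apply: end1; lra.
  + apply: end1; rewrite normrZ nh; apply: (@le_trans _ _ (h * 1)); last by lra.
    by rewrite ler_wpM2l ?(ltW hp) // norm_unit_vec.
  exact: jet_continuous Jt.
pose h := Num.min h0 rho / 2.
have mnh : 0 < Num.min h0 rho by rewrite lt_min h00.
have hp : 0 < h by rewrite divr_gt0.
have [hh0 hrho] : h < h0 /\ h < rho.
  have [a1 a2] : Num.min h0 rho <= h0 /\ Num.min h0 rho <= rho by rewrite !ge_min !lexx orbT.
  by rewrite /h; split; lra.
have nh : `|h| = h := gtr0_norm hp.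
have [z zr Hz] := Hh h hp hh0.
have zr' : `|z - z0| <= rho by exact: ltW.
have nh1 : `|h| <= rho1 by rewrite nh; lra.
have nz1 : `|z - z0| <= rho1 by lra.
have [[A1 _] _ A4 _ A6] := mot h (z - z0) nh1 nz1.
have nh2 : `|- h| <= rho1 by rewrite normrN.
have [[B1 _] _ _ _ _] := mot (- h) (z - z0) nh2 nz1.
have Oz : Om z by rewrite -(subrK z0 z) addrC; apply: ball; lra.
have h2 : 0 < h ^+ 2 by rewrite exprn_gt0.
(* The frame is chosen after h, at the touching point; its error h^2 becomes 1 after division by h^2
   and is part of [Ctouch]. *)
have [s [b [sb tr]]] := st_eq st Oz h2.
exists s, b; split => //.
rewrite nh in A1; rewrite normrN nh in B1; rewrite -xA in A6.
apply: (touching_sum (q := q) (r := r) (z0 := z0) (xi0 := xi0) (M := M) (A := A) (h := h) (z := z) (rp := rot h) (rm := rot (- h)) c0 hp _ sb tr).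
- by lra.
- by [].
- by rewrite /M mulNr.
- exact: rot1.
- exact: rot2.
- exact: rot1.
- exact: rot2.
- by apply: segs => //; apply: le_trans A1 _; lra.
- by apply: segs => //; apply: le_trans B1 _; lra.
- exact: A1.
- exact: B1.
- exact: A4.
- move=> j; apply: segs => //; rewrite normrZ nh; apply: (@le_trans _ _ (h * 1)); last by lra.
  by rewrite ler_wpM2l ?(ltW hp) // norm_unit_vec.
- exact: A6.
- move=> x; apply: (quotient_gradient (rho := d1) x Om_open (st_u st) H1 hp); lra.
move=> c1 l1 q1 Jt x; have := Hz _ _ _ Jt x; rewrite /q.
by rewrite (_ : 2 * 4^-1 = 2^-1) //; field.
Qed.

End TouchingInequality.

(** * The maximum of the ratio *)

Section TestArithmetic.
Variables (R : realType).

(** Young's inequality: half of a^2 y1 absorbs the terms linear in [a], and y1 >= 1/2 turns the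
    remainder into a power of [k]. *)
Lemma cross_term_arith (a k y1 D3 hp tau hx e2 : R) : 1 <= k -> 0 < y1 -> 1 <= 2 * y1 -> 0 <= e2 ->
  `|D3| <= k * e2 -> `|hp| <= k * e2 -> `|tau| <= k -> `|hx| <= k * e2 ->
  2 * a * (D3 + hp - tau * hx) <= (2^-1 * (a ^+ 2 * y1) + 36 * k ^+ 4) * e2.
Proof.
move=> k1 y10 y12 e20 H1 H2 H3 H4.
have k0 : 0 <= k by lra.
have th : `|tau * hx| <= k * (k * e2) by rewrite normrM ler_pM.
have kk : k * e2 <= k * (k * e2) by rewrite ler_wpM2l // ler_peMl.
have S : `|D3 + hp - tau * hx| <= 3 * (k * (k * e2)).
  by move: H1 H2 th; rewrite !ler_norml => /andP[? ?] /andP[? ?] /andP[? ?]; apply/andP; split; lra.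
have A0 : 0 <= `|a| := normr_ge0 a.
have B : 2 * a * (D3 + hp - tau * hx) <= 2 * `|a| * (3 * (k * (k * e2))).
  apply: le_trans (ler_norm _) _; rewrite !normrM (ger0_norm (_ : 0 <= 2)) //.
  by rewrite ler_wpM2l // mulr_ge0.
have key : 12 * k ^+ 2 * `|a| <= a ^+ 2 * y1 + 72 * k ^+ 4.
  have aE : a ^+ 2 = `|a| ^+ 2 by rewrite real_normK // num_real.
  rewrite aE -(ler_pM2r y10).
  have : 0 <= (`|a| * y1 - 6 * k ^+ 2) ^+ 2 by rewrite sqr_ge0.
  have : 0 <= k ^+ 4 * (2 * y1 - 1) by rewrite mulr_ge0 ?exprn_ge0 // subr_ge0.
  move: (`|a|) => A; lra.
have := ler_wpM2r e20 key; move: (`|a|) B => A B; lra.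
Qed.

(** The dilation contributes chi (y1 a)^2, which chi y1 <= 1 reduces to a^2 y1. *)
Lemma zero_order_arith (a k y1 chi0 tau r pp e2 : R) : 1 <= k -> 0 < y1 -> 0 <= chi0 -> chi0 <= 2 ->
  chi0 * y1 <= 1 -> 0 <= e2 -> `|tau| <= k -> r = y1 * a - tau -> pp <= k * e2 ->
  chi0 * (r ^+ 2 * e2 + pp) <= (2 * (a ^+ 2 * y1) + 6 * k ^+ 4) * e2.
Proof.
move=> k1 y10 c0 c2 cy e20 H3 -> H4.
have k0 : 0 <= k by lra.
have t2 : tau ^+ 2 <= k ^+ 2 by rewrite -(real_normK (num_real tau)) ler_sqr // nnegrE.
have k2 : 1 <= k ^+ 2 by rewrite expr_ge1.
have k24 : k ^+ 2 <= k ^+ 4 by rewrite -[4%N]/(2 + 2)%N exprD ler_peMr // exprn_ge0.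
have kk4 : k <= k ^+ 4 by apply: le_trans k24; rewrite expr2 ler_peMr.
have r2 : (y1 * a - tau) ^+ 2 <= 2 * (y1 * a) ^+ 2 + 2 * k ^+ 2.
  have : 0 <= (y1 * a + tau) ^+ 2 by rewrite sqr_ge0.
  lra.
have A1 : chi0 * ((y1 * a - tau) ^+ 2 * e2) <= chi0 * ((2 * (y1 * a) ^+ 2 + 2 * k ^+ 2) * e2).
  by rewrite ler_wpM2l // ler_wpM2r.
have A2 : chi0 * y1 * (2 * (a ^+ 2 * y1) * e2) <= 1 * (2 * (a ^+ 2 * y1) * e2).
  have a2 : 0 <= a ^+ 2 * y1 by rewrite mulr_ge0 ?sqr_ge0 // ltW.
  by rewrite ler_wpM2r // mulr_ge0 // mulr_ge0.
have A3 : chi0 * pp <= chi0 * (k * e2) by rewrite ler_wpM2l.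
have A4 : chi0 * (k * e2) <= 2 * (k * e2) by rewrite ler_wpM2r // mulr_ge0.
have A5 : chi0 * (2 * k ^+ 2 * e2) <= 2 * (2 * k ^+ 2 * e2).
  by rewrite ler_wpM2r // mulr_ge0 // mulr_ge0 // exprn_ge0.
have A6 : k * e2 <= k ^+ 4 * e2 by rewrite ler_wpM2r.
have A7 : k ^+ 2 * e2 <= k ^+ 4 * e2 by rewrite ler_wpM2r.
rewrite mulrDr; lra.
Qed.

(** The subtracted term in n^2 comes from the concave correction in [cutoff]; it absorbs the
    products of n with the rotation and with [tau]. *)
Lemma mixed_term_arith (k l0 chi1 n t wp tau e2 : R) : 1 <= k -> 0 < l0 -> 0 <= chi1 -> chi1 <= l0^-1 ->
  0 <= e2 -> t ^+ 2 <= e2 -> wp ^+ 2 <= k * e2 -> `|tau| <= k ->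
  chi1 * n * (2 * (wp - tau * t)) - 128 * k ^+ 2 / (2 * l0) * n ^+ 2 <= 16^-1 / l0 * e2.
Proof.
move=> k1 l00 c0 cl e20 H1 H2 H3.
have k0 : 0 < k by lra.
have k20 : 0 < k ^+ 2 by rewrite exprn_gt0.
have t2 : tau ^+ 2 <= k ^+ 2 by rewrite -(real_normK (num_real tau)) ler_sqr // nnegrE ltW.
have v2 : (wp - tau * t) ^+ 2 <= 4 * k ^+ 2 * e2.
  have B1 : tau ^+ 2 * t ^+ 2 <= k ^+ 2 * e2 by rewrite ler_pM ?sqr_ge0.
  have B2 : k * e2 <= k ^+ 2 * e2 by rewrite ler_wpM2r // expr2 ler_peMr // ltW.
  have : 0 <= (wp + tau * t) ^+ 2 by rewrite sqr_ge0.
  by lra.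
set v := wp - tau * t in v2 *.
have li : 0 < l0^-1 by rewrite invr_gt0.
have key : n * (2 * v) <= 64 * k ^+ 2 * n ^+ 2 + 16^-1 * e2.
  rewrite -(ler_pM2r k20).
  have : 0 <= (8 * k ^+ 2 * n - 8^-1 * v) ^+ 2 by rewrite sqr_ge0.
  lra.
have B0 : 0 <= 64 * k ^+ 2 * n ^+ 2 + 16^-1 * e2.
  apply: addr_ge0; last by rewrite mulr_ge0.
  by apply: mulr_ge0; [rewrite mulr_ge0 // ltW|exact: sqr_ge0].
have B1 : chi1 * (n * (2 * v)) <= l0^-1 * (64 * k ^+ 2 * n ^+ 2 + 16^-1 * e2).
  apply: le_trans (_ : chi1 * (64 * k ^+ 2 * n ^+ 2 + 16^-1 * e2) <= _).
    by rewrite ler_wpM2l.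
  by rewrite ler_wpM2r.
have -> : 128 * k ^+ 2 / (2 * l0) = 64 * k ^+ 2 * l0^-1 by field; rewrite gt_eqF.
lra.
Qed.

(** The first term is the cost of the concavity of the logarithmic scale, the second the cross term
    of chi' with the dilation. For eps = 0 their sum is at most (theta^2 / 2 - theta) t^2 / l0,
    which is nonpositive for theta between 0 and 1. *)
Lemma main_term_arith (l0 chi1 theta t eps e2 : R) : 0 < l0 -> 2^-1 / l0 <= chi1 -> chi1 <= l0^-1 ->
  0 <= theta -> theta <= 1 -> t ^+ 2 <= e2 ->
  (- theta * t + eps) ^+ 2 / (2 * l0) + 2 * chi1 * (- theta * t + eps) * t <=
  l0^-1 * (16^-1 * e2 + 37 * eps ^+ 2).
Proof.
move=> l00 c1 c2 th0 th1 te.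
rewrite -(ler_pM2l l00) mulrA divff ?gt_eqF // mul1r.
set x := l0 * chi1.
have x1 : 2^-1 <= x by rewrite /x mulrC -ler_pdivrMr.
have x2 : x <= 1 by rewrite /x mulrC -ler_pdivlMr // div1r.
have -> : l0 * ((- theta * t + eps) ^+ 2 / (2 * l0) + 2 * chi1 * (- theta * t + eps) * t) =
   2^-1 * (- theta * t + eps) ^+ 2 + 2 * x * (- theta * t + eps) * t.
  by rewrite /x; field; rewrite gt_eqF.
have T2 : 0 <= t ^+ 2 by rewrite sqr_ge0.
have B1 : 0 <= (2 * x - 1) * theta * t ^+ 2 by rewrite mulr_ge0 // mulr_ge0 //; lra.
have B2 : 0 <= (1 - theta) * theta * t ^+ 2 by rewrite mulr_ge0 // mulr_ge0 // subr_ge0.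
have B3 : (2 * x - theta) * t * eps <= 16^-1 * t ^+ 2 + 16 * eps ^+ 2.
  have w0 : 0 <= 2 * x - theta by lra.
  have w2 : (2 * x - theta) ^+ 2 <= 4 by rewrite (_ : 4 = 2 ^+ 2 :> R) ?ler_sqr ?nnegrE //; [lra|ring].
  have : 0 <= (4^-1 * t - 2 * (2 * x - theta) * eps) ^+ 2 by rewrite sqr_ge0.
  have : (2 * x - theta) ^+ 2 * eps ^+ 2 <= 4 * eps ^+ 2 by rewrite ler_wpM2r ?sqr_ge0.
  lra.
have B4 : 0 <= (theta * t) ^+ 2 by rewrite sqr_ge0.
have : 0 <= eps ^+ 2 by rewrite sqr_ge0.
lra.
Qed.

Lemma test_quadratic_arith (k l0 a y1 chi0 chi1 theta tau r t n eps hx D3 hp pp wp e2 : R) :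
  1 <= k -> 0 < l0 -> 42 * k ^+ 4 <= 8^-1 / l0 -> 0 < y1 -> 1 <= 2 * y1 ->
  0 <= chi0 -> chi0 <= 2 -> chi0 * y1 <= 1 -> 2^-1 / l0 <= chi1 -> chi1 <= l0^-1 ->
  0 <= theta -> theta <= 1 -> `|tau| <= k -> r = y1 * a - tau -> y1 * a * n = - theta * t + eps ->
  0 <= e2 -> t ^+ 2 <= e2 -> `|hx| <= k * e2 -> `|D3| <= k * e2 -> `|hp| <= k * e2 ->
  pp <= k * e2 -> wp ^+ 2 <= k * e2 ->
  2 * a * (D3 + (r * hx + hp)) - a ^+ 2 * (y1 * (2^-1 * hx) + - (y1 ^+ 2 / l0) / 2 * (n * n))
    + (chi0 * (r ^+ 2 * e2 + pp) + (chi1 * (2^-1 * hx) + - (128 * k ^+ 2 / l0) / 2 * (n * n))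
      + chi1 * n * (2 * (r * t + wp)))
  <= (3 / 2 * (a ^+ 2 * y1) + chi1 / 2) * hx + (5 / 2 * (a ^+ 2 * y1) + 4^-1 / l0) * e2
     + 37 / l0 * eps ^+ 2.
Proof.
move=> k1 l00 kl y10 y12 c0 c2 cy c3 c4 th0 th1 H1 rE etaE e20 H2 H3 H4 H5 H6 H7.
have li : 0 < l0^-1 by rewrite invr_gt0.
have c10 : 0 <= chi1 by apply: le_trans c3; rewrite mulr_ge0 // ltW.
have A1 := cross_term_arith a k1 y10 y12 e20 H4 H5 H1 H3.
have A2 := zero_order_arith k1 y10 c0 c2 cy e20 H1 rE H6.
have A3 := mixed_term_arith n k1 l00 c10 c4 e20 H2 H7 H1.
have A4 := main_term_arith eps l00 c3 c4 th0 th1 H2.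
rewrite -etaE in A4.
have A5 := ler_wpM2r e20 kl.
have E1 : 128 * k ^+ 2 / (2 * l0) = 64 * k ^+ 2 * l0^-1 by field; rewrite gt_eqF.
have E2 : (y1 * a * n) ^+ 2 / (2 * l0) = 2^-1 * ((y1 * a * n) ^+ 2 * l0^-1) by field; rewrite gt_eqF.
rewrite E1 in A3; rewrite E2 in A4; rewrite rE in A2; rewrite rE.
move: A2 A3 A4 A5; move: (l0^-1) => li0 A2 A3 A4 A5; lra.
Qed.

(** With W = a^2 y1, the trace of psi leaves M (- 7/4 W - 3/8 / l0) after the zero-order terms are
    paid. Each of the three costs [Q1], [Q2], [Q3] is at most M sig (1 + r^2), and r^2 is controlled
    by W, so together they cost at most M (W + 1/4 / l0). The term in [SX] on the lower side, of
    weight 1/8, absorbs two of weight 1/16. *)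
Lemma touching_contradiction (Ct Cb Cc k l0 kap cc M sig a y1 chi1 tau r SX SA Sh Sq : R) :
  1 <= k -> 0 < l0 -> 0 < kap -> 0 < cc -> 0 < M -> 0 < y1 -> y1 * kap <= 1 -> 2^-1 / l0 <= chi1 ->
  `|tau| <= k -> r = y1 * a - tau -> 0 <= Ct -> 0 <= Cb -> 0 <= Cc -> 0 <= SX -> Sh <= - 2 ->
  SA <= (r ^+ 2 + k) / 2 -> 0 <= sig -> cc * (Cb * k + Cc) <= sig -> 2 * Ct <= M * sig ->
  16 * k ^+ 2 <= M * sig * (M * cc) -> 592 <= M ^+ 2 * cc * kap ^+ 2 * l0 -> 6 * sig <= kap ->
  36 * k ^+ 2 * l0 * sig <= 1 ->
  - (Ct * (1 + `|r|)) + M * cc * (8^-1 * SX - Cb * SA - Cc) <= Sq ->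
  Sq <= M * ((3 / 2 * (a ^+ 2 * y1) + chi1 / 2) * Sh + (5 / 2 * (a ^+ 2 * y1) + 4^-1 / l0) / 2
      + 37 / l0 * (y1 / M) ^+ 2 * SX) + M * cc / 16 * SX + 16 * k ^+ 2 * (1 + r ^+ 2) / (M * cc) ->
  False.
Proof.
move=> k1 l00 kap0 cc0 M0 y10 yk c1 tk rE Ct0 Cb0 Cc0 SX0 Sh2 SA1 s0 h1 h2 h3 h4 h5 h6 low up.
have k0 : 0 <= k by lra.
have Mc0 : 0 < M * cc by rewrite mulr_gt0.
pose W := a ^+ 2 * y1; have W0 : 0 <= W by rewrite /W mulr_ge0 ?sqr_ge0 // ltW.
have li0 : 0 < l0^-1 by rewrite invr_gt0.
have c10 : 0 <= chi1 by apply: le_trans c1; rewrite mulr_ge0 // ltW.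
have t2 : tau ^+ 2 <= k ^+ 2 by rewrite -(real_normK (num_real tau)) ler_sqr // nnegrE.
pose rho := 1 + r ^+ 2.
have r20 : 0 <= r ^+ 2 by rewrite sqr_ge0.
have rho1 : 1 <= rho by rewrite /rho; lra.
have k21 : 1 <= k ^+ 2 by rewrite expr_ge1.
have rhoW : kap * rho <= 2 * W + 3 * k ^+ 2 * kap.
  have A1 : r ^+ 2 <= 2 * (y1 * W) + 2 * k ^+ 2.
    have : 0 <= (y1 * a + tau) ^+ 2 by rewrite sqr_ge0.
    by rewrite rE /W; lra.
  have A2 : y1 * kap * W <= 1 * W by rewrite ler_wpM2r.
  have A3 : kap * r ^+ 2 <= kap * (2 * (y1 * W) + 2 * k ^+ 2) by rewrite ler_wpM2l // ltW.
  have A4 : kap * 1 <= kap * k ^+ 2 by rewrite ler_wpM2l // ltW.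
  by rewrite /rho; lra.
have X1 : M * (37 / l0 * (y1 / M) ^+ 2 * SX) <= M * cc / 16 * SX.
  rewrite mulrA ler_wpM2r //.
  have yk2 : (y1 * kap) ^+ 2 <= 1 by rewrite exprn_ile1 // mulr_ge0 // ltW.
  have key : 592 * y1 ^+ 2 <= M ^+ 2 * cc * l0.
    have kk0 : 0 < kap ^+ 2 by rewrite exprn_gt0.
    rewrite -(ler_pM2r kk0); have : 592 * (y1 * kap) ^+ 2 <= 592 by lra.
    lra.
  rewrite [leLHS](_ : _ = (592 * y1 ^+ 2) / (16 * l0 * M)); last by field; rewrite !gt_eqF.
  rewrite ler_pdivrMr ?mulr_gt0 // [leRHS](_ : _ = M ^+ 2 * cc * l0) //; by field.
have Q1 : Ct * (1 + `|r|) <= M * sig * rho.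
  have n1 : `|r| <= 1 + r ^+ 2.
    have := sqr_ge0 (`|r| - 1); rewrite sqrrB real_normK ?num_real // expr1n mulr1.
    have := normr_ge0 r; lra.
  have B1 : Ct * (1 + `|r|) <= Ct * (2 * rho) by rewrite ler_wpM2l // /rho; lra.
  have B2 : 2 * Ct * rho <= M * sig * rho by rewrite ler_wpM2r //; lra.
  lra.
have Q2 : M * cc * (Cb * SA + Cc) <= M * sig * rho.
  have D1 : Cb * SA <= Cb * ((r ^+ 2 + k) / 2) by rewrite ler_wpM2l.
  have D2 : Cb * r ^+ 2 <= Cb * k * r ^+ 2 by rewrite ler_wpM2r // ler_peMr.
  have D3 : 0 <= Cb * k by rewrite mulr_ge0.
  have D4 : 0 <= Cb * k * r ^+ 2 by rewrite mulr_ge0.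
  have D5 : 0 <= Cc * r ^+ 2 by rewrite mulr_ge0.
  have D6 : Cb * SA + Cc <= (Cb * k + Cc) * rho by rewrite /rho; lra.
  have D7 : M * cc * (Cb * SA + Cc) <= M * cc * ((Cb * k + Cc) * rho) by rewrite ler_wpM2l // ltW.
  have D8 : (M * rho) * (cc * (Cb * k + Cc)) <= (M * rho) * sig.
    by rewrite ler_wpM2l // mulr_ge0 ?(ltW M0) //; lra.
  lra.
have Q3 : 16 * k ^+ 2 * (1 + r ^+ 2) / (M * cc) <= M * sig * rho.
  rewrite ler_pdivrMr // -/rho.
  have : 16 * k ^+ 2 * rho <= M * sig * (M * cc) * rho by rewrite ler_wpM2r //; lra.
  lra.
have Q4 : (3 / 2 * W + chi1 / 2) * Sh <= (3 / 2 * W + chi1 / 2) * - 2.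
  by rewrite ler_wpM2l //; lra.
have Q5 : M * ((3 / 2 * W + chi1 / 2) * Sh + (5 / 2 * W + 4^-1 / l0) / 2) <=
    M * (- (7 / 4 * W) - 3 / 8 / l0).
  by rewrite ler_wpM2l ?(ltW M0) //; move: (l0^-1) c1 Q4 => li c1 Q4; lra.
have Q6 : 3 * (sig * rho) <= W + 4^-1 / l0.
  have E1 : 6 * sig * rho <= kap * rho by rewrite ler_wpM2r //; lra.
  have E2 : 6 * sig * (kap * rho) <= 6 * sig * (2 * W + 3 * k ^+ 2 * kap).
    by rewrite ler_wpM2l // mulr_ge0.
  have E3 : 6 * sig * W <= kap * W by rewrite ler_wpM2r.
  have E4 : k ^+ 2 * sig <= 36^-1 / l0 by rewrite ler_pdivlMr //; lra.
  have E5 : kap * (k ^+ 2 * sig) <= kap * (36^-1 / l0) by rewrite ler_wpM2l // ltW.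
  rewrite -(ler_pM2l kap0); lra.
have Q7 : M * (3 * (sig * rho)) <= M * (W + 4^-1 / l0) by rewrite ler_wpM2l // ltW.
have Q8 : M * (- (7 / 4 * W) - 3 / 8 / l0) + M * (W + 4^-1 / l0) < 0.
  rewrite -mulrDr pmulr_rlt0 //; move: (l0^-1) li0 => li li0; lra.
move: up low Q5 X1; rewrite -/W.
move: (37 / l0 * (y1 / M) ^+ 2 * SX) (16 * k ^+ 2 * _ / _) Q3 => U V Q3 up low Q5 X1.
rewrite mulrDr in up; move: up Q5 Q7 Q8.
move: (M * (_ + _ / 2)) (M * (- _ - _)) (M * (W + _)) (M * U) X1 => S1 S2 S3 S4 X1 up Q5 Q7 Q8.
lra.
Qed.

End TestArithmetic.

Section ContinuityForms.
Variables (R : realType) (m : nat) (T : topologicalType).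
Implicit Types (t : T) (a b : T -> 'rV[R]_m) (H : T -> 'M[R]_m).

Lemma cont_dot a b t : (forall k, {for t, continuous (fun s => a s 0 k)}) ->
  (forall k, {for t, continuous (fun s => b s 0 k)}) ->
  {for t, continuous (fun s => dot (a s) (b s))}.
Proof.
move=> ca cb; rewrite (_ : (fun s => _) = (fun s => \sum_k a s 0 k * b s 0 k)).
  by apply: cont_sum => k; exact: cont_mul.
by apply/funext => s; rewrite dot_sum.
Qed.

Lemma cont_mulmx a H t : (forall k, {for t, continuous (fun s => a s 0 k)}) ->
  (forall k l, {for t, continuous (fun s => H s k l)}) ->
  forall k, {for t, continuous (fun s => (a s *m H s) 0 k)}.
Proof.
move=> ca cH k; rewrite (_ : (fun s => _) = (fun s => \sum_l a s 0 l * H s l k)).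
  by apply: cont_sum => l; exact: cont_mul.
by apply/funext => s; rewrite mxE.
Qed.

Lemma cont_inv (f : T -> R) t : f t != 0 -> {for t, continuous f} ->
  {for t, continuous (fun s => (f s)^-1)}.
Proof. by move=> f0 cf; exact: (cvgV f0 cf). Qed.

End ContinuityForms.

Section UnitVectors.
Variables (R : realType) (m : nat).
Implicit Types (x z : 'rV[R]_m).

Lemma entry_continuous (k : 'I_m) x : {for x, continuous (fun y : 'rV[R]_m => y 0 k)}.
Proof.
apply: continuous_of_eps => e e0; exists e => // w wx.
by apply: le_lt_trans wx; have := entry_le_norm (w - x) k; rewrite !mxE.
Qed.

Lemma normalize x : x != 0 -> exists2 a : R, 0 < a & dot (a *: x) (a *: x) = 1.
Proof.
move=> x0; have xx : 0 < dot x x.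
  by rewrite lt0r dot_ge0 andbT; apply: contra_neq x0; exact: dot_eq0.
exists (Num.sqrt (dot x x))^-1; first by rewrite invr_gt0 sqrtr_gt0.
rewrite !dotE mulrA -invfM -expr2 sqr_sqrtr ?dot_ge0 // mulVf // gt_eqF //.
Qed.

Lemma quadratic_le_unit (H : 'M[R]_m) (a : R) :
  (forall x, dot x x = 1 -> dot (x *m H) x <= a) -> forall x, dot (x *m H) x <= a * dot x x.
Proof.
move=> Ha x; have [->|x0] := eqVneq x 0; first by rewrite mul0mx !dotE mulr0.
have [k k0 kx] := normalize x0; have := Ha _ kx; move: kx.
rewrite -scalemxAl !dotE !mulrA -expr2 => kx Hk.
have k2 : 0 < k ^+ 2 by rewrite exprn_gt0.
by rewrite -(ler_pM2l k2) (mulrC a) mulrA kx mul1r.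
Qed.

Lemma compact_unit_sphere : compact [set x : 'rV[R]_m | dot x x = 1].
Proof.
apply: bounded_closed_compact.
  exists 1; split; rewrite ?num_real // => M M1 x /= xx.
  apply: le_trans (ltW M1); rewrite -[leRHS]sqrtr1 -xx -[leLHS]ger0_norm // -sqrtr_sqr.
  by rewrite ler_sqrt ?dot_ge0 // sqr_norm_le_dot.
have := @closed_comp _ _ (fun x : 'rV[R]_m => dot x x) [set t : R | t = 1].
apply; last exact: closed_eq.
by move=> x _; apply: cont_dot => k; exact: entry_continuous.
Qed.

Lemma ratio_maximum (S : set 'rV[R]_m) (Q B : 'rV[R]_m -> 'rV[R]_m -> R) z1 x1 : compact S ->
  (forall z x, S z -> dot x x = 1 -> 0 < B z x) ->
  (forall z x, S z -> dot x x = 1 -> {for (z, x), continuous (fun t => Q t.1 t.2)}) ->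
  (forall z x, S z -> dot x x = 1 -> {for (z, x), continuous (fun t => B t.1 t.2)}) ->
  S z1 -> dot x1 x1 = 1 ->
  exists z0 x0, [/\ S z0, dot x0 x0 = 1 & forall z x, S z -> dot x x = 1 ->
    Q z x <= Q z0 x0 / B z0 x0 * B z x].
Proof.
move=> cS B0 cQ cB Sz1 x11.
have [|||[z0 x0] [Sz0 xx0] Hmax] := @EVT_pointwise _ _ (S `*` [set x : 'rV[R]_m | dot x x = 1])
    (fun t => Q t.1 t.2 / B t.1 t.2).
- by exists (z1, x1).
- exact: (compact_setX cS compact_unit_sphere).
- move=> [z x] [/= Sz xx]; apply: cont_mul; first exact: cQ.
  by apply: cont_inv; [rewrite gt_eqF // B0|exact: cB].
exists z0, x0; split => // z x Sz xx.
by have := Hmax (z, x) (conj Sz xx); rewrite /= ler_pdivrMr // B0.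
Qed.

End UnitVectors.

(** * Interior propagation by translations *)

Section InteriorBound.
Variables (R : realType) (m : nat) (J : 'M[R]_m) (I : finType).
Variables (K Kf Kg b0 : R) (fr : (I -> 'rV[R]_m) -> R -> Prop).
Variables (Om : set 'rV[R]_m) (psi f g u : 'rV[R]_m -> R).
Hypothesis (frP : frames J b0 fr) (st : setting K Kf Kg fr Om psi f g u).
Hypothesis (K1 : 1 <= K) (Kf0 : 0 <= Kf) (Kg0 : 0 <= Kg) (b00 : 0 <= b0).
Implicit Types (z v w x : 'rV[R]_m).

Let Om_open : open Om := st_open st.
Let psi2 : Cclass 2 Om psi := Cclass_le (isT : (2 <= 4)%N) (psi_class st).
Let Ct := Ctouch m Kf b0.

Lemma Ctouch_ge0 : 0 <= Ct.
Proof. by rewrite /Ct /Ctouch addr_ge0 // !mulr_ge0. Qed.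

Lemma hess_u_continuous z k l : Om z -> {for z, continuous (fun w => hess u w k l)}.
Proof.
move=> Oz; rewrite (_ : (fun w => _) = partial [:: l; k] u).
  exact: ((st_u st).2 [:: l; k] z isT Oz).
by apply/funext => w; rewrite hess_entry.
Qed.

(** Without rotation, dilation and square term the motion is a translation along [xi]. At a maximum
    of u_(xi)(xi) - (Ct + 1) psi inside psi > mu, the linearized equation would read - Ct <= - (Ct +
    1). *)
Lemma interior_bound (mu N : R) : 0 < mu -> 0 <= N ->
  (forall z, Om z -> psi z = mu -> forall x, dot (x *m hess u z) x <= N * dot x x) ->
  forall z, Om z -> mu <= psi z -> forall x, dot (x *m hess u z) x <= (N + (Ct + 1) * K) * dot x x.
Proof.
move=> mu0 N0 HN z1 Oz1 z1mu; apply: quadratic_le_unit => xi xi1; rewrite leNgt; apply/negP => big.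
have Ct0 := Ctouch_ge0; pose C := Ct + 1; have C0 : 0 < C by rewrite /C ltr_wpDl.
pose Q z := dot (xi *m hess u z) xi.
have [|||z0 [cz0 z0mu] Hmax] := @EVT_pointwise _ _ [set z | closure Om z /\ mu <= psi z]
    (fun z => Q z - C * psi z).
- by exists z1; split => //; exact: Om_closure.
- exact: (compact_level st).
- move=> z [cz zmu]; have Oz : Om z by apply: (Om_of_psi st cz); exact: lt_le_trans zmu.
  apply: cont_sub; last first.
    by apply: cont_mul; [exact: cont_cst|exact: (partial_psi_continuous st (s := [::]) isT cz)].
  apply: cont_dot => [|k]; last exact: cont_cst.
  apply: cont_mulmx => [k|k l]; [exact: cont_cst|exact: hess_u_continuous].
have Oz0 : Om z0 by apply: (Om_of_psi st cz0); exact: lt_le_trans z0mu.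
have M1 := Hmax z1 (conj (Om_closure Oz1) z1mu).
have Cpsi : C * psi z1 <= C * K by rewrite ler_wpM2l ?(ltW C0) // (psi_le st).
have Cpsi0 : 0 <= C * psi z0 by rewrite mulr_ge0 ?(ltW C0) // ltW // (psi_gt0 st).
have z0mu' : mu < psi z0.
  rewrite lt_neqAle z0mu andbT; apply/eqP => E.
  have := HN z0 Oz0 (esym E) xi; rewrite xi1 mulr1 -/(Q z0) => QN.
  by move: big M1; rewrite -/(Q z1) -/C; lra.
have [d1 d10 H1] := open_eps Om_open Oz0.
have e0 : 0 < psi z0 - mu by rewrite subr_gt0.
have [d2 d20 H2] := continuous_eps (partial_psi_continuous st (s := [::]) isT cz0) e0.
have J0 := jet_Taylor Om_open Oz0 psi2.
have [_ _ Jp] := J0; have e1 : 0 < (8 * C)^-1 by rewrite invr_gt0 mulr_gt0.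
have [d3 d30 H3] := Jp _ e1.
have [lin quad _] := jetZ C J0.
have [||||||s [b [sb]]] := @transported_max _ _ _ _ _ _ _ _ _ _ _ _ _ _ frP st K1 Kf0 Kg0 b00
   z0 xi 0 0 0 0 0 (Num.min d1 (Num.min d2 d3)) _ _ _ _ _ _ xi1 Oz0 (lexx 0) lin quad.
- by rewrite trmx0 oppr0.
- by rewrite mul0mx mulmx0.
- by rewrite raddf0 addr0.
- by rewrite mul0mx scaler0 addr0.
- by rewrite !lt_min d10 d20.
- move=> x; rewrite !lt_min => /andP[x1 /andP[x2 x3]].
  rewrite !mul0r mulmx0 !addr0 -/(Q z0) -/(Q (z0 + x)).
  have Ox : Om (z0 + x) by apply: H1; rewrite addrAC subrr add0r.
  have : `|psi (z0 + x) - psi z0| < psi z0 - mu by apply: H2; rewrite addrAC subrr add0r.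
  rewrite ltr_norml => /andP[pl _].
  have px : mu <= psi (z0 + x) by lra.
  have := Hmax (z0 + x) (conj (Om_closure Ox) px).
  have := H3 x x3; rewrite ler_norml => /andP[_ /(ler_wpM2l (ltW C0))].
  rewrite [leRHS](_ : _ = 8^-1 * `|x| ^+ 2); last by field; rewrite gt_eqF.
  move: (dot _ x) (dot _ x) (psi _) (psi _) (`|x| ^+ 2) (Q _) (Q _) => a1 a2 a3 a4 a5 a6 a7.
  rewrite /=; lra.
rewrite mul0r addr0 normr0 addr0 mulr1 big_split /=.
rewrite [X in _ <= _ + X -> _]big1; last by move=> i _; rewrite mulmx0 dotC dot0l.
rewrite addr0 -!mulr_sumr -/(trace_op s psi z0) => E.
have := st_psi_sup st sb Oz0; move: E; rewrite -/Ct /C; move: (trace_op s psi z0) => S E S2.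
have : (Ct + 1) * (2^-1 * S) <= (Ct + 1) * - 1 by rewrite ler_wpM2l ?(ltW C0) //; lra.
lra.
Qed.

End InteriorBound.

Section TestJets.
Variables (R : realType) (m : nat).
Implicit Types (x z w : 'rV[R]_m) (A : 'M[R]_m) (f p Y X : 'rV[R]_m -> R).

Lemma eq_jet f f' z c c' l l' q q' : jet f z c l q -> f =1 f' -> c = c' -> l =1 l' -> q =1 q' ->
  jet f' z c' l' q'.
Proof. by move=> J0 /funext <- <- /funext <- /funext <-. Qed.

Lemma jet_affine_entry xi0 z0 A k :
  jet (fun w => (xi0 + (w - z0) *m A) 0 k) z0 (xi0 0 k) (fun x => (x *m A) 0 k) (fun _ => 0).
Proof.
split; [|exact: quadratic_part0|move=> e e0; exists 1 => // x _].
  rewrite (_ : (fun x => _) = (fun x => dot (delta_mx 0 k) (x *m A))); first exact: linear_part_dotM.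
  by apply/funext => x; rewrite dotC dot_deltar.
rewrite (_ : z0 + x - z0 = x) 1?mxE; last by rewrite addrAC subrr add0r.
rewrite (_ : _ - 0 = 0); last by ring.
by rewrite normr0 mulr_ge0 ?exprn_ge0 // ltW.
Qed.

(* [p^2/Y] agrees to second order with its tangent expression
   [2 a p - a^2 Y] once [p - a Y] vanishes to first order. *)
Lemma jet_tangent p Y X z (a Kp M y0 cX : R) ly qp qY lX qX :
  jet p z (a * y0) (fun x => a * ly x) qp -> jet Y z y0 ly qY -> jet X z cX lX qX ->
  exists c l, jet (fun w => M * (2 * a * p w - a ^+ 2 * Y w + Kp * ((p w - a * Y w) * (p w - a * Y w))
     + X w)) z c l (fun x => M * (2 * a * qp x - a ^+ 2 * qY x + qX x)).
Proof.
move=> Jp JY JX.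
have Jd : jet (fun w => p w - a * Y w) z 0 (fun _ => 0) (fun x => qp x - a * qY x).
  apply: (eq_jet (jetD Jp (jetZ (- a) JY))) => [w||x|x]; rewrite ?mulNr ?subrr //.
have J0 := jetZ M (jetD (jetD (jetD (jetZ (2 * a) Jp) (jetZ (- a ^+ 2) JY)) (jetZ Kp (jetM Jd Jd))) JX).
eexists; eexists; apply: (eq_jet J0) => [w||x|x]; rewrite ?mulNr //.
by congr (_ * _); congr (_ + _); ring.
Qed.

End TestJets.

(** * The similarity adapted to the level sets of psi *)

Section FieldJets.
Variables (R : realType) (m : nat) (J : 'M[R]_m) (I : finType).
Variables (K Kf Kg b0 : R) (fr : (I -> 'rV[R]_m) -> R -> Prop).
Variables (Om : set 'rV[R]_m) (psi f g u : 'rV[R]_m -> R).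
Hypothesis (frP : frames J b0 fr) (st : setting K Kf Kg fr Om psi f g u).
Hypothesis (K1 : 1 <= K) (Kf0 : 0 <= Kf) (Kg0 : 0 <= Kg) (b00 : 0 <= b0).
Hypothesis (JT : J^T = - J) (JJ : J *m J = - 1%:M).
Implicit Types (z v w x : 'rV[R]_m).

Let Om_open : open Om := st_open st.
Let psi2 : Cclass 2 Om psi := Cclass_le (isT : (2 <= 4)%N) (psi_class st).
Let psi3 : Cclass 3 Om psi := Cclass_le (isT : (3 <= 4)%N) (psi_class st).
Let K0 : 0 < K := lt_le_trans ltr01 K1.

(** One constant for all coefficients a m^j K^i produced by psi, with a <= 200, j <= 3 and i <=
    2. *)
Definition kbound : R := 200 * (m%:R + 1) ^+ 3 * K ^+ 2.

Let m0 : 0 <= m%:R :> R. Proof. exact: ler0n. Qed.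

Let kbound_arith (j : nat) (i : nat) (a : R) : (j <= 3)%N -> (i <= 2)%N -> 0 <= a -> a <= 200 ->
  a * m%:R ^+ j * K ^+ i <= kbound.
Proof.
move=> j3 i2 a0 a200; rewrite /kbound.
have K2p : 0 <= K ^+ i by rewrite exprn_ge0 // ltW.
have mj : 0 <= m%:R ^+ j :> R by rewrite exprn_ge0.
have mm : m%:R ^+ j <= (m%:R + 1) ^+ 3 :> R.
  apply: le_trans (_ : (m%:R + 1) ^+ j <= _).
    by rewrite lerXn2r ?nnegrE ?addr_ge0 // lerDl.
  by rewrite ler_weXn2l // lerDr.
apply: ler_pM; [exact: mulr_ge0|exact: K2p|exact: ler_pM|by rewrite ler_weXn2l].
Qed.

Lemma kbound_ge1 : 1 <= kbound.
Proof.
rewrite /kbound; have A : 1 <= (m%:R + 1) ^+ 3 :> R by rewrite expr_ge1 // lerDr.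
have B : 1 <= K ^+ 2 by exact: exprn_ege1.
have : 1 * 1 <= (m%:R + 1) ^+ 3 * K ^+ 2 :> R by exact: ler_pM.
by rewrite -mulrA; lra.
Qed.

Lemma hess_psi_entry z k l : Om z -> `|hess psi z k l| <= K.
Proof. by move=> Oz; rewrite hess_entry; exact: (st_psi_le st (s := [:: l; k])). Qed.

Lemma hess_psi_image z x : Om z -> dot (x *m hess psi z) (x *m hess psi z) <= m%:R ^+ 3 * K ^+ 2 * dot x x.
Proof.
move=> Oz; apply: le_trans (dot_le_sqr_norm _) _.
have : `|x *m hess psi z| <= m%:R * K * `|x|.
  apply: le_trans (norm_mulmx_le _ _) _; rewrite ler_wpM2r // ler_wpM2l //.
  by apply: norm_mx_le => [|k l]; [exact: ltW|exact: hess_psi_entry].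
move=> le; have : `|x *m hess psi z| ^+ 2 <= (m%:R * K * `|x|) ^+ 2.
  by rewrite ler_sqr ?nnegrE ?mulr_ge0 // ltW.
have := sqr_norm_le_dot x; rewrite -(ler_pM2l (exprn_gt0 2 K0)) => A /(ler_wpM2l m0) B.
apply: le_trans B _; have := ler_wpM2l (exprn_ge0 3 m0) A.
by lra.
Qed.

Lemma hess_psi_form z x : Om z -> `|dot (x *m hess psi z) x| <= kbound * dot x x.
Proof.
move=> Oz; apply: le_trans (bil_le x x (fun k l => hess_psi_entry k l Oz) (ltW K0)) _.
rewrite -mulrA -expr2; apply: ler_pM => //; rewrite ?exprn_ge0 ?sqr_norm_le_dot //.
  by rewrite mulr_ge0 ?exprn_ge0 // ltW.
by have := @kbound_arith 2 1 1 isT isT ler01 (ltW (ltac:(lra) : (1 : R) < 200)); rewrite mul1r expr1.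
Qed.

Lemma hess_psi_cross z P x : Om z -> dot (x *m P) (x *m P) <= 160 * m%:R ^+ 3 * K ^+ 2 * dot x x ->
  `|dot (x *m hess psi z) (x *m P)| <= kbound * dot x x.
Proof.
move=> Oz HP; have HH := hess_psi_image x Oz.
have B := @kbound_arith 3 2 81 isT isT (ltac:(lra)) (ltac:(lra)).
have e0 := dot_ge0 x.
have C := ler_wpM2r e0 B.
have := dot_ge0 (x *m hess psi z + x *m P); have := dot_ge0 (x *m hess psi z - x *m P).
rewrite !dotE ![dot (x *m P) (x *m hess _ _)]dotC ler_norml => A1 A2.
by apply/andP; split; lra.
Qed.

(** A skew matrix can send N = grad psi only to vectors orthogonal to N; [tau] removes the component
    of xi0 D^2 psi along N. What remains of the derivative of p is [tau] times that of psi, to be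
    corrected by the dilation. *)
Lemma rotation_field z0 xi0 : Om z0 -> psi z0 < lam1 m K -> dot xi0 xi0 = 1 ->
  exists P tau, [/\ P^T = - P, P *m J = J *m P, `|tau| <= kbound,
    forall x, dot (x *m P) (x *m P) <= kbound * dot x x
      /\ `|dot (x *m hess psi z0) (x *m P)| <= kbound * dot x x &
    grad psi z0 *m P = xi0 *m hess psi z0 - tau *: grad psi z0].
Proof.
move=> Oz0 pl unit0; have := grad_psi_ge frP st K1 Oz0 pl.
set N := grad psi z0; set H := hess psi z0 => NN.
have NN0 : 0 < dot N N by apply: lt_le_trans NN.
have Nx : N != 0 by apply: contraTneq NN0 => ->; rewrite dot0l ltxx.
pose tau := dot (xi0 *m H) N / dot N N.
pose w := xi0 *m H - tau *: N.
have Nw : dot N w = 0 by rewrite /w dotDr dotNr dotZr /tau divfK ?gt_eqF // dotC subrr.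
have [P [PT PJ Pw PP]] := skew_with_image JT JJ Nx Nw.
have HH := hess_psi_image xi0 Oz0; rewrite -/H unit0 mulr1 in HH.
have ww : dot w w <= m%:R ^+ 3 * K ^+ 2.
  apply: le_trans HH.
  have -> : dot (xi0 *m H) (xi0 *m H) = dot w w + tau ^+ 2 * dot N N.
    rewrite (_ : xi0 *m H = w + tau *: N); last by rewrite /w subrK.
    by move: (w) Nw => y Ny; rewrite !dotE (dotC y N) Ny; ring.
  by rewrite lerDl mulr_ge0 ?sqr_ge0 // ltW.
exists P, tau; split => //; last first.
  move=> x; have Px : dot (x *m P) (x *m P) <= 160 * m%:R ^+ 3 * K ^+ 2 * dot x x.
    apply: le_trans (PP x) _; rewrite ler_wpM2r ?dot_ge0 //.
    apply: le_trans (_ : 40 * (m%:R ^+ 3 * K ^+ 2 * 4) <= _); last by lra.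
    rewrite ler_wpM2l // ler_pM ?dot_ge0 ?invr_ge0 // ?dot_ge0 //.
    by rewrite -[leRHS]invrK lef_pV2 ?posrE ?invr_gt0.
  split; last exact: hess_psi_cross.
  apply: le_trans Px _; rewrite ler_wpM2r ?dot_ge0 //.
  exact: (@kbound_arith 3 2 160 isT isT (ltac:(lra)) (ltac:(lra))).
have N1 : `|N| <= K := grad_psi_norm st K1 Oz0.
have x1 : `|xi0| <= 1.
  by rewrite -[leRHS]sqrtr1 -unit0 -[leLHS]ger0_norm // -sqrtr_sqr ler_sqrt ?dot_ge0 // sqr_norm_le_dot.
rewrite /tau normrM normfV (gtr0_norm NN0) ler_pdivrMr //.
apply: le_trans (bil_le xi0 N (fun k l => hess_psi_entry k l Oz0) (ltW K0)) _.
have A : m%:R ^+ 2 * K * `|xi0| * `|N| <= m%:R ^+ 2 * K * 1 * K.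
  by rewrite ler_pM ?mulr_ge0 ?exprn_ge0 ?(ltW K0) // ler_wpM2l // mulr_ge0 ?exprn_ge0 // ltW.
apply: le_trans A _.
have B := @kbound_arith 2 2 4 isT isT (ltac:(lra)) (ltac:(lra)).
have : kbound * 4^-1 <= kbound * dot N N.
  by rewrite ler_wpM2l //; have := kbound_ge1; lra.
lra.
Qed.

(** Third derivatives of psi enter the estimate here, through [D3]. *)
Lemma jet_pairing z0 xi0 A : Om z0 -> `|xi0| <= 1 -> exists2 D3 : 'rV[R]_m -> R,
  forall x, `|D3 x| <= kbound * dot x x &
  jet (fun w => dot (grad psi w) (xi0 + (w - z0) *m A)) z0 (dot (grad psi z0) xi0)
    (fun x => dot (x *m hess psi z0) xi0 + dot (grad psi z0) (x *m A))
    (fun x => D3 x + dot (x *m hess psi z0) (x *m A)).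
Proof.
move=> Oz0 xi01.
pose Dk k x := 2^-1 * dot (x *m hess (partial [:: k] psi) z0) x.
exists (fun x => \sum_k xi0 0 k * Dk k x).
  move=> x; apply: le_trans (ler_norm_sum _ _ _) _.
  apply: (@le_trans _ _ (\sum_(k < m) 2^-1 * (m%:R ^+ 2 * K * dot x x))); last first.
    rewrite sum_cst_ord; have := @kbound_arith 3 1 (2^-1) isT isT (ltac:(lra)) (ltac:(lra)).
    by move=> /(ler_wpM2r (dot_ge0 x)); lra.
  apply: ler_sum => k _; rewrite normrM -[leRHS]mul1r ler_pM //.
    exact: le_trans (entry_le_norm _ _) xi01.
  rewrite /Dk normrM (gtr0_norm (_ : 0 < 2^-1)) ?invr_gt0 // ler_wpM2l ?invr_ge0 //.
  have Hk i j : `|hess (partial [:: k] psi) z0 i j| <= K.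
    by rewrite hess_entry; exact: (st_psi_le st (s := [:: j; i; k])).
  apply: le_trans (bil_le x x Hk (ltW K0)) _.
  rewrite -mulrA -expr2 ler_wpM2l ?sqr_norm_le_dot //.
  by rewrite mulr_ge0 ?exprn_ge0 // ltW.
have Jk k := jetM (jet_Taylor Om_open Oz0 (Cclass_partial k psi3)) (jet_affine_entry xi0 z0 A k).
apply: (eq_jet (jet_sum Jk)) => [w||x|x].
- by rewrite dot_sum; apply: eq_bigr => k _; rewrite grad_entry.
- by rewrite dot_sum; apply: eq_bigr => k _; rewrite grad_entry.
- rewrite (bil_sym x xi0 Om_open Oz0 psi2) hessE dot_sum -big_split /=.
  by apply: eq_bigr => k _; rewrite grad_entry addrC.
rewrite (bil_sym x (x *m A) Om_open Oz0 psi2) hessE -big_split /=.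
by apply: eq_bigr => k _; rewrite mulr0 add0r /Dk; ring.
Qed.

End FieldJets.

(** * The logarithmic scale *)

Section LogScale.
Variables (R : realType).
Implicit Types (s kap : R).

(** The solution of y' = 1 / (kap + s / l) with y(0) = 0, so that y'' = - y'^2 / l. It is at most s
    / kap near 0, yet exceeds any prescribed value at a fixed s once kap is small. *)
Definition logscale (kap l : R) s : R := l * (ln (kap * l + s) - ln (kap * l)).

Section Facts.
Variables (kap l : R).
Hypothesis (kap0 : 0 < kap) (l0 : 0 < l).
Let kl0 : 0 < kap * l. Proof. exact: mulr_gt0. Qed.

Lemma logscale_gt0 s : 0 < s -> 0 < logscale kap l s.
Proof.
move=> s0; rewrite mulr_gt0 // subr_gt0 ltr_ln ?posrE //; last by rewrite addr_gt0.
by rewrite ltrDl.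
Qed.

Lemma logscale_le s : 0 < s -> logscale kap l s <= s / kap.
Proof.
move=> s0; have E : kap * l + s = kap * l * (1 + s / (kap * l)) by field; rewrite !gt_eqF.
have q0 : 0 < s / (kap * l) by rewrite divr_gt0.
rewrite /logscale E lnM ?posrE //; last by rewrite addr_gt0.
rewrite addrAC subrr add0r [leRHS](_ : _ = l * (s / (kap * l))); last by field; rewrite !gt_eqF.
by rewrite ler_wpM2l ?(ltW l0) // le_ln1Dx //; lra.
Qed.

Lemma logscale_ge s A : kap * l * expR A <= s -> l * A <= logscale kap l s.
Proof.
move=> le; rewrite ler_wpM2l ?(ltW l0) // lerBrDl -[A in leLHS]expRK -lnM ?posrE ?expR_gt0 //.
have e0 : 0 < kap * l * expR A by rewrite mulr_gt0 // expR_gt0.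
rewrite ler_ln ?posrE //; first by apply: le_trans le _; rewrite lerDr ltW.
by rewrite addr_gt0 // (lt_le_trans e0).
Qed.

Lemma logscale_expansion s : 0 < s -> forall e : R, 0 < e -> exists2 d : R, 0 < d &
  forall t : R, `|t| < d -> `|logscale kap l (s + t) - logscale kap l s - l / (kap * l + s) * t
    - (- ((l / (kap * l + s)) ^+ 2 / l) / 2) * t ^+ 2| <= e * t ^+ 2.
Proof.
move=> s0 e e0; have c0 : 0 < kap * l + s by rewrite addr_gt0.
have el : 0 < e / l by rewrite divr_gt0.
have [d d0 Hd] := ln_expansion c0 el; exists d => // t /Hd; rewrite /logscale addrA.
move: (ln (kap * l + s + t)) (ln (kap * l + s)) (ln (kap * l)) => a b c.
rewrite (_ : l * (a - c) - l * (b - c) - l / (kap * l + s) * t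
   - (- ((l / (kap * l + s)) ^+ 2 / l) / 2) * t ^+ 2 =
   l * (a - b - (kap * l + s)^-1 * t - - (kap * l + s) ^- 2 / 2 * t ^+ 2)); last first.
  by field; rewrite !gt_eqF.
move=> le; rewrite normrM gtr0_norm // -ler_pdivlMl //; apply: le_trans le _.
by rewrite [leRHS](_ : _ = e / l * t ^+ 2) //; ring.
Qed.

End Facts.

Lemma linear_form_eq0 (b c : R) : (forall t : R, 0 <= 2 * b * t + c * t ^+ 2) -> b = 0.
Proof.
move=> H; have c1 : 0 < 1 + `|c| by rewrite ltr_pwDl.
have := H (- b / (1 + `|c|)).
rewrite (_ : _ + _ = b ^+ 2 * (c - 2 * (1 + `|c|)) / (1 + `|c|) ^+ 2); last by field; rewrite gt_eqF.
rewrite pmulr_lge0 ?invr_gt0 ?exprn_gt0 // => A.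
have neg : c - 2 * (1 + `|c|) < 0 by have := ler_norm c; have := normr_ge0 c; lra.
move: A; rewrite nmulr_lge0 // => A; apply/eqP; rewrite -sqrf_eq0 eq_le A sqr_ge0.
by [].
Qed.

End LogScale.

Lemma threshold_arith (R : realType) (k Ct Cn s c kap l M : R) : 0 < k ^+ 2 -> 0 <= Ct -> 0 <= Cn ->
  0 < kap -> 0 < l -> 0 < s -> 0 < c ->
  1 + 592 / (c * kap ^+ 2 * l) + 2 * Ct / s + 16 * k ^+ 2 / (s * c) + 2 * (Cn + 1) / kap <= M ->
  [/\ 592 <= M ^+ 2 * c * kap ^+ 2 * l, 2 * Ct <= M * s, 16 * k ^+ 2 <= M * s * (M * c), 1 <= M
    & 2 * (Cn + 1) <= M * kap].
Proof.
move=> k2 Ct0 Cn0 kap0 l0 s0 c0 le.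
have ckl : 0 < c * kap ^+ 2 * l by rewrite mulr_gt0 // mulr_gt0 // exprn_gt0.
have sc : 0 < s * c by rewrite mulr_gt0.
have t1 : 0 <= 592 / (c * kap ^+ 2 * l) by rewrite divr_ge0 ?ler0n // ltW.
have t2 : 0 <= 2 * Ct / s by rewrite divr_ge0 ?mulr_ge0 // ltW.
have t3 : 0 <= 16 * k ^+ 2 / (s * c) by rewrite divr_ge0 ?(ltW sc) // mulr_ge0 // ltW.
have t4 : 0 <= 2 * (Cn + 1) / kap by rewrite divr_ge0 ?(ltW kap0) // mulr_ge0 // addr_ge0.
have M1 : 1 <= M by lra.
have MM : M <= M ^+ 2 by rewrite expr2 ler_peMr // (le_trans ler01).
have u1 : 592 / (c * kap ^+ 2 * l) <= M by lra.
have u2 : 2 * Ct / s <= M by lra.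
have u3 : 16 * k ^+ 2 / (s * c) <= M by lra.
have u4 : 2 * (Cn + 1) / kap <= M by lra.
rewrite ler_pdivrMr // in u1; rewrite ler_pdivrMr // in u2.
rewrite ler_pdivrMr // in u3; rewrite ler_pdivrMr // in u4.
split => //.
- apply: le_trans u1 _; have := ler_wpM2r (ltW ckl) MM; lra.
- apply: le_trans u3 _; have := ler_wpM2r (ltW sc) MM; lra.
Qed.

(** * The ratio and its constants *)

Section InteriorRatio.
Variables (R : realType) (m : nat) (J : 'M[R]_m) (I : finType).
Variables (K Kf Kg b0 : R) (fr : (I -> 'rV[R]_m) -> R -> Prop).
Variables (Om : set 'rV[R]_m) (psi f g u : 'rV[R]_m -> R).
Hypothesis (frP : frames J b0 fr) (st : setting K Kf Kg fr Om psi f g u).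
Hypothesis (K1 : 1 <= K) (Kf0 : 0 <= Kf) (Kg0 : 0 <= Kg) (b00 : 0 <= b0).
Hypothesis (JT : J^T = - J) (JJ : J *m J = - 1%:M).
Implicit Types (z v w x : 'rV[R]_m).

Let Om_open : open Om := st_open st.
Let psi2 : Cclass 2 Om psi := Cclass_le (isT : (2 <= 4)%N) (psi_class st).
Let k := kbound m K.
Let k1 : 1 <= k := kbound_ge1 m K1.
Let Cg := Cgrad m K Kf Kg b0.
Let Cb := Cfield m K Kf Kg b0.
Let Cc := Csquare m K Kf Kg b0.
Let Ct := Ctouch m Kf b0.

(** Close to 1 / y' = kap + s / l, so that the product of cutoff and y' stays at most 1; the
    quadratic correction supplies the negative second derivative used in [mixed_term_arith]. *)
Definition cutoff (kap l s : R) : R := kap + (s - 128 * k ^+ 2 / 2 * s ^+ 2) / l.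

Lemma cutoff_expansion (kap l s : R) : 0 < l -> forall e : R, 0 < e -> exists2 d : R, 0 < d &
  forall t : R, `|t| < d -> `|cutoff kap l (s + t) - cutoff kap l s
    - (1 - 128 * k ^+ 2 * s) / l * t - (- (128 * k ^+ 2 / l) / 2) * t ^+ 2| <= e * t ^+ 2.
Proof.
move=> l0 e e0; exists 1 => // t _; rewrite (_ : _ - _ = 0).
  by rewrite normr0 mulr_ge0 ?sqr_ge0 // ltW.
by rewrite /cutoff; field; rewrite gt_eqF.
Qed.

(* The denominator of the ratio maximized near the boundary. *)
Definition ratio_form (kap l c : R) z x : R :=
  dot (grad psi z) x ^+ 2 / logscale kap l (psi z)
  + (cutoff kap l (psi z) - c * grad_square K Kf Kg b0 u z) * dot x x.

(** The quadratic form M B - D^2 u is nonnegative and vanishes at [xi0], so [xi0] lies in its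
    kernel. This is the critical-point equation in the direction variable. *)
Lemma ratio_critical (kap l c M : R) z0 xi0 :
  (forall x, dot (x *m hess u z0) x <= M * ratio_form kap l c z0 x) ->
  dot (xi0 *m hess u z0) xi0 = M * ratio_form kap l c z0 xi0 -> Om z0 ->
  forall x, dot (x *m hess u z0) xi0 = M * (dot (grad psi z0) xi0 / logscale kap l (psi z0)
     * dot (grad psi z0) x
     + (cutoff kap l (psi z0) - c * grad_square K Kf Kg b0 u z0) * dot xi0 x).
Proof.
move=> Hle Heq Oz0 x; apply/esym/eqP; rewrite -subr_eq0; apply/eqP.
apply: (@linear_form_eq0 _ _ (M * ratio_form kap l c z0 x - dot (x *m hess u z0) x)) => t.
have := Hle (xi0 + t *: x); rewrite -subr_ge0.
rewrite mulmxDl -scalemxAl {1}/ratio_form !dotE Heq (bil_sym xi0 x Om_open Oz0 (st_u st)).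
rewrite /ratio_form (dotC x xi0).
move: (logscale _ _ _)^-1 (dot _ _) (dot _ _) (dot _ _) (dot _ _) (dot _ _) (dot (grad psi z0) _) (dot (grad psi z0) _).
by move=> yi a1 a2 a3 a4 a5 a6 a7 H; apply: le_trans H _; rewrite le_eqVlt; apply/orP; left; apply/eqP; ring.
Qed.

(** The rate sig allowed to each of the three costs in [touching_contradiction]. *)
Definition small_rate (kap l : R) : R := Num.min (kap / 6) (36 * k ^+ 2 * l)^-1.

(** Small enough that the squares cost no more than [small_rate] and lower the cutoff by at most kap
    / 4. *)
Definition gradient_weight (kap l : R) : R :=
  Num.min (small_rate kap l / (Cb * k + Cc)) (kap / (16 * m%:R * Cg ^+ 2 + 1)).

(** Each summand secures one lower bound on the ratio M; 592 = 16 * 37, with 37 from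
    [main_term_arith]. *)
Definition ratio_threshold (kap l : R) : R :=
  1 + 592 / (gradient_weight kap l * kap ^+ 2 * l) + 2 * Ct / small_rate kap l
  + 16 * k ^+ 2 / (small_rate kap l * gradient_weight kap l) + 2 * (Ctan m K Kf Kg b0 + 1) / kap.

Let Cb0 : 0 <= Cb.
Proof. by rewrite /Cb /Cfield mulr_ge0 ?sqr_ge0 // mulr_ge0. Qed.

Let Cc1 : 1 <= Cc.
Proof.
rewrite /Cc /Csquare lerDr mulr_ge0 //; last by rewrite addr_ge0 // !mulr_ge0.
by rewrite mulr_ge0 ?(Cgrad_ge0 m K1 Kf0 Kg0 b00) // mulr_ge0.
Qed.

Lemma small_rate_gt0 (kap l : R) : 0 < kap -> 0 < l -> 0 < small_rate kap l.
Proof.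
move=> kap0 l0; have k0 : 0 < k by apply: lt_le_trans k1.
have k2 : 0 < k ^+ 2 by exact: exprn_gt0.
by rewrite lt_min divr_gt0 //= invr_gt0 mulr_gt0 // mulr_gt0.
Qed.

Let CbCc : 0 < Cb * k + Cc.
Proof. by rewrite ltr_wpDl ?(lt_le_trans ltr01 Cc1) // mulr_ge0 // (le_trans _ k1). Qed.

Lemma gradient_weight_gt0 (kap l : R) : 0 < kap -> 0 < l -> 0 < gradient_weight kap l.
Proof.
move=> kap0 l0; rewrite lt_min divr_gt0 ?small_rate_gt0 //= divr_gt0 //.
by rewrite ltr_wpDl // mulr_ge0 ?sqr_ge0 // mulr_ge0.
Qed.

Lemma ratio_constants (kap l M : R) : 0 < kap -> 0 < l -> ratio_threshold kap l <= M ->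
  let s := small_rate kap l in let c := gradient_weight kap l in
  [/\ [/\ c * (Cb * k + Cc) <= s, c * (4 * m%:R * Cg ^+ 2) <= kap / 4, 2 * Ct <= M * s
        & 16 * k ^+ 2 <= M * s * (M * c)],
      592 <= M ^+ 2 * c * kap ^+ 2 * l, 6 * s <= kap, 36 * k ^+ 2 * l * s <= 1
      & 1 <= M /\ 2 * (Ctan m K Kf Kg b0 + 1) <= M * kap].
Proof.
move=> kap0 l0 le s c; have s0 := small_rate_gt0 kap0 l0; have c0 := gradient_weight_gt0 kap0 l0.
rewrite -/s -/c in s0 c0; have k0 : 0 < k by apply: lt_le_trans k1.
have Ct0 : 0 <= Ct := Ctouch_ge0 m Kf0 b00.
have Cn0 : 0 <= Ctan m K Kf Kg b0 := Ctan_ge0 m K1 Kf0 Kg0 b00.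
have k2 : 0 < k ^+ 2 by exact: exprn_gt0.
have [h1 h2 h3 h4 h5] := threshold_arith k2 Ct0 Cn0 kap0 l0 s0 c0 le.
split; first split.
- by rewrite -ler_pdivlMr // /c ge_min lexx.
- have D0 : 0 < 16 * m%:R * Cg ^+ 2 + 1 by rewrite ltr_wpDl // mulr_ge0 ?sqr_ge0 // mulr_ge0.
  have : c <= kap / (16 * m%:R * Cg ^+ 2 + 1) by rewrite /c ge_min lexx orbT.
  by rewrite ler_pdivlMr //; lra.
- by [].
- exact: h3.
- exact: h1.
- have : s <= kap / 6 by rewrite /s ge_min lexx.
  lra.
- have D0 : 0 < 36 * k ^+ 2 * l by rewrite mulr_gt0 // mulr_gt0.
  by rewrite -ler_pdivlMl // mulr1 /s ge_min lexx orbT.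
by [].
Qed.

Lemma grad_square_bounds z : Om z -> 0 <= grad_square K Kf Kg b0 u z <= 4 * m%:R * Cg ^+ 2.
Proof.
move=> Oz; have Cg0 : 0 <= Cg := Cgrad_ge0 m K1 Kf0 Kg0 b00.
apply/andP; split; first by rewrite sumr_ge0 // => j _; rewrite -expr2 sqr_ge0.
have -> : 4 * m%:R * Cg ^+ 2 = m%:R * ((2 * Cg) * (2 * Cg)) by ring.
rewrite -sum_cst_ord; apply: ler_sum => j _.
have := gradient_bound frP st K1 Kf0 Kg0 b00 j Oz; rewrite -/Cg ler_norml => /andP[A B].
by apply: ler_pM; move: A B; move: (partial _ _ _) => p A B; lra.
Qed.

(** With k^2 s <= 1/336 the correction in the cutoff is a relative change below 1/4, and its
    derivative changes by less than half; 336 = 8 * 42 also serves [rate_arith]. *)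
Lemma cutoff_bounds (kap l s : R) : 0 < kap -> kap <= 16^-1 -> 0 < l -> 336 * k ^+ 4 * l <= 1 ->
  0 < s -> s <= l -> let chi := cutoff kap l s in let y := l / (kap * l + s) in
  let chi1 := (1 - 128 * k ^+ 2 * s) / l in
  [/\ kap + 3 / 4 * (s / l) <= chi /\ chi <= kap + s / l, chi * y <= 1, 1 <= 2 * y, y * kap <= 1
    & 2^-1 / l <= chi1 /\ chi1 <= l^-1].
Proof.
move=> kap0 kap1 l0 kl s0 sl chi y chi1.
have D0 : 0 < kap * l + s by rewrite addr_gt0 // mulr_gt0.
have k24 : k ^+ 2 <= k ^+ 4 by rewrite ler_weXn2l.
have ks : 336 * (k ^+ 2 * s) <= 1.
  have : k ^+ 2 * s <= k ^+ 4 * l by rewrite ler_pM ?sqr_ge0 // ltW.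
  lra.
have ks0 : 0 <= k ^+ 2 * s by rewrite mulr_ge0 ?sqr_ge0 // ltW.
have sl0 : 0 < s / l by rewrite divr_gt0.
have sl1 : s / l <= 1 by rewrite ler_pdivrMr // mul1r.
have E : chi = kap + (s / l) * (1 - 64 * (k ^+ 2 * s)).
  by rewrite /chi /cutoff; field; rewrite gt_eqF.
have A : kap + 3 / 4 * (s / l) <= chi.
  have : s / l * (3 / 4) <= s / l * (1 - 64 * (k ^+ 2 * s)) by rewrite ler_wpM2l ?(ltW sl0) //; lra.
  by rewrite E; lra.
have B : chi <= kap + s / l.
  have : s / l * (1 - 64 * (k ^+ 2 * s)) <= s / l * 1 by rewrite ler_wpM2l ?(ltW sl0) //; lra.
  by rewrite E; lra.
have yE : (kap + s / l) * y = 1 by rewrite /y; field; rewrite !gt_eqF.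
have y0 : 0 < y by rewrite divr_gt0.
split.
- by [].
- by rewrite -yE ler_wpM2r // ltW.
- have : (kap + s / l) * y <= 2 * y by rewrite ler_wpM2r ?(ltW y0) //; lra.
  by rewrite yE.
- have : 0 <= s / l * y by rewrite mulr_ge0 // ltW.
  by move: yE; rewrite mulrDl (mulrC y); lra.
have li : 0 < l^-1 by rewrite invr_gt0.
have a1 : 2^-1 <= 1 - 128 * k ^+ 2 * s by lra.
have a2 : 1 - 128 * k ^+ 2 * s <= 1 by lra.
split; first exact: (ler_wpM2r (ltW li) a1).
by have := ler_wpM2r (ltW li) a2; rewrite mul1r.
Qed.

End InteriorRatio.

Lemma collect_arith (R : realType) (M U V W E Y X hx e c2 c3 : R) :
  M * (W * E) <= M * (W * (Y * X)) ->
  M * (U * hx + V * e + W * E) + (c2 * X + c3 * e) <=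
  M * U * hx + (M * V + c3) * e + (M * (W * Y) + c2) * X.
Proof. lra. Qed.

(** p^2 / Y equals its tangent expression plus (p - a Y)^2 / Y, and 1 / Y <= 2 / y0 close to the
    maximum point. *)
Lemma tangent_bound_arith (R : realType) (a c1 l1 q1 e M c y0 Y X E p q V : R) : 0 < M -> 0 < y0 ->
  `|Y - y0| < y0 / 2 ->
  `|M * (2 * a * p - a ^+ 2 * Y + 2 / y0 * ((p - a * Y) * (p - a * Y)) + X * E) - c1 - l1 - q1| <= e ->
  V <= M * (p ^+ 2 / Y + (X - c * q) * E) -> V + M * c * (q * E) <= c1 + l1 + q1 + e.
Proof.
move=> M0 y00; rewrite ltr_norml => /andP[Ylo _]; rewrite ler_norml => /andP[_ up] le.
have y02 : 0 < y0 / 2 by rewrite divr_gt0.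
have Yx0 : y0 / 2 < Y by lra.
have Yp : 0 < Y by lra.
have tangent : p ^+ 2 / Y <= 2 * a * p - a ^+ 2 * Y + 2 / y0 * ((p - a * Y) * (p - a * Y)).
  rewrite (_ : p ^+ 2 / Y = 2 * a * p - a ^+ 2 * Y + Y^-1 * ((p - a * Y) * (p - a * Y))).
    rewrite lerD2l ler_wpM2r // -?expr2 ?sqr_ge0 //.
    by rewrite -[leRHS]invrK lef_pV2 ?posrE ?invr_gt0 ?divr_gt0 // invf_div ltW.
  by field; rewrite gt_eqF.
have := ler_wpM2l (ltW M0) tangent.
move: up le; rewrite !mulrDr; lra.
Qed.

Lemma cutoff_product_arith (R : realType) (chi cq y sl kap : R) : 0 < y -> 0 < kap -> 0 < sl ->
  sl <= 1 -> kap <= 16^-1 -> kap + 3 / 4 * sl <= chi -> chi <= kap + sl -> chi * y <= 1 ->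
  0 <= cq -> cq <= kap / 4 -> [/\ 0 <= y * (chi - cq), y * (chi - cq) <= 1, 0 <= chi & chi <= 2].
Proof.
move=> y0 kap0 sl0 sl1 kap1 lo hi cy cq0 cq1; split; [|apply: le_trans cy|lra|lra].
  by rewrite mulr_ge0 ?(ltW y0) //; lra.
by rewrite mulrC ler_wpM2r ?(ltW y0) //; lra.
Qed.

Lemma rate_arith (R : realType) (k l : R) : 0 < l -> 336 * k ^+ 4 * l <= 1 -> 42 * k ^+ 4 <= 8^-1 / l.
Proof. by move=> l0 kl; rewrite ler_pdivlMr //; lra. Qed.

(** * No interior maximum with a large ratio *)

Section RatioContradiction.
Variables (R : realType) (m : nat) (J : 'M[R]_m) (I : finType).
Variables (K Kf Kg b0 : R) (fr : (I -> 'rV[R]_m) -> R -> Prop).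
Variables (Om : set 'rV[R]_m) (psi f g u : 'rV[R]_m -> R).
Hypothesis (frP : frames J b0 fr) (st : setting K Kf Kg fr Om psi f g u).
Hypothesis (K1 : 1 <= K) (Kf0 : 0 <= Kf) (Kg0 : 0 <= Kg) (b00 : 0 <= b0).
Hypothesis (JT : J^T = - J) (JJ : J *m J = - 1%:M).
Implicit Types (z v w x : 'rV[R]_m).

Let Om_open : open Om := st_open st.
Let psi2 : Cclass 2 Om psi := Cclass_le (isT : (2 <= 4)%N) (psi_class st).

(** Young's inequality between D^2 u and the acceleration; the first term is to be absorbed by the
    squares of second derivatives. *)
Lemma cross_second_le (H P N : 'M[R]_m) (k r M : R) x : 1 <= k -> 0 < M ->
  (forall y, dot (y *m P) (y *m P) <= k * dot y y) -> N = P *m P + (2 * r) *: P ->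
  dot (x *m H) (x *m N) <= M / 16 * dot (x *m H) (x *m H) + 32 * k ^+ 2 * (1 + r ^+ 2) / M * dot x x.
Proof.
move=> k1 M0 HP NE; have k0 : 0 <= k by lra.
have xN : x *m N = x *m P *m P + (2 * r) *: (x *m P) by rewrite NE mulmxDr mulmxA scalemxAr.
have nN : dot (x *m N) (x *m N) <= 8 * k ^+ 2 * (1 + r ^+ 2) * dot x x.
  rewrite xN; apply: le_trans (dot_add_le _ _) _; rewrite dotZl dotZr.
  have A1 := HP x; have A2 := HP (x *m P); have A3 := ler_wpM2l k0 A1.
  have e0 := dot_ge0 x; have r2 : 0 <= r ^+ 2 by rewrite sqr_ge0.
  have A4 := ler_wpM2l r2 A1.
  have rx : 0 <= r ^+ 2 * dot x x by exact: mulr_ge0.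
  have kk : k <= k ^+ 2 by rewrite expr2 ler_peMr.
  have A5 := ler_wpM2r rx kk.
  have A6 : 0 <= k ^+ 2 * dot x x by rewrite mulr_ge0 // sqr_ge0.
  move: A1 A2 A3 A4 A5 A6; move: (dot (x *m P) _) (dot (x *m P *m P) _) (dot x x) => a b c; lra.
have A : dot (x *m H) (x *m N) <= M / 16 * dot (x *m H) (x *m H) + 4 / M * dot (x *m N) (x *m N).
  have := dot_ge0 ((M / 8) *: (x *m H) - x *m N).
  rewrite !dotE [dot (x *m N) (x *m H)]dotC.
  move: (dot (x *m H) (x *m H)) (dot (x *m N) (x *m N)) (dot (x *m H) (x *m N)) => c b a pos.
  have : 0 <= 4 / M * (M / 8 * (M / 8 * c) - M / 8 * a - (M / 8 * a - b)).
    rewrite mulr_ge0 // ?divr_ge0 ?(ltW M0) //; move: pos; lra.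
  rewrite (_ : _ * (_ - _ - _) = M / 16 * c - a + 4 / M * b); last by field; rewrite gt_eqF.
  lra.
apply: le_trans A _; rewrite lerD2l.
have : 4 / M * dot (x *m N) (x *m N) <= 4 / M * (8 * k ^+ 2 * (1 + r ^+ 2) * dot x x).
  by rewrite ler_wpM2l // divr_ge0 // ltW.
lra.
Qed.

(* The contradiction at an interior maximum of the ratio of [D^2 u] to [ratio_form]. *)
Lemma interior_ratio (kap l M d : R) z0 xi0 : 0 < kap -> kap <= 16^-1 -> 0 < l ->
  336 * kbound m K ^+ 4 * l <= 1 -> ratio_threshold m K Kf Kg b0 kap l <= M ->
  Om z0 -> psi z0 <= l -> psi z0 < lam1 m K -> dot xi0 xi0 = 1 -> 0 < d ->
  let c := gradient_weight m K Kf Kg b0 kap l in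
  (forall x, `|x| < d -> Om (z0 + x) /\ forall y, dot (y *m hess u (z0 + x)) y
     <= M * ratio_form K Kf Kg b0 psi u kap l c (z0 + x) y) ->
  dot (xi0 *m hess u z0) xi0 = M * ratio_form K Kf Kg b0 psi u kap l c z0 xi0 -> False.
Proof.
move=> kap0 kap1 l0 kl thr Oz0 sl slam unit0 d0 c Hmax Heq.
have k1 := kbound_ge1 m K1; pose k := kbound m K.
have [[h1 h2 h3 h4] h5 h6 h7 [M1 _]] := ratio_constants K1 Kf0 Kg0 b00 kap0 l0 thr.
have c0 : 0 < c := gradient_weight_gt0 m K1 Kf0 Kg0 b00 kap0 l0.
have sig0 : 0 < small_rate m K kap l := small_rate_gt0 m K1 kap0 l0.
rewrite -/c in h1 h2 h4 h5.
have M0 : 0 < M by lra.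
have s0 := psi_gt0 st Oz0.
have [[chilo chihi] chiy yy1 ykap [chi1lo chi1hi]] := cutoff_bounds K1 kap0 kap1 l0 kl s0 sl.
set s := psi z0 in s0 sl slam chilo chihi chiy yy1 ykap chi1lo chi1hi.
set chi := cutoff m K kap l s in chilo chihi chiy.
set y1 := l / (kap * l + s) in chiy yy1 ykap.
set chi1 := (1 - 128 * kbound m K ^+ 2 * s) / l in chi1lo chi1hi.
have D0 : 0 < kap * l + s by rewrite addr_gt0 // mulr_gt0.
have y10 : 0 < y1 by rewrite divr_gt0.
pose y0 := logscale kap l s; have y00 : 0 < y0 by exact: logscale_gt0.
set N := grad psi z0; set H := hess psi z0.
pose a := dot N xi0 / y0.
have pa : dot N xi0 = a * y0 by rewrite /a divfK // gt_eqF.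
have [P [tau [PT PJ tauk PP NP]]] := rotation_field frP st K1 JT JJ Oz0 slam unit0.
rewrite -/N -/H in NP.
(* The dilation rate that makes the derivative of p equal to [a] times that of Y, so that p - a Y
   vanishes to first order, as [jet_tangent] requires. *)
pose r := y1 * a - tau; pose A : 'M[R]_m := r%:M + P; pose Nm : 'M[R]_m := P *m P + (2 * r) *: P.
have xA x : x *m A = r *: x + x *m P by rewrite /A mulmxDr mul_mx_scalar.
have xi01 : `|xi0| <= 1.
  by rewrite -[leRHS]sqrtr1 -unit0 -[leLHS]ger0_norm // -sqrtr_sqr ler_sqrt ?dot_ge0 // sqr_norm_le_dot.
have [D3 D3b Jp0] := jet_pairing st K1 A Oz0 xi01; rewrite -/N -/H in Jp0.
have Jpsi := jet_Taylor Om_open Oz0 psi2; rewrite -/N -/H -/s in Jpsi.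
have JY := jet_comp Jpsi (logscale_expansion kap0 l0 s0); rewrite -/y1 -/y0 in JY.
have JX := jetM (jet_comp Jpsi (cutoff_expansion m K kap s l0)) (jet_field_norm xi0 z0 A z0).
rewrite -/chi -/chi1 in JX.
have Jp : jet (fun w => dot (grad psi w) (xi0 + (w - z0) *m A)) z0 (a * y0)
    (fun x => a * (y1 * dot N x)) (fun x => D3 x + dot (x *m H) (x *m A)).
  apply: (eq_jet Jp0) => // x; rewrite xA dotDr dotZr.
  have -> : dot N (x *m P) = - dot (N *m P) x by rewrite dot_mulmx PT mulmxN dotNr opprK.
  rewrite NP dotDl dotNl dotZl (bil_sym x xi0 Om_open Oz0 psi2) /r -/H.
  by move: (dot _ _) (dot _ _) => b1 b2; ring.
have [c1 [l1 Jt]] := jet_tangent (2 / y0) M Jp JY JX.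
have tv := jet_value Jt; case: (Jt) => lin quad Jtest.
have Z0 : (z0 - z0) *m A = 0 :> 'rV[R]_m by rewrite subrr mul0mx.
have q0 := grad_square_bounds frP st K1 Kf0 Kg0 b00 Oz0.
set q := grad_square _ _ _ _ _ z0 in q0.
have tv0 : c1 = dot (xi0 *m hess u z0) xi0 + M * c * q.
  rewrite -tv Heq /ratio_form -/N -/s -/q -/y0 -/chi !Z0 !addr0 pa unit0.
  by field; rewrite gt_eqF.
have e80 : 0 < 8^-1 :> R by rewrite invr_gt0.
have [d1 d10 Hd1] := Jtest _ e80.
have y02 : 0 < y0 / 2 by rewrite divr_gt0.
have [d2 d20 Hd2] := continuous_eps (jet_continuous JY) y02.
have Mc0 : 0 <= M * c by rewrite mulr_ge0 // ltW.
have [||||s' [b [sb low]]] := @transported_max _ _ _ _ _ _ _ _ _ _ _ _ _ _ frP st K1 Kf0 Kg0 b00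
   z0 xi0 P A Nm r (M * c) (Num.min d (Num.min d1 d2)) _ _ PT PJ _ _ unit0 Oz0 Mc0 lin quad.
- by [].
- by [].
- by rewrite !lt_min d0 d10.
- move=> x; rewrite !lt_min => /andP[xd /andP[xd1 xd2]].
  have [Ox Hx] := Hmax x xd; have := Hx (xi0 + x *m A).
  have shift : z0 + x - z0 = x by rewrite addrAC subrr add0r.
  have Hjet := Hd1 x xd1; rewrite shift in Hjet.
  have Hy := Hd2 (z0 + x); rewrite shift in Hy; have {}Hy := Hy xd2.
  move: Hjet Hy; rewrite /ratio_form -tv0 -/s -/y0 -/q.
  move: (logscale kap l (psi (z0 + x))) (cutoff m K kap l (psi (z0 + x))) => Yx Xx.
  move: (dot (grad psi (z0 + x)) (xi0 + x *m A)) (dot (xi0 + x *m A) (xi0 + x *m A)) => px Ex.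
  move: (grad_square _ _ _ _ _ (z0 + x)) (dot (_ *m hess u (z0 + x)) _) => qx Vx.
  by move=> up Ylo; exact: (tangent_bound_arith M0 y00 Ylo up).
have Hle y : dot (y *m hess u z0) y <= M * ratio_form K Kf Kg b0 psi u kap l c z0 y.
  by have [|_] := Hmax 0; rewrite ?normr0 // addr0.
have crit := ratio_critical st Hle Heq Oz0.
rewrite -/N -/s -/y0 -/q -/chi -/a in crit.
(* Multiplied by y1 / M, the critical-point equation becomes y1 a <N, x> = - th <xi0, x> + eps; the
   smallness of c q keeps th between 0 and 1. *)
pose th := y1 * (chi - c * q).
have cq : c * q <= kap / 4.
  apply: le_trans h2; rewrite ler_wpM2l ?(ltW c0) //; by case/andP: q0.
have cq0 : 0 <= c * q by rewrite mulr_ge0 ?(ltW c0) //; case/andP: q0.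
have sl0 : 0 < s / l by rewrite divr_gt0.
have sl1 : s / l <= 1 by rewrite ler_pdivrMr // mul1r.
have [th0 th1 chi0 chi2] := cutoff_product_arith y10 kap0 sl0 sl1 kap1 chilo chihi chiy cq0 cq.
rewrite -/th in th0 th1.
have kl4 : 42 * k ^+ 4 <= 8^-1 / l := rate_arith l0 kl.
have AAE x : dot (x *m A) (x *m A) = r ^+ 2 * dot x x + dot (x *m P) (x *m P).
  have xPx : dot x (x *m P) = 0 by rewrite dotC dot_skew.
  by rewrite xA !dotE (dotC (x *m P) x) xPx; ring.
pose SX := \sum_i dot (s' i *m hess u z0) (s' i *m hess u z0).
have each x : M * (2 * a * (D3 x + dot (x *m H) (x *m A)) - a ^+ 2 *
     (y1 * (2^-1 * dot (x *m H) x) + - (y1 ^+ 2 / l) / 2 * (dot N x * dot N x)) +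
     (chi * dot (x *m A) (x *m A) + dot (xi0 + (z0 - z0) *m A) (xi0 + (z0 - z0) *m A)
        * (chi1 * (2^-1 * dot (x *m H) x) + - (128 * k ^+ 2 / l) / 2 * (dot N x * dot N x))
      + chi1 * dot N x * (2 * dot (xi0 + (z0 - z0) *m A) (x *m A))))
     + dot (x *m hess u z0) (x *m Nm)
   <= M * (3 / 2 * (a ^+ 2 * y1) + chi1 / 2) * dot (x *m H) x
      + (M * (5 / 2 * (a ^+ 2 * y1) + 4^-1 / l) + 32 * k ^+ 2 * (1 + r ^+ 2) / (M * c)) * dot x x
      + (M * (37 / l * (y1 / M) ^+ 2) + M * c / 16) * dot (x *m hess u z0) (x *m hess u z0).
  rewrite Z0 addr0 unit0 mul1r AAE.
  have -> : dot (x *m H) (x *m A) = r * dot (x *m H) x + dot (x *m H) (x *m P) by rewrite xA !dotE.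
  have -> : dot xi0 (x *m A) = r * dot xi0 x + dot xi0 (x *m P) by rewrite xA !dotE.
  (* Its square is at most (y1 / M)^2 |x D^2 u|^2: a large M makes it absorbable by the squares. *)
  pose eps := y1 * dot (x *m hess u z0) xi0 / M.
  have etaE : y1 * a * dot N x = - th * dot xi0 x + eps.
    by rewrite /eps crit /th; field; rewrite gt_eqF.
  have CS y : dot xi0 y ^+ 2 <= dot y y by have := CauchySchwarz_dot xi0 y; rewrite unit0 mul1r.
  have eps2 : eps ^+ 2 <= (y1 / M) ^+ 2 * dot (x *m hess u z0) (x *m hess u z0).
    rewrite /eps mulrAC exprMn ler_wpM2l ?sqr_ge0 // dotC; exact: CS.
  have wp2 : dot xi0 (x *m P) ^+ 2 <= k * dot x x by apply: le_trans (CS _) (PP x).1.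
  have [HP hpb] := PP x; rewrite -/H in hpb.
  have := test_quadratic_arith k1 l0 kl4 y10 yy1 chi0 chi2 chiy chi1lo chi1hi th0 th1 tauk
    (erefl : r = y1 * a - tau) etaE (dot_ge0 x) (CS x) (hess_psi_form st K1 x Oz0) (D3b x) hpb HP wp2.
  rewrite -/k => /(ler_wpM2l (ltW M0)) B1.
  have B2 := cross_second_le (hess u z0) x k1 (mulr_gt0 M0 c0) (fun y => (PP y).1) (erefl : Nm = P *m P + (2 * r) *: P).
  have li : 0 <= 37 / l by rewrite divr_ge0 ?ler0n // ltW.
  have B3 : M * (37 / l * eps ^+ 2) <= M * (37 / l * ((y1 / M) ^+ 2 * dot (x *m hess u z0) (x *m hess u z0))).
    by rewrite ler_wpM2l ?(ltW M0) // ler_wpM2l.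
  apply: le_trans (lerD B1 B2) _; exact: collect_arith B3.
have up := ler_sum (index_enum I) (fun i (_ : true) => each (s' i)).
have S2 := st_psi_sup st sb Oz0; rewrite /trace_op -/H in S2.
have SA : \sum_i dot (s' i *m A) (s' i *m A) <= (r ^+ 2 + k) / 2.
  apply: (frame_sum_le frP sb) => i; have [HP _] := PP (s' i).
  by rewrite AAE mulrDl lerD2l.
have SX0 : 0 <= SX by rewrite sumr_ge0 // => i _; exact: dot_ge0.
have Cb0 : 0 <= Cfield m K Kf Kg b0 by rewrite /Cfield mulr_ge0 ?sqr_ge0 // mulr_ge0.
have Cc0 : 0 <= Csquare m K Kf Kg b0.
  rewrite /Csquare addr_ge0 // mulr_ge0 //; last by rewrite addr_ge0 // !mulr_ge0.
  by rewrite mulr_ge0 ?(Cgrad_ge0 m K1 Kf0 Kg0 b00) // mulr_ge0.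
apply: (touching_contradiction k1 l0 kap0 c0 M0 y10 ykap chi1lo tauk (erefl : r = y1 * a - tau)
  (Ctouch_ge0 m Kf0 b00) Cb0 Cc0 SX0 S2 SA (ltW sig0) h1 h3 h4 h5 h6 h7 low).
apply: le_trans up _; rewrite !big_split /= -!mulr_sumr (fr_norm frP sb) -/SX -/k le_eqVlt.
by apply/orP; left; apply/eqP; field; rewrite !gt_eqF.
Qed.

End RatioContradiction.

(** * Halving the bound between two levels *)

Section LevelBound.
Variables (R : realType) (m : nat) (J : 'M[R]_m) (I : finType).
Variables (K Kf Kg b0 : R) (fr : (I -> 'rV[R]_m) -> R -> Prop).
Variables (Om : set 'rV[R]_m) (psi f g u : 'rV[R]_m -> R).
Hypothesis (frP : frames J b0 fr) (st : setting K Kf Kg fr Om psi f g u).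
Hypothesis (K1 : 1 <= K) (Kf0 : 0 <= Kf) (Kg0 : 0 <= Kg) (b00 : 0 <= b0).
Hypothesis (JT : J^T = - J) (JJ : J *m J = - 1%:M).
Implicit Types (z v w x : 'rV[R]_m).

Let Om_open : open Om := st_open st.
Let K0 : 0 < K := lt_le_trans ltr01 K1.

(** So small that y(mu) >= 16 m K^2, hence p^2 / y <= 1/16 at level mu on unit vectors. *)
Definition level_rate (l mu : R) : R := Num.min 16^-1 (mu / l * expR (- (16 * m%:R * K ^+ 2 / l))).

Lemma compact_shell (a b : R) : compact [set z | closure Om z /\ (a <= psi z /\ psi z <= b)].
Proof.
apply: (subclosed_compact _ (compact_closure st)) => [|z []//].
apply: closed_of_eps => z nS; have [cz|ncz] := pselect (closure Om z); last first.
  have : open (~` closure Om) by rewrite openC; exact: closed_closure.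
  by move=> /open_eps/(_ ncz)[d d0 Hd]; exists d => // w /Hd ncw [].
have cont := partial_psi_continuous st (s := [::]) isT cz.
have [az|az] := leP a (psi z); last first.
  have e0 : 0 < a - psi z by rewrite subr_gt0.
  have [d d0 Hd] := continuous_eps cont e0; exists d => // w /Hd.
  by rewrite /= ltr_norml => /andP[_ A] [_ [B _]]; lra.
have e0 : 0 < psi z - b by rewrite subr_gt0 ltNge; apply/negP => zb; apply: nS.
have [d d0 Hd] := continuous_eps cont e0; exists d => // w /Hd.
by rewrite /= ltr_norml => /andP[A _] [_ [_ B]]; lra.
Qed.

Lemma ratio_form_scale (kap l c a : R) z x :
  ratio_form K Kf Kg b0 psi u kap l c z (a *: x) = a ^+ 2 * ratio_form K Kf Kg b0 psi u kap l c z x.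
Proof. by rewrite /ratio_form !dotE; move: (logscale _ _ _)^-1 => y; ring. Qed.

Lemma ratio_form_continuous (kap l c : R) z x : 0 < kap -> 0 < l -> Om z ->
  {for (z, x), continuous (fun t => ratio_form K Kf Kg b0 psi u kap l c t.1 t.2)}.
Proof.
move=> kap0 l0 Oz; have s0 := psi_gt0 st Oz.
have cx k : {for (z, x), continuous (fun t : 'rV[R]_m * 'rV[R]_m => t.2 0 k)}.
  by apply: (@continuous_comp _ _ _ (@snd _ _) (fun y : 'rV[R]_m => y 0 k) (z, x));
    [exact: cvg_snd|exact: entry_continuous].
have c1 (h : 'rV[R]_m -> R) : {for z, continuous h} ->
    {for (z, x), continuous (fun t : 'rV[R]_m * 'rV[R]_m => h t.1)}.
  by move=> ch; apply: (@continuous_comp _ _ _ (@fst _ _) h (z, x)); [exact: cvg_fst|exact: ch].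
have cz := Om_closure Oz.
have cpsi : {for z, continuous psi} := partial_psi_continuous st (s := [::]) isT cz.
rewrite /ratio_form; apply: cont_add; apply: cont_mul.
- rewrite (_ : (fun t => _) = (fun t : 'rV[R]_m * 'rV[R]_m => dot (grad psi t.1) t.2 * dot (grad psi t.1) t.2)).
    have cd : {for (z, x), continuous (fun t : 'rV[R]_m * 'rV[R]_m => dot (grad psi t.1) t.2)}.
      apply: cont_dot => k; last exact: cx.
      apply: (c1 (fun w => grad psi w 0 k)).
      rewrite (_ : (fun w => _) = partial [:: k] psi); last by apply/funext => w; rewrite grad_entry.
      exact: (partial_psi_continuous st (s := [:: k]) isT cz).
    exact: cont_mul.
  by apply/funext => t; rewrite expr2.
- apply: (c1 (fun w => (logscale kap l (psi w))^-1)); apply: cont_inv.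
    by rewrite gt_eqF // logscale_gt0.
  apply: cont_mul; first exact: cont_cst.
  apply: cont_sub; last exact: cont_cst.
  apply: (@continuous_comp _ _ _ (fun w => kap * l + psi w) (@ln R) z).
    by apply: cont_add; [exact: cont_cst|exact: cpsi].
  by apply: continuous_ln; rewrite addr_gt0 // mulr_gt0.
- apply: (c1 (fun w => cutoff m K kap l (psi w) - c * grad_square K Kf Kg b0 u w)).
  apply: cont_sub.
    apply: cont_add; first exact: cont_cst.
    apply: cont_mul; last exact: cont_cst.
    apply: cont_sub; first exact: cpsi.
    apply: cont_mul; first exact: cont_cst.
    rewrite (_ : (fun w => _) = (fun w => psi w * psi w)); first exact: cont_mul.
    by apply/funext => w; rewrite expr2.
  apply: cont_mul; first exact: cont_cst.
  apply: cont_sum => j.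
  have cu : {for z, continuous (fun w => partial [:: j] u w + Cgrad m K Kf Kg b0)}.
    by apply: cont_add; [exact: ((st_u st).2 [:: j] z isT Oz)|exact: cont_cst].
  exact: cont_mul.
by apply: cont_dot => k; exact: cx.
Qed.

Lemma level_rate_gt0 (l mu : R) : 0 < l -> 0 < mu -> 0 < level_rate l mu.
Proof. by move=> l0 mu0; rewrite lt_min invr_gt0 ltr0n /= mulr_gt0 ?expR_gt0 // divr_gt0. Qed.

Lemma ratio_form_lower (kap l : R) z x : 0 < kap -> kap <= 16^-1 -> 0 < l ->
  336 * kbound m K ^+ 4 * l <= 1 -> Om z -> psi z <= l -> dot x x = 1 ->
  dot (grad psi z) x ^+ 2 / logscale kap l (psi z) + 3 / 4 * kap + 3 / 4 * (psi z / l) <=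
  ratio_form K Kf Kg b0 psi u kap l (gradient_weight m K Kf Kg b0 kap l) z x.
Proof.
move=> kap0 kap1 l0 kl Oz sl xx; have s0 := psi_gt0 st Oz.
have [[chilo _] _ _ _ _] := cutoff_bounds K1 kap0 kap1 l0 kl s0 sl.
have [[_ h2 _ _] _ _ _ _] := ratio_constants K1 Kf0 Kg0 b00 kap0 l0 (lexx (ratio_threshold m K Kf Kg b0 kap l)).
have c0 := gradient_weight_gt0 m K1 Kf0 Kg0 b00 kap0 l0.
have /andP[_ q1] := grad_square_bounds frP st K1 Kf0 Kg0 b00 Oz.
have := ler_wpM2l (ltW c0) q1; rewrite /ratio_form xx mulr1.
move: h2 chilo; move: (gradient_weight _ _ _ _ _ _ _ * grad_square _ _ _ _ _ _) => A.
move: (gradient_weight _ _ _ _ _ _ _ * _) (cutoff _ _ _ _ _) (_ ^+ 2 / _) (psi z / l) => B C D E; lra.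
Qed.

(** 1/4 = 1/16 + 1/16 + 1/8: the term p^2 / y, the rate kap, and mu / l. *)
Lemma ratio_form_upper (l mu : R) z x : 0 < l -> 336 * kbound m K ^+ 4 * l <= 1 -> 0 < mu ->
  8 * mu <= l -> Om z -> psi z = mu -> dot x x = 1 ->
  ratio_form K Kf Kg b0 psi u (level_rate l mu) l
    (gradient_weight m K Kf Kg b0 (level_rate l mu) l) z x <= 4^-1.
Proof.
move=> l0 kl mu0 mul Oz zmu xx; set kap := level_rate l mu; have kap0 : 0 < kap := level_rate_gt0 l0 mu0.
have kap1 : kap <= 16^-1 by rewrite /kap ge_min lexx.
have c0 := gradient_weight_gt0 m K1 Kf0 Kg0 b00 kap0 l0.
have sl : psi z <= l by rewrite zmu; lra.
have [[_ chihi] _ _ _ _] := cutoff_bounds K1 kap0 kap1 l0 kl (psi_gt0 st Oz) sl.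
have /andP[q0 _] := grad_square_bounds frP st K1 Kf0 Kg0 b00 Oz.
have cq := mulr_ge0 (ltW c0) q0.
have mul8 : mu / l <= 8^-1 by rewrite ler_pdivrMr //; lra.
have Y : 16 * m%:R * K ^+ 2 <= logscale kap l (psi z).
  rewrite zmu; have E : l * (16 * m%:R * K ^+ 2 / l) = 16 * m%:R * K ^+ 2 by field; rewrite gt_eqF.
  rewrite -E; apply: logscale_ge => //.
  have : kap <= mu / l * expR (- (16 * m%:R * K ^+ 2 / l)) by rewrite /kap ge_min lexx orbT.
  rewrite expRN; set e := expR _ => le; have e0 : 0 < e by exact: expR_gt0.
  have := ler_wpM2r (ltW (mulr_gt0 l0 e0)) le.
  by rewrite (_ : mu / l * e^-1 * (l * e) = mu) ?mulrA //; field; rewrite !gt_eqF.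
have Y0 : 0 < logscale kap l (psi z) by rewrite logscale_gt0 // (psi_gt0 st).
have P : dot (grad psi z) x ^+ 2 / logscale kap l (psi z) <= 16^-1.
  rewrite ler_pdivrMr //; apply: le_trans (CauchySchwarz_dot _ _) _; rewrite xx mulr1.
  apply: le_trans (dot_le_sqr_norm _) _.
  have : `|grad psi z| ^+ 2 <= K ^+ 2 by rewrite ler_sqr ?nnegrE ?(ltW K0) //; exact: grad_psi_norm st K1 z Oz.
  move=> /(ler_wpM2l (ler0n R m)); lra.
rewrite /ratio_form xx mulr1; rewrite zmu in chihi P *.
move: P cq chihi; move: (gradient_weight _ _ _ _ _ _ _ * grad_square _ _ _ _ _ _) => A.
move: (cutoff _ _ _ _ _) (_ ^+ 2 / _) (mu / l) mul8 => C D E *; lra.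
Qed.

(** The denominator of the ratio is at most 1/4 at level mu and at least 3/4 at level l. A large
    second derivative at level mu thus forces a ratio M too large for level l; tangential control
    excludes a low level, and [interior_ratio] excludes everything between. *)
Lemma level_bound (l mu N : R) : 0 < l -> l < lam1 m K -> 336 * kbound m K ^+ 4 * l <= 1 ->
  0 < mu -> 8 * mu <= l -> 0 <= N ->
  (forall z, Om z -> psi z = l -> forall x, dot (x *m hess u z) x <= N * dot x x) ->
  forall z, Om z -> psi z = mu -> forall x, dot (x *m hess u z) x <=
    (N / 2 + ratio_threshold m K Kf Kg b0 (level_rate l mu) l) * dot x x.
Proof.
move=> l0 llam kl mu0 mul N0 HN z1 Oz1 z1mu; apply: quadratic_le_unit => x1 x11.
set kap := level_rate l mu; have kap0 : 0 < kap := level_rate_gt0 l0 mu0.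
have kap1 : kap <= 16^-1 by rewrite /kap ge_min lexx.
set M1 := ratio_threshold _ _ _ _ _ _ _; rewrite leNgt; apply/negP => big.
pose c := gradient_weight m K Kf Kg b0 kap l.
pose B := ratio_form K Kf Kg b0 psi u kap l c.
pose Q z x := dot (x *m hess u z) x.
have [_ _ _ _ [M11 M1kap]] := ratio_constants K1 Kf0 Kg0 b00 kap0 l0 (lexx M1).
have [Cu [lam [Cu0 lam0 Htan]]] := tangential frP st K1 Kf0 Kg0 b00.
(* The lowest level depends on [u] through [Cu] and [lam], but [M1] does not. Since y(lu) <= lu /
   kap <= M1 / (Cu + 1), the term M p^2 / y there outweighs [Cu] p^2. *)
pose lu := Num.min (mu / 2) (Num.min (lam / 2) (M1 * kap / (Cu + 1))).
have Cu1 : 0 < Cu + 1 by rewrite ltr_wpDl.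
have M10 : 0 < M1 by exact: lt_le_trans M11.
have lu0 : 0 < lu by rewrite !lt_min !divr_gt0 // mulr_gt0.
have [lu1 lu2 lu3] : [/\ lu <= mu / 2, lu <= lam / 2 & lu <= M1 * kap / (Cu + 1)].
  by split; rewrite !ge_min lexx ?orbT.
pose S := [set z | closure Om z /\ (lu <= psi z /\ psi z <= l)].
have OS z : S z -> Om z by move=> [cz [lz _]]; apply: (Om_of_psi st cz); apply: lt_le_trans lz.
have low z x : S z -> dot x x = 1 ->
    dot (grad psi z) x ^+ 2 / logscale kap l (psi z) + 3 / 4 * kap + 3 / 4 * (psi z / l) <= B z x.
  by move=> Sz xx; apply: ratio_form_lower => //; [exact: OS|case: Sz => _ []].
have Y0 z : S z -> 0 < logscale kap l (psi z).
  by move=> Sz; rewrite logscale_gt0 // (psi_gt0 st (OS z Sz)).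
have sl0 z : S z -> 0 < psi z / l by move=> Sz; rewrite divr_gt0 // (psi_gt0 st (OS z Sz)).
have P0 z x : S z -> 0 <= dot (grad psi z) x ^+ 2 / logscale kap l (psi z).
  by move=> Sz; rewrite divr_ge0 ?sqr_ge0 // ltW // Y0.
have B0 z x : S z -> dot x x = 1 -> 0 < B z x.
  move=> Sz xx; apply: lt_le_trans (low z x Sz xx).
  by have := P0 z x Sz; have := sl0 z Sz; move: (_ / logscale _ _ _) (psi z / l) => a b; lra.
have Sz1 : S z1 by split; [exact: Om_closure|rewrite z1mu; split; lra].
have cS : compact S by exact: compact_shell.
have [||z0 [x0 [Sz0 x00 Hmax]]] := ratio_maximum (Q := Q) cS B0 _ _ Sz1 x11.
- move=> z x Sz xx; have Oz := OS z Sz.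
  have cx k : {for (z, x), continuous (fun t : 'rV[R]_m * 'rV[R]_m => t.2 0 k)}.
    by apply: (@continuous_comp _ _ _ (@snd _ _) (fun y : 'rV[R]_m => y 0 k) (z, x));
      [exact: cvg_snd|exact: entry_continuous].
  apply: cont_dot => k; last exact: cx.
  apply: cont_mulmx => [j|j j']; first exact: cx.
  by apply: (@continuous_comp _ _ _ (@fst _ _) (fun w => hess u w j j') (z, x));
    [exact: cvg_fst|exact: (hess_u_continuous st)].
- by move=> z x Sz xx; apply: ratio_form_continuous => //; exact: OS.
have Oz0 := OS _ Sz0; have B00 := B0 _ _ Sz0 x00.
set M := Q z0 x0 / B z0 x0 in Hmax.
have QM : Q z0 x0 = M * B z0 x0 by rewrite /M divfK // gt_eqF.
have Bz1 : B z1 x1 <= 4^-1 by exact: ratio_form_upper.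
have B10 := B0 _ _ Sz1 x11.
have Mbig : 4 * M1 + 2 * N <= M.
  have A := Hmax _ _ Sz1 x11; rewrite -/(Q z1 x1) in big.
  have M0 : 0 < M.
    by rewrite -(pmulr_lgt0 _ B10); apply: lt_le_trans A; apply: le_lt_trans big; lra.
  have := ler_wpM2l (ltW M0) Bz1; lra.
have M0 : 0 < M by lra.
have le_all z : S z -> forall x, dot (x *m hess u z) x <= M * B z x.
  move=> Sz x; have [->|xx] := eqVneq x 0.
    rewrite mul0mx dot0l (_ : 0 = 0 *: (0 : 'rV[R]_m)) ?scaler0 // /B.
    by rewrite -[in leRHS](scale0r (0 : 'rV[R]_m)) ratio_form_scale expr0n mul0r mulr0.
  have [k k0 kx] := normalize xx; have := Hmax z (k *: x) Sz kx.
  rewrite /Q /B -scalemxAl ratio_form_scale !dotE mulrA -expr2 [leRHS]mulrCA.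
  by rewrite ler_pM2l // exprn_gt0.
have [_ [luz zl]] := Sz0.
have low0 := low _ _ Sz0 x00.
(* On the upper level 3/4 M <= N, against M >= 4 M1 + 2 N. *)
have [zl1|zl1] := eqVneq (psi z0) l.
  have := HN z0 Oz0 zl1 x0; rewrite x00 mulr1 -/(Q z0 x0) QM => A.
  have := P0 z0 x0 Sz0; rewrite zl1 divff ?gt_eqF // in low0 * => P.
  have b1 : 3 / 4 <= B z0 x0 by move: low0 P; move: (_ / logscale _ _ _) => a; lra.
  have := ler_wpM2l (ltW M0) b1; lra.
(* On the lowest level the cutoff leaves 3/4 M kap, more than the tangential bound [Ctan] + 1,
   because M1 kap >= 2 (Ctan + 1). *)
have [lz1|lz1] := eqVneq (psi z0) lu.
  have zlam : psi z0 < lam by rewrite lz1; lra.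
  have := Htan z0 x0 Oz0 zlam; rewrite -/(Q z0 x0) QM x00 mulr1 => A.
  have Yle : logscale kap l (psi z0) * (Cu + 1) <= M1.
    have s0 : 0 < psi z0 by rewrite lz1.
    have := logscale_le kap0 l0 s0; rewrite lz1 => le1.
    have le2 : lu / kap <= M1 / (Cu + 1).
      by rewrite ler_pdivrMr // mulrAC.
    by rewrite -ler_pdivlMr //; exact: le_trans le1 le2.
  have Y1 := Y0 _ Sz0; have := sl0 _ Sz0.
  have p2 : Cu * dot (grad psi z0) x0 ^+ 2 <= M * (dot (grad psi z0) x0 ^+ 2 / logscale kap l (psi z0)).
    rewrite mulrA ler_pdivlMr // mulrAC ler_wpM2r ?sqr_ge0 //.
    by move: Yle Y1; move: (logscale _ _ _) => Y; lra.
  move=> sl; have B1 := ler_wpM2l (ltW M0) low0.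
  have Mk : M1 * kap <= M * kap by rewrite ler_wpM2r ?(ltW kap0) //; lra.
  have Msl : 0 <= M * (3 / 4 * (psi z0 / l)).
    by apply: mulr_ge0; [exact: ltW|apply: mulr_ge0 => //; exact: ltW].
  have Cn0 := Ctan_ge0 m K1 Kf0 Kg0 b00.
  move: B1 A p2 Msl; rewrite !mulrDr.
  move: (M * (_ / logscale _ _ _)) (Cu * _) (M * B z0 x0) (M * (3 / 4 * (_ / _))) => a1 a2 a3 a4; lra.
have luz' : lu < psi z0 by rewrite lt_neqAle eq_sym lz1.
have zl' : psi z0 < l by rewrite lt_neqAle zl1.
have e1 : 0 < psi z0 - lu by rewrite subr_gt0.
have e2 : 0 < l - psi z0 by rewrite subr_gt0.
have cont := partial_psi_continuous st (s := [::]) isT (Om_closure Oz0).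
have [d1 d10 H1] := open_eps Om_open Oz0.
have [d2 d20 H2] := continuous_eps cont e1; have [d3 d30 H3] := continuous_eps cont e2.
apply: (interior_ratio (d := Num.min d1 (Num.min d2 d3)) frP st K1 Kf0 Kg0 b00 JT JJ kap0 kap1 l0 kl
  (M := M) (_ : M1 <= M) Oz0 zl (lt_trans zl' llam) x00).
- lra.
- by rewrite !lt_min d10 d20.
- move=> x; rewrite !lt_min => /andP[xd1 /andP[xd2 xd3]].
  have sh : `|z0 + x - z0| = `|x| by rewrite addrAC subrr add0r.
  have Ox : Om (z0 + x) by apply: H1; rewrite sh.
  split => // y; apply: le_all; split; first exact: Om_closure.
  have := H2 (z0 + x); have := H3 (z0 + x); rewrite sh => /(_ xd3) A3 /(_ xd2).
  move: A3; rewrite /= !ltr_norml => /andP[_ A] /andP[A' _]; split; lra.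
exact: QM.
Qed.

End LevelBound.

(** * Two-sided bounds from the trace *)

Section PositiveForms.
Variables (R : realType) (m : nat).

(** Positivity on combinations of two basis vectors bounds each off-diagonal contribution by the
    mean of two diagonal ones; the factor m is the price of summing these entrywise. *)
Lemma psd_le_trace (G : 'M[R]_m) x : G^T = G -> (forall y, 0 <= dot (y *m G) y) ->
  dot (x *m G) x <= m%:R * \tr G * dot x x.
Proof.
move=> GT pos.
have entry k l : dot (delta_mx 0 k *m G) (delta_mx 0 l) = G k l.
  by rewrite dot_deltar -rowE mxE.
have diag0 k : 0 <= G k k by rewrite -entry.
have xk k : x 0 k ^+ 2 <= dot x x.
  rewrite dot_sum (bigD1 k) //= -expr2 lerDl sumr_ge0 // => j _; rewrite -expr2 sqr_ge0.
  by [].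
have cross k l : x 0 k * (x 0 l * G k l) <= 2^-1 * (x 0 k ^+ 2 * G k k) + 2^-1 * (x 0 l ^+ 2 * G l l).
  have := pos (x 0 k *: delta_mx 0 k - x 0 l *: delta_mx 0 l).
  have Gs : G l k = G k l by rewrite -[in LHS]GT mxE.
  rewrite mulmxBl -!scalemxAl !dotE !entry Gs.
  by move: (x 0 k) (x 0 l) (G k k) (G k l) (G l l) => a b c d e; lra.
have -> : dot (x *m G) x = \sum_k \sum_l x 0 k * (x 0 l * G k l).
  rewrite dot_sum exchange_big; apply: eq_bigr => l _; rewrite mxE mulr_suml.
  by apply: eq_bigr => k _; ring.
apply: le_trans (ler_sum _ (fun k _ => ler_sum _ (fun l _ => cross k l))) _.
pose T := \sum_k x 0 k ^+ 2 * G k k.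
rewrite (eq_bigr (fun k => m%:R * (2^-1 * (x 0 k ^+ 2 * G k k)) + 2^-1 * T)); last first.
  by move=> k _; rewrite big_split /= sum_cst_ord -mulr_sumr.
rewrite big_split /= -!mulr_sumr sum_cst_ord -/T.
have TT : T <= \tr G * dot x x.
  rewrite /T /mxtrace mulr_suml; apply: ler_sum => k _.
  by rewrite mulrC ler_wpM2l.
have := ler_wpM2l (ler0n R m) TT; lra.
Qed.

(** C - H is nonnegative with trace at most m C, hence bounded above, which bounds H below. *)
Lemma form_ge_of_trace (H : 'M[R]_m) (C : R) x : H^T = H -> 0 <= \tr H ->
  (forall y, dot (y *m H) y <= C * dot y y) -> 0 <= C -> `|dot (x *m H) x| <= (m%:R ^+ 2 + 1) * C * dot x x.
Proof.
move=> HT tr0 up C0; have e0 := dot_ge0 x.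
have GE y : dot (y *m (C%:M - H)) y = C * dot y y - dot (y *m H) y.
  by rewrite mulmxBr mul_mx_scalar !dotE.
have := @psd_le_trace (C%:M - H) x _ _; rewrite linearB /= tr_scalar_mx HT GE => /(_ erefl).
move=> A; have {}A : C * dot x x - dot (x *m H) x <= m%:R * \tr (C%:M - H) * dot x x.
  by apply: A => y; rewrite GE subr_ge0.
have trE : \tr (C%:M - H) <= m%:R * C by rewrite linearB /= mxtrace_scalar mulr_natl lerBlDr lerDl.
have := ler_wpM2r e0 (ler_wpM2l (ler0n R m) trE) => B.
have := up x; have : 0 <= m%:R ^+ 2 * C * dot x x by rewrite !mulr_ge0 // exprn_ge0.
have : 0 <= C * dot x x by rewrite mulr_ge0.
rewrite ler_norml => *; apply/andP; split; lra.
Qed.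

End PositiveForms.

(** * The estimate in the abstract setting *)

Section CoreBound.
Variables (R : realType) (m : nat) (J : 'M[R]_m) (I : finType).
Variables (K Kf Kg b0 : R) (fr : (I -> 'rV[R]_m) -> R -> Prop).
Variables (Om : set 'rV[R]_m) (psi f g u : 'rV[R]_m -> R).
Hypothesis (frP : frames J b0 fr) (st : setting K Kf Kg fr Om psi f g u).
Hypothesis (K1 : 1 <= K) (Kf0 : 0 <= Kf) (Kg0 : 0 <= Kg) (b00 : 0 <= b0).
Hypothesis (JT : J^T = - J) (JJ : J *m J = - 1%:M).
Implicit Types (z v w x : 'rV[R]_m).

Definition top_level : R := Num.min (lam1 m K / 2) (336 * kbound m K ^+ 4)^-1.
Definition low_level (d : R) : R := Num.min (top_level / 8) d.
Definition step_constant (d : R) : R :=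
  ratio_threshold m K Kf Kg b0 (level_rate m K top_level (low_level d)) top_level
  + (Ctouch m Kf b0 + 1) * K.
Definition core_constant (d : R) : R := (m%:R ^+ 2 + 1) * (2 * step_constant d + 1).

Lemma top_level_gt0 : 0 < top_level.
Proof.
have k4 : 0 < kbound m K ^+ 4 by rewrite exprn_gt0 // (lt_le_trans ltr01) // kbound_ge1.
by rewrite lt_min divr_gt0 ?lam1_gt0 ?ltr0n //= invr_gt0 pmulr_lgt0 ?ltr0n.
Qed.

Lemma step_constant_gt0 (d : R) : 0 < d -> 0 < step_constant d.
Proof.
move=> d0; have l0 := top_level_gt0.
have mu0 : 0 < low_level d by rewrite lt_min divr_gt0.
have [_ _ _ _ [M1 _]] := ratio_constants K1 Kf0 Kg0 b00 (level_rate_gt0 m K l0 mu0) l0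
  (lexx (ratio_threshold m K Kf Kg b0 (level_rate m K top_level (low_level d)) top_level)).
rewrite ltr_pwDl // ?(lt_le_trans ltr01) // mulr_ge0 ?(le_trans ler01 K1) // addr_ge0 //.
exact: Ctouch_ge0.
Qed.

(** The set [T] of bounds valid on the level l is nonempty by the qualitative Hessian bound and
    stable under N |-> N / 2 + C. Its infimum is therefore at most 2 C, which replaces an iteration
    and removes the dependence on [u]. *)
Lemma upper_bound (d : R) z : 0 < d -> Om z -> d <= psi z ->
  forall x, dot (x *m hess u z) x <= (2 * step_constant d + 1) * dot x x.
Proof.
move=> d0 Oz zd; set C := step_constant d; have C0 : 0 < C := step_constant_gt0 d0.
pose l := top_level; pose mu := low_level d; have l0 : 0 < l := top_level_gt0.
have mu0 : 0 < mu by rewrite lt_min divr_gt0.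
have mul : 8 * mu <= l.
  have : mu <= l / 8 by rewrite /mu /low_level ge_min lexx.
  lra.
have mud : mu <= d by rewrite /mu /low_level ge_min lexx orbT.
have llam : l < lam1 m K.
  have : l <= lam1 m K / 2 by rewrite /l /top_level ge_min lexx.
  by have := lam1_gt0 m K1; lra.
have kl : 336 * kbound m K ^+ 4 * l <= 1.
  have k4 : 0 < 336 * kbound m K ^+ 4.
    by rewrite pmulr_rgt0 ?ltr0n // exprn_gt0 // (lt_le_trans ltr01) // kbound_ge1.
  by rewrite -ler_pdivlMl // mulr1 /l /top_level ge_min lexx orbT.
have Ct0 := Ctouch_ge0 m Kf0 b00.
have th0 : 0 <= ratio_threshold m K Kf Kg b0 (level_rate m K l mu) l.
  have [_ _ _ _ [M1 _]] := ratio_constants K1 Kf0 Kg0 b00 (level_rate_gt0 m K l0 mu0) l0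
    (lexx (ratio_threshold m K Kf Kg b0 (level_rate m K l mu) l)).
  exact: le_trans M1.
pose T := [set N : R | 0 <= N /\ forall z, Om z -> psi z = l ->
  forall x, dot (x *m hess u z) x <= N * dot x x].
have step N : T N -> forall z, Om z -> mu <= psi z -> forall x, dot (x *m hess u z) x <= (N / 2 + C) * dot x x.
  move=> [N0 HN] z' Oz' z'mu x.
  have N2 : 0 <= N / 2 + ratio_threshold m K Kf Kg b0 (level_rate m K l mu) l by rewrite addr_ge0 // divr_ge0.
  have H2 := level_bound frP st K1 Kf0 Kg0 b00 JT JJ l0 llam kl mu0 mul N0 HN.
  have := interior_bound frP st K1 Kf0 Kg0 b00 mu0 N2 H2 Oz' z'mu x.
  by rewrite -addrA.
have Tstep N : T N -> T (N / 2 + C).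
  move=> TN; split; first by case: TN => N0 _; rewrite addr_ge0 ?divr_ge0 // ltW.
  by move=> z' Oz' z'l; apply: (step N TN) => //; rewrite z'l; lra.
have [L L0 HL] := hess_bounded st.
have TL : T (m%:R ^+ 2 * L).
  split; first by rewrite mulr_ge0 ?exprn_ge0.
  move=> z' Oz' _ x; have := bil_le x x (fun k l => HL z' k l Oz') L0.
  rewrite ler_norml => /andP[_ le]; apply: le_trans le _.
  by rewrite -mulrA -expr2 ler_wpM2l ?sqr_norm_le_dot // mulr_ge0 ?exprn_ge0.
have hT : has_inf T by split; [exists (m%:R ^+ 2 * L)|exists 0 => N []].
have inf2C : inf T <= 2 * C.
  have : 2 * inf T - 2 * C <= inf T.
    apply: lb_le_inf; first by exists (m%:R ^+ 2 * L).
    by move=> N /Tstep TN; have := ge_inf hT.2 TN; lra.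
  by lra.
have [N TN Nlt] := inf_adherent ltr01 hT.
move=> x; apply: le_trans (step N TN z Oz (le_trans mud zd) x) _.
by rewrite ler_wpM2r ?dot_ge0 //; lra.
Qed.

Lemma core_bound (d : R) z : 0 < d -> (forall z, Om z -> 0 <= \tr (hess u z)) -> Om z -> d <= psi z ->
  forall x, `|dot (x *m hess u z) x| <= core_constant d * dot x x.
Proof.
move=> d0 tr Oz zd x; have C0 := step_constant_gt0 d0.
apply: form_ge_of_trace; [exact: (hess_sym (st_open st) Oz (st_u st))|exact: tr| |lra].
exact: upper_bound.
Qed.

End CoreBound.

(** * Concave functions on symmetric cones *)

Section Rearrangement.
Variables (R : realType) (n : nat).

Lemma sorting_perm (a : 'I_n -> R) :
  exists p : 'S_n, forall i j : 'I_n, (i <= j)%N -> a (p i) <= a (p j).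
Proof.
pose t := [tuple a i | i < n].
have /tuple_permP[p Hp] : perm_eq (sort <=%R t) t by rewrite perm_sort.
exists p => i j ij.
have srt : sorted <=%R (sort <=%R t) by apply: sort_sorted; exact: le_total.
have E (k : 'I_n) : nth 0 (sort <=%R t) k = a (p k).
  by rewrite Hp -tnth_nth tnth_mktuple tnth_mktuple.
have sz : size (sort <=%R t) = n by rewrite size_sort size_tuple.
rewrite -!E; apply: (sorted_leq_nth le_trans lexx 0 srt) => //;
  by rewrite inE sz.
Qed.

(* [p] and [l |-> a l * b l - p l] are optimal dual variables of the transportation
   problem with cost a k * b l. *)
Lemma opposite_monotone_potential (a b : 'I_n -> R) :
  (forall i j : 'I_n, (i <= j)%N -> a i <= a j) ->
  (forall i j : 'I_n, (i <= j)%N -> b j <= b i) ->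
  exists p : 'I_n -> R, forall k l, p k - p l <= (a k - a l) * b l.
Proof.
move=> Ha Hb; have [n0|n_gt0] := leqP n 0.
  by exists (fun=> 0) => k; have := ltn_ord k; rewrite ltnNge (leq_trans n0).
pose o (j : nat) : 'I_n := insubd (Ordinal n_gt0) j.
have oE (k : 'I_n) : o k = k by rewrite /o valKd.
have oV j : (j < n)%N -> o j = j :> nat by move=> jn; rewrite /o val_insubd jn.
pose p (k : nat) := \sum_(0 <= j < k) b (o j) * (a (o j.+1) - a (o j)).
have up (l d : nat) : (l + d < n)%N ->
    p (l + d)%N - p l <= (a (o (l + d)%N) - a (o l)) * b (o l).
  elim: d => [|d IH] ld; first by rewrite addn0 !subrr mul0r.
  rewrite addnS in ld *; have ld' := ltnW ld; move: (IH ld').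
  rewrite /p big_nat_recr //= -/(p _) -/(p l).
  have ha : a (o (l + d)%N) <= a (o (l + d).+1) by apply: Ha; rewrite !oV.
  have hb : b (o (l + d)%N) <= b (o l).
    by apply: Hb; rewrite !oV ?leq_addr // (leq_ltn_trans (leq_addr d l)).
  move: ha hb; clear; nra.
have dn (k d : nat) : (k + d < n)%N ->
    p k - p (k + d)%N <= (a (o k) - a (o (k + d)%N)) * b (o (k + d)%N).
  elim: d => [|d IH] ld; first by rewrite addn0 !subrr mul0r.
  rewrite addnS in ld *; have ld' := ltnW ld; move: (IH ld').
  rewrite /p big_nat_recr //= -/(p _) -/(p k).
  have ha : a (o k) <= a (o (k + d)%N).
    by apply: Ha; rewrite !oV ?leq_addr // (leq_ltn_trans (leq_addr d k)).
  have ha' : a (o (k + d)%N) <= a (o (k + d).+1) by apply: Ha; rewrite !oV.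
  have hb : b (o (k + d).+1) <= b (o (k + d)%N) by apply: Hb; rewrite !oV.
  move: ha ha' hb; clear; nra.
exists (fun k => p k) => k l; have [kl|/ltnW lk] := leqP k l.
  by have := dn k (l - k)%N; rewrite subnKC // !oE; apply.
by have := up l (k - l)%N; rewrite subnKC // !oE; apply.
Qed.

(** Weak duality for the transportation problem: after sorting [a] and [b] oppositely, the
    potentials bound each cost from below and are exact on the diagonal. No decomposition of doubly
    stochastic matrices into permutations is involved. *)
Lemma doubly_stochastic_rearrangement (S : 'I_n -> 'I_n -> R) (a b : 'I_n -> R) :
  (forall k l, 0 <= S k l) -> (forall k, \sum_l S k l = 1) ->
  (forall l, \sum_k S k l = 1) ->
  exists s : 'S_n, \sum_k a k * b (s k) <= \sum_k \sum_l S k l * (a k * b l).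
Proof.
move=> S0 Sr Sc.
have [p Hp] := sorting_perm a; have [q Hq] := sorting_perm (fun k => - b k).
have [h Hh] := opposite_monotone_potential (a := a \o p) (b := b \o q) Hp
  (fun i j ij => ltac:(by have := Hq i j ij; rewrite lerN2)).
exists (p^-1 * q)%g.
have -> : \sum_k a k * b ((p^-1 * q)%g k) = \sum_k a (p k) * b (q k).
  rewrite (reindex_inj (@perm_inj _ p)); apply: eq_bigr => k _.
  by rewrite permM permK.
have -> : \sum_k \sum_l S k l * (a k * b l) =
    \sum_k \sum_l S (p k) (q l) * (a (p k) * b (q l)).
  rewrite (reindex_inj (@perm_inj _ p)); apply: eq_bigr => k _.
  by rewrite (reindex_inj (@perm_inj _ q)).
have Sr' k : \sum_l S (p k) (q l) = 1.
  by rewrite -(Sr (p k)) [RHS](reindex_inj (@perm_inj _ q)).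
have Sc' l : \sum_k S (p k) (q l) = 1.
  by rewrite -(Sc (q l)) [RHS](reindex_inj (@perm_inj _ p)).
apply: (@le_trans _ _ (\sum_k \sum_l S (p k) (q l) * (h k + (a (p l) * b (q l) - h l)))).
  rewrite le_eqVlt; apply/orP; left; apply/eqP; symmetry.
  under eq_bigr => k _ do under eq_bigr => l _ do rewrite mulrDr.
  under eq_bigr => k _ do rewrite big_split /= -mulr_suml Sr' mul1r.
  rewrite big_split /= [X in _ + X]exchange_big /=.
  under [X in _ + X]eq_bigr => l _ do rewrite -mulr_suml Sc' mul1r.
  by rewrite sumrB addrC subrK.
apply: ler_sum => k _; apply: ler_sum => l _; rewrite ler_wpM2l //.
have := Hh k l => /=; move: (h k) (h l) => x y; nra.
Qed.

End Rearrangement.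

Lemma derivable_eps (R : realType) (m : nat) (h : 'rV[R]_m -> R) (z v : 'rV[R]_m) :
  derivable h z v -> forall e : R, 0 < e -> exists2 d : R, 0 < d & forall t : R, `|t| < d ->
    `|h (z + t *: v) - h z - t * 'D_v h z| <= e * `|t|.
Proof.
move=> dh e e0.
have /(@cvgrPdist_le _ _ _ (0^')) H : (fun k : R => k^-1 *: ((h \o shift z) (k *: v) - h z)) @ 0^' --> 'D_v h z.
  exact: dh.
have [d /= d0 Hd] := H _ e0; exists d => // t td.
have [->|t0] := eqVneq t 0; first by rewrite scale0r addr0 subrr mul0r subr0 normr0 mulr0.
have /= := Hd t; rewrite /= sub0r normrN => /(_ td t0).
rewrite [t *: v + z]addrC.
have -> : h (z + t *: v) - h z - t * 'D_v h z =
    - (t * ('D_v h z - t^-1 *: (h (z + t *: v) - h z))).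
  by rewrite /GRing.scale /=; field.
by move=> h0; rewrite normrN normrM [e * _]mulrC ler_wpM2l.
Qed.

(** * Supergradients on the cone *)

Section Cone.
Variables (R : realType) (n : nat).
Hypothesis (n_gt0 : (0 < n)%N).
Variables (Gam : set 'rV[R]_n) (F : 'rV[R]_n -> R).
Hypothesis (cG : symmetric_cone Gam) (sF : structure_conditions Gam F).
Implicit Types (l mu x y w : 'rV[R]_n).

Definition slope (l : 'rV[R]_n) (k : 'I_n) : R := 'D_(unit_vec R k) F l.

Definition total_slope (l : 'rV[R]_n) : R := \sum_k slope l k.

Lemma cone_add x y : Gam x -> Gam y -> Gam (x + y).
Proof.
move=> Gx Gy; have := cone_scale cG (t := 2) (cone_convex cG (t := 2^-1) Gx Gy _).
rewrite scalerDr !scalerA.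
have -> : 2 * 2^-1 = 1 :> R by field.
have -> : 2 * (1 - 2^-1) = 1 :> R by field.
by rewrite !scale1r; apply=> //; apply/andP; split; lra.
Qed.

Lemma op_superadditive x y : Gam x -> Gam y -> F x + F y <= F (x + y).
Proof.
move=> Gx Gy; have G2 := cone_convex cG (t := 2^-1) Gx Gy.
have h2 : 0 <= (2^-1 : R) <= 1 by apply/andP; split; lra.
have := op_concave sF Gx Gy h2.
have -> : x + y = 2 *: (2^-1 *: x + (1 - 2^-1) *: y).
  rewrite scalerDr !scalerA.
  have -> : 2 * 2^-1 = 1 :> R by field.
  have -> : 2 * (1 - 2^-1) = 1 :> R by field.
  by rewrite !scale1r.
by rewrite (op_homogeneous sF (G2 h2)) //; lra.
Qed.

Lemma op_superadditive_sum (J : finType) (j0 : J) (x : J -> 'rV[R]_n) :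
  (forall j, Gam (x j)) -> \sum_j F (x j) <= F (\sum_j x j).
Proof.
move=> Gx.
suff [[_ /eqP]|[_ //]] : ((\sum_j x j = 0 /\ \sum_(j : J) 1 = 0 :> nat) \/
    Gam (\sum_j x j) /\ \sum_j F (x j) <= F (\sum_j x j)).
  by rewrite sum1_card -leqn0 leqNgt; move/negP; case; apply/card_gt0P; exists j0.
(* The empty sum 0 is outside [Gam]; the running count of terms sets this case apart. *)
apply: (big_rec3 (fun (s : 'rV[R]_n) (c : nat) (a : R) =>
  (s = 0 /\ c = 0%N \/ Gam s /\ a <= F s) /\ (c = 0%N -> a = 0)) _ _).1.
  by split; [left|].
move=> j c a s _ [[[-> c0]|[Gs as_]] ca]; split => //; right.
  by rewrite addr0 (ca c0) addr0.
split; first exact: cone_add.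
by apply: le_trans (op_superadditive _ _); rewrite ?lerD2l.
Qed.

Lemma op_gt0 l : Gam l -> 0 < F l.
Proof.
move=> Gl; have [x ->//|r0 r00 H] := op_large sF (@compact_set1 _ l) _ ltr01.
have := H l r0 erefl (lexx _); rewrite (op_homogeneous sF Gl r00) => h.
by rewrite -(pmulr_rgt0 _ r00); apply: lt_le_trans h.
Qed.

(** Only partial derivatives of F are given. The point l + t w is the average of n points, the k-th
    moved by n t w_k along the k-th axis, and concavity turns the partial expansions into a lower
    bound in every direction. *)
Lemma op_lower_slope l w : Gam l -> forall e : R, 0 < e -> exists2 d : R, 0 < d &
  forall t : R, 0 < t -> t < d ->
    F l + t * (\sum_k slope l k * w 0 k) - t * e <= F (l + t *: w).
Proof.
move=> Gl e e0; have N0 : 0 < n%:R :> R by rewrite ltr0n.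
have Nn0 : n%:R != 0 :> R by rewrite gt_eqF.
pose p k (t : R) := F l + n%:R * (t * w 0 k) * slope l k - t * e <=
  F (l + (n%:R * (t * w 0 k)) *: unit_vec R k) /\ Gam (l + (n%:R * (t * w 0 k)) *: unit_vec R k).
have [||d d0 Hd] := @finite_eps R 'I_n (fun k d => forall t : R, 0 < t -> t < d -> p k t).
- by move=> k d d' Pd _ dd t t0 td; apply: Pd => //; apply: lt_le_trans dd.
- move=> k; pose c := n%:R * `|w 0 k| + 1.
  have c0 : 0 < c by rewrite ltr_wpDl // mulr_ge0 // ltW.
  have [d1 d10 H1] := derivable_eps (op_increasing sF k Gl).1 (divr_gt0 e0 c0).
  have [d2 d20 H2] := open_eps (cone_open cG) Gl.
  have tc (t d : R) : 0 < t -> t < d / c -> `|n%:R * (t * w 0 k)| < d.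
    move=> t0; rewrite ltr_pdivlMr // => td; apply: le_lt_trans td.
    rewrite !normrM (gtr0_norm t0) gtr0_norm // /c mulrDr mulr1 mulrCA lerDl; exact: ltW.
  exists (Num.min d1 d2 / c); first by rewrite divr_gt0 // lt_min d10.
  move=> t t0 /(tc _ _ t0); rewrite lt_min => /andP[td1 td2].
  split; last first.
    apply: H2; rewrite addrC addKr; apply: le_lt_trans td2.
    apply: norm_rV_le => // j; rewrite !mxE normrM ler_piMr //.
    by case: (_ && _); rewrite ?normr1 ?normr0 ?ler01.
  have := H1 _ td1; rewrite -/(slope l k) ler_norml => /andP[h _].
  have : e / c * `|n%:R * (t * w 0 k)| <= t * e.
    rewrite !normrM (gtr0_norm t0) (gtr0_norm N0) mulrAC ler_pdivrMr // /c.
    have := mulr_gt0 t0 e0; move: (`|w 0 k|) (n%:R) => a b; nra.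
  by move: h; lra.
exists d => // t t0 td.
have E : l + t *: w = \sum_k n%:R^-1 *: (l + (n%:R * (t * w 0 k)) *: unit_vec R k).
  rewrite -scaler_sumr big_split /= sumr_const card_ord -[l *+ n]scaler_nat scalerDr scalerA mulVf // scale1r.
  congr (_ + _); rewrite [w in LHS]row_sum_delta !scaler_sumr; apply: eq_bigr => k _.
  by rewrite !scalerA mulKf.
rewrite E; apply: le_trans (op_superadditive_sum (Ordinal n_gt0) _); last first.
  by move=> k; apply: cone_scale => //; [have [] := Hd k t t0 td|rewrite invr_gt0].
apply: (@le_trans _ _ (\sum_(k < n) n%:R^-1 * (F l + n%:R * (t * w 0 k) * slope l k - t * e))).
  rewrite le_eqVlt -mulr_sumr; apply/orP; left; apply/eqP.
  have -> : \sum_k (F l + n%:R * (t * w 0 k) * slope l k - t * e) =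
      \sum_k ((F l - t * e) + n%:R * t * (slope l k * w 0 k)).
    by apply: eq_bigr => k _; ring.
  rewrite big_split /= sumr_const card_ord -mulr_sumr -[_ *+ n]mulr_natl.
  by move: (\sum_k slope l k * w 0 k) (F l) Nn0 => A B; clear => ?; field.
apply: ler_sum => k _; have [h G] := Hd k t t0 td.
by rewrite (op_homogeneous sF G) ?invr_gt0 // ler_wpM2l // invr_ge0 ltW.
Qed.

(** By superadditivity and homogeneity F(l) >= F(l - t mu) + t F(mu); the lower expansion of the
    first term gives the claim as t tends to 0. *)
Lemma op_supergradient l mu : Gam l -> Gam mu -> F mu <= \sum_k slope l k * mu 0 k.
Proof.
move=> Gl Gm; apply/ler_addgt0Pr => e e0.
have [d d0 H] := op_lower_slope (- mu) Gl e0.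
have [d2 d20 H2] := open_eps (cone_open cG) Gl.
pose t := Num.min d (d2 / (`|mu| + 1)) / 2.
have m1 : 0 < `|mu| + 1 by rewrite ltr_wpDl.
have q0 : 0 < Num.min d (d2 / (`|mu| + 1)) by rewrite lt_min d0 divr_gt0.
have t0 : 0 < t by rewrite divr_gt0.
have tq : t < Num.min d (d2 / (`|mu| + 1)) by rewrite /t; lra.
have [td td2] : t < d /\ t < d2 / (`|mu| + 1) by apply/andP; move: tq; rewrite lt_min.
have Gt : Gam (l + t *: - mu).
  apply: H2; rewrite addrC addKr normrZ normrN gtr0_norm //.
  by move: td2; rewrite ltr_pdivlMr // mulrDr mulr1; lra.
have := op_superadditive Gt (cone_scale cG Gm t0).
rewrite scalerN subrK (op_homogeneous sF Gm t0) => h1.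
have := H t t0 td; rewrite scalerN.
under eq_bigr do rewrite mxE mulrN.
rewrite sumrN => h2; rewrite -(ler_pM2l t0); lra.
Qed.

Lemma op_Euler l : Gam l -> F l = \sum_k slope l k * l 0 k.
Proof.
move=> Gl; apply/eqP; rewrite eq_le op_supergradient //=; apply/ler_addgt0Pr => e e0.
have [d d0 H] := op_lower_slope l Gl e0.
have t0 : 0 < d / 2 by rewrite divr_gt0.
have := H (d / 2) t0; rewrite -[X in F (X + _)]scale1r -scalerDl.
rewrite (op_homogeneous sF Gl) ?addr_gt0 // mulrDl mul1r => h.
by rewrite -(ler_pM2l t0); have := h ltac:(lra); lra.
Qed.

Lemma cone_one : Gam (const_mx 1).
Proof.
apply: (cone_lower cG) => j /andP[j1 jn]; rewrite /Defs.esym.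
under eq_bigr => S _ do under eq_bigr do rewrite mxE.
under eq_bigr => S _ do rewrite big1 //.
rewrite sumr_const ltr0n -sum1_card.
have -> : (\sum_(S in [pred S : {set 'I_n} | #|S| == j]) 1)%N = #|[set S : {set 'I_n} | #|S| == j]%SET|.
  by rewrite -sum1_card; apply: eq_bigl => S; rewrite !inE.
by rewrite card_draws card_ord bin_gt0.
Qed.

Lemma slope_gt0 l k : Gam l -> 0 < slope l k.
Proof. by move=> Gl; exact: (op_increasing sF k Gl).2. Qed.

(** This bounds the coefficient b = 1 / total_slope of f: the operator enters the estimate only
    through F(1, ..., 1). *)
Lemma total_slope_ge l : Gam l -> F (const_mx 1) <= total_slope l.
Proof.
move=> Gl; apply: le_trans (op_supergradient Gl cone_one) _.
by apply: ler_sum => k _; rewrite mxE mulr1.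
Qed.

Lemma total_slope_gt0 l : Gam l -> 0 < total_slope l.
Proof. by move=> Gl; apply: lt_le_trans (total_slope_ge Gl); exact/op_gt0/cone_one. Qed.

(** A nearby point of [Gam] differs from [mu] by less than the room around (s, ..., s), and the cone
    is closed under addition. *)
Lemma closure_cone_shift mu (s : R) : closure Gam mu -> 0 < s -> Gam (mu + const_mx s).
Proof.
move=> cm s0; have Gs : Gam (const_mx s).
  have := cone_scale cG cone_one s0; congr (Gam _); apply/rowP => k.
  by rewrite !mxE mulr1.
have [d d0 H] := open_eps (cone_open cG) Gs.
have [l [Gl]] := cm (ball mu d) (nbhsx_ballx mu d d0); rewrite -ball_normE /= => ml.
have -> : mu + const_mx s = l + (const_mx s + (mu - l)) by rewrite [RHS]addrCA [l + (mu - l)]addrC subrK addrC.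
by apply: cone_add => //; apply: H; rewrite addrC addKr.
Qed.

Lemma bdry_of_closure mu : closure Gam mu -> ~ Gam mu -> bdry Gam mu.
Proof.
have E : Gam° = Gam by apply/interior_id; exact: cone_open cG.
by rewrite /bdry E.
Qed.

Lemma op_small_near_bdry mu : bdry Gam mu -> forall e : R, 0 < e -> exists2 d : R, 0 < d &
  forall l, Gam l -> `|l - mu| < d -> F l <= e.
Proof.
move=> bm e e0; have L := op_boundary sF bm.
have : (limf_esup (fun l => (F l)%:E) (within Gam (nbhs mu)) < e%:E)%E by rewrite L lte_fin.
rewrite /limf_esup => /ereal_inf_lt[_ [V /nbhs_ballP[d /= d0 HV] <-] Ve].
exists d => // l Gl ld; rewrite -lee_fin; apply: le_trans (ltW Ve).
apply: ereal_sup_ubound; exists l => //; apply: HV => //.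
by rewrite -ball_normE /= distrC.
Qed.

Definition op_value mu : R := if mu \in Gam then F mu else 0.

(** On the boundary of the cone the value is 0, and the sum is a limit of sums that dominate
    positive values of F at shifted points. *)
Lemma supporting_ge l mu (s : 'S_n) : Gam l -> closure Gam mu ->
  op_value mu <= \sum_k slope l k * mu 0 (s k).
Proof.
move=> Gl cm; rewrite /op_value; case: ifPn => [|_].
  rewrite inE => Gm; rewrite -(op_symmetric sF s Gm).
  apply: le_trans (op_supergradient Gl (cone_perm cG s Gm)) _.
  by apply: ler_sum => k _; rewrite mxE.
apply/ler_addgt0Pr => e e0; have T0 := total_slope_gt0 Gl.
have Gm := cone_perm cG s (closure_cone_shift cm (divr_gt0 e0 T0)).
have := le_trans (ltW (op_gt0 Gm)) (op_supergradient Gl Gm).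
have -> : \sum_k slope l k * col_perm s (mu + const_mx (e / total_slope l)) 0 k =
    \sum_k slope l k * mu 0 (s k) + \sum_k slope l k * (e / total_slope l).
  by rewrite -big_split; apply: eq_bigr => k _; rewrite !mxE mulrDr.
by rewrite -mulr_suml -/(total_slope l) mulrC divfK // gt_eqF.
Qed.

(** Inside the cone Euler's identity gives equality with l = mu. On the boundary F has no slopes;
    they are taken at a slightly shifted [l], where F(l) is small compared with the total slope.
    This is why the equation is attained only up to [e]. *)
Lemma supporting_attained mu (e : R) : closure Gam mu -> 0 < e -> exists2 l, Gam l &
  (total_slope l)^-1 * (\sum_k slope l k * mu 0 k) <= (total_slope l)^-1 * op_value mu + e.
Proof.
move=> cm e0; rewrite /op_value; case: ifPn => [|].
  by rewrite inE => Gm; exists mu; rewrite // -op_Euler // lerDl ltW.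
rewrite notin_setE => nG; have F1 := op_gt0 cone_one.
have [d d0 H] := op_small_near_bdry (bdry_of_closure cm nG) (mulr_gt0 e0 F1).
have d20 : 0 < d / 2 by rewrite divr_gt0.
pose l := mu + const_mx (d / 2).
have Gl : Gam l by exact: closure_cone_shift.
have T0 := total_slope_gt0 Gl; exists l => //; rewrite mulr0 add0r mulrC ler_pdivrMr //.
apply: (@le_trans _ _ (F l)).
  rewrite op_Euler //; apply: ler_sum => k _; rewrite ler_wpM2l //; first exact/ltW/slope_gt0.
  by rewrite /l !mxE lerDl ltW.
apply: le_trans (H l Gl _) _; last by rewrite ler_wpM2l ?total_slope_ge // ltW.
rewrite /l addrC addKr; apply: le_lt_trans (norm_rV_le (a := d / 2) _ _) _; rewrite ?ltW //.
- by move=> k; rewrite mxE gtr0_norm.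
- by lra.
Qed.

(** The inclusion of [Gam] in the half-space of positive coordinate sums; on Hessians it becomes a
    nonnegative Laplacian. *)
Lemma closure_sum_ge0 mu : closure Gam mu -> 0 <= \sum_k mu 0 k.
Proof.
move=> cm; apply/ler_addgt0Pr => e e0.
have N0 : 0 < n%:R :> R by rewrite ltr0n.
have := cone_upper cG (closure_cone_shift cm (divr_gt0 e0 N0)) (isT : (1 <= 1 <= 1)%N).
suff -> : Defs.esym 1 (mu + const_mx (e / n%:R)) = \sum_k mu 0 k + e by move/ltW.
have -> : Defs.esym 1 (mu + const_mx (e / n%:R)) = \sum_k (mu 0 k + e / n%:R).
  rewrite /Defs.esym (reindex_onto (fun k : 'I_n => [set k]%SET)
     (fun S : {set 'I_n} => odflt (Ordinal n_gt0) [pick k in S])) /=; last first.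
    move=> S /cards1P[k ->]; case: pickP => [j|/(_ k)]; rewrite inE ?eqxx //.
    by move/eqP => ->.
  apply: eq_big => [k|k _]; last by rewrite big_set1 !mxE.
  rewrite cards1 eqxx /=; case: pickP => [j|/(_ k)]; rewrite inE ?eqxx //.
by rewrite big_split /= sumr_const card_ord -[_ *+ n]mulr_natr divfK // gt_eqF.
Qed.

End Cone.

(** * Complex Hessians *)

Section ComplexForms.
Local Open Scope sesquilinear_scope.
Variables (R : realType) (n : nat).
Local Notation C := (R[i]).
Implicit Types (V W H A B : 'M[C]_n) (x y : 'rV[R]_(n + n)) (M : 'M[R]_(n + n)).

Lemma complex_sumE (I : Type) (r : seq I) (a b : I -> R) :
  \sum_(i <- r) (a i +i* b i)%C = ((\sum_(i <- r) a i) +i* (\sum_(i <- r) b i))%C.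
Proof.
elim: r => [|i r IH]; first by rewrite !big_nil.
by rewrite !big_cons IH.
Qed.

Lemma real_complex_sum (I : Type) (r : seq I) (a : I -> R) :
  \sum_(i <- r) (a i)%:C%C = (\sum_(i <- r) a i)%:C%C.
Proof. by rewrite rmorph_sum. Qed.

Lemma Re_sum (I : Type) (r : seq I) (f : I -> C) :
  complex.Re (\sum_(i <- r) f i) = \sum_(i <- r) complex.Re (f i).
Proof.
rewrite -[RHS]/(complex.Re (_ +i* \sum_(i <- r) complex.Im (f i))%C) -complex_sumE.
by congr complex.Re; apply: eq_bigr => i _; case: (f i).
Qed.

(* Multiplication by the imaginary unit on R^(2n) = C^n. *)
Definition Jmx : 'M[R]_(n + n) := block_mx 0 1%:M (- 1%:M) 0.

Lemma Jmx_tr : Jmx^T = - Jmx.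
Proof. by rewrite /Jmx tr_block_mx opp_block_mx !trmx0 !oppr0 opprK linearN /= trmx1. Qed.

Lemma Jmx_sqr : Jmx *m Jmx = - 1%:M.
Proof.
rewrite /Jmx mulmx_block !mul0mx !mulmx0 !mul1mx !mulmx1 !add0r !addr0.
by rewrite [in RHS]scalar_mx_block opp_block_mx oppr0.
Qed.

Lemma mulJ_l x i : (x *m Jmx) 0 (lshift n i) = - x 0 (rshift n i).
Proof.
rewrite -[x]hsubmxK mul_row_block !mulmx0 mulmx1 mulmxN mulmx1 add0r addr0.
by rewrite row_mxEl row_mxEr mxE.
Qed.

Lemma mulJ_r x i : (x *m Jmx) 0 (rshift n i) = x 0 (lshift n i).
Proof.
rewrite -[x]hsubmxK mul_row_block !mulmx0 mulmx1 mulmxN mulmx1 add0r addr0.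
by rewrite row_mxEl row_mxEr.
Qed.

Lemma dot_split x y :
  dot x y = \sum_(i < n) (x 0 (lshift n i) * y 0 (lshift n i) + x 0 (rshift n i) * y 0 (rshift n i)).
Proof. by rewrite dot_sum big_split_ord big_split. Qed.

(** The real and imaginary parts of Hermitian orthonormality, in real coordinates. *)
Definition orthoframe (xi : 'I_n -> 'rV[R]_(n + n)) : Prop :=
  (forall k l, dot (xi k) (xi l) = (k == l)%:R) /\ (forall k l, dot (xi k) (xi l *m Jmx) = 0).

Definition complex_rows (xi : 'I_n -> 'rV[R]_(n + n)) : 'M[C]_n :=
  \matrix_(k, j) (xi k 0 (lshift n j) +i* xi k 0 (rshift n j))%C.

Lemma complex_rows_gram xi k l : (complex_rows xi *m (complex_rows xi)^t*) k l =
  (dot (xi k) (xi l) +i* dot (xi k) (xi l *m Jmx))%C.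
Proof.
rewrite mxE !dot_split -complex_sumE; apply: eq_bigr => j _; rewrite mulJ_l mulJ_r !mxE.
by apply/eqP; rewrite eq_complex /=; apply/andP; split; apply/eqP; ring.
Qed.

Lemma complex_rows_unitary xi : orthoframe xi -> complex_rows xi \is unitarymx.
Proof.
move=> [h1 h2]; apply/unitarymxP/matrixP => k l.
by rewrite complex_rows_gram h1 h2 mxE; case: (k == l).
Qed.

Lemma unitary_rows V : V \is unitarymx -> exists2 xi, orthoframe xi & complex_rows xi = V.
Proof.
move=> Vu; pose xi k : 'rV[R]_(n + n) :=
  row_mx (\row_j complex.Re (V k j)) (\row_j complex.Im (V k j)).
have E : complex_rows xi = V.
  by apply/matrixP => k j; rewrite mxE row_mxEl row_mxEr !mxE; case: (V k j).
exists xi => //; move/unitarymxP: Vu; rewrite -E => /matrixP Vu.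
by split=> k l; have := Vu k l; rewrite complex_rows_gram mxE; case: (k == l) => -[].
Qed.

(** The complex Hessian u_(z_i conj z_j) of a function with real Hessian [M]. *)
Definition levi M : 'M[C]_n := \matrix_(i, j)
  ((4^-1 * (M (lshift n i) (lshift n j) + M (rshift n i) (rshift n j)))
   +i* (4^-1 * (M (lshift n i) (rshift n j) - M (rshift n i) (lshift n j))))%C.

Lemma herm_of_entry H : (forall i j, (H j i)^* = H i j) -> H \is hermsymmx.
Proof. by move=> hH; apply/is_hermitianmxP/matrixP => i j; rewrite expr0 scale1r !mxE hH. Qed.

Lemma levi_herm M : M^T = M -> levi M \is hermsymmx.
Proof.
move=> sM; have E k l : M k l = M l k by rewrite -{1}sM mxE.
apply: herm_of_entry => i j; rewrite !mxE; apply/eqP; rewrite eq_complex /=.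
rewrite !(E (lshift n j)) !(E (rshift n j)); apply/andP; split; apply/eqP => //; ring.
Qed.

Lemma form_entries V H k : (V *m H *m V^t*) k k = \sum_i \sum_j V k i * H i j * (V k j)^*.
Proof.
rewrite mxE exchange_big /=; apply: eq_bigr => j _; rewrite !mxE mulr_suml.
by apply: eq_bigr.
Qed.

Lemma dot_form x M : dot (x *m M) x = \sum_k \sum_l x 0 k * M k l * x 0 l.
Proof.
rewrite dot_sum exchange_big /=; apply: eq_bigr => j _.
by rewrite mxE mulr_suml.
Qed.

Lemma levi_form M xi k : complex.Re ((complex_rows xi *m levi M *m (complex_rows xi)^t*) k k) =
  4^-1 * (dot (xi k *m M) (xi k) + dot (xi k *m Jmx *m M) (xi k *m Jmx)).
Proof.
rewrite form_entries !dot_form Re_sum.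
rewrite !big_split_ord /= -!big_split /= mulr_sumr; apply: eq_bigr => i _.
rewrite Re_sum !big_split_ord /= -!big_split /= mulr_sumr; apply: eq_bigr => j _.
by rewrite !mulJ_l !mulJ_r !mxE /=; field.
Qed.

Lemma levi_trace M : complex.Re (\tr (levi M)) = 4^-1 * \tr M.
Proof.
rewrite /mxtrace Re_sum big_split_ord /= -big_split mulr_sumr /=.
by apply: eq_bigr => i _; rewrite mxE.
Qed.

Definition sqr_modulus (z : C) : R := complex.Re z ^+ 2 + complex.Im z ^+ 2.

Lemma sqr_modulusE z : z * z^* = (sqr_modulus z)%:C%C.
Proof. by case: z => a b; apply/eqP; rewrite eq_complex /sqr_modulus /=; apply/andP; split; apply/eqP; ring. Qed.

Lemma sqr_modulus_ge0 z : 0 <= sqr_modulus z.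
Proof. by rewrite addr_ge0 ?sqr_ge0. Qed.

Lemma eigvec_real A k : A \is hermsymmx -> spectral_diag A 0 k = (eigvec A 0 k)%:C%C.
Proof.
by move=> hA; rewrite mxE RRe_real //; exact: (mxOverP (hermitian_spectral_diag_real hA)).
Qed.

Lemma spectral_decomposition A : A \is hermsymmx ->
  A = (spectralmx A)^t* *m diag_mx (spectral_diag A) *m spectralmx A.
Proof.
move=> hA; rewrite -(invmx_unitary (spectral_unitarymx A)).
exact/orthomx_spectralP/hermitian_normalmx.
Qed.

Lemma diag_form W (d : 'rV[C]_n) k :
  (W *m diag_mx d *m W^t*) k k = \sum_l W k l * (W k l)^* * d 0 l.
Proof.
rewrite mxE; apply: eq_bigr => l _.
by rewrite mul_mx_diag !mxE mulrAC.
Qed.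

Lemma adjE V i j : (V^t*) i j = (V j i)^*.
Proof. by rewrite !mxE. Qed.

(** Schur's observation: if U diagonalizes A, the weights are the squared moduli of the entries of
    the unitary matrix V U^*. *)
Lemma unitary_form V A : A \is hermsymmx -> V \is unitarymx ->
  exists S : 'I_n -> 'I_n -> R, [/\ (forall k l, 0 <= S k l), (forall k, \sum_l S k l = 1),
    (forall l, \sum_k S k l = 1)
  & forall k, (V *m A *m V^t*) k k = (\sum_l S k l * eigvec A 0 l)%:C%C].
Proof.
move=> hA Vu; pose W := V *m (spectralmx A)^t*.
have Pu : (spectralmx A)^t* \is unitarymx by rewrite trmxC_unitary spectral_unitarymx.
have Wu : W \is unitarymx := mul_unitarymx Vu Pu.
exists (fun k l => sqr_modulus (W k l)); split.
- by move=> k l; exact: sqr_modulus_ge0.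
- move=> k; move/unitarymxP/matrixP/(_ k k): Wu; rewrite mxE [in RHS]mxE eqxx.
  under eq_bigr => l _ do rewrite adjE sqr_modulusE.
  by rewrite real_complex_sum => -[].
- move=> l; have := Wu; rewrite -trmxC_unitary => /unitarymxP/matrixP/(_ l l); rewrite mxE [in RHS]mxE eqxx.
  under eq_bigr => k _ do rewrite !adjE conjCK mulrC sqr_modulusE.
  by rewrite real_complex_sum => -[].
move=> k; have -> : V *m A *m V^t* = W *m diag_mx (spectral_diag A) *m W^t*.
  rewrite {1}(spectral_decomposition hA) /W trmx_mul map_mxM /= !mulmxA.
  by rewrite (_ : ((spectralmx A)^t*)^t* = spectralmx A) //; apply/matrixP => i j; rewrite !adjE conjCK.
rewrite diag_form -real_complex_sum; apply: eq_bigr => l _.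
by rewrite sqr_modulusE eigvec_real // -rmorphM.
Qed.

Lemma spectral_form A k : A \is hermsymmx ->
  (spectralmx A *m A *m (spectralmx A)^t*) k k = (eigvec A 0 k)%:C%C.
Proof.
move=> hA; have /unitarymxP U := spectral_unitarymx A.
rewrite {2}(spectral_decomposition hA) !mulmxA U mul1mx -mulmxA U mulmx1.
by rewrite mxE eqxx mulr1n eigvec_real.
Qed.

Lemma herm_trace A : A \is hermsymmx -> \tr A = (\sum_k eigvec A 0 k)%:C%C.
Proof.
move=> hA; have /unitarymxP U := spectral_unitarymx A.
rewrite {1}(spectral_decomposition hA) mxtrace_mulC mulmxA U mul1mx mxtrace_diag -real_complex_sum.
by apply: eq_bigr => k _; rewrite eigvec_real.
Qed.

End ComplexForms.

(** * Wirtinger derivatives in real coordinates *)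

Section Wirtinger.
Local Open Scope sesquilinear_scope.
Variables (R : realType) (n : nat).
Local Notation C := (R[i]).
Implicit Types (u : 'Cn[R]_n -> R) (z w : 'Cn[R]_n).

Lemma partialC_toC k u w : partialC k (toC u) w = (partial [:: k] u w)%:C%C.
Proof. by rewrite /partialC /toC /= derive_cst. Qed.

Lemma dz_toC i u w : dz i (toC u) w =
  ((2^-1 * partial [:: lshift n i] u w) +i* (- 2^-1 * partial [:: rshift n i] u w))%C.
Proof.
rewrite /dz !partialC_toC; apply/eqP.
rewrite (_ : 2^-1 = (2^-1 : R)%:C%C :> C); last by rewrite fmorphV rmorph_nat.
move: (partial _ u w) (partial _ u w) => a b.
by rewrite eq_complex /=; apply/andP; split; apply/eqP; field.
Qed.

Lemma dzbar_toC i u w : dzbar i (toC u) w =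
  ((2^-1 * partial [:: lshift n i] u w) +i* (2^-1 * partial [:: rshift n i] u w))%C.
Proof.
rewrite /dzbar !partialC_toC; apply/eqP.
rewrite (_ : 2^-1 = (2^-1 : R)%:C%C :> C); last by rewrite fmorphV rmorph_nat.
move: (partial _ u w) (partial _ u w) => a b.
by rewrite eq_complex /=; apply/andP; split; apply/eqP; field.
Qed.

Lemma derive_scale (m : nat) (c : R) (g : 'rV[R]_m -> R) (w v : 'rV[R]_m) : derivable g w v ->
  'D_v (fun y => c * g y) w = c * 'D_v g w.
Proof. by move=> dg; rewrite -[LHS]/('D_v (c \*: g) w) deriveZ. Qed.

Lemma hessC_levi u z (Om : set 'Cn[R]_n) : Cclass 2 Om u -> Om z -> hessC u z = levi (hess u z).
Proof.
move=> [du _] Oz; apply/matrixP => i j; rewrite !mxE.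
have -> : dz i (toC u) = fun w => ((2^-1 * partial [:: lshift n i] u w) +i*
    (- 2^-1 * partial [:: rshift n i] u w))%C by apply/funext => w; exact: dz_toC.
have D k l : derivable (partial [:: k] u) z (unit_vec R l) by apply: du.
rewrite /dzbar /partialC /= !derive_scale //; try exact: D.
rewrite !hess_entry /=; apply/eqP.
rewrite (_ : 2^-1 = (2^-1 : R)%:C%C :> C); last by rewrite fmorphV rmorph_nat.
move: ('D_(unit_vec R (lshift n j)) _ z) ('D_(unit_vec R (lshift n j)) _ z) => a b.
move: ('D_(unit_vec R (rshift n j)) _ z) ('D_(unit_vec R (rshift n j)) _ z) => c d.
by rewrite eq_complex /=; apply/andP; split; apply/eqP; field.
Qed.

Definition real_row (zeta : 'rV[C]_n) : 'rV[R]_(n + n) :=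
  row_mx (map_mx (@complex.Re R) zeta) (map_mx (@complex.Im R) zeta).

Lemma real_row_l zeta i : real_row zeta 0 (lshift n i) = complex.Re (zeta 0 i).
Proof. by rewrite row_mxEl mxE. Qed.

Lemma real_row_r zeta i : real_row zeta 0 (rshift n i) = complex.Im (zeta 0 i).
Proof. by rewrite row_mxEr mxE. Qed.

Lemma dirC_toC zeta u : dirC zeta (toC u) = toC (fun w => dot (grad u w) (real_row zeta)).
Proof.
apply/funext => w; rewrite /dirC /toC dot_split -real_complex_sum; apply: eq_bigr => i _.
rewrite dz_toC dzbar_toC real_row_l real_row_r !grad_entry.
by case: (zeta 0 i) => a b; apply/eqP; rewrite eq_complex /=; apply/andP; split; apply/eqP; field.
Qed.

Lemma grad_dot_grad u z v (Om : set 'Cn[R]_n) : Cclass 2 Om u -> Om z ->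
  grad (fun w => dot (grad u w) v) z = v *m hess u z.
Proof.
move=> [du _] Oz; apply/rowP => k; rewrite !mxE.
have D l : derivable (partial [:: l] u) z (unit_vec R k) by apply: du.
have -> : (fun w => dot (grad u w) v) = \sum_l (v 0 l \*: partial [:: l] u).
  apply/funext => w; rewrite dot_sum fct_sumE; apply: eq_bigr => l _.
  by rewrite grad_entry mulrC.
rewrite derive_sum => [|l]; last exact: derivableZ.
by apply: eq_bigr => l _; rewrite deriveZ // hess_entry.
Qed.

Lemma dirC_dirC zeta u z (Om : set 'Cn[R]_n) : Cclass 2 Om u -> Om z ->
  dirC zeta (dirC zeta (toC u)) z =
    (dot (real_row zeta *m hess u z) (real_row zeta))%:C%C.
Proof. by move=> cu Oz; rewrite !dirC_toC /toC (grad_dot_grad _ cu Oz). Qed.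

Lemma normc_real (a : R) : Normc.normc (a%:C%C) = `|a|.
Proof. by rewrite /Normc.normc /= expr0n addr0 sqrtr_sqr. Qed.

Lemma dot_real_row (zeta : 'rV[C]_n) : \sum_(i < n) `|zeta 0 i| ^+ 2 = 1 ->
  dot (real_row zeta) (real_row zeta) = 1.
Proof.
under eq_bigr => i _ do rewrite -add_Re2_Im2.
rewrite real_complex_sum => -[<-]; rewrite dot_split; apply: eq_bigr => i _.
by rewrite real_row_l real_row_r !expr2.
Qed.

End Wirtinger.

(** * Supporting operators as frames *)

Section Frames.
Local Open Scope sesquilinear_scope.
Variables (R : realType) (n : nat).
Hypothesis (n_gt0 : (0 < n)%N).
Local Notation C := (R[i]).
Variables (Gam : set 'rV[R]_n) (F : 'rV[R]_n -> R).
Hypothesis (cG : symmetric_cone Gam) (sF : structure_conditions Gam F).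
Implicit Types (u h : 'Cn[R]_n -> R) (z w : 'Cn[R]_n) (l : 'rV[R]_n) (V A : 'M[C]_n).

Definition weight l (k : 'I_n) : R := (total_slope F l)^-1 * slope F l k.

Lemma weight_ge0 l k : Gam l -> 0 <= weight l k.
Proof.
move=> Gl; rewrite mulr_ge0 ?invr_ge0 ?(ltW (slope_gt0 sF k Gl)) //.
exact/ltW/(total_slope_gt0 n_gt0 cG sF Gl).
Qed.

Lemma weight_sum l : Gam l -> \sum_k weight l k = 1.
Proof.
by move=> Gl; rewrite -mulr_sumr mulVf // gt_eqF // (total_slope_gt0 n_gt0 cG sF Gl).
Qed.

(* A supporting operator \sum_k weight_k u_(xi_k)(conj xi_k) of the concave operator, written
   as a sum of pure second derivatives along real directions. *)
Definition hessian_frame (s : 'I_n + 'I_n -> 'rV[R]_(n + n)) (b : R) : Prop :=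
  exists l xi, [/\ Gam l, orthoframe xi, b = (total_slope F l)^-1,
    forall k, s (inl k) = (2^-1 * Num.sqrt (weight l k)) *: xi k
  & forall k, s (inr k) = (2^-1 * Num.sqrt (weight l k)) *: (xi k *m Jmx R n)].

Definition weighted_form l V A : R := \sum_k weight l k * complex.Re ((V *m A *m V^t*) k k).

Lemma trace_op_frame (s : 'I_n + 'I_n -> 'rV[R]_(n + n)) l xi h z : Gam l ->
  (forall k, s (inl k) = (2^-1 * Num.sqrt (weight l k)) *: xi k) ->
  (forall k, s (inr k) = (2^-1 * Num.sqrt (weight l k)) *: (xi k *m Jmx R n)) ->
  trace_op s h z = weighted_form l (complex_rows xi) (levi (hess h z)).
Proof.
move=> Gl s1 s2; rewrite /trace_op big_sumType /= -big_split /=; apply: eq_bigr => k _.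
rewrite levi_form s1 s2 -!scalemxAl !dotZl !dotZr.
by rewrite -[in RHS](sqr_sqrtr (weight_ge0 k Gl)); field.
Qed.

Lemma dot_mulJ (x y : 'rV[R]_(n + n)) : dot (x *m Jmx R n) (y *m Jmx R n) = dot x y.
Proof. by rewrite dot_mulmx Jmx_tr -mulmxA mulmxN Jmx_sqr opprK mulmx1. Qed.

Lemma hessian_frames : frames (Jmx R n) (F (const_mx 1))^-1 hessian_frame.
Proof.
split.
- move=> s b [l [xi [Gl [h1 _] _ s1 s2]]].
  rewrite big_sumType /= -big_split /=.
  have -> : 2^-1 = \sum_k weight l k * 2^-1 :> R by rewrite -mulr_suml weight_sum // mul1r.
  apply: eq_bigr => k _; rewrite s1 s2 !dotZl !dotZr dot_mulJ h1 eqxx mulr1n !mulr1.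
  by rewrite -[in RHS](sqr_sqrtr (weight_ge0 k Gl)); field.
- move=> s b [l [xi [Gl _ -> _ _]]].
  have T0 := total_slope_gt0 n_gt0 cG sF Gl.
  rewrite invr_ge0 (ltW T0) lef_pV2 ?posrE ?(total_slope_ge n_gt0 cG sF) //.
  exact/(op_gt0 sF)/(cone_one cG).
- move=> O s b OO OJ [l [xi [Gl [h1 h2] -> s1 s2]]]; exists l, (fun k => xi k *m O); split => //.
  + split=> k k'; first by rewrite dot_mulmx -mulmxA OO mulmx1.
    by rewrite -mulmxA OJ mulmxA dot_mulmx -mulmxA OO mulmx1.
  + by move=> k; rewrite s1 scalemxAl.
  + by move=> k; rewrite s2 -!scalemxAl -!mulmxA OJ.
Qed.

Lemma frame_form (s : 'I_n + 'I_n -> 'rV[R]_(n + n)) b : hessian_frame s b -> exists l V,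
  [/\ Gam l, V \is unitarymx, b = (total_slope F l)^-1
    & forall h z, trace_op s h z = weighted_form l V (levi (hess h z))].
Proof.
move=> [l [xi [Gl oxi -> s1 s2]]]; exists l, (complex_rows xi); split => //.
  exact: complex_rows_unitary.
by move=> h z; exact: trace_op_frame.
Qed.

Lemma form_frame l V : Gam l -> V \is unitarymx ->
  exists s : 'I_n + 'I_n -> 'rV[R]_(n + n), hessian_frame s (total_slope F l)^-1 /\
    forall h z, trace_op s h z = weighted_form l V (levi (hess h z)).
Proof.
move=> Gl /unitary_rows[xi oxi <-].
pose s (i : 'I_n + 'I_n) := match i with
  | inl k => (2^-1 * Num.sqrt (weight l k)) *: xi k
  | inr k => (2^-1 * Num.sqrt (weight l k)) *: (xi k *m Jmx R n) end.
exists s; split; first by exists l, xi.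
by move=> h z; exact: trace_op_frame.
Qed.

(** The diagonal of V A V^* is a doubly stochastic average of the eigenvalues, so rearrangement
    reduces V to a permutation, where the supergradient inequality applies. *)
Lemma weighted_form_ge l V A : Gam l -> V \is unitarymx -> A \is hermsymmx ->
  closure Gam (eigvec A) -> (total_slope F l)^-1 * op_value Gam F (eigvec A) <= weighted_form l V A.
Proof.
move=> Gl Vu hA cA; have [S [S0 Sr Sc E]] := unitary_form hA Vu.
have [p Hp] := doubly_stochastic_rearrangement (slope F l) (eigvec A 0) S0 Sr Sc.
have T0 := total_slope_gt0 n_gt0 cG sF Gl.
rewrite /weighted_form; under eq_bigr do rewrite E /weight /= -mulrA.
rewrite -mulr_sumr ler_wpM2l ?invr_ge0 ?(ltW T0) //.
apply: le_trans (supporting_ge n_gt0 cG sF p Gl cA) _; apply: le_trans Hp _.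
rewrite le_eqVlt; apply/orP; left; apply/eqP; apply: eq_bigr => k _.
by rewrite mulr_sumr; apply: eq_bigr => j _; rewrite mulrCA.
Qed.

Lemma weighted_form_attained A (e : R) : A \is hermsymmx -> closure Gam (eigvec A) -> 0 < e ->
  exists l V, [/\ Gam l, V \is unitarymx &
    weighted_form l V A <= (total_slope F l)^-1 * op_value Gam F (eigvec A) + e].
Proof.
move=> hA cA e0; have [l Gl H] := supporting_attained n_gt0 cG sF cA e0.
exists l, (spectralmx A); split => //; first exact: spectral_unitarymx.
apply: le_trans H; rewrite mulr_sumr /weighted_form.
rewrite le_eqVlt; apply/orP; left; apply/eqP; apply: eq_bigr => k _.
by rewrite spectral_form // -mulrA.
Qed.

(** The coefficient matrix a^(ij) of a weighted form, needed to see it as an element of the dual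
    cone, where the scaling of psi applies. *)
Definition form_matrix l V : 'M[C]_n :=
  \matrix_(i, j) \sum_k (weight l k)%:C%C * (V k i * (V k j)^*).

Lemma form_matrix_pairing l V A :
  \sum_i \sum_j form_matrix l V i j * A i j = \sum_k (weight l k)%:C%C * (V *m A *m V^t*) k k.
Proof.
transitivity (\sum_i \sum_j \sum_k (weight l k)%:C%C * (V k i * A i j * (V k j)^*)).
  apply: eq_bigr => i _; apply: eq_bigr => j _; rewrite mxE mulr_suml.
  by apply: eq_bigr => k _; rewrite -!mulrA; congr (_ * (_ * _)); rewrite mulrC.
under eq_bigr => i _ do rewrite exchange_big /=.
rewrite exchange_big /=; apply: eq_bigr => k _; rewrite form_entries mulr_sumr.
by apply: eq_bigr => i _; rewrite mulr_sumr.
Qed.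

Lemma form_matrix_dual l V : Gam l -> V \is unitarymx ->
  dual_cone (herm_cone Gam) (form_matrix l V).
Proof.
move=> Gl Vu; split.
  apply: herm_of_entry => i j; rewrite !mxE rmorph_sum; apply: eq_bigr => k _.
  case: (V k i) (V k j) => a b [c d]; apply/eqP; rewrite eq_complex /=.
  by apply/andP; split; apply/eqP; ring.
(* tr(A B) pairs A with the transpose of B, whereas the weighted form pairs entries directly;
   conjugating V exchanges the two. *)
move=> B [hB GB]; pose V' := map_mx Num.conj V.
have V'u : V' \is unitarymx.
  apply/unitarymxP; move/unitarymxP: Vu => /(congr1 (map_mx Num.conj)).
  rewrite map_mxM map_mx1 => <-; congr (_ *m _); apply/matrixP => i j.
  by rewrite !mxE.
have := form_matrix_pairing l V' B; rewrite /V'.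
have -> : \sum_i \sum_j form_matrix l V' i j * B i j = \tr (form_matrix l V *m B).
  rewrite /mxtrace exchange_big; apply: eq_bigr => j _; rewrite mxE; apply: eq_bigr => i _.
  rewrite !mxE; congr (_ * _); apply: eq_bigr => k _; rewrite !mxE conjCK; congr (_ * _).
  by rewrite mulrC.
move=> ->; have [S [S0 Sr Sc E]] := unitary_form hB V'u.
have cB : closure Gam (eigvec B) by exact: subset_closure.
have T0 := total_slope_gt0 n_gt0 cG sF Gl.
have := weighted_form_ge Gl V'u hB cB; rewrite /op_value mem_set // => h.
under eq_bigr => k _ do rewrite E -rmorphM.
rewrite real_complex_sum ltcE /= eqxx /=; apply: lt_le_trans (_ : 0 < (total_slope F l)^-1 * F (eigvec B)) _.
  by rewrite mulr_gt0 ?invr_gt0 // (op_gt0 sF GB).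
apply: le_trans h _; rewrite le_eqVlt; apply/orP; left; apply/eqP; apply: eq_bigr => k _.
by rewrite E.
Qed.

Lemma form_matrix_trace l V : Gam l -> V \is unitarymx -> \tr (form_matrix l V) = 1.
Proof.
move=> Gl /unitarymxP Vu; rewrite /mxtrace; under eq_bigr => i _ do rewrite mxE.
rewrite exchange_big /= -[1]/((1 : R)%:C%C) -(weight_sum Gl) -real_complex_sum.
apply: eq_bigr => k _; rewrite -mulr_sumr -[RHS]mulr1; congr (_ * _).
transitivity ((V *m V^t*) k k); last by rewrite Vu mxE eqxx.
by rewrite mxE; apply: eq_bigr => i _; rewrite adjE.
Qed.

End Frames.

(** * Assembling the estimate *)

Section Negation.
Variables (R : realType) (m : nat).
Implicit Types (h : 'rV[R]_m -> R) (v w z : 'rV[R]_m).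

Lemma derivable_opp h z v : derivable (fun y => - h y) z v -> derivable h z v.
Proof. by move=> /derivableN; rewrite (_ : - _ = h) //; apply/funext => y /=; rewrite opprK. Qed.

(* Unconditional: where h has no derivative, both sides are the junk value 0. *)
Lemma derive_opp h z v : 'D_v (fun y => - h y) z = - 'D_v h z.
Proof.
have [dh|ndh] := pselect (derivable h z v); first by rewrite -deriveN.
have ndh' : ~ derivable (fun y => - h y) z v by move/derivable_opp.
have D0 (g : 'rV[R]_m -> R) : ~ derivable g z v -> 'D_v g z = 0 by move=> ndg; exact: dvgP.
by rewrite (D0 _ ndh) (D0 _ ndh') oppr0.
Qed.

Lemma partial_opp h s : partial s (fun y => - h y) = fun y => - partial s h y.
Proof. by elim: s => //= k s ->; apply/funext => z; exact: derive_opp. Qed.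

Lemma Cclass_opp r U h : Cclass r U (fun y => - h y) -> Cclass r U h.
Proof.
move=> [dh ch]; split=> [s k v sr Uv|s v sr Uv].
  by apply: derivable_opp; rewrite -partial_opp; exact: dh.
have := cont_opp (ch s v sr Uv); rewrite partial_opp.
by rewrite (_ : (fun w => - - _) = partial s h) //; apply/funext => y; rewrite opprK.
Qed.

End Negation.

(** * Bounds read off from the Hoelder norms *)

Section HolderNorms.
Variables (R : realType) (m : nat).
Implicit Types (h : 'rV[R]_m -> R) (v w z : 'rV[R]_m) (Om : set 'rV[R]_m).

(** Valid for empty and unbounded sets too, whose [sup] takes the default value 0; in particular the
    boundary term of the theorem is nonnegative. *)
Lemma sup_ge0 (E : set R) : (forall x, E x -> 0 <= x) -> 0 <= sup E.
Proof.
move=> E0; have [[[x Ex] uE]|nE] := pselect (has_sup E); last by rewrite sup_out.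
by apply: le_trans (E0 x Ex) _; exact: ub_le_sup.
Qed.

Lemma enorm_ge0 v : 0 <= enorm v.
Proof. exact: sqrtr_ge0. Qed.

Lemma sqr_enorm v : enorm v ^+ 2 = dot v v.
Proof.
rewrite /enorm sqr_sqrtr; last by rewrite sumr_ge0 // => k _; exact: sqr_ge0.
by rewrite dot_sum; apply: eq_bigr => k _; rewrite expr2.
Qed.

Lemma enorm_le v : enorm v <= m%:R * `|v|.
Proof.
rewrite -ler_sqr ?nnegrE ?enorm_ge0 ?mulr_ge0 // sqr_enorm.
apply: le_trans (dot_le_sqr_norm _) _; rewrite exprMn ler_wpM2r ?sqr_ge0 //.
by rewrite -natrX ler_nat; case: m => // m'; rewrite expnS leq_pmulr.
Qed.

Lemma deriv_values_ge0 r Om h : 0 <= sup (deriv_values r Om h).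
Proof. by apply: sup_ge0 => x [s [v [_ _ ->]]]. Qed.

Lemma lip_quotients_ge0 r Om h : 0 <= sup (lip_quotients r Om h).
Proof. by apply: sup_ge0 => x [s [v [w [_ _ _ _ ->]]]]; rewrite divr_ge0 ?enorm_ge0. Qed.

Lemma Cr1_norm_ge0 r Om h : 0 <= Cr1_norm r Om h.
Proof. by rewrite addr_ge0 ?deriv_values_ge0 ?lip_quotients_ge0. Qed.

Lemma partial_le_Cr1_norm r Om h s z : has_ubound (deriv_values r Om h) ->
  (size s <= r)%N -> Om z -> `|partial s h z| <= Cr1_norm r Om h.
Proof.
move=> ub sr Oz; apply: (@le_trans _ _ (sup (deriv_values r Om h))).
  by apply: ub_le_sup => //; exists s, z.
by rewrite lerDl lip_quotients_ge0.
Qed.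

(** The factor m passes from the Euclidean norm in the quotients to the sup norm. *)
Lemma partial_lip_Cr1_norm r Om h s v w : has_ubound (lip_quotients r Om h) ->
  size s = r -> Om v -> Om w ->
  `|partial s h v - partial s h w| <= m%:R * Cr1_norm r Om h * `|v - w|.
Proof.
move=> ub sr Ov Ow; have [->|vw] := eqVneq v w; first by rewrite !subrr !normr0 mulr0.
have e0 : 0 < enorm (v - w).
  rewrite lt_neqAle enorm_ge0 andbT; apply/eqP => e0; move/eqP: vw; apply.
  by apply/eqP; rewrite -subr_eq0; apply/eqP/dot_eq0; rewrite -sqr_enorm -e0 expr0n.
have q : `|partial s h v - partial s h w| / enorm (v - w) <= Cr1_norm r Om h.
  apply: (@le_trans _ _ (sup (lip_quotients r Om h))).
    by apply: ub_le_sup => //; exists s, v, w; split => //; exact/eqP.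
  by rewrite lerDr deriv_values_ge0.
move: q; rewrite ler_pdivrMr // => /le_trans; apply.
by rewrite mulrAC [leRHS]mulrC ler_wpM2l ?Cr1_norm_ge0 // enorm_le.
Qed.

Lemma deriv_values_bounded r Om U h : bounded_set Om -> closure Om `<=` U -> Cclass r U h ->
  compact (closure Om) -> has_ubound (deriv_values r Om h).
Proof.
move=> bOm cU [_ ch] cpt.
have [Om0|/set0P[z0 Oz0]] := eqVneq Om set0.
  by exists 0 => x [s [v [_]]]; rewrite Om0.
have bound s : (size s <= r)%N -> exists M : R, forall z, Om z -> `|partial s h z| <= M.
  move=> sr; have cn z : closure Om z -> {for z, continuous (fun y => `|partial s h y|)}.
    by move=> /cU Uz; exact: cvg_norm (ch s z sr Uz).
  have ne : closure Om !=set0 by exists z0; exact: subset_closure.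
  have [c _ Hc] := EVT_pointwise ne cpt cn.
  by exists `|partial s h c| => z Oz; apply: Hc; exact: subset_closure.
have bound_size j : (j <= r)%N -> exists M : R, forall s z, size s = j -> Om z -> `|partial s h z| <= M.
  move=> jr; have bt (t : j.-tuple 'I_m) : exists M : R, forall z, Om z -> `|partial t h z| <= M.
    by apply: bound; rewrite size_tuple.
  pose M t := sval (cid (bt t)).
  have MP (t : j.-tuple 'I_m) z : Om z -> `|partial t h z| <= M t by rewrite /M; case: cid => ? /=; apply.
  have M0 t : 0 <= M t by apply: le_trans (MP t z0 Oz0).
  exists (\sum_t M t) => s z /eqP sj Oz.
  apply: le_trans (MP (Tuple sj) z Oz) _; rewrite (bigD1 (Tuple sj)) //= lerDl.
  by rewrite sumr_ge0.
suff [M HM] : exists M : R, forall s z, (size s <= r)%N -> Om z -> `|partial s h z| <= M.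
  by exists M => x [s [v [sr Ov ->]]]; exact: HM.
elim: {-2}r (leqnn r) => [r0|j IH jr].
  by have [M HM] := bound_size 0%N r0; exists M => s z; rewrite leqn0 => /eqP; exact: HM.
have [M HM] := IH (ltnW jr); have [M' HM'] := bound_size _ jr.
exists (Num.max M M') => s z; rewrite le_max leq_eqVlt => /orP[/eqP sj Oz|sj Oz].
  by rewrite HM' ?orbT.
by rewrite HM.
Qed.

End HolderNorms.

Section Assembly.
Variables (R : realType) (n : nat).
Hypothesis (n_gt0 : (0 < n)%N).
Variables (Gam : set 'rV[R]_n) (F : 'rV[R]_n -> R).
Hypothesis (cG : symmetric_cone Gam) (sF : structure_conditions Gam F).
Variables (Om : set 'Cn[R]_n) (psi f g u : 'Cn[R]_n -> R).
Hypothesis (dom : bounded_domain Om) (psiP : normalized_defining Gam Om psi).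
Hypothesis (fP : Cr1 1 Om f) (gP : Cr1 1 Om g) (f0 : forall z, Om z -> 0 <= f z).
Hypothesis (adm : admissible Gam Om u) (cu : Cclass_closure 2 Om u).
Hypothesis (eq_u : forall z, Om z -> hess_op Gam F (hessC u z) = f z).
Hypothesis (ug : forall z, bdry Om z -> u z = g z).

Let Om_open : open Om.
Proof. by case: dom. Qed.

Let Om_bounded : bounded_set Om.
Proof. by case: dom. Qed.

Lemma psi_near : exists U, [/\ open U, closure Om `<=` U, Cclass 4 U psi,
    Om = U `&` [set z | 0 < psi z] & bdry Om = U `&` [set z | psi z = 0]].
Proof.
have [U [oU cU ch [E1 E2 _]]] := psi_defining psiP; exists U; split => //.
- exact: Cclass_opp.
- by rewrite {1}E1; congr (_ `&` _); apply/funext => z; rewrite /= oppr_lt0.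
- rewrite {1}E2; congr (_ `&` _); apply/funext => z; apply/propext => /=; split.
    by move/eqP; rewrite oppr_eq0 => /eqP.
  by move->; rewrite oppr0.
Qed.

Lemma psi_deriv_values : has_ubound (deriv_values 3 Om psi).
Proof.
have [U [oU cU ch _ _]] := psi_near.
apply: (deriv_values_bounded Om_bounded cU (Cclass_le _ ch)) => //.
exact: compact_closure_of_bounded.
Qed.

Lemma levi_hess_herm (h : 'Cn[R]_n -> R) z : Cclass 2 Om h -> Om z -> hessC h z \is hermsymmx.
Proof.
move=> ch Oz; rewrite (hessC_levi ch Oz); apply: levi_herm; exact: (hess_sym Om_open Oz ch).
Qed.

Lemma op_value_hess z : Om z -> op_value Gam F (eigvec (hessC u z)) = f z.
Proof. exact: eq_u. Qed.

Lemma hess_trace_ge0 z : Om z -> 0 <= \tr (hess u z).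
Proof.
move=> Oz; have [cu2 cl] := adm; have := closure_sum_ge0 n_gt0 cG (cl z Oz).
have := congr1 (@complex.Re R) (herm_trace (levi_hess_herm cu2 Oz)).
rewrite (hessC_levi cu2 Oz) levi_trace /= => <-.
by rewrite pmulr_rge0 // invr_gt0.
Qed.

(** Adding 1 to the norm of psi secures 1 <= K, on which the constants rely. The dual matrix of each
    frame has trace 1, which turns the scaling of psi into the bound -2 on its trace. *)
Lemma Bellman_setting : setting (1 + Cr1_norm 3 Om psi)
  ((n + n)%:R * Cr1_norm 1 Om f) ((n + n)%:R * Cr1_norm 1 Om g)
  (hessian_frame Gam F) Om psi f g u.
Proof.
have [cu2 cl] := adm; have [_ ucl ulim] := cu.
have [cf _ fb fl] := fP; have [cg gcl gb gl] := gP.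
have m1 : 1 <= (n + n)%:R :> R by rewrite ler1n addn_gt0 n_gt0.
have widen r h : Cr1_norm r Om h <= (n + n)%:R * Cr1_norm r Om h.
  by rewrite ler_peMl ?Cr1_norm_ge0.
have cpsi : Cclass 2 Om psi.
  have [U [_ cU ch _ _]] := psi_near.
  apply: Cclass_sub (Cclass_le _ ch) => // z Oz; exact/cU/subset_closure.
split => //.
- exact: psi_near.
- move=> s z sz Oz; apply: le_trans (partial_le_Cr1_norm psi_deriv_values sz Oz) _.
  by rewrite lerDr.
- move=> z bz; rewrite -sqr_enorm -[1](expr1n _ 2) ler_sqr ?nnegrE ?enorm_ge0 //.
  exact: (psi_grad psiP).
- by move=> s z sz Oz; apply: le_trans (widen 1%N f); exact: partial_le_Cr1_norm.
- by move=> k v w Ov Ow; exact: partial_lip_Cr1_norm.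
- by move=> s z sz Oz; apply: le_trans (widen 1%N g); exact: partial_le_Cr1_norm.
- by move=> k v w Ov Ow; exact: partial_lip_Cr1_norm.
- move=> s b z /(frame_form n_gt0 cG sF)[l [V [Gl Vu -> E]]] Oz.
  rewrite E -(hessC_levi cu2 Oz) -op_value_hess //.
  by apply: (weighted_form_ge n_gt0 cG sF) => //; [exact: levi_hess_herm|exact: cl].
- move=> z e Oz e0.
  have [l [V [Gl Vu H]]] := weighted_form_attained n_gt0 cG sF (levi_hess_herm cu2 Oz) (cl z Oz) e0.
  have [s [fs E]] := form_frame n_gt0 cG sF Gl Vu.
  by exists s, (total_slope F l)^-1; rewrite E -(hessC_levi cu2 Oz) -op_value_hess.
- move=> s b z /(frame_form n_gt0 cG sF)[l [V [Gl Vu _ E]]] Oz; rewrite E -(hessC_levi cpsi Oz).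
  have := psi_scaled psiP (form_matrix_dual n_gt0 cG sF Gl Vu) (form_matrix_trace n_gt0 cG sF Gl Vu)
    (subset_closure Oz).
  rewrite form_matrix_pairing lecE => /andP[_]; rewrite Re_sum /weighted_form.
  rewrite (_ : complex.Re (- 2%:R) = - 2) // => H; apply: le_trans H.
  rewrite le_eqVlt; apply/orP; left; apply/eqP; apply: eq_bigr => k _.
  by case: (_ k k) => a b' /=; rewrite mul0r subr0.
Qed.

End Assembly.

Theorem theorem4p5 (R : realType) (n : nat) (n_gt0 : (0 < n)%N)
    (Gam : set 'rV[R]_n) (F : 'rV[R]_n -> R)
    (Gam_cone : symmetric_cone Gam) (F_struct : structure_conditions Gam F) :
  exists C : R -> R -> R -> R -> R -> R,
  forall (eps delta : R) (Om : set 'Cn[R]_n) (psi f g u : 'Cn[R]_n -> R),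
    0 < eps -> 0 < delta ->
    bounded_domain Om -> boundary_class 4 Om -> strictly_pseudoconvex Gam Om ->
    normalized_defining Gam Om psi ->
    Cr1 1 Om f -> Cr1 1 Om g -> (forall z, Om z -> 0 <= f z) ->
    admissible Gam Om u -> Cclass_closure 2 Om u ->
    (forall z, Om z -> hess_op Gam F (hessC u z) = f z) ->
    (forall z, bdry Om z -> u z = g z) ->
    forall (zeta : 'rV[R[i]]_n) (z : 'Cn[R]_n),
      \sum_(i < n) `|zeta 0 i| ^+ 2 = 1 ->
      Om z -> delta < eucl_dist z (bdry Om) ->
      Normc.normc (dirC zeta (dirC zeta (toC u)) z)
        <= eps * sup [set `|bdry_second Om u (inner_normal psi w) w|
                     | w in bdry Om]
           + C (Cr1_norm 1 Om f) (Cr1_norm 1 Om g) (Cr1_norm 3 Om psi)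
               eps delta.
Proof.
(* The distance enters squared, through psi >= delta^2; cone and operator enter only through F(1,
   ..., 1). *)
exists (fun nf ng np _ delta => core_constant (n + n) (1 + np) ((n + n)%:R * nf)
  ((n + n)%:R * ng) (F (const_mx 1))^-1 (delta ^+ 2)).
move=> eps delta Om psi f g u eps0 delta0 dom _ _ psiP fP gP f0 adm cu eq_u ug zeta z zeta1 Oz zd.
have st := Bellman_setting n_gt0 Gam_cone F_struct dom psiP fP gP f0 adm cu eq_u ug.
have frP := hessian_frames n_gt0 Gam_cone F_struct.
rewrite (dirC_dirC zeta adm.1 Oz) normc_real.
have dpsi : delta ^+ 2 <= psi z.
  apply: (dist_le_psi frP st Oz (ltW delta0)) => w bw; rewrite -sqr_enorm ltr_sqr ?nnegrE ?enorm_ge0 ?(ltW delta0) //.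
  apply: lt_le_trans zd _; rewrite /eucl_dist; apply: ge_inf; first by exists 0 => _ [v _ <-]; exact: enorm_ge0.
  exists w => //; rewrite /enorm; congr Num.sqrt; apply: eq_bigr => k _.
  by rewrite !mxE -sqrrN opprB.
have m0 : 0 <= (n + n)%:R :> R by [].
have b00 : 0 <= (F (const_mx 1))^-1.
  by rewrite invr_ge0; exact/ltW/(op_gt0 F_struct)/(cone_one Gam_cone).
have := core_bound frP st _ (mulr_ge0 m0 (Cr1_norm_ge0 _ _ _)) (mulr_ge0 m0 (Cr1_norm_ge0 _ _ _)) b00
  (Jmx_tr R n) (Jmx_sqr R n) (exprn_gt0 2 delta0)
  (hess_trace_ge0 n_gt0 Gam_cone dom adm) Oz dpsi (real_row zeta).
rewrite (dot_real_row zeta1) mulr1 lerDl Cr1_norm_ge0 => /(_ isT) H; apply: le_trans H _.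
by rewrite lerDr mulr_ge0 ?(ltW eps0) //; apply: sup_ge0 => _ [w _ <-].
Qed.
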